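(* Let $0<\gamma_i\leqslant 1$ for $i=1,2,3$ and $0<\delta_j<1$ for $j=1,3$ satisfy \[ \frac{\gamma_1+\gamma_2}{2}+\frac{\delta_1}{40}>1,\qquad \frac{\gamma_1+\gamma_2}{2}+\frac{\delta_3}{3}>1, \] \[ 73(1-\gamma_i)+86\delta_1<9\quad (i=1,2),\qquad 1714(1-\gamma_3)+1725\delta_3<46 . \] Let $\tau=N^{1-\sigma}$ with $0<\sigma\leqslant 1/6$. Then for every $B>0$, \[ \int_{1/\tau}^{1+1/\tau} T_{1,1}(N,\alpha)T_{1,2}(N,\alpha)T_3(N,\alpha)e(-N\alpha)\,\mathrm{d}\alpha =\int_{1/\tau}^{1+1/\tau} S_1^2(N,\alpha)S_3(N,\alpha)e(-N\alpha)\,\mathrm{d}\alpha+O\big(N^{4/3}(\log N)^{-B}\big). \]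
   Context: $N$ is a sufficiently large natural number, $P=N^{1/3}$, $e(x)=e^{2\pi i x}$, and $p$ denotes primes. For $0<\gamma\leqslant1$, $\mathcal{P}_\gamma=\{p: p=[n^{1/\gamma}] \text{ for some } n\in\mathbb{N}\}$, where $[x]$ is the integer part of $x$. Define \[ S_1(N,\alpha)=\sum_{p\leqslant N}e(\alpha p),\qquad S_3(N,\alpha)=\sum_{p\leqslant P}e(\alpha p^3), \] \[ T_{1,i}(N,\alpha)=\frac{1}{\gamma_i}\sum_{\substack{p\leqslant N\\ p\in\mathcal{P}_{\gamma_i}}}p^{1-\gamma_i}e(\alpha p)\ (i=1,2),\qquad T_3(N,\alpha)=\frac{1}{\gamma_3}\sum_{\substack{p\leqslant P\\ p\in\mathcal{P}_{\gamma_3}}}p^{1-\gamma_3}e(\alpha p^3). \] *)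

(* Defs.v *)
From Stdlib Require Export Reals ZArith Znumtheory ClassicalEpsilon.
From Coquelicot Require Export Coquelicot.

Open Scope R_scope.

Definition e (x : R) : C := (cos (2 * PI * x), sin (2 * PI * x)).

(* The set of integer parts [n^(1/gamma)], n >= 1; [Int_part] is the floor.
   [Rpower 0 y] is not 0 in the library, hence the restriction to n >= 1. *)
Definition floor_power (gamma : R) (m : nat) : Prop :=
  exists n : nat,
    (1 <= n)%nat /\ Z.of_nat m = Int_part (Rpower (INR n) (1 / gamma)).

Definition is_prime (p : nat) : Prop := prime (Z.of_nat p).

Definition PS_prime (gamma : R) (p : nat) : Prop :=
  is_prime p /\ floor_power gamma p.

(* Sum of [f m] over the natural numbers m <= x with [A m], for x >= 0
   ([sum_n u k] is u 0 + ... + u k). *)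
Definition sum_le (x : R) (A : nat -> Prop) (f : nat -> C) : C :=
  sum_n (fun m => if excluded_middle_informative (A m) then f m else RtoC 0)
        (Z.to_nat (Int_part x)).

Definition cube_root (N : nat) : R := Rpower (INR N) (1 / 3).

Definition S1 (N : nat) (alpha : R) : C :=
  sum_le (INR N) is_prime (fun p => e (alpha * INR p)).

Definition S3 (N : nat) (alpha : R) : C :=
  sum_le (cube_root N) is_prime (fun p => e (alpha * INR p ^ 3)).

Definition T1 (gamma : R) (N : nat) (alpha : R) : C :=
  (RtoC (1 / gamma) *
   sum_le (INR N) (PS_prime gamma)
     (fun p => RtoC (Rpower (INR p) (1 - gamma)) * e (alpha * INR p)))%C.

Definition T3 (gamma : R) (N : nat) (alpha : R) : C :=
  (RtoC (1 / gamma) *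
   sum_le (cube_root N) (PS_prime gamma)
     (fun p => RtoC (Rpower (INR p) (1 - gamma)) * e (alpha * INR p ^ 3)))%C.

Definition CRInt (f : R -> C) (a b : R) : C :=
  RInt (V := C_R_CompleteNormedModule) f a b.

(* Main.v *)
Require Import Defs.
From HB Require Import structures.

(* All error terms save a power of N. Write D_i = T_i - S_i and split
   T1 T2 T3 - S1^2 S3 = D_1 T2 T3 + S1 D_2 T3 + S1^2 D_3. The integral of this
   trigonometric polynomial of degree O(N) is its average over the points k / M,
   M = 20 N + 1.
   - The weight p^(1-g) / g on Piatetski-Shapiro numbers is close to 1 on
     average: membership of n is a condition on the fractional part of n^g, which
     the Fejer kernel turns into exponential sums with phase al p + h p^g
     (Vaughan's identity and van der Corput differencing). This gives a
     power-saving bound for D_1 and D_2 and for the analogue of D_3 over all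
     integers, uniformly in al.
   - For a sum of G T3 over the points, Cauchy-Schwarz over the primes followed by
     positivity replaces primes by all integers z <= P, so that only the complete
     Weyl sum W over cubes appears; it is split according to |W| <= t and
     |W| <= |W|^8 / t^7, and Hua's eighth moment finishes. This treats the first
     two terms, and the third one on the minor arcs, where S1 is small.
   - On the major arcs D_3 is bounded by the linear analogue of D_3 twisted by
     additive characters modulo q, and partial summation. *)

(** The numerical hypotheses force all exponents close to 1. With [a] the mean of [1 - gamma1] and
    [1 - gamma2] they give [40 a < delta1] and [3 a < delta3], hence [a < 9 / 3513] and
    [1 - gamma3 < 46 / 1714]. The obstacle is the cubic sum: the phase [al p^3 + h p^g] over primes
    is never estimated directly, so no bound for D_3 uniform in [al] is at hand. This dictates the
    telescoping: T_3 stays whole beside D_1 and D_2, which supply the saving, and in the last term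
    S_1 alone has to supply it off the major arcs. In the splitting by size the threshold is
    [t = P^(1 - ka)]. The part |W| <= t must make up for the loss N^(2a) in the mean squares of T_1
    and T_2, whence [ka > 6 a]; the part with the eighth power costs N^(7 ka / 3), paid for by the
    uniform saving N^(-de) of D_1 or D_2, whence [16 a < 2 de]. The exponent [de] in turn is limited
    by the estimates for primes. With sample points in place of the integral every mean value is a
    finite sum, and orthogonality modulo M counts solutions of equations exactly. *)

Module PiatetskiShapiro.

(* The imports are confined to this module: they would change the meaning of
   [<=] on [nat] in the theorem. *)
From mathcomp Require Import all_boot zify.
From Stdlib Require Import Lra Lia Psatz.
Set Implicit Arguments.
Unset Strict Implicit.
Unset Printing Implicit Defensive.
Local Open Scope R_scope.

(** * Finite sums and the function e *)

HB.instance Definition _ := Monoid.isComLaw.Build R 0 Rplus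
  (fun x y z => esym (Rplus_assoc x y z)) Rplus_comm Rplus_0_l.
HB.instance Definition _ := Monoid.isComLaw.Build C (RtoC 0) Cplus
  Cplus_assoc Cplus_comm Cplus_0_l.

Notation "\Rsum_ ( i <- r | P ) F" := (\big[Rplus/0]_(i <- r | P%B) F)
  (at level 36, F at level 36, i, r at level 50) : R_scope.
Notation "\Rsum_ ( i <- r ) F" := (\big[Rplus/0]_(i <- r) F)
  (at level 36, F at level 36, i, r at level 50) : R_scope.
Notation "\Rsum_ ( m <= i < n | P ) F" := (\big[Rplus/0]_(m%N <= i < n%N | P%B) F)
  (at level 36, F at level 36, m, i, n at level 50) : R_scope.
Notation "\Rsum_ ( m <= i < n ) F" := (\big[Rplus/0]_(m%N <= i < n%N) F)
  (at level 36, F at level 36, m, i, n at level 50) : R_scope.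
Notation "\Csum_ ( i <- r | P ) F" := (\big[Cplus/RtoC 0]_(i <- r | P%B) F%C)
  (at level 36, F at level 36, i, r at level 50) : C_scope.
Notation "\Csum_ ( i <- r ) F" := (\big[Cplus/RtoC 0]_(i <- r) F%C)
  (at level 36, F at level 36, i, r at level 50) : C_scope.
Notation "\Csum_ ( m <= i < n | P ) F" := (\big[Cplus/RtoC 0]_(m%N <= i < n%N | P%B) F%C)
  (at level 36, F at level 36, m, i, n at level 50) : C_scope.
Notation "\Csum_ ( m <= i < n ) F" := (\big[Cplus/RtoC 0]_(m%N <= i < n%N) F%C)
  (at level 36, F at level 36, m, i, n at level 50) : C_scope.
Notation "\Csum_ ( i <- r | P ) F" := (\big[Cplus/RtoC 0]_(i <- r | P%B) F%C)
  (at level 36, F at level 36, i, r at level 50) : R_scope.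
Notation "\Csum_ ( i <- r ) F" := (\big[Cplus/RtoC 0]_(i <- r) F%C)
  (at level 36, F at level 36, i, r at level 50) : R_scope.
Notation "\Csum_ ( m <= i < n | P ) F" := (\big[Cplus/RtoC 0]_(m%N <= i < n%N | P%B) F%C)
  (at level 36, F at level 36, m, i, n at level 50) : R_scope.
Notation "\Csum_ ( m <= i < n ) F" := (\big[Cplus/RtoC 0]_(m%N <= i < n%N) F%C)
  (at level 36, F at level 36, m, i, n at level 50) : R_scope.
Notation "x `^ a" := (Rpower x a) (at level 30, right associativity) : R_scope.

Lemma Rsum_mull (I : Type) (r : seq I) (P : pred I) (c : R) F :
  c * \Rsum_(i <- r | P i) F i = \Rsum_(i <- r | P i) (c * F i).
Proof. by apply: (big_morph (fun x => c * x)) => [x y|]; ring. Qed.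

Lemma Rsum_mulr (I : Type) (r : seq I) (P : pred I) (c : R) F :
  (\Rsum_(i <- r | P i) F i) * c = \Rsum_(i <- r | P i) (F i * c).
Proof. by apply: (big_morph (fun x => x * c)) => [x y|]; ring. Qed.

Lemma Csum_mull (I : Type) (r : seq I) (P : pred I) (c : C) F :
  (c * \Csum_(i <- r | P i) F i = \Csum_(i <- r | P i) (c * F i))%C.
Proof. by apply: (big_morph (fun x => Cmult c x)) => [x y|]; ring. Qed.

Lemma Csum_mulr (I : Type) (r : seq I) (P : pred I) (c : C) F :
  ((\Csum_(i <- r | P i) F i) * c = \Csum_(i <- r | P i) (F i * c))%C.
Proof. by apply: (big_morph (fun x => Cmult x c)) => [x y|]; ring. Qed.

Lemma Rsum_le (I : Type) (r : seq I) (P : pred I) F G :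
  (forall i, P i -> F i <= G i) ->
  \Rsum_(i <- r | P i) F i <= \Rsum_(i <- r | P i) G i.
Proof. by move=> h; apply: (big_ind2 Rle) => //; [lra | move=> *; lra]. Qed.

Lemma Rsum_le_seq (I : eqType) (r : seq I) (P : pred I) F G :
  (forall i, i \in r -> P i -> F i <= G i) ->
  \Rsum_(i <- r | P i) F i <= \Rsum_(i <- r | P i) G i.
Proof.
move=> h; rewrite big_seq_cond [X in _ <= X]big_seq_cond.
by apply: Rsum_le => i /andP[]; apply: h.
Qed.

Lemma Rsum_le_nat (m n : nat) (P : pred nat) F G :
  (forall i, (m <= i < n)%N -> P i -> F i <= G i) ->
  \Rsum_(m <= i < n | P i) F i <= \Rsum_(m <= i < n | P i) G i.
Proof. by move=> h; apply: Rsum_le_seq => i; rewrite mem_index_iota; apply: h. Qed.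

Lemma Rsum_ge0 (I : Type) (r : seq I) (P : pred I) F :
  (forall i, P i -> 0 <= F i) -> 0 <= \Rsum_(i <- r | P i) F i.
Proof. by move=> h; apply: (big_ind (Rle 0)) => //; [lra | move=> *; lra]. Qed.

Lemma Rsum_pred_le (I : Type) (r : seq I) (P Q : pred I) F :
  (forall i, P i -> Q i) -> (forall i, Q i -> 0 <= F i) ->
  \Rsum_(i <- r | P i) F i <= \Rsum_(i <- r | Q i) F i.
Proof.
move=> PQ F0; rewrite (big_mkcond P) (big_mkcond Q); apply: Rsum_le => i _.
case: ifP => Pi; first by rewrite PQ //; lra.
by case: ifP => Qi; [apply: F0 | lra].
Qed.

Lemma Rsum_const_nat (m n : nat) (c : R) :
  \Rsum_(m <= i < n) c = INR (n - m) * c.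
Proof.
rewrite big_const_nat; elim: (n - m)%N => [|k IH]; first by rewrite /=; ring.
by rewrite iterS IH S_INR; ring.
Qed.

Lemma Csum_const_nat (m n : nat) (c : C) :
  \Csum_(m <= i < n) c = (INR (n - m) * c)%C.
Proof.
rewrite big_const_nat; elim: (n - m)%N => [|k IH]; first by rewrite /=; ring.
by rewrite iterS IH S_INR RtoC_plus; ring.
Qed.

Lemma Rsum_le_const_nat (m n : nat) (P : pred nat) F c : 0 <= c ->
  (forall i, (m <= i < n)%N -> P i -> F i <= c) ->
  \Rsum_(m <= i < n | P i) F i <= INR (n - m) * c.
Proof.
move=> c0 h; rewrite -Rsum_const_nat big_mkcond; apply: Rsum_le_nat => i hi _.
by case: ifP => Pi; [apply: h | ].
Qed.

Lemma Rsum_opp (I : Type) (r : seq I) (P : pred I) F :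
  - (\Rsum_(i <- r | P i) F i) = \Rsum_(i <- r | P i) (- F i).
Proof. by apply: (big_morph Ropp) => [x y|]; ring. Qed.

Lemma Csum_opp (I : Type) (r : seq I) (P : pred I) F :
  (- (\Csum_(i <- r | P i) F i) = \Csum_(i <- r | P i) (- F i))%C.
Proof. by apply: (big_morph Copp) => [x y|]; ring. Qed.

Lemma RsumB (I : Type) (r : seq I) (P : pred I) F G :
  \Rsum_(i <- r | P i) (F i - G i) =
  \Rsum_(i <- r | P i) F i - \Rsum_(i <- r | P i) G i.
Proof. by rewrite /Rminus Rsum_opp -big_split. Qed.

Lemma CsumB (I : Type) (r : seq I) (P : pred I) F G :
  (\Csum_(i <- r | P i) (F i - G i) =
  \Csum_(i <- r | P i) F i - \Csum_(i <- r | P i) G i)%C.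
Proof. by rewrite /Cminus Csum_opp -big_split. Qed.

Lemma Csum_RtoC (I : Type) (r : seq I) (P : pred I) (F : I -> R) :
  RtoC (\Rsum_(i <- r | P i) F i) = \Csum_(i <- r | P i) RtoC (F i).
Proof. by apply: (big_morph RtoC) => [x y|//]; rewrite RtoC_plus. Qed.

Lemma Csum_conj (I : Type) (r : seq I) (P : pred I) F :
  Cconj (\Csum_(i <- r | P i) F i) = \Csum_(i <- r | P i) Cconj (F i).
Proof.
apply: (big_morph Cconj) => [x y|]; first by rewrite Cplus_conj.
by rewrite /Cconj /= Ropp_0.
Qed.

Lemma Cmod_sum (I : Type) (r : seq I) (P : pred I) F :
  Cmod (\Csum_(i <- r | P i) F i) <= \Rsum_(i <- r | P i) Cmod (F i).
Proof.
apply: (big_ind2 (fun x y => Cmod x <= y)) => [|x1 x2 y1 y2 h1 h2|i _].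
- by rewrite Cmod_0; lra.
- by move: (Cmod_triangle x1 y1); lra.
- by lra.
Qed.

Lemma Cmod_sum_const (m n : nat) (P : pred nat) F c : 0 <= c ->
  (forall i, (m <= i < n)%N -> P i -> Cmod (F i) <= c) ->
  Cmod (\Csum_(m <= i < n | P i) F i) <= INR (n - m) * c.
Proof. by move=> c0 h; apply: Rle_trans (Cmod_sum _ _ _) _; apply: Rsum_le_const_nat. Qed.

Lemma Cauchy_R (I : Type) (r : seq I) (P : pred I) (a b : I -> R) :
  (\Rsum_(i <- r | P i) (a i * b i)) ^ 2 <=
  (\Rsum_(i <- r | P i) a i ^ 2) * (\Rsum_(i <- r | P i) b i ^ 2).
Proof.
elim: r => [|x r IH]; first by rewrite !big_nil; lra.
rewrite !big_cons; case: ifP => // _.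
have hA : 0 <= \Rsum_(i <- r | P i) a i ^ 2 by apply: Rsum_ge0 => i _; apply: pow2_ge_0.
have hB : 0 <= \Rsum_(i <- r | P i) b i ^ 2 by apply: Rsum_ge0 => i _; apply: pow2_ge_0.
move: IH hA hB; set S := \Rsum_(i <- r | P i) (a i * b i).
set A := \Rsum_(i <- r | P i) _; set B := \Rsum_(i <- r | P i) _ => IH hA hB.
have [[hu uA] [hv vB]] := (conj (conj (sqrt_pos A) (sqrt_sqrt A hA)) (conj (sqrt_pos B) (sqrt_sqrt B hB))).
move: (sqrt A) (sqrt B) hu uA hv vB => u v hu uA hv vB.
have hS : Rabs S <= u * v.
  rewrite -[u * v]Rabs_pos_eq; last by apply: Rmult_le_pos.
  by apply: Rsqr_le_abs_0; rewrite /Rsqr; nra.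
(* With [|S| <= u v] from the induction hypothesis, the cross term is covered by the
   arithmetic-geometric mean inequality for [u |b x|] and [v |a x|]. *)
suff : 2 * S * (a x * b x) <= A * b x ^ 2 + B * a x ^ 2 by nra.
have h1 : S * (a x * b x) <= (u * v) * Rabs (a x * b x).
  apply: Rle_trans (Rle_abs _) _; rewrite Rabs_mult.
  by apply: Rmult_le_compat_r => //; apply: Rabs_pos.
have : 2 * (u * v) * Rabs (a x * b x) <= (u * Rabs (b x)) ^ 2 + (v * Rabs (a x)) ^ 2.
  by rewrite Rabs_mult; move: (pow2_ge_0 (u * Rabs (b x) - v * Rabs (a x))); lra.
by rewrite !Rpow_mult_distr !pow2_abs -uA -vB; lra.
Qed.

Lemma Cauchy_C (I : Type) (r : seq I) (P : pred I) (a b : I -> C) :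
  Cmod (\Csum_(i <- r | P i) (a i * b i)) ^ 2 <=
  (\Rsum_(i <- r | P i) Cmod (a i) ^ 2) * (\Rsum_(i <- r | P i) Cmod (b i) ^ 2).
Proof.
apply: Rle_trans (Cauchy_R _ _ _ _); apply: pow_incr; split; first exact: Cmod_ge_0.
apply: Rle_trans (Cmod_sum _ _ _) _.
by apply: Rsum_le => i _; rewrite Cmod_mult; lra.
Qed.

Lemma Cauchy_1 (m n : nat) (b : nat -> C) :
  Cmod (\Csum_(m <= i < n) b i) ^ 2 <= INR (n - m) * (\Rsum_(m <= i < n) Cmod (b i) ^ 2).
Proof.
have -> : \Csum_(m <= i < n) b i = \Csum_(m <= i < n) (RtoC 1 * b i).
  by apply: eq_bigr => i _; ring.
apply: Rle_trans (Cauchy_C _ _ _ _) _.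
rewrite (eq_bigr (fun=> 1)); last by move=> i _; rewrite Cmod_1; ring.
by rewrite Rsum_const_nat Rmult_1_r; lra.
Qed.

Lemma Cauchy_R1 (m n : nat) (b : nat -> R) :
  (\Rsum_(m <= i < n) b i) ^ 2 <= INR (n - m) * (\Rsum_(m <= i < n) b i ^ 2).
Proof.
rewrite (eq_bigr (fun i => 1 * b i)); last by move=> i _; ring.
apply: Rle_trans (Cauchy_R _ _ _ _) _.
rewrite (eq_bigr (fun=> 1)); last by move=> i _; ring.
by rewrite Rsum_const_nat Rmult_1_r; lra.
Qed.

Lemma Cmod_sqr_sum (I : Type) (r : seq I) (P : pred I) (a : I -> C) :
  RtoC (Cmod (\Csum_(i <- r | P i) a i) ^ 2) =
  \Csum_(i <- r | P i) \Csum_(j <- r | P j) (a i * Cconj (a j)).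
Proof.
rewrite Cmod2_conj Csum_conj Csum_mulr; apply: eq_bigr => i _.
by rewrite Csum_mull.
Qed.

Lemma e_add x y : e (x + y) = (e x * e y)%C.
Proof.
by rewrite /e /Cmult /= Rmult_plus_distr_l cos_plus sin_plus; congr (_, _); ring.
Qed.

Lemma e_0 : e 0 = RtoC 1.
Proof. by rewrite /e Rmult_0_r cos_0 sin_0. Qed.

Lemma Cmod_e x : Cmod (e x) = 1.
Proof.
rewrite /Cmod /e; apply: sqrt_lem_1; try lra; first by nra.
by rewrite Rmult_1_l /= !Rmult_1_r Rplus_comm -(sin2_cos2 (2 * PI * x)) /Rsqr; ring.
Qed.

Lemma e_conj x : Cconj (e x) = e (- x).
Proof. by rewrite /e /Cconj /= Ropp_mult_distr_r_reverse cos_neg sin_neg. Qed.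

Lemma e_opp_mul x : (e x * e (- x))%C = RtoC 1.
Proof. by rewrite -e_add Rplus_opp_r e_0. Qed.

Lemma e_INR (n : nat) : e (INR n) = RtoC 1.
Proof.
elim: n => [|n IH]; first exact: e_0.
have e1 : e 1 = RtoC 1 by rewrite /e Rmult_1_r cos_2PI sin_2PI.
by rewrite S_INR e_add IH e1 Cmult_1_l.
Qed.

Lemma e_IZR (n : Z) : e (IZR n) = RtoC 1.
Proof.
case: n => [|p|p]; first exact: e_0.
  by rewrite -positive_nat_Z -INR_IZR_INZ e_INR.
rewrite -Pos2Z.opp_pos opp_IZR -positive_nat_Z -INR_IZR_INZ -e_conj e_INR.
by rewrite /Cconj /= Ropp_0.
Qed.

Lemma e_addZ x (n : Z) : e (x + IZR n) = e x.
Proof. by rewrite e_add e_IZR Cmult_1_r. Qed.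

Lemma Cmod_1_sub_e x : Cmod (1 - e x) = 2 * Rabs (sin (PI * x)).
Proof.
rewrite /Cmod; apply: sqrt_lem_1; [by nra | by move: (Rabs_pos (sin (PI * x))); lra |].
rewrite /e /= -[2 * Rabs _ * _]Rmult_1_r.
have -> : 2 * Rabs (sin (PI * x)) * (2 * Rabs (sin (PI * x))) = 4 * (Rabs (sin (PI * x))) ^ 2 by ring.
rewrite pow2_abs.
have -> : 2 * PI * x = 2 * (PI * x) by ring.
rewrite sin_2a cos_2a; have h := sin2_cos2 (PI * x); rewrite /Rsqr in h.
set s := sin _ in h *; set c := cos _ in h *.
have hc : c * c = 1 - s * s by lra.
ring_simplify.
have -> : c ^ 4 = (c * c) ^ 2 by ring.
have -> : c ^ 2 = c * c by ring.
rewrite hc; ring.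
Qed.

Lemma Cmod_1_sub_e_lip x : Cmod (1 - e x) <= 2 * PI * Rabs x.
Proof.
rewrite Cmod_1_sub_e.
suff : Rabs (sin (PI * x)) <= PI * Rabs x by lra.
have hp := PI_RGT_0.
rewrite -[X in X * Rabs x](Rabs_pos_eq PI); last lra.
rewrite -Rabs_mult.
move: (PI * x) => y; case: (Rle_dec 0 y) => hy.
  rewrite (Rabs_pos_eq y) //; case: (Req_dec y 0) => [->|hy0]; first by rewrite sin_0 Rabs_R0; lra.
  apply: Rabs_le; have h1 := sin_lt_x y; split; last lra.
  case: (Rle_dec y PI) => hyp; first by have := sin_ge_0 y; lra.
  by have := SIN_bound y; have := PI2_1; lra.
rewrite (Rabs_left y); last lra.
have -> : sin y = - sin (- y) by rewrite sin_neg; ring.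
rewrite Rabs_Ropp; apply: Rabs_le; have h1 := sin_lt_x (- y); split; last lra.
case: (Rle_dec (- y) PI) => hyp; first by have := sin_ge_0 (- y); lra.
by have := SIN_bound (- y); have := PI2_1; lra.
Qed.

(** * Kusmin-Landau and van der Corput inequalities *)

Lemma pw_gt0 x a : 0 < x `^ a.
Proof. exact: exp_pos. Qed.

Lemma pw_ge0 x a : 0 <= x `^ a.
Proof. exact/Rlt_le/pw_gt0. Qed.

Lemma pw_add x a b : x `^ (a + b) = x `^ a * x `^ b.
Proof. exact: Rpower_plus. Qed.

Lemma pw_le x a b : 1 <= x -> a <= b -> x `^ a <= x `^ b.
Proof. by move=> x1 ab; apply: Rle_Rpower. Qed.

Lemma pw_base x y a : 0 < x <= y -> 0 <= a -> x `^ a <= y `^ a.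
Proof. by move=> xy a0; apply: Rle_Rpower_l. Qed.

Lemma pw_baseN x y a : 0 < x <= y -> a <= 0 -> y `^ a <= x `^ a.
Proof.
move=> xy a0; rewrite -[a]Ropp_involutive !(Rpower_Ropp _ (- a)).
by apply: Rinv_le_contravar; [apply: pw_gt0 | apply: pw_base => //; lra].
Qed.

Lemma pw_0 x : x `^ 0 = 1.
Proof. by rewrite /Rpower Rmult_0_l exp_0. Qed.

Lemma pw_1 x : 0 < x -> x `^ 1 = x.
Proof. exact: Rpower_1. Qed.

Lemma pw_1l a : 1 `^ a = 1.
Proof. by rewrite /Rpower ln_1 Rmult_0_r exp_0. Qed.

Lemma pw_ge1 x a : 1 <= x -> 0 <= a -> 1 <= x `^ a.
Proof. by move=> x1 a0; rewrite -(pw_0 x); apply: pw_le. Qed.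

Lemma pw_opp x a : x `^ (- a) = / x `^ a.
Proof. exact: Rpower_Ropp. Qed.

Lemma pw_pw x a b : (x `^ a) `^ b = x `^ (a * b).
Proof. exact: Rpower_mult. Qed.

Lemma pw_pow x a (n : nat) : (x `^ a) ^ n = x `^ (a * INR n).
Proof. by rewrite -(Rpower_pow n (x `^ a)) ?pw_pw //; apply: pw_gt0. Qed.

Lemma pw_mulb x y a : 0 < x -> 0 < y -> (x * y) `^ a = x `^ a * y `^ a.
Proof. by move=> x0 y0; rewrite Rpower_mult_distr. Qed.

Lemma pw_nat x (n : nat) : 0 < x -> x `^ (INR n) = x ^ n.
Proof. exact: Rpower_pow. Qed.

Lemma ln_le_pw x a : 1 <= x -> 0 < a -> ln x <= x `^ a / a.
Proof.
move=> x1 a0; apply: (Rmult_le_reg_l a) => //.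
have -> : a * (x `^ a / a) = x `^ a by field; lra.
by have := exp_ineq1_le (a * ln x); rewrite /Rpower; lra.
Qed.

(** A crude Jordan inequality, from sin y >= y - y^3 / 6 and y^2 <= 4. The constant 1/3 suffices:
    since PI >= 3 it yields [sin (PI * g) >= g] without constants. *)
Lemma sin_ge_third y : 0 <= y <= PI / 2 -> y / 3 <= sin y.
Proof.
move=> [y0 yp]; have hp := PI_4.
have y4 : y <= 4 by lra.
have [h _] := pre_sin_bound y 0 y0 y4.
apply: Rle_trans h.
have -> : sin_approx y (2 * 0 + 1)%coq_nat = y - y * y * y / 6.
  by rewrite /sin_approx /sin_term /=; field.
have : y * y <= 4 by nra.
by nra.
Qed.

Lemma half_le_sin g : 0 <= g <= 1 / 2 -> g <= sin (PI * g).
Proof.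
move=> hg; have hp := PI2_3_2; apply: Rle_trans (sin_ge_third _); last by nra.
by nra.
Qed.

Lemma sin_PI_ge g x : 0 <= g <= 1 / 2 -> g <= x <= 1 - g -> g <= sin (PI * x).
Proof.
move=> hg hx; case: (Rle_dec x (1 / 2)) => h.
  by apply: Rle_trans (half_le_sin _); lra.
have -> : PI * x = PI - PI * (1 - x) by ring.
by rewrite sin_PI_x; apply: Rle_trans (half_le_sin _); lra.
Qed.

Definition cot x := cos x / sin x.

Lemma cot_nonincr x y : 0 < x -> x <= y -> y <= PI / 2 -> cot y <= cot x.
Proof.
move=> x0 xy yp; have hp := PI2_3_2.
have sx : 0 < sin x by apply: sin_gt_0; lra.
have sy : 0 < sin y by apply: sin_gt_0; lra.
suff : 0 <= cot x - cot y by lra.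
have -> : cot x - cot y = sin (y - x) / (sin x * sin y).
  by rewrite sin_minus /cot; field; lra.
apply: Rdiv_le_0_compat; last by nra.
by apply: sin_ge_0; lra.
Qed.

(* The inverse of [e g - 1], see [e_diff]. *)
Definition kl_weight g : C := (- (1 / 2), - (1 / 2) * cot (PI * g)).

Lemma e_diff x y : sin (PI * (y - x)) <> 0 ->
  e x = ((e y - e x) * kl_weight (y - x))%C.
Proof.
move=> hs; have -> : e y = (e x * e (y - x))%C by rewrite -e_add; congr e; ring.
suff : ((e (y - x) - 1) * kl_weight (y - x) = 1)%C.
  by move=> h; transitivity (e x * ((e (y - x) - 1) * kl_weight (y - x)))%C; [rewrite h; ring | ring].
move: (y - x) hs => g hs.
rewrite /e /kl_weight /cot.
have -> : 2 * PI * g = 2 * (PI * g) by ring.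
rewrite sin_2a cos_2a; move: (sin2_cos2 (PI * g)) hs; rewrite /Rsqr.
set s := sin _; set c := cos _ => h hs.
rewrite /Cmult /Cminus /Cplus /Copp /RtoC /=; congr (_, _); field_simplify => //; try lra.
- have -> : s ^ 2 = 1 - c * c by lra.
  by field_simplify; lra.
Qed.

Lemma Cmod_pair_le x y : Cmod (x, y) <= Rabs x + Rabs y.
Proof.
have -> : (x, y) = (RtoC x + Ci * RtoC y)%C.
  by rewrite /Cplus /Cmult /=; congr (_, _); ring.
apply: Rle_trans (Cmod_triangle _ _) _.
by rewrite Cmod_mult !Cmod_R Cmod_Ci; lra.
Qed.

(** By [e_diff] each term is the difference of two consecutive terms times [kl_weight]. The real
    part of this weight is constant and its imaginary part is monotone, because the increments of
    [f] decrease. Summation by parts thus leaves boundary terms and a variation that telescopes to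
    the largest cotangent, at most [/ th]. *)
Lemma kusmin_landau (f : nat -> R) (a b : nat) (th : R) :
  0 < th ->
  (forall n, (a <= n)%N -> (n.+1 < b)%N -> th <= f n.+1 - f n <= 1 / 2) ->
  (forall n, (a <= n)%N -> (n.+2 < b)%N -> f n.+2 - f n.+1 <= f n.+1 - f n) ->
  Cmod (\Csum_(a <= n < b) e (f n)) <= 2 + / th.
Proof.
move=> th0 hg hmono; have ith : 0 < / th by apply: Rinv_0_lt_compat.
case: (leqP b a) => [ba|ab]; first by rewrite big_geq // Cmod_0; lra.
case: (leqP b a.+1) => [ba|ab1].
  have -> : b = a.+1 by lia.
  by rewrite big_nat1 Cmod_e; lra.
pose g n := f n.+1 - f n; pose c n := cot (PI * g n).
have hp := PI2_3_2.
have gpos n : (a <= n)%N -> (n.+1 < b)%N -> th <= g n <= 1 / 2 by exact: hg.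
have hsin n : (a <= n)%N -> (n.+1 < b)%N -> th <= sin (PI * g n).
  by move=> h1 h2; have h := gpos n h1 h2; apply: Rle_trans (half_le_sin _); lra.
have cmono n : (a <= n)%N -> (n.+2 < b)%N -> c n <= c n.+1.
  move=> h1 h2; have h3 := gpos n h1 ltac:(lia).
  have h4 := gpos n.+1 ltac:(lia) ltac:(lia).
  have h5 := hmono n h1 h2.
  by apply: cot_nonincr; [nra | apply: Rmult_le_compat_l; [lra| exact: h5] | nra].
have c0 n : (a <= n)%N -> (n.+1 < b)%N -> 0 <= c n <= / th.
  move=> h1 h2; have h3 := gpos n h1 h2; have h4 := hsin n h1 h2.
  have hc : 0 <= cos (PI * g n) by apply: cos_ge_0; nra.
  have hc1 := COS_bound (PI * g n).
  split; first by apply: Rdiv_le_0_compat => //; lra.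
  rewrite /c /cot /Rdiv -[X in _ <= X]Rmult_1_l.
  apply: Rmult_le_compat; try lra; first by left; apply: Rinv_0_lt_compat; lra.
  by apply: Rinv_le_contravar.
pose u n := kl_weight (g n).
(* Invariant of the summation by parts: once the boundary term is removed, the partial sum only
   collects increments of the weights, all of one sign. *)
have key k : (a + k.+1 < b)%N ->
  Cmod (\Csum_(a <= n < a + k.+1) e (f n) - e (f (a + k.+1)%N) * u (a + k)%N) <=
    Cmod (u a) + (c (a + k)%N - c a) / 2.
  elim: k => [|k IH] hk.
    rewrite addn1 big_nat1 addn0.
    have h := hsin a ltac:(lia) ltac:(lia).
    have -> : (e (f a) - e (f a.+1) * u a = - (e (f a) * u a))%C.
      by rewrite {1}(e_diff (x := f a) (y := f a.+1)); [rewrite -/(g a) -/(u a); ring | rewrite -/(g a); lra].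
    by rewrite Cmod_opp Cmod_mult Cmod_e; lra.
  have {IH} := IH ltac:(lia); rewrite (addnS a k.+1) big_nat_recr /=; last by lia.
  set S := \big[_/_]_(_ <= _ < _) _ => IH.
  have ha : (a + k.+1 = (a + k).+1)%N by lia.
  have h := hsin (a + k.+1)%N ltac:(lia) ltac:(lia).
  have -> : (S + e (f (a + k.+1)%N) - e (f (a + k.+1).+1) * u (a + k.+1)%N =
     (S - e (f (a + k.+1)%N) * u (a + k)%N) + e (f (a + k.+1)%N) * (u (a + k)%N - u (a + k.+1)%N))%C.
    rewrite {1}(e_diff (x := f (a + k.+1)%N) (y := f (a + k.+1).+1)); last by rewrite -/(g _); lra.
    by rewrite -/(g _) -/(u _); ring.
  apply: Rle_trans (Cmod_triangle _ _) _; rewrite Cmod_mult Cmod_e.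
  suff : Cmod (u (a + k)%N - u (a + k.+1)%N) <= (c (a + k.+1)%N - c (a + k)%N) / 2 by lra.
  have hc := cmono (a + k)%N ltac:(lia) ltac:(lia); rewrite -ha in hc.
  have -> : (u (a + k)%N - u (a + k.+1)%N)%C = (0, (c (a + k.+1)%N - c (a + k)%N) / 2).
    by rewrite /u /kl_weight -/(c _) -/(c _) /Cminus /Cplus /Copp /=; congr (_, _); field.
  apply: Rle_trans (Cmod_pair_le _ _) _.
  by rewrite Rabs_R0 Rabs_pos_eq; lra.
have hk : (a + (b - a - 2).+1 < b)%N by lia.
have := key _ hk; set k := (b - a - 2)%N in hk *.
have -> : b = (a + k.+1).+1 by rewrite /k; lia.
rewrite big_nat_recr /=; last by lia.
set S := \big[_/_]_(_ <= _ < _) _ => {}key.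
have -> : (S + e (f (a + k.+1)%N) = (S - e (f (a + k.+1)%N) * u (a + k)%N) +
   (e (f (a + k.+1)%N) * u (a + k)%N + e (f (a + k.+1)%N)))%C by ring.
apply: Rle_trans (Cmod_triangle _ _) _.
have h1 : Cmod (e (f (a + k.+1)%N) * u (a + k)%N + e (f (a + k.+1)%N)) <= Cmod (u (a + k)%N) + 1.
  by apply: Rle_trans (Cmod_triangle _ _) _; rewrite Cmod_mult !Cmod_e; lra.
have hu n : (a <= n)%N -> (n.+1 < b)%N -> Cmod (u n) <= 1 / 2 + c n / 2.
  move=> h2 h3; apply: Rle_trans (Cmod_pair_le _ _) _; have h4 := c0 n h2 h3.
  rewrite -/(c n) Rabs_Ropp Rabs_pos_eq; last lra.
  by rewrite Rabs_mult Rabs_Ropp !Rabs_pos_eq; lra.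
have h2 := hu a ltac:(lia) ltac:(lia).
have h3 := hu (a + k)%N ltac:(lia) ltac:(lia).
have h4 := c0 (a + k)%N ltac:(lia) ltac:(lia).
lra.
Qed.

Lemma Csum_shift_supp (F : nat -> C) (lo hi m n s : nat) :
  (forall j, ~~ (lo <= j < hi)%N -> F j = RtoC 0) ->
  (m + s <= lo)%N -> (hi <= n + s)%N ->
  \Csum_(m <= k < n) F (k + s)%N = \Csum_(lo <= j < hi) F j.
Proof.
move=> h0 h1 h2.
have -> : \Csum_(m <= k < n) F (k + s)%N = \Csum_(m + s <= k < n + s) F k.
  by rewrite (big_addn m (n + s) s) addnK.
have z p q : (forall j, (p <= j < q)%N -> ~~ (lo <= j < hi)%N) -> \Csum_(p <= j < q) F j = RtoC 0.
  move=> h; rewrite big_nat_cond big1 // => j /andP[hj _]; apply: h0; exact: h.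
case: (leqP hi lo) => hl.
  by rewrite [RHS]big_geq // z // => j hj; lia.
rewrite (big_cat_nat (n := lo)) /=; try lia.
rewrite (big_cat_nat (m := lo) (n := hi)) /=; try lia.
rewrite (z (m + s)%N lo) ?(z hi (n + s)%N) ?Cplus_0_l ?Cplus_0_r // => j hj; lia.
Qed.

(** For fixed [s] a distance [d >= 1] occurs at most twice, at [s - d] and at [s + d]. *)
Lemma vdc_corr_sum (c : nat -> R) (R s : nat) : (forall d, 0 <= c d) -> (s < R)%N ->
  \Rsum_(0 <= r < R) c (if (s <= r)%N then r - s else s - r)%N <=
  c 0%N + 2 * \Rsum_(1 <= d < R) c d.
Proof.
move=> c0 sR.
rewrite (big_cat_nat (n := s)) /=; try lia.
rewrite (@big_ltn _ _ _ s R) // leqnn subnn.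
have h1 : \Rsum_(0 <= r < s) c (if (s <= r)%N then r - s else s - r)%N <= \Rsum_(1 <= d < R) c d.
  have -> : \Rsum_(0 <= r < s) c (if (s <= r)%N then r - s else s - r)%N = \Rsum_(1 <= d < s.+1) c d.
    rewrite [RHS]big_nat_rev big_add1 /=; apply: eq_big_nat => i hi.
    by case: leqP => h; [lia | congr c; lia].
  rewrite [X in _ <= X](big_cat_nat (n := s.+1)) /=; try lia.
  set x := \big[_/_]_(_ <= _ < _) _; set y := \big[_/_]_(_ <= _ < _) _.
  suff : 0 <= y by lra.
  by apply: Rsum_ge0.
have h2 : \Rsum_(s.+1 <= r < R) c (if (s <= r)%N then r - s else s - r)%N <= \Rsum_(1 <= d < R) c d.
  have -> : \Rsum_(s.+1 <= r < R) c (if (s <= r)%N then r - s else s - r)%N = \Rsum_(1 <= d < R - s) c d.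
    rewrite -[in LHS]add1n big_addn; apply: eq_big_nat => i hi.
    by case: leqP => h; [congr c; lia | lia].
  rewrite [X in _ <= X](big_cat_nat (n := (R - s)%N)) /=; try lia.
  set x := \big[_/_]_(_ <= _ < _) _; set y := \big[_/_]_(_ <= _ < _) _.
  suff : 0 <= y by lra.
  by apply: Rsum_ge0.
lra.
Qed.

(** Each [xi n] lies in exactly [R] of the [b - a + R - 1] windows of length [R] that meet the
    range. Cauchy-Schwarz over the windows, with the squares expanded, leaves correlations at
    distances below [R]. *)
Lemma van_der_corput (xi : nat -> C) (a b R : nat) :
  (a <= b)%N -> (0 < R)%N -> (forall n, (a <= n < b)%N -> Cmod (xi n) <= 1) ->
  INR R * Cmod (\Csum_(a <= n < b) xi n) ^ 2 <=
  INR (b - a + R) * (INR (b - a) +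
    2 * \Rsum_(1 <= d < R) Cmod (\Csum_(a <= n < b - d) (xi (n + d)%N * Cconj (xi n)))).
Proof.
move=> ab R0 hxi.
(* The sequence is extended by zero and moved up by [R], so that every window meeting its support
   starts at a natural number. *)
pose z j := if (a + R <= j < b + R)%N then xi (j - R)%N else RtoC 0.
pose T k := \Csum_(0 <= r < R) z (k + r)%N.
have hS r : (r < R)%N -> \Csum_(a.+1 <= k < b + R) z (k + r)%N = \Csum_(a <= n < b) xi n.
  move=> hr; rewrite (Csum_shift_supp (lo := (a + R)%N) (hi := (b + R)%N)); try lia.
    rewrite big_addn addnK; apply: eq_big_nat => i hi.
    by rewrite /z ifT ?addnK //; lia.
  by move=> j hj; rewrite /z (negbTE hj).
have hRS : (INR R * \Csum_(a <= n < b) xi n = \Csum_(a.+1 <= k < b + R) T k)%C.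
  rewrite /T exchange_big /= -[in LHS](subn0 R) -Csum_const_nat.
  by apply: eq_big_nat => r hr; rewrite hS //; lia.
pose c d := Cmod (\Csum_(a <= n < b - d) (xi (n + d)%N * Cconj (xi n))).
have hcor r s : (r < R)%N -> (s < R)%N -> (s <= r)%N ->
    \Csum_(a.+1 <= k < b + R) (z (k + r)%N * Cconj (z (k + s)%N)) =
    \Csum_(a <= n < b - (r - s)) (xi (n + (r - s))%N * Cconj (xi n)).
  move=> hr hs sr.
  pose F j := (z (j + (r - s))%N * Cconj (z j))%C.
  have -> : \Csum_(a.+1 <= k < b + R) (z (k + r)%N * Cconj (z (k + s)%N)) =
            \Csum_(a.+1 <= k < b + R) F (k + s)%N.
    by apply: eq_bigr => k _; rewrite /F; congr (z _ * _)%C; lia.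
  rewrite (Csum_shift_supp (lo := (a + R)%N) (hi := (b - (r - s) + R)%N)); try lia.
    rewrite big_addn addnK; apply: eq_big_nat => i hi.
    rewrite /F /z !ifT; try lia.
    by rewrite addnK; congr (xi _ * _)%C; lia.
  move=> j hj; rewrite /F /z.
  case: ifP => h1; last by ring.
  case: ifP => h2; first lia.
  by rewrite /Cconj /= Ropp_0; apply: Cmult_0_r.
have hT : \Rsum_(a.+1 <= k < b + R) Cmod (T k) ^ 2 <=
   INR R * (c 0%N + 2 * \Rsum_(1 <= d < R) c d).
  have -> : \Rsum_(a.+1 <= k < b + R) Cmod (T k) ^ 2 =
     Re (\Csum_(0 <= s < R) \Csum_(0 <= r < R) \Csum_(a.+1 <= k < b + R) (z (k + r)%N * Cconj (z (k + s)%N))).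
    transitivity (Re (RtoC (\Rsum_(a.+1 <= k < b + R) Cmod (T k) ^ 2))) => //.
    congr Re; rewrite Csum_RtoC.
    under eq_bigr => k _ do rewrite Cmod_sqr_sum exchange_big /=.
    rewrite exchange_big /=; apply: eq_bigr => s _.
    by rewrite exchange_big.
  apply: Rle_trans (Rle_abs _) _; apply: Rle_trans (re_le_Cmod _) _.
  apply: Rle_trans (Cmod_sum _ _ _) _.
  rewrite -[in X in _ <= X](subn0 R) -Rsum_const_nat subn0.
  apply: Rsum_le_nat => s hs _.
  apply: Rle_trans (Cmod_sum _ _ _) _.
  apply: Rle_trans (vdc_corr_sum (c := c) (s := s) _ _); last lia; last by move=> d; apply: Cmod_ge_0.
  apply: Rsum_le_nat => r hr _.
  case: (leqP s r) => h; first by rewrite hcor; try lia; apply: Rle_refl.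
  have := hcor s r ltac:(lia) ltac:(lia) ltac:(lia) => h'.
  rewrite -Cmod_conj Csum_conj /c -h'; right; congr Cmod; apply: eq_bigr => k _.
  by rewrite Cmult_conj Cconj_conj Cmult_comm.
have hc0 : c 0%N <= INR (b - a).
  rewrite /c subn0 -[X in _ <= X]Rmult_1_r; apply: Cmod_sum_const => [|i hi _]; first lra.
  rewrite addn0 Cmod_mult Cmod_conj; have := hxi i hi; have := Cmod_ge_0 (xi i); nra.
have hR : 0 < INR R by apply: lt_0_INR; lia.
have hn : INR (b + R - a.+1) <= INR (b - a + R) by apply: le_INR; lia.
have h1 : (INR R * Cmod (\Csum_(a <= n < b) xi n)) ^ 2 <=
    INR (b + R - a.+1) * (\Rsum_(a.+1 <= k < b + R) Cmod (T k) ^ 2).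
  have -> : INR R * Cmod (\Csum_(a <= n < b) xi n) = Cmod (\Csum_(a.+1 <= k < b + R) T k).
    by rewrite -hRS Cmod_mult Cmod_R Rabs_pos_eq; lra.
  exact: Cauchy_1.
have hsum0 : 0 <= \Rsum_(1 <= d < R) c d by apply: Rsum_ge0 => d _; apply: Cmod_ge_0.
have hn0 : 0 <= INR (b + R - a.+1) by apply: pos_INR.
suff : INR R * Cmod (\Csum_(a <= n < b) xi n) ^ 2 <=
    INR (b - a + R) * (INR (b - a) + 2 * \Rsum_(1 <= d < R) c d) by [].
apply: (Rmult_le_reg_l (INR R)) => //.
have hc00 : 0 <= c 0%N by apply: Cmod_ge_0.
move: h1 hT hsum0.
set X := \big[Rplus/0]_(_ <= k < _) (Cmod (T k) ^ 2); set W := \big[Rplus/0]_(_ <= d < _) c d.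
move=> h1 hT hsum0.
have hT' : X <= INR R * (INR (b - a) + 2 * W) by nra.
have h3 : INR (b + R - a.+1) * X <= INR (b - a + R) * (INR R * (INR (b - a) + 2 * W)).
  apply: Rle_trans (Rmult_le_compat_l _ _ _ hn0 hT') _.
  apply: Rmult_le_compat_r => //; nra.
by lra.
Qed.

(** * Exponential sums with phase c n^g plus a polynomial *)

Fixpoint dif (rs : seq nat) (f : R -> R) (x : R) : R :=
  if rs is r :: rs' then dif rs' f (x + INR r) - dif rs' f x else f x.

Definition pw (s x : R) : R := x `^ s.

(** The product s (s - 1) ... (s - k + 1), the factor in the k-th derivative of x^s. *)
Fixpoint falling (s : R) (k : nat) : R :=
  if k is k'.+1 then s * falling (s - 1) k' else 1.

Definition prodR (rs : seq nat) : R := foldr (fun r x => INR r * x) 1 rs.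

Lemma dif_cons r rs f x : dif (r :: rs) f x = dif rs f (x + INR r) - dif rs f x.
Proof. by []. Qed.

Lemma difD rs f g x : dif rs (fun y => f y + g y) x = dif rs f x + dif rs g x.
Proof. by elim: rs x => [|r rs IH] x //=; rewrite !IH; ring. Qed.

Lemma difM rs c f x : dif rs (fun y => c * f y) x = c * dif rs f x.
Proof. by elim: rs x => [|r rs IH] x //=; rewrite !IH; ring. Qed.

Lemma is_derive_pw s x : 0 < x -> is_derive (pw s) x (s * pw (s - 1) x).
Proof.
move=> x0; apply/is_derive_Reals; exact: derivable_pt_lim_power.
Qed.

Lemma is_derive_dif_pw rs s x : 0 < x ->
  is_derive (dif rs (pw s)) x (s * dif rs (pw (s - 1)) x).
Proof.
elim: rs x => [|r rs IH] x x0; first exact: is_derive_pw.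
rewrite /= Rmult_minus_distr_l; apply: (is_derive_minus (V := R_NormedModule)); last exact: IH.
have hr := pos_INR r.
have -> : s * dif rs (pw (s - 1)) (x + INR r) = scal 1 (s * dif rs (pw (s - 1)) (x + INR r)).
  by rewrite /scal /= /mult /= Rmult_1_l.
apply: (is_derive_comp (dif rs (pw s)) (fun y => y + INR r)).
  by apply: IH; lra.
by auto_derive.
Qed.

(** One application of the mean value theorem per shift: differencing commutes with differentiation,
    which lowers the exponent by 1. *)
Lemma dif_pw rs s x : 0 < x ->
  exists xi, x <= xi <= x + INR (sumn rs) /\
    dif rs (pw s) x = prodR rs * falling s (size rs) * pw (s - INR (size rs)) xi.
Proof.
elim: rs s x => [|r rs IH] s x x0.
  by exists x; split; [rewrite /= ; lra | rewrite /= Rminus_0_r; ring].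
have hr := pos_INR r.
case: (Req_dec (INR r) 0) => hr0.
  exists x; split; first by have := pos_INR (sumn (r :: rs)); lra.
  by rewrite [LHS]/= hr0 Rplus_0_r /= hr0; ring.
have [c [hc1 hc2]] := MVT_gen (dif rs (pw s)) x (x + INR r) (fun y => s * dif rs (pw (s - 1)) y)
  (fun y hy => is_derive_dif_pw rs s (x := y) ltac:(by move: hy; rewrite Rmin_left; lra))
  (fun y hy => derivable_continuous_pt _ _ (ex_derive_Reals_0 _ _ (ex_intro _ _ (is_derive_dif_pw rs s (x := y) ltac:(by move: hy; rewrite Rmin_left; lra))))).
rewrite Rmin_left in hc1; last lra; rewrite Rmax_right in hc1; last lra.
have [xi [h1 h2]] := IH (s - 1) c ltac:(lra).
exists xi; split.
  by rewrite /= plus_INR; lra.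
change (dif (r :: rs) (pw s) x) with (dif rs (pw s) (x + INR r) - dif rs (pw s) x).
rewrite hc2 h2; change (prodR (r :: rs)) with (INR r * prodR rs).
change (falling s (size (r :: rs))) with (s * falling (s - 1) (size rs)).
have -> : s - INR (size (r :: rs)) = s - 1 - INR (size rs) by rewrite [size _]/= S_INR; ring.
ring.
Qed.

Lemma e_dif_step F d rs x :
  (e (dif rs F (x + INR d)) * Cconj (e (dif rs F x)))%C = e (dif (d :: rs) F x).
Proof. by rewrite e_conj -e_add. Qed.

(** One or two further unit shifts turn the first and second differences needed by [kusmin_landau]
    into instances of [dif_pw]; the signs of the two falling factorials are the sign of the
    increments and their monotonicity. For 0 < g < 1 these signs hold after an odd number of
    differencings, such as the one or three used later. The point 6 M bounds [n] plus all shifts. *)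
Lemma kl_dif_pw (g c be : R) (rs : seq nat) (a b M : nat) :
  0 < c -> (0 < M)%N -> 0 < prodR rs -> g <= 1 ->
  falling g (size rs).+1 < 0 -> 0 <= falling g (size rs).+2 ->
  (M <= a)%N -> (b <= 2 * M)%N -> (sumn rs <= 3 * M)%N ->
  c * prodR rs * (- falling g (size rs).+1) * pw (g - INR (size rs).+1) (INR M) <= 1 / 2 ->
  Cmod (\Csum_(a <= n < b) e (be + c * dif rs (pw g) (INR n))) <=
   2 + / (c * prodR rs * (- falling g (size rs).+1) * pw (g - INR (size rs).+1) (6 * INR M)).
Proof.
move=> c0 M0 D0 g1 A0 A1 Ma bM sM hhalf.
set A := - falling g (size rs).+1 in hhalf *; have hA : 0 < A by rewrite /A; lra.
have hM : 1 <= INR M by apply: (le_INR 1); lia.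
have hk : g - INR (size rs).+1 <= 0 by rewrite S_INR; have := pos_INR (size rs); lra.
have hpw x : 0 < pw (g - INR (size rs).+1) x by apply: pw_gt0.
have hCD : 0 < c * prodR rs * A by apply: Rmult_lt_0_compat => //; apply: Rmult_lt_0_compat.
have diff n : (a <= n)%N -> (n.+1 < b)%N -> exists xi, INR M <= xi <= 6 * INR M /\
    c * dif rs (pw g) (INR n) - c * dif rs (pw g) (INR n.+1) =
    c * prodR rs * A * pw (g - INR (size rs).+1) xi.
  move=> h1 h2; have hn0 : 0 < INR n by apply: lt_0_INR; lia.
  have [xi [hx1 hx2]] := dif_pw (1%N :: rs) g hn0.
  exists xi; split.
    have h3 : INR M <= INR n by apply: le_INR; lia.
    have h4 : INR n + INR (sumn (1%N :: rs)) <= 6 * INR M.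
      have -> : 6 * INR M = INR (6 * M) by rewrite mult_INR /=; ring.
      by rewrite -plus_INR; apply: le_INR; rewrite [sumn _]/=; lia.
    by lra.
  rewrite S_INR -Rmult_minus_distr_l.
  have -> : dif rs (pw g) (INR n) - dif rs (pw g) (INR n + 1) = - dif (1%N :: rs) (pw g) (INR n).
    by rewrite dif_cons; change (INR 1) with 1; ring.
  rewrite hx2 /A; change (size (1%N :: rs)) with (size rs).+1.
  change (prodR (1%N :: rs)) with (INR 1 * prodR rs); change (INR 1) with 1; ring.
(* The increments of the phase are negative; conjugation makes them positive. *)
rewrite -Cmod_conj Csum_conj.
have -> : \Csum_(a <= n < b) Cconj (e (be + c * dif rs (pw g) (INR n))) =
          \Csum_(a <= n < b) e (- be - c * dif rs (pw g) (INR n)).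
  by apply: eq_bigr => n _; rewrite e_conj; congr e; ring.
apply: kusmin_landau.
- by apply: Rmult_lt_0_compat.
- move=> n h1 h2; have [xi [hx1 hx2]] := diff n h1 h2.
  have -> : - be - c * dif rs (pw g) (INR n.+1) - (- be - c * dif rs (pw g) (INR n)) =
     c * dif rs (pw g) (INR n) - c * dif rs (pw g) (INR n.+1) by ring.
  rewrite hx2; split.
    by apply: Rmult_le_compat_l; [lra | apply: pw_baseN => //; lra].
  apply: Rle_trans hhalf.
  by apply: Rmult_le_compat_l; [lra | apply: pw_baseN => //; lra].
- move=> n h1 h2.
  have hn0 : 0 < INR n by apply: lt_0_INR; lia.
  have [xi [hx1 hx2]] := dif_pw (1%N :: 1%N :: rs) g hn0.
  suff : 0 <= c * dif (1%N :: 1%N :: rs) (pw g) (INR n).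
    rewrite !dif_cons !S_INR; rewrite !Rplus_0_l; lra.
  rewrite hx2; change (size [:: 1%N, 1%N & rs]) with (size rs).+2.
  change (prodR [:: 1%N, 1%N & rs]) with (INR 1 * (INR 1 * prodR rs)); change (INR 1) with 1; rewrite !Rmult_1_l.
  apply: Rmult_le_pos; first lra.
  by apply: Rmult_le_pos; [apply: Rmult_le_pos => //; lra | apply/Rlt_le/pw_gt0].
Qed.


Lemma harmonic_le (R : nat) : (0 < R)%N ->
  \Rsum_(1 <= d < R.+1) / INR d <= 1 + ln (INR R).
Proof.
case: R => // R _; elim: R => [|R IH].
  by rewrite big_nat1 ln_1 /= Rinv_1; lra.
rewrite big_nat_recr //=.
suff : / INR R.+2 <= ln (INR R.+2) - ln (INR R.+1) by move: IH; rewrite /=; lra.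
have h1 : 0 < INR R.+1 by apply: lt_0_INR; lia.
have h2 : INR R.+2 = INR R.+1 + 1 by rewrite !S_INR.
have h3 : 0 < / INR R.+2 by apply: Rinv_0_lt_compat; lra.
have h4 : 0 < INR R.+1 / INR R.+2 by apply: Rdiv_lt_0_compat; lra.
have : ln (INR R.+1) = ln (INR R.+1 / INR R.+2) + ln (INR R.+2).
  by rewrite -ln_mult; [congr ln; field; lra | lra | lra].
have := exp_ineq1_le (ln (INR R.+1 / INR R.+2)).
rewrite exp_ln //.
have -> : INR R.+1 / INR R.+2 = 1 - / INR R.+2 by rewrite h2; field; lra.
lra.
Qed.

Lemma harmonic_lt (R : nat) : (0 < R)%N ->
  \Rsum_(1 <= d < R) / INR d <= 1 + ln (INR R).
Proof.
move=> R0; apply: Rle_trans (harmonic_le R0); rewrite [X in _ <= X]big_nat_recr //=.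
have : 0 < / INR R by apply: Rinv_0_lt_compat; apply: lt_0_INR; lia.
by lra.
Qed.

Lemma Rdiv_le_r x y z : 0 < y -> x <= z * y -> x / y <= z.
Proof. by move=> y0 h; apply: (Rmult_le_reg_r y) => //; rewrite /Rdiv Rmult_assoc Rinv_l; lra. Qed.

Lemma square_avg (K x : R) (Rn : nat) (y : nat -> R) :
  0 <= K -> (0 < Rn)%N -> 0 <= x -> (forall d, 0 <= y d) ->
  x <= K / INR Rn * (1 + \Rsum_(1 <= d < Rn) y d) ->
  x ^ 2 <= 2 * K ^ 2 / INR Rn * (1 + \Rsum_(1 <= d < Rn) y d ^ 2).
Proof.
move=> K0 R0 x0 y0 h.
have hR : 1 <= INR Rn by apply: (le_INR 1); lia.
have hX := Cauchy_R1 1 Rn y.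
have hR1 : INR (Rn - 1) <= INR Rn by apply: le_INR; lia.
move: hX h; set X := \big[_/_]_(_ <= _ < _) y _.
set Y := \big[_/_]_(_ <= d < _) y d ^ 2 => hX h.
have X0 : 0 <= X by apply: Rsum_ge0.
have Y0 : 0 <= Y by apply: Rsum_ge0 => d _; apply: pow2_ge_0.
have hX' : X ^ 2 <= INR Rn * Y by nra.
apply: (Rle_trans _ ((K / INR Rn * (1 + X)) ^ 2)); first by apply: pow_incr.
have -> : (K / INR Rn * (1 + X)) ^ 2 = K ^ 2 / INR Rn * ((1 + X) ^ 2 / INR Rn) by field; lra.
have -> : 2 * K ^ 2 / INR Rn * (1 + Y) = K ^ 2 / INR Rn * (2 * (1 + Y)) by field; lra.
apply: Rmult_le_compat_l; first by apply: Rdiv_le_0_compat; [nra | lra].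
apply: Rdiv_le_r; first lra.
have : (1 + X) ^ 2 <= 2 * (1 + X ^ 2) by have := pow2_ge_0 (1 - X); lra.
by nra.
Qed.

Section Phase.

Variables (F : R -> R) (M Rn : nat).
Hypotheses (R0 : (0 < Rn)%N) (RM : (Rn <= M)%N).

Definition phase_sum (rs : seq nat) (a b : nat) : R :=
  Cmod (\Csum_(a <= n < b) e (dif rs F (INR n))) / INR M.

Lemma phase_sum_ge0 rs a b : 0 <= phase_sum rs a b.
Proof.
apply: Rmult_le_pos; first exact: Cmod_ge_0.
by left; apply: Rinv_0_lt_compat; apply: lt_0_INR; lia.
Qed.

Lemma vdc_phase2 rs a b : (M <= a)%N -> (b <= 2 * M)%N ->
  phase_sum rs a b ^ 2 <=
  4 / INR Rn * (1 + \Rsum_(1 <= d < Rn) phase_sum (d :: rs) a (b - d)).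
Proof.
move=> Ma bM.
have hM : 0 < INR M by apply: lt_0_INR; lia.
have hR : 0 < INR Rn by apply: lt_0_INR; lia.
have hiR : 0 < / INR Rn by apply: Rinv_0_lt_compat.
case: (leqP a b) => ab; last first.
  rewrite /phase_sum big_geq; last lia.
  rewrite Cmod_0 /Rdiv Rmult_0_l pow_i; last lia.
  have : 0 <= \Rsum_(1 <= d < Rn) phase_sum (d :: rs) a (b - d).
    by apply: Rsum_ge0 => d _; apply: phase_sum_ge0.
  rewrite /phase_sum /Rdiv => h; apply: Rmult_le_pos; last by lra.
  by lra.
have := van_der_corput (xi := fun n => e (dif rs F (INR n))) ab R0 (fun n _ => Req_le _ _ (Cmod_e _)).
set S := Cmod _; set T := \big[_/_]_(_ <= _ < _) _ => h.
have hT : T = INR M * \Rsum_(1 <= d < Rn) phase_sum (d :: rs) a (b - d).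
  rewrite Rsum_mull; apply: eq_bigr => d _; rewrite /phase_sum.
  have -> : \Csum_(a <= n < b - d) (e (dif rs F (INR (n + d))) * Cconj (e (dif rs F (INR n)))) =
            \Csum_(a <= n < b - d) e (dif (d :: rs) F (INR n)).
    by apply: eq_bigr => n _; rewrite plus_INR e_dif_step.
  by field; lra.
have T0 : 0 <= T by apply: Rsum_ge0 => d _; apply: Cmod_ge_0.
have h1 : INR (b - a) <= INR M by apply: le_INR; lia.
have h2 : INR (b - a + Rn) <= 2 * INR M.
  by change 2 with (INR 2); rewrite -mult_INR; apply: le_INR; lia.
have h3 : INR Rn * S ^ 2 <= 2 * INR M * (INR M + 2 * T).
  apply: Rle_trans h _; apply: Rmult_le_compat => //; try exact: pos_INR; try lra.
  by have := pos_INR (b - a); lra.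
rewrite /phase_sum -/S.
move: hT; set W := \big[Rplus/0]_(_ <= _ < _) phase_sum _ _ _ => hT.
have W0 : 0 <= W by apply: Rsum_ge0 => d _; apply: phase_sum_ge0.
have -> : (S / INR M) ^ 2 = (INR Rn * S ^ 2) / (INR Rn * INR M ^ 2) by field; lra.
apply: Rdiv_le_r; first by apply: Rmult_lt_0_compat => //; apply: pow_lt.
have -> : 4 / INR Rn * (1 + W) * (INR Rn * INR M ^ 2) = 4 * (1 + W) * INR M ^ 2 by field; lra.
by apply: Rle_trans h3 _; rewrite hT; nra.
Qed.

(** Three differencings, as many as the degree of a cubic phase, so that only a constant is left of
    the polynomial. The constants follow [K -> 2 K^2]: 4, then 32, then 2048. *)
Lemma vdc_phase8 a b : (M <= a)%N -> (b <= 2 * M)%N ->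
  phase_sum [::] a b ^ 8 <=
  2048 / INR Rn * (1 + \Rsum_(1 <= d < Rn) (32 / INR Rn * (1 + \Rsum_(1 <= d2 < Rn)
   (4 / INR Rn * (1 + \Rsum_(1 <= d3 < Rn) phase_sum [:: d3; d2; d] a (b - d - d2 - d3)))))).
Proof.
move=> Ma bM.
have hR : 1 <= INR Rn by apply: (le_INR 1); lia.
have h0 (k : R) : 0 <= k -> 0 <= k / INR Rn by move=> k0; apply: Rdiv_le_0_compat; lra.
have p2 rs b' : (b' <= 2 * M)%N -> phase_sum rs a b' ^ 2 <=
  4 / INR Rn * (1 + \Rsum_(1 <= d < Rn) phase_sum (d :: rs) a (b' - d)) by exact: vdc_phase2.
have p4 rs b' : (b' <= 2 * M)%N -> phase_sum rs a b' ^ 4 <=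
  32 / INR Rn * (1 + \Rsum_(1 <= d < Rn) phase_sum (d :: rs) a (b' - d) ^ 2).
  move=> hb; have -> : 32 = 2 * 4 ^ 2 by ring.
  have -> : phase_sum rs a b' ^ 4 = (phase_sum rs a b' ^ 2) ^ 2 by ring.
  apply: (square_avg (y := fun d => phase_sum (d :: rs) a (b' - d)%N)) => //.
  - lra.
  - exact: pow2_ge_0.
  - by move=> d; apply: phase_sum_ge0.
  - exact: p2.
have p8 rs b' : (b' <= 2 * M)%N -> phase_sum rs a b' ^ 8 <=
  2048 / INR Rn * (1 + \Rsum_(1 <= d < Rn) phase_sum (d :: rs) a (b' - d) ^ 4).
  move=> hb; have -> : 2048 = 2 * 32 ^ 2 by ring.
  have -> : phase_sum rs a b' ^ 8 = (phase_sum rs a b' ^ 4) ^ 2 by ring.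
  have -> : \Rsum_(1 <= d < Rn) phase_sum (d :: rs) a (b' - d) ^ 4 =
            \Rsum_(1 <= d < Rn) (phase_sum (d :: rs) a (b' - d) ^ 2) ^ 2.
    by apply: eq_bigr => d _; ring.
  apply: (square_avg (y := fun d => phase_sum (d :: rs) a (b' - d)%N ^ 2)) => //.
  - lra.
  - by apply: pow_le; apply: phase_sum_ge0.
  - by move=> d; apply: pow2_ge_0.
  - exact: p4.
apply: Rle_trans (p8 _ _ bM) _; apply: Rmult_le_compat_l; first by apply: h0; lra.
apply: Rplus_le_compat_l; apply: Rsum_le => d _.
apply: Rle_trans (p4 _ _ _) _; first by lia.
apply: Rmult_le_compat_l; first by apply: h0; lra.
apply: Rplus_le_compat_l; apply: Rsum_le => d2 _.
by apply: p2; lia.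
Qed.

End Phase.

Lemma pw_scale6 (M s : R) (k : nat) : 0 < M -> - INR k <= s <= 0 ->
  / pw s (6 * M) <= 6 ^ k * M `^ (- s).
Proof.
move=> M0 hs; rewrite /pw -pw_opp pw_mulb //; last lra.
apply: Rmult_le_compat_r; first exact: pw_ge0.
rewrite -pw_nat; last lra.
by apply: pw_le; lra.
Qed.

(** Differencing by [d] makes the linear phase constant and leaves increments of size
    [c d n^(g - 2)]; Kusmin-Landau then gives [M^(2 - g) / (c d)], and the sum over [d] costs a
    logarithm. The displayed smallness condition keeps the increments below 1/2. *)
Lemma one_step (g : R) : 0 < g < 1 -> exists K : R, 0 < K /\
  forall (al c : R) (M Rn a b : nat), 0 < c -> (0 < Rn <= M)%N -> (M <= a)%N -> (b <= 2 * M)%N ->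
  c * INR Rn * INR M `^ (g - 2) <= 1 / 2 ->
  (Cmod (\Csum_(a <= n < b) e (al * INR n + c * INR n `^ g)) / INR M) ^ 2 <=
  K / INR Rn * (1 + INR M `^ (1 - g) * (1 + ln (INR Rn)) / c).
Proof.
move=> g01; set A := g * (1 - g); have hA : 0 < A by rewrite /A; nra.
have hA1 : A <= 1 by rewrite /A; nra.
exists (12 + 144 / A); split.
  by have := Rdiv_lt_0_compat 144 A; lra.
move=> al c M Rn a b c0 /andP[R0 RM] Ma bM hcond.
have hR : 1 <= INR Rn by apply: (le_INR 1); lia.
have hM : 1 <= INR M by apply: (le_INR 1); lia.
pose F x := al * x + c * pw g x.
have := vdc_phase2 F R0 RM [::] Ma bM.
rewrite {1}/phase_sum.
have -> : \Csum_(a <= n < b) e (dif [::] F (INR n)) =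
          \Csum_(a <= n < b) e (al * INR n + c * INR n `^ g) by apply: eq_bigr.
move=> h; apply: Rle_trans h _.
have hlnR : 0 <= ln (INR Rn) by rewrite -ln_1; apply: ln_le; lra.
(* 36 = 6^2 is the loss in passing from 6 M to M in [pw_scale6] with exponent g - 2 >= -2. *)
set Q := 36 / A * INR M `^ (1 - g) / c.
have hf2 : falling g 2 = - A by rewrite /A /=; ring.
have hf3 : falling g 3 = A * (2 - g) by rewrite /A /=; ring.
have hd d : (1 <= d < Rn)%N -> phase_sum F M [:: d] a (b - d) <= 2 / INR M + Q * / INR d.
  move=> hd; have hdR : 1 <= INR d by apply: (le_INR 1); lia.
  have hdR' : INR d <= INR Rn by apply: le_INR; lia.
  rewrite /phase_sum; apply: Rdiv_le_r; first lra.
  have -> : \Csum_(a <= n < b - d) e (dif [:: d] F (INR n)) =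
    \Csum_(a <= n < b - d) e (al * INR d + c * dif [:: d] (pw g) (INR n)).
    by apply: eq_bigr => n _; congr e; rewrite /F /=; ring.
  apply: Rle_trans (@kl_dif_pw g c _ [:: d] a (b - d) M c0 _ _ _ _ _ _ _ _ _) _; try lia; try lra.
  - by rewrite /prodR /=; lra.
  - by change (size [:: d]).+1 with 2%N; lra.
  - by change (size [:: d]).+2 with 3%N; rewrite hf3; nra.
  - by rewrite /=; lia.
  - change (size [:: d]).+1 with 2%N; rewrite hf2.
    have -> : g - INR 2 = g - 2 by rewrite /=; ring.
    apply: Rle_trans hcond; apply: Rmult_le_compat_r; first exact: pw_ge0.
    have -> : c * prodR [:: d] * - - A = c * (INR d * A) by rewrite /prodR /=; ring.
    by apply: Rmult_le_compat_l; [lra | nra].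
  - change (size [:: d]).+1 with 2%N; rewrite hf2.
    have -> : g - INR 2 = g - 2 by rewrite /=; ring.
    have -> : c * prodR [:: d] * - - A = c * INR d * A by rewrite /prodR /=; ring.
    have hcd : 0 < c * INR d * A by apply: Rmult_lt_0_compat => //; nra.
    rewrite Rinv_mult.
    have hs := pw_scale6 (M := INR M) (s := g - 2) (k := 2) ltac:(lra) ltac:(rewrite /=; lra).
    have -> : (2 / INR M + Q * / INR d) * INR M =
       2 + / (c * INR d * A) * (6 ^ 2 * (INR M `^ (1 - g) * INR M)).
      by rewrite /Q; field; lra.
    apply: Rplus_le_compat_l; apply: Rmult_le_compat_l.
      by left; apply: Rinv_0_lt_compat.
    apply: Rle_trans hs _; apply: Rmult_le_compat_l; first lra.
    rewrite -[X in _ <= _ * X]pw_1; last lra.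
    by rewrite -pw_add; right; congr Rpower; ring.
have hsum : \Rsum_(1 <= d < Rn) phase_sum F M [:: d] a (b - d) <= 2 + Q * (1 + ln (INR Rn)).
  apply: (Rle_trans _ (\Rsum_(1 <= d < Rn) (2 / INR M + Q * / INR d))).
    by apply: Rsum_le_nat => d h _; apply: hd.
  rewrite big_split /= Rsum_const_nat -Rsum_mull.
  apply: Rplus_le_compat.
    have : INR (Rn - 1) <= INR M by apply: le_INR; lia.
    move=> h; have -> : INR (Rn - 1) * (2 / INR M) = (2 * INR (Rn - 1)) / INR M by field; lra.
    by apply: Rdiv_le_r; lra.
  apply: Rmult_le_compat_l; last exact: harmonic_lt.
  rewrite /Q; apply: Rdiv_le_0_compat => //; apply: Rmult_le_pos; last exact: pw_ge0.
  by apply: Rdiv_le_0_compat; lra.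
have -> : (12 + 144 / A) / INR Rn * (1 + INR M `^ (1 - g) * (1 + ln (INR Rn)) / c) =
  4 / INR Rn * (1 + 2 + Q * (1 + ln (INR Rn)) + (36 / A + 3 * (INR M `^ (1 - g) * (1 + ln (INR Rn)) / c))).
  by rewrite /Q; field; lra.
apply: Rmult_le_compat_l; first by apply: Rdiv_le_0_compat; lra.
suff : 0 <= 36 / A + 3 * (INR M `^ (1 - g) * (1 + ln (INR Rn)) / c) by lra.
apply: Rplus_le_le_0_compat; first by apply: Rdiv_le_0_compat; lra.
apply: Rmult_le_pos; first lra.
apply: Rdiv_le_0_compat => //; apply: Rmult_le_pos; first exact: pw_ge0.
by lra.
Qed.

(** The cubic analogue of [one_step]: after three differencings the increments have size
    [c d d2 d3 n^(g - 4)], and the three harmonic sums give the cube of the logarithm. *)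
Lemma three_step (g : R) : 0 < g < 1 -> exists K : R, 0 < K /\
  forall (al c : R) (M Rn a b : nat), 0 < c -> (0 < Rn <= M)%N -> (M <= a)%N -> (b <= 2 * M)%N ->
  c * INR Rn ^ 3 * INR M `^ (g - 4) <= 1 / 4 ->
  (Cmod (\Csum_(a <= n < b) e (al * INR n ^ 3 + c * INR n `^ g)) / INR M) ^ 8 <=
  K / INR Rn * (1 + INR M `^ (3 - g) * (1 + ln (INR Rn)) ^ 3 / (c * INR Rn ^ 2)).
Proof.
move=> g01; set A := g * (1 - g) * ((2 - g) * (3 - g)).
have hA : 0 < A by apply: Rmult_lt_0_compat; nra.
(* [A] may exceed 1 here, unlike in [one_step]; since it is below 2, the smallness condition with
   1/4 still provides the 1/2 of Kusmin-Landau. *)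
have hA1 : A <= 3 / 2.
  have h1 : g * (1 - g) <= 1 / 4 by have := pow2_ge_0 (g - 1 / 2); lra.
  have h2 : 0 <= (2 - g) * (3 - g) <= 6 by nra.
  by have := Rmult_le_compat (g * (1 - g)) (1 / 4) ((2 - g) * (3 - g)) 6; rewrite -/A; nra.
pose K0 := 6 ^ 4 / A; have hK0 : 0 < K0 by apply: Rdiv_lt_0_compat; lra.
(* 417 = 1 + 32 * 13 and 13 = 1 + 4 * 3 collect the diagonal terms of the three levels; 128 = 32 * 4
   multiplies the main term. *)
exists (2048 * 417 + 2048 * 128 * K0); split; first lra.
move=> al c M Rn a b c0 /andP[R0 RM] Ma bM hcond.
have hR : 1 <= INR Rn by apply: (le_INR 1); lia.
have hM : 1 <= INR M by apply: (le_INR 1); lia.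
pose F x := al * x ^ 3 + c * pw g x.
have := vdc_phase8 F R0 RM Ma bM.
rewrite {1}/phase_sum.
have -> : \Csum_(a <= n < b) e (dif [::] F (INR n)) =
          \Csum_(a <= n < b) e (al * INR n ^ 3 + c * INR n `^ g) by apply: eq_bigr.
move=> h; apply: Rle_trans h _.
have hlnR : 0 <= ln (INR Rn) by rewrite -ln_1; apply: ln_le; lra.
set H := 1 + ln (INR Rn); have hH : 1 <= H by rewrite /H; lra.
set Q := K0 * INR M `^ (3 - g) / c.
have hQ : 0 <= Q.
  by apply: Rdiv_le_0_compat => //; apply: Rmult_le_pos; [lra | apply: pw_ge0].
have hf4 : falling g 4 = - A by rewrite /A /=; ring.
have hf5 : falling g 5 = A * (4 - g) by rewrite /A /=; ring.
have hd d d2 d3 : (1 <= d < Rn)%N -> (1 <= d2 < Rn)%N -> (1 <= d3 < Rn)%N ->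
    phase_sum F M [:: d3; d2; d] a (b - d - d2 - d3) <=
    2 / INR M + Q / (INR d * INR d2) * / INR d3.
  move=> hd hd2 hd3.
  have hdR : 1 <= INR d by apply: (le_INR 1); lia.
  have hdR2 : 1 <= INR d2 by apply: (le_INR 1); lia.
  have hdR3 : 1 <= INR d3 by apply: (le_INR 1); lia.
  have hdR' : INR d <= INR Rn by apply: le_INR; lia.
  have hdR2' : INR d2 <= INR Rn by apply: le_INR; lia.
  have hdR3' : INR d3 <= INR Rn by apply: le_INR; lia.
  rewrite /phase_sum; apply: Rdiv_le_r; first lra.
  pose be := al * (6 * INR d * INR d2 * INR d3).
  have hD : 0 < prodR [:: d3; d2; d].
    by rewrite /prodR /=; apply: Rmult_lt_0_compat; [lra | apply: Rmult_lt_0_compat; [lra | nra]].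
  pose be' x := al * dif [:: d3; d2; d] (fun y => y ^ 3) x.
  have hbe x : dif [:: d3; d2; d] F x = be' x + c * dif [:: d3; d2; d] (pw g) x.
    by rewrite /F /be' (difD _ (fun x => al * x ^ 3) (fun x => c * pw g x)) !difM.
  have hbe' x : be' x = be by rewrite /be' /be /=; ring.
  have -> : \Csum_(a <= n < b - d - d2 - d3) e (dif [:: d3; d2; d] F (INR n)) =
    \Csum_(a <= n < b - d - d2 - d3) e (be + c * dif [:: d3; d2; d] (pw g) (INR n)).
    by apply: eq_bigr => n _; rewrite hbe hbe'.
  have hg4 : g - INR 4 = g - 4 by rewrite /=; ring.
  have hP : prodR [:: d3; d2; d] = INR d * INR d2 * INR d3 by rewrite /prodR /=; ring.
  have hP3 : INR d * INR d2 * INR d3 <= INR Rn ^ 3.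
    have -> : INR Rn ^ 3 = INR Rn * INR Rn * INR Rn by ring.
    by apply: Rmult_le_compat; [nra | lra | apply: Rmult_le_compat; lra | lra].
  rewrite hP in hD.
  apply: Rle_trans (@kl_dif_pw g c _ [:: d3; d2; d] a (b - d - d2 - d3) M c0 _ _ _ _ _ _ _ _ _) _; try lia; try lra.
  - by rewrite [size _]/= hf4; lra.
  - by rewrite [size _]/= hf5; nra.
  - by rewrite /=; lia.
  - rewrite [size _]/= hf4 hg4 hP.
    apply: (Rle_trans _ (2 * (c * INR Rn ^ 3 * INR M `^ (g - 4)))); last lra.
    have -> : c * (INR d * INR d2 * INR d3) * - - A * pw (g - 4) (INR M) =
      c * INR M `^ (g - 4) * ((INR d * INR d2 * INR d3) * A) by rewrite /pw; ring.
    have -> : 2 * (c * INR Rn ^ 3 * INR M `^ (g - 4)) =  c * INR M `^ (g - 4) * (INR Rn ^ 3 * 2) by ring.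
    apply: Rmult_le_compat_l; first by apply: Rmult_le_pos; [lra | apply: pw_ge0].
    by apply: Rmult_le_compat; lra.
  - rewrite [size _]/= hf4 hg4 hP Ropp_involutive.
    have hcd : 0 < c * (INR d * INR d2 * INR d3) * A.
      by apply: Rmult_lt_0_compat => //; apply: Rmult_lt_0_compat.
    rewrite Rinv_mult.
    have hs := pw_scale6 (M := INR M) (s := g - 4) (k := 4) ltac:(lra) ltac:(rewrite /=; lra).
    have -> : (2 / INR M + Q / (INR d * INR d2) * / INR d3) * INR M =
       2 + / (c * (INR d * INR d2 * INR d3) * A) * (6 ^ 4 * (INR M `^ (3 - g) * INR M)).
      by rewrite /Q /K0; field; lra.
    apply: Rplus_le_compat_l; apply: Rmult_le_compat_l.
      by left; apply: Rinv_0_lt_compat.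
    apply: Rle_trans hs _; apply: Rmult_le_compat_l; first lra.
    rewrite -[X in _ <= _ * X]pw_1; last lra.
    by rewrite -pw_add; right; congr Rpower; ring.
have hh := harmonic_lt R0; rewrite -/H in hh.
have hsum3 d d2 : (1 <= d < Rn)%N -> (1 <= d2 < Rn)%N ->
    \Rsum_(1 <= d3 < Rn) phase_sum F M [:: d3; d2; d] a (b - d - d2 - d3) <=
    2 + Q * H / INR d * / INR d2.
  move=> h1 h2.
  have hdR : 1 <= INR d by apply: (le_INR 1); lia.
  have hdR2 : 1 <= INR d2 by apply: (le_INR 1); lia.
  apply: (Rle_trans _ (\Rsum_(1 <= d3 < Rn) (2 / INR M + Q / (INR d * INR d2) * / INR d3))).
    by apply: Rsum_le_nat => d3 h3 _; apply: hd.
  rewrite big_split /= Rsum_const_nat -Rsum_mull.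
  apply: Rplus_le_compat.
    have : INR (Rn - 1) <= INR M by apply: le_INR; lia.
    move=> h'; have -> : INR (Rn - 1) * (2 / INR M) = (2 * INR (Rn - 1)) / INR M by field; lra.
    by apply: Rdiv_le_r; lra.
  have -> : Q * H / INR d * / INR d2 = Q / (INR d * INR d2) * H by field; lra.
  by apply: Rmult_le_compat_l => //; apply: Rdiv_le_0_compat => //; nra.
have hsum2 d : (1 <= d < Rn)%N ->
    \Rsum_(1 <= d2 < Rn) (4 / INR Rn * (1 + \Rsum_(1 <= d3 < Rn) phase_sum F M [:: d3; d2; d] a (b - d - d2 - d3)))
    <= 12 + 4 * Q * H ^ 2 / INR Rn * / INR d.
  move=> h1; have hdR : 1 <= INR d by apply: (le_INR 1); lia.
  rewrite -Rsum_mull.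
  have -> : 12 + 4 * Q * H ^ 2 / INR Rn * / INR d = 4 / INR Rn * (INR Rn * 3 + Q * H / INR d * H) by field; lra.
  apply: Rmult_le_compat_l; first by apply: Rdiv_le_0_compat; lra.
  apply: (Rle_trans _ (\Rsum_(1 <= d2 < Rn) (3 + Q * H / INR d * / INR d2))).
    by apply: Rsum_le_nat => d2 h2 _; have := hsum3 d d2 h1 h2; lra.
  rewrite big_split /= Rsum_const_nat -Rsum_mull.
  apply: Rplus_le_compat.
    by apply: Rmult_le_compat_r; [lra | apply: le_INR; lia].
  by apply: Rmult_le_compat_l => //; apply: Rdiv_le_0_compat; nra.
have hsum1 :
    \Rsum_(1 <= d < Rn) (32 / INR Rn * (1 + \Rsum_(1 <= d2 < Rn) (4 / INR Rn *
      (1 + \Rsum_(1 <= d3 < Rn) phase_sum F M [:: d3; d2; d] a (b - d - d2 - d3)))))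
    <= 416 + 128 * Q * H ^ 3 / INR Rn ^ 2.
  rewrite -Rsum_mull.
  have -> : 416 + 128 * Q * H ^ 3 / INR Rn ^ 2 =
    32 / INR Rn * (INR Rn * 13 + 4 * Q * H ^ 2 / INR Rn * H) by field; lra.
  apply: Rmult_le_compat_l; first by apply: Rdiv_le_0_compat; lra.
  apply: (Rle_trans _ (\Rsum_(1 <= d < Rn) (13 + 4 * Q * H ^ 2 / INR Rn * / INR d))).
    by apply: Rsum_le_nat => d h1 _; have := hsum2 d h1; lra.
  rewrite big_split /= Rsum_const_nat -Rsum_mull.
  apply: Rplus_le_compat.
    by apply: Rmult_le_compat_r; [lra | apply: le_INR; lia].
  apply: Rmult_le_compat_l => //; apply: Rdiv_le_0_compat; last lra.
  by apply: Rmult_le_pos; [lra | nra].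
apply: (Rle_trans _ (2048 / INR Rn * (417 + 128 * Q * H ^ 3 / INR Rn ^ 2))).
  by apply: Rmult_le_compat_l; [apply: Rdiv_le_0_compat; lra | lra].
set Z := INR M `^ (3 - g) * H ^ 3 / (c * INR Rn ^ 2).
have hZ : 0 <= Z.
  apply: Rdiv_le_0_compat; last by apply: Rmult_lt_0_compat => //; apply: pow_lt; lra.
  by apply: Rmult_le_pos; [apply: pw_ge0 | apply: pow_le; lra].
have -> : 128 * Q * H ^ 3 / INR Rn ^ 2 = 128 * K0 * Z by rewrite /Q /Z; field; lra.
have hx : 0 <= / INR Rn by left; apply: Rinv_0_lt_compat; lra.
rewrite /Rdiv; move: (/ INR Rn) hx => x hx.
have h1 : 0 <= x * Z by apply: Rmult_le_pos.
have h2 : 0 <= K0 * x by apply: Rmult_le_pos; lra.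
nra.
Qed.

(** * Fejer kernel *)

Lemma INRB m n : (n <= m)%N -> INR (m - n) = INR m - INR n.
Proof. by move=> h; rewrite minus_INR //; lia. Qed.

Lemma INR_gt0 n : (0 < n)%N -> 0 < INR n.
Proof. by move=> h; apply: lt_0_INR; lia. Qed.

Lemma INR_ge1 n : (0 < n)%N -> 1 <= INR n.
Proof. by move=> h; apply: (le_INR 1); lia. Qed.

Lemma INR_le m n : (m <= n)%N -> INR m <= INR n.
Proof. by move=> h; apply: le_INR; lia. Qed.

Lemma INR_lt m n : (m < n)%N -> INR m + 1 <= INR n.
Proof. by move=> h; rewrite -S_INR; apply: INR_le. Qed.

Lemma le_of_INR m n : INR m <= INR n -> (m <= n)%N.
Proof. by move/Stdlib.Reals.RIneq.INR_le => h; apply/leP. Qed.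

Lemma nfloorP x : 0 <= x -> exists n : nat, INR n <= x < INR n + 1.
Proof. by move=> x0; have [n hn] := nfloor_ex x x0; exists n. Qed.

Lemma geom_e th m n : (m <= n)%N ->
  ((1 - e th) * \Csum_(m <= k < n) e (INR k * th) = e (INR m * th) - e (INR n * th))%C.
Proof.
move=> mn; rewrite -(subnKC mn); elim: (n - m)%N => [|k IH].
  by rewrite addn0 big_geq //; ring.
rewrite addnS big_nat_recr /=; last lia.
rewrite Cmult_plus_distr_l IH.
have -> : e (INR (m + k).+1 * th) = (e (INR (m + k) * th) * e th)%C.
  by rewrite -e_add S_INR; congr e; ring.
ring.
Qed.

Lemma geom_bound th m n : Cmod (\Csum_(m <= k < n) e (INR k * th)) * Rabs (sin (PI * th)) <= 1.
Proof.
case: (leqP m n) => mn; last first.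
  by rewrite big_geq ?Cmod_0 ?Rmult_0_l; [lra | lia].
have h := f_equal Cmod (geom_e th mn).
rewrite Cmod_mult Cmod_1_sub_e in h.
have h2 : Cmod (e (INR m * th) - e (INR n * th)) <= 2.
  by apply: Rle_trans (Cmod_triangle _ _) _; rewrite Cmod_opp !Cmod_e; lra.
by rewrite -h in h2; lra.
Qed.

Section Fejer.

Variable H : nat.
Hypothesis H0 : (0 < H)%N.

Definition fejer (x : R) : R := Cmod (\Csum_(0 <= j < H) e (INR j * x)) ^ 2 / INR H.

Lemma fejer_ge0 x : 0 <= fejer x.
Proof. by apply: Rdiv_le_0_compat; [apply: pow2_ge_0 | apply: INR_gt0]. Qed.

Lemma fejer_addZ x (z : Z) : fejer (x + IZR z) = fejer x.
Proof.
rewrite /fejer; congr (Cmod _ ^ 2 / _); apply: eq_bigr => j _.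
by rewrite Rmult_plus_distr_l INR_IZR_INZ -mult_IZR e_addZ.
Qed.

Lemma fejer_le rho x : 0 < rho <= 1 / 2 -> rho <= x <= 1 - rho ->
  fejer x <= / (INR H * rho ^ 2).
Proof.
move=> hr hx; have hH := INR_gt0 H0.
have hs : rho <= sin (PI * x) by apply: sin_PI_ge; lra.
have := geom_bound x 0 H; rewrite Rabs_pos_eq; last lra.
rewrite /fejer; set S := Cmod _ => h.
have S0 : 0 <= S by apply: Cmod_ge_0.
have h2 : S * rho <= 1 by nra.
rewrite Rinv_mult (Rmult_comm (/ _)) /Rdiv; apply: Rmult_le_compat_r.
  by left; apply: Rinv_0_lt_compat.
apply: (Rmult_le_reg_r (rho ^ 2)); first by apply: pow_lt; lra.
rewrite Rinv_l; last by apply: pow_nonzero; lra.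
have hSr : 0 <= S * rho by apply: Rmult_le_pos; lra.
have -> : S ^ 2 * rho ^ 2 = (S * rho) ^ 2 by ring.
by nra.
Qed.

Lemma fejer_opp x : fejer (- x) = fejer x.
Proof.
rewrite /fejer -Cmod_conj Csum_conj; congr (Cmod _ ^ 2 / _); apply: eq_bigr => j _.
by rewrite e_conj; congr e; ring.
Qed.

Lemma fejerE x : RtoC (INR H * fejer x) =
  \Csum_(0 <= i < H) \Csum_(0 <= j < H) e (INR i * x - INR j * x).
Proof.
have hH := INR_gt0 H0.
have -> : INR H * fejer x = Cmod (\Csum_(0 <= j < H) e (INR j * x)) ^ 2.
  by rewrite /fejer; field; lra.
rewrite Cmod_sqr_sum; apply: eq_bigr => i _; apply: eq_bigr => j _.
by rewrite e_conj -e_add.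
Qed.

(* With L sample points per period and L >= H, the discrete average of the
   kernel is exactly 1. *)
Definition fejer_avg (L K : nat) (u x : R) : R :=
  (\Rsum_(0 <= k < K) fejer (x - u - INR k / INR L)) / INR L.

Lemma fejer_avg_ge0 L K u x : (0 < L)%N -> 0 <= fejer_avg L K u x.
Proof.
move=> L0; apply: Rdiv_le_0_compat; last exact: INR_gt0.
by apply: Rsum_ge0 => k _; apply: fejer_ge0.
Qed.

Definition avg_coef (L K : nat) (u : R) (i j : nat) : C :=
  \Csum_(0 <= k < K) e (- (INR i - INR j) * (u + INR k / INR L)).

Lemma fejer_avgE L K u x : (0 < L)%N ->
  RtoC (INR L * INR H * fejer_avg L K u x) =
  \Csum_(0 <= i < H) \Csum_(0 <= j < H) (avg_coef L K u i j * e ((INR i - INR j) * x)).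
Proof.
move=> L0; have hL := INR_gt0 L0.
have -> : INR L * INR H * fejer_avg L K u x = \Rsum_(0 <= k < K) (INR H * fejer (x - u - INR k / INR L)).
  by rewrite -Rsum_mull /fejer_avg; field; lra.
rewrite Csum_RtoC; under eq_bigr => k _ do rewrite fejerE.
rewrite exchange_big /=; apply: eq_bigr => i _.
rewrite exchange_big /=; apply: eq_bigr => j _.
rewrite /avg_coef Csum_mulr; apply: eq_bigr => k _.
by rewrite -e_add; congr e; ring.
Qed.

Lemma avg_coef_diag L K u i : avg_coef L K u i i = INR K.
Proof.
rewrite /avg_coef (eq_bigr (fun=> RtoC 1)); last first.
  by move=> k _; rewrite Rminus_diag -e_0; congr e; ring.
by rewrite Csum_const_nat subn0; ring.
Qed.

Definition ndist (i j : nat) : nat := ((i - j) + (j - i))%N.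

Lemma sin_ndist L i j : (0 < L)%N -> (2 * ndist i j <= L)%N ->
  INR (ndist i j) / INR L <= Rabs (sin (PI * (- (INR i - INR j) / INR L))).
Proof.
move=> L0 hij; have hL := INR_gt0 L0.
have hd : 0 <= INR (ndist i j) / INR L <= 1 / 2.
  split; first by apply: Rdiv_le_0_compat => //; apply: pos_INR.
  apply: Rdiv_le_r => //; have := INR_le hij; rewrite mult_INR; change (INR 2) with 2; lra.
have h := half_le_sin hd.
have habs : Rabs (sin (PI * (- (INR i - INR j) / INR L))) = Rabs (sin (PI * (INR (ndist i j) / INR L))).
  rewrite /ndist; case: (leqP i j) => ij.
    have -> : (i - j + (j - i) = j - i)%N by lia.
    by rewrite INRB //; congr (Rabs (sin _)); field; lra.
  have -> : (i - j + (j - i) = i - j)%N by lia.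
  rewrite INRB; last lia.
  by rewrite -Rabs_Ropp -sin_neg; congr (Rabs (sin _)); field; lra.
rewrite habs; apply: Rle_trans h (Rle_abs _).
Qed.

Lemma avg_coef_le L K u i j : (0 < L)%N -> (2 * ndist i j <= L)%N -> i != j ->
  Cmod (avg_coef L K u i j) <= INR L / INR (ndist i j).
Proof.
move=> L0 hij ij; have hL := INR_gt0 L0.
have hd0 : 0 < INR (ndist i j) by apply: INR_gt0; rewrite /ndist; lia.
have -> : avg_coef L K u i j = (e (- (INR i - INR j) * u) * \Csum_(0 <= k < K) e (INR k * (- (INR i - INR j) / INR L)))%C.
  rewrite /avg_coef Csum_mull; apply: eq_bigr => k _; rewrite -e_add; congr e; field; lra.
rewrite Cmod_mult Cmod_e Rmult_1_l.
have := geom_bound (- (INR i - INR j) / INR L) 0 K.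
have := sin_ndist L0 hij.
set s := Rabs _; set S := Cmod _ => h1 h2.
have S0 : 0 <= S by apply: Cmod_ge_0.
have hp : 0 < INR (ndist i j) / INR L by apply: Rdiv_lt_0_compat.
have h3 : S * (INR (ndist i j) / INR L) <= 1 by nra.
apply: (Rmult_le_reg_r (INR (ndist i j) / INR L)) => //.
by have -> : INR L / INR (ndist i j) * (INR (ndist i j) / INR L) = 1 by field; lra.
Qed.

Lemma fejer_avg_full L u x : (H <= L)%N -> fejer_avg L L u x = 1.
Proof.
move=> HL; have L0 : (0 < L)%N by lia.
have hL := INR_gt0 L0; have hH := INR_gt0 H0.
suff h : RtoC (INR L * INR H * fejer_avg L L u x) = RtoC (INR L * INR H).
  have {}h : INR L * INR H * fejer_avg L L u x = INR L * INR H by case: h.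
  apply: (Rmult_eq_reg_l (INR L * INR H)); first by rewrite h; ring.
  by apply: Rmult_integral_contrapositive_currified; lra.
rewrite fejer_avgE //.
have hz i j : (i < H)%N -> (j < H)%N -> i != j -> avg_coef L L u i j = RtoC 0.
  move=> hi hj ij.
  have -> : avg_coef L L u i j = (e (- (INR i - INR j) * u) * \Csum_(0 <= k < L) e (INR k * (- (INR i - INR j) / INR L)))%C.
    rewrite /avg_coef Csum_mull; apply: eq_bigr => k _; rewrite -e_add; congr e; field; lra.
  have hg := geom_e (- (INR i - INR j) / INR L) (leq0n L).
  have h1 : e (INR L * (- (INR i - INR j) / INR L)) = RtoC 1.
    have -> : INR L * (- (INR i - INR j) / INR L) = IZR (Z.of_nat j - Z.of_nat i).
      by rewrite minus_IZR -!INR_IZR_INZ; field; lra.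
    exact: e_IZR.
  rewrite h1 Rmult_0_l e_0 in hg.
  have hne : (1 - e (- (INR i - INR j) / INR L))%C <> 0.
    apply/Cmod_gt_0; rewrite Cmod_1_sub_e.
    have hs : sin (PI * (- (INR i - INR j) / INR L)) <> 0.
      have hd1 : 0 < INR (ndist i j) < INR L.
        split; first by apply: INR_gt0; rewrite /ndist; lia.
        by apply: (Rlt_le_trans _ (INR (ndist i j) + 1)); [lra | apply: INR_lt; rewrite /ndist; lia].
      have hp := PI_RGT_0.
      have hsp : 0 < sin (PI * (INR (ndist i j) / INR L)).
        have hq : 0 < INR (ndist i j) / INR L < 1.
          split; first by apply: Rdiv_lt_0_compat; lra.
          by apply: (Rmult_lt_reg_r (INR L)) => //; rewrite /Rdiv Rmult_assoc Rinv_l; lra.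
        by apply: sin_gt_0; nra.
      move: hsp; rewrite /ndist; case: (leqP i j) => hij.
        have -> : (i - j + (j - i) = j - i)%N by lia.
        rewrite INRB //; have -> : (INR j - INR i) / INR L = - (INR i - INR j) / INR L by field; lra.
        lra.
      have -> : (i - j + (j - i) = i - j)%N by lia.
      rewrite INRB; last lia.
      have -> : PI * (- (INR i - INR j) / INR L) = - (PI * ((INR i - INR j) / INR L)) by field; lra.
      by rewrite sin_neg; lra.
    by have := Rabs_pos_lt _ hs; lra.
  have -> : \Csum_(0 <= k < L) e (INR k * (- (INR i - INR j) / INR L)) = RtoC 0.
    have := f_equal (fun z => (/ (1 - e (- (INR i - INR j) / INR L)) * z)%C) hg.
    rewrite Cmult_assoc Cinv_l // Cmult_1_l => ->.
    ring.
  ring.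
transitivity (\Csum_(0 <= i < H) (RtoC (INR L))).
  apply: eq_big_nat => i hi.
  rewrite (bigD1_seq i) ?mem_index_iota ?iota_uniq //=.
  rewrite avg_coef_diag big_seq_cond big1; last first.
    move=> j /andP[]; rewrite mem_index_iota => hj ji; rewrite hz; try lia; ring.
  by rewrite Rminus_diag Rmult_0_l e_0; ring.
by rewrite Csum_const_nat subn0 RtoC_mult; ring.
Qed.

Lemma ndist_sum (f : nat -> R) i : (i < H)%N -> (forall d, 0 <= f d) ->
  \Rsum_(0 <= j < H | j != i) f (ndist i j) <= 2 * \Rsum_(1 <= d < H) f d.
Proof.
move=> iH f0.
(* Setting the value at 0 to zero removes the diagonal term, so that [vdc_corr_sum] applies. *)
pose g (d : nat) := if d is _.+1 then f d else 0.
have g0 d : 0 <= g d by case: d => //=; lra.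
have -> : \Rsum_(1 <= d < H) f d = \Rsum_(1 <= d < H) g d.
  by apply: eq_big_nat => -[].
have := vdc_corr_sum g0 iH; rewrite [g 0%N]/= Rplus_0_l; apply: Rle_trans.
rewrite big_mkcond /=; right; apply: eq_bigr => j _.
rewrite /ndist; case: eqP => [->|hji] /=.
  by rewrite leqnn subnn.
have gS d : (0 < d)%N -> g d = f d by case: d.
by case: leqP => h; rewrite gS; try lia; congr f; lia.
Qed.

(** In the expansion into characters the diagonal produces the mean value [K / L], which is
    subtracted; frequency [i - j] carries a coefficient at most [L / |i - j|] and an exponential sum
    at most [T], and there remains a harmonic sum. *)
Lemma fejer_avg_sum L K u (c : nat -> C) (x : nat -> R) (a b : nat) (T : R) :
  (2 * H <= L)%N -> 0 <= T ->
  (forall d, (0 < d < H)%N -> Cmod (\Csum_(a <= n < b) (c n * e (INR d * x n))) <= T) ->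
  (forall d, (0 < d < H)%N -> Cmod (\Csum_(a <= n < b) (c n * e (- (INR d * x n)))) <= T) ->
  Cmod (\Csum_(a <= n < b) (c n * RtoC (fejer_avg L K u (x n) - INR K / INR L))) <=
  2 * T * (1 + ln (INR H)).
Proof.
move=> HL T0 hT1 hT2; have L0 : (0 < L)%N by lia.
have hL := INR_gt0 L0; have hH := INR_gt0 H0.
have hLH : 0 < INR L * INR H by apply: Rmult_lt_0_compat.
pose S i j := \Csum_(a <= n < b) (c n * e ((INR i - INR j) * x n)).
have hS i j : (i < H)%N -> (j < H)%N -> i != j -> Cmod (S i j) <= T.
  move=> hi hj ij; rewrite /S; case: (leqP i j) => h.
    have -> : \Csum_(a <= n < b) (c n * e ((INR i - INR j) * x n)) =
              \Csum_(a <= n < b) (c n * e (- (INR (j - i) * x n))).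
      by apply: eq_bigr => n _; rewrite INRB //; congr (_ * e _)%C; ring.
    by apply: hT2; lia.
  have -> : \Csum_(a <= n < b) (c n * e ((INR i - INR j) * x n)) =
            \Csum_(a <= n < b) (c n * e (INR (i - j) * x n)).
    by apply: eq_bigr => n _; rewrite INRB //; lia.
  by apply: hT1; lia.
have hmain : (RtoC (INR L * INR H) * \Csum_(a <= n < b) (c n * RtoC (fejer_avg L K u (x n) - INR K / INR L)))%C =
    \Csum_(0 <= i < H) \Csum_(0 <= j < H | j != i) (avg_coef L K u i j * S i j).
  rewrite Csum_mull.
  transitivity (\Csum_(a <= n < b) \Csum_(0 <= i < H) \Csum_(0 <= j < H | j != i)
     (avg_coef L K u i j * (c n * e ((INR i - INR j) * x n)))).
    apply: eq_bigr => n _.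
    have -> : (RtoC (INR L * INR H) * (c n * RtoC (fejer_avg L K u (x n) - INR K / INR L)))%C =
       (c n * (RtoC (INR L * INR H * fejer_avg L K u (x n)) - RtoC (INR H * INR K)))%C.
      move: (fejer_avg L K u (x n)) => G.
      rewrite RtoC_minus !RtoC_mult RtoC_inv; last lra.
      by field; case=> h; lra.
    rewrite fejer_avgE //.
    have -> : RtoC (INR H * INR K) = \Csum_(0 <= i < H) RtoC (INR K).
      by rewrite Csum_const_nat subn0 RtoC_mult.
    rewrite -CsumB Csum_mull; apply: eq_big_nat => i hi.
    rewrite (bigD1_seq i) ?mem_index_iota ?iota_uniq //=.
    rewrite avg_coef_diag Rminus_diag Rmult_0_l e_0.
    transitivity (c n * \Csum_(0 <= j < H | j != i) (avg_coef L K u i j * e ((INR i - INR j) * x n)))%C.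
      ring.
    by rewrite Csum_mull; apply: eq_bigr => j _; ring.
  rewrite exchange_big /=; apply: eq_bigr => i _.
  rewrite exchange_big /=; apply: eq_bigr => j _.
  by rewrite /S Csum_mull.
apply: (Rmult_le_reg_l (INR L * INR H)) => //.
have -> : INR L * INR H * Cmod (\Csum_(a <= n < b) (c n * RtoC (fejer_avg L K u (x n) - INR K / INR L))) =
   Cmod (RtoC (INR L * INR H) * \Csum_(a <= n < b) (c n * RtoC (fejer_avg L K u (x n) - INR K / INR L))).
  by rewrite Cmod_mult Cmod_R Rabs_pos_eq //; lra.
rewrite hmain.
apply: Rle_trans (Cmod_sum _ _ _) _.
have -> : INR L * INR H * (2 * T * (1 + ln (INR H))) = INR (H - 0) * (2 * (INR L * T * (1 + ln (INR H)))).
  by rewrite subn0; ring.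
rewrite -Rsum_const_nat; apply: Rsum_le_nat => i hi _.
apply: Rle_trans (Cmod_sum _ _ _) _.
pose f d := INR L * T * / INR d.
apply: (Rle_trans _ (2 * \Rsum_(1 <= d < H) f d)); last first.
  apply: Rmult_le_compat_l; first lra.
  rewrite /f -Rsum_mull; apply: Rmult_le_compat_l; last exact: harmonic_lt.
  by apply: Rmult_le_pos; lra.
have f0 d : 0 <= f d.
  rewrite /f; case: d => [|d]; first by rewrite Rinv_0; lra.
  apply: Rmult_le_pos; first by apply: Rmult_le_pos; lra.
  by left; apply: Rinv_0_lt_compat; apply: INR_gt0.
apply: Rle_trans (ndist_sum (i := i) _ f0); last lia.
apply: Rsum_le_nat => j hj ji; rewrite Cmod_mult /f.
have -> : INR L * T * / INR (ndist i j) = INR L / INR (ndist i j) * T by rewrite /Rdiv; ring.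
apply: Rmult_le_compat; try exact: Cmod_ge_0.
  by apply: avg_coef_le => //; [rewrite /ndist; lia | rewrite eq_sym].
by apply: hS; [lia | lia | rewrite eq_sym].
Qed.

End Fejer.

Lemma fejer_tail (H L K0 K1 : nat) (u x tau : R) : (0 < H)%N -> (0 < L)%N -> (K1 <= L)%N ->
  0 <= tau ->
  (forall k, (K0 <= k < K1)%N -> fejer H (x - u - INR k / INR L) <= tau) ->
  (\Rsum_(K0 <= k < K1) fejer H (x - u - INR k / INR L)) / INR L <= tau.
Proof.
move=> H0 L0 KL t0 h; have hL := INR_gt0 L0; apply: Rdiv_le_r => //.
apply: Rle_trans (Rsum_le_const_nat (P := xpredT) t0 (fun k hk _ => h k hk)) _.
rewrite Rmult_comm; apply: Rmult_le_compat_l => //; apply: INR_le; lia.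
Qed.

(** [p] is the indicator of a window modulo 1 whose length varies with [n] between [dm] and [dp]. It
    is trapped between smoothed indicators of an interval slightly longer than [dp] and one slightly
    shorter than [dm]. For the longer one the weighted sum is evaluated by Fourier expansion; the
    gap between the two is summed in the same way without the weights [c], which is why sums with
    and without [c] are assumed small. *)
Lemma fejer_block (H : nat) (c : nat -> C) (x p : nat -> R) (a b : nat) (dm dp rho T : R) :
  (0 < H)%N -> 0 < rho <= 1 / 2 -> 0 <= dm <= dp -> dp <= 1 -> 0 <= T -> (a <= b)%N ->
  (forall n, (a <= n < b)%N -> Cmod (c n) <= 1) ->
  (forall n, (a <= n < b)%N ->
     (p n = 1 /\ exists z : Z, 0 <= x n + IZR z < dp) \/
     (p n = 0 /\ exists z : Z, dm <= x n + IZR z < 1)) ->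
  (forall d, (0 < d < H)%N ->
     Cmod (\Csum_(a <= n < b) (c n * e (INR d * x n))) <= T /\
     Cmod (\Csum_(a <= n < b) (c n * e (- (INR d * x n)))) <= T) ->
  (forall d, (0 < d < H)%N ->
     Cmod (\Csum_(a <= n < b) e (INR d * x n)) <= T /\
     Cmod (\Csum_(a <= n < b) e (- (INR d * x n))) <= T) ->
  Cmod (\Csum_(a <= n < b) (c n * RtoC (p n - dp))) <=
  INR (b - a) * (dp - dm + 6 * rho + 3 / INR H + 3 / (INR H * rho ^ 2)) + 6 * T * (1 + ln (INR H)).
Proof.
move=> H0 hrho hdm hdp T0 ab hc hp hT1 hT2.
(* Twice [H], so that [|i - j| / L <= 1/2] for all frequencies, as [avg_coef_le] requires. *)
pose L := (2 * H)%N; have L0 : (0 < L)%N by rewrite /L; lia.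
have hL := INR_gt0 L0; have hH := INR_ge1 H0.
set tau := / (INR H * rho ^ 2).
have hr2 : 0 < rho ^ 2 by apply: pow_lt; lra.
have ht : 0 < tau by apply: Rinv_0_lt_compat; apply: Rmult_lt_0_compat; lra.
have hLH : / INR L <= / INR H.
  by apply: Rinv_le_contravar; [lra | apply: INR_le; rewrite /L; lia].
(* [Kp / L] is [dp + 2 rho] rounded up to the grid of mesh [1 / L], or 1 when that exceeds a period.
   Started at [- rho], the smoothed interval exceeds the window by [rho] on both sides. *)
have [Kp [hKp1 hKp2 hKp3 hKp4]] : exists Kp : nat, [/\ (Kp <= L)%N, dp <= INR Kp / INR L,
     INR Kp / INR L <= dp + 2 * rho + / INR H &
     (Kp < L)%N -> dp + 2 * rho <= INR Kp / INR L].
  have [n [hn1 hn2]] := nfloorP (x := (dp + 2 * rho) * INR L) ltac:(apply: Rmult_le_pos; lra).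
  case: (leqP L n) => hn.
    exists L; split => //.
    - by rewrite /Rdiv Rinv_r; lra.
    - have : INR L <= (dp + 2 * rho) * INR L by apply: Rle_trans hn1; apply: INR_le.
      move=> h; rewrite /Rdiv Rinv_r; last lra.
      have : 1 <= dp + 2 * rho by nra.
      by have : 0 < / INR H by [apply: Rinv_0_lt_compat; lra]; lra.
    - by rewrite ltnn.
  have h1 : dp + 2 * rho <= INR n.+1 / INR L.
    by apply: (Rmult_le_reg_r (INR L)) => //; rewrite S_INR /Rdiv Rmult_assoc Rinv_l; lra.
  exists n.+1; split => //; first lra.
  apply: Rdiv_le_r => //; rewrite S_INR.
  have : 1 <= / INR H * INR L.
    have -> : 1 = / INR L * INR L by field; lra.
    by apply: Rmult_le_compat_r; lra.
  lra.
(* The inner interval starts at [rho] and has length [dm - 2 rho] rounded down; it is empty when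
   [dm < 2 rho]. *)
have [Km [hKm1 hKm2 hKm3]] : exists Km : nat, [/\ (Km <= L)%N, dm - 2 * rho - / INR H <= INR Km / INR L &
     forall k, (k < Km)%N -> INR k / INR L <= dm - 2 * rho].
  have hiH : 0 < / INR H by apply: Rinv_0_lt_compat; lra.
  case: (Rle_dec 0 (dm - 2 * rho)) => h; last first.
    exists 0%N; split => //; rewrite [INR 0]/=; lra.
  have [n [hn1 hn2]] := nfloorP (x := (dm - 2 * rho) * INR L) ltac:(apply: Rmult_le_pos; lra).
  have h1 : INR n / INR L <= dm - 2 * rho by apply: Rdiv_le_r; lra.
  exists n; split.
  - apply: le_of_INR; apply: Rle_trans hn1 _.
    rewrite -[X in _ <= X]Rmult_1_l; apply: Rmult_le_compat_r; lra.
  - apply: (Rmult_le_reg_r (INR L)) => //; rewrite /Rdiv Rmult_assoc Rinv_l; last lra.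
    have : 1 <= / INR H * INR L.
      have -> : 1 = / INR L * INR L by field; lra.
      by apply: Rmult_le_compat_r; lra.
    by lra.
  - move=> k hk; apply: Rle_trans h1; apply: Rmult_le_compat_r; last by apply: INR_le; lia.
    by left; apply: Rinv_0_lt_compat.
pose Gp n := fejer_avg H L Kp (- rho) (x n).
pose Gm n := fejer_avg H L Km rho (x n).
have split_avg K u n : (K <= L)%N -> fejer_avg H L K u (x n) =
    1 - (\Rsum_(K <= k < L) fejer H (x n - u - INR k / INR L)) / INR L.
  move=> hK; have := fejer_avg_full H0 u (x n) (L := L) ltac:(rewrite /L; lia).
  rewrite /fejer_avg (big_cat_nat (n := K)) //= => <-.
  by field; lra.
have tail0 K n u : 0 <= (\Rsum_(K <= k < L) fejer H (x n - u - INR k / INR L)) / INR L.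
  by apply: Rdiv_le_0_compat => //; apply: Rsum_ge0 => k _; apply: fejer_ge0.
have hkL k : (k < L)%N -> 0 <= INR k / INR L <= 1 - / INR L.
  move=> hk; split; first by apply: Rdiv_le_0_compat => //; apply: pos_INR.
  apply: Rdiv_le_r => //; have := INR_lt hk.
  have -> : (1 - / INR L) * INR L = INR L - 1 by field; lra.
  by lra.
have hiL : 0 < / INR L by apply: Rinv_0_lt_compat.
have hGp n : (a <= n < b)%N -> p n <= Gp n + tau.
  move=> hn; have := hp n hn => -[[-> [z hz]] | [-> _]]; last first.
    by have := fejer_avg_ge0 H0 Kp (- rho) (x n) L0; rewrite -/(Gp n); lra.
  rewrite /Gp split_avg //.
  suff : (\Rsum_(Kp <= k < L) fejer H (x n - - rho - INR k / INR L)) / INR L <= tau by lra.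
  apply: fejer_tail => //; first lra.
  move=> k hk; have h1 := hKp4 ltac:(lia); have h2 := hkL k ltac:(lia).
  have h3 : INR Kp / INR L <= INR k / INR L.
    by apply: Rmult_le_compat_r; [lra | apply: INR_le; lia].
  rewrite -(fejer_addZ H _ z) -fejer_opp.
  by apply: fejer_le => //; lra.
have hGm n : (a <= n < b)%N -> Gm n - tau <= p n.
  move=> hn; have := hp n hn => -[[-> _] | [-> [z hz]]].
    by rewrite /Gm split_avg //; have := tail0 Km n rho; lra.
  suff : Gm n <= tau by lra.
  rewrite /Gm /fejer_avg; apply: fejer_tail => //; first lra.
  move=> k hk; have h1 := hKm3 k ltac:(lia); have h2 := hkL k ltac:(lia).
  rewrite -(fejer_addZ H _ z).
  by apply: fejer_le => //; lra.
(* From [Gm - tau <= p <= Gp + tau]. When [p] exceeds [Gp] the right side must still be at least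
   [tau], and [Gp - Gm >= - 2 tau] makes it so. *)
have hdiff n : (a <= n < b)%N -> Rabs (p n - Gp n) <= Gp n - Gm n + 3 * tau.
  by move=> hn; have := hGp n hn; have := hGm n hn => h1 h2; apply: Rabs_le; lra.
have hlnH : 0 <= ln (INR H) by rewrite -ln_1; apply: ln_le; lra.
have avg1 K u : Rabs (\Rsum_(a <= n < b) (fejer_avg H L K u (x n) - INR K / INR L)) <= 2 * T * (1 + ln (INR H)).
  have h1 (s : nat -> C) : \Csum_(a <= n < b) (1 * s n) = \Csum_(a <= n < b) s n.
    by apply: eq_bigr => n _; ring.
  have := @fejer_avg_sum H H0 L K u (fun=> RtoC 1) x a b T (leqnn _) T0.
  rewrite (h1 (fun n => RtoC (fejer_avg H L K u (x n) - INR K / INR L))) -Csum_RtoC Cmod_R; apply.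
  - by move=> d hd; rewrite (h1 (fun n => e (INR d * x n))); case: (hT2 d hd).
  - by move=> d hd; rewrite (h1 (fun n => e (- (INR d * x n)))); case: (hT2 d hd).
have -> : \Csum_(a <= n < b) (c n * RtoC (p n - dp)) =
   (\Csum_(a <= n < b) (c n * RtoC (p n - Gp n)) +
    (\Csum_(a <= n < b) (c n * RtoC (Gp n - INR Kp / INR L)) +
     \Csum_(a <= n < b) (c n * RtoC (INR Kp / INR L - dp))))%C.
  rewrite -!big_split /=; apply: eq_bigr => n _; rewrite !RtoC_minus; ring.
have b1 : Cmod (\Csum_(a <= n < b) (c n * RtoC (p n - Gp n))) <=
   INR (b - a) * (INR Kp / INR L - INR Km / INR L + 3 * tau) + 4 * T * (1 + ln (INR H)).
  apply: Rle_trans (Cmod_sum _ _ _) _.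
  apply: (Rle_trans _ (\Rsum_(a <= n < b) ((Gp n - INR Kp / INR L) - (Gm n - INR Km / INR L) + (INR Kp / INR L - INR Km / INR L + 3 * tau)))).
    apply: Rsum_le_nat => n hn _; rewrite Cmod_mult Cmod_R.
    have h1 := hdiff n hn; have h2 := hc n hn; have h3 := Rabs_pos (p n - Gp n); have h4 := Cmod_ge_0 (c n).
    by nra.
  rewrite big_split /= Rsum_const_nat RsumB.
  have h1 := avg1 Kp (- rho); have h2 := avg1 Km rho.
  have h3 := Rle_abs (\Rsum_(a <= n < b) (fejer_avg H L Kp (- rho) (x n) - INR Kp / INR L)).
  have h4 := Rle_abs (- \Rsum_(a <= n < b) (fejer_avg H L Km rho (x n) - INR Km / INR L)).
  by rewrite Rabs_Ropp in h4; rewrite /Gp /Gm; lra.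
have b2 : Cmod (\Csum_(a <= n < b) (c n * RtoC (Gp n - INR Kp / INR L))) <= 2 * T * (1 + ln (INR H)).
  apply: fejer_avg_sum => //.
  - by move=> d hd; case: (hT1 d hd).
  - by move=> d hd; case: (hT1 d hd).
have b3 : Cmod (\Csum_(a <= n < b) (c n * RtoC (INR Kp / INR L - dp))) <= INR (b - a) * (INR Kp / INR L - dp).
  apply: Cmod_sum_const => [|n hn _]; first lra.
  rewrite Cmod_mult Cmod_R Rabs_pos_eq; last lra.
  by have := hc n hn; have := Cmod_ge_0 (c n); nra.
apply: Rle_trans (Cmod_triangle _ _) _.
have t2 := Cmod_triangle (\Csum_(a <= n < b) (c n * RtoC (Gp n - INR Kp / INR L))) (\Csum_(a <= n < b) (c n * RtoC (INR Kp / INR L - dp))).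
apply: (Rle_trans _ (INR (b - a) * (INR Kp / INR L - INR Km / INR L + 3 * tau) + INR (b - a) * (INR Kp / INR L - dp) + 6 * T * (1 + ln (INR H)))).
  lra.
rewrite -Rmult_plus_distr_l; apply: Rplus_le_compat_r; apply: Rmult_le_compat_l; first exact: pos_INR.
have -> : 3 / (INR H * rho ^ 2) = 3 * tau by [].
have -> : 3 / INR H = 3 * / INR H by [].
lra.
Qed.

(** * Piatetski-Shapiro weights *)

Lemma pw_le1 x a : 1 <= x -> a <= 0 -> x `^ a <= 1.
Proof. by move=> x1 a0; have := pw_le x1 a0; rewrite pw_0. Qed.

Definition ind (A : Prop) : R := if excluded_middle_informative A then 1 else 0.

Lemma ind_true (A : Prop) : A -> ind A = 1.
Proof. by move=> hA; rewrite /ind; destruct (excluded_middle_informative A). Qed.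

Lemma ind_false (A : Prop) : ~ A -> ind A = 0.
Proof. by move=> hA; rewrite /ind; destruct (excluded_middle_informative A). Qed.

Lemma ind_01 (A : Prop) : 0 <= ind A <= 1.
Proof. by rewrite /ind; split; destruct (excluded_middle_informative A) => /=; lra. Qed.

Definition psind (g : R) (n : nat) : R := ind (floor_power g n).

Definition psw (g : R) (n : nat) : R := / g * INR n `^ (1 - g) * psind g n.

Definition ceilR (x : R) : R := - IZR (Int_part (- x)).

Lemma ceilRP x : x <= ceilR x < x + 1.
Proof. by rewrite /ceilR; have := base_Int_part (- x); lra. Qed.

Lemma ceilR_IZR x : exists z : Z, ceilR x = IZR z.
Proof. by exists (- Int_part (- x))%Z; rewrite opp_IZR. Qed.

Lemma IZR_lt_le (z w : Z) : IZR z < IZR w -> IZR z + 1 <= IZR w.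
Proof. by move/lt_IZR => h; rewrite -plus_IZR; apply: IZR_le; lia. Qed.

Lemma ceilR_le x y : x <= y -> ceilR x <= ceilR y.
Proof.
move=> xy; have [z hz] := ceilR_IZR x; have [w hw] := ceilR_IZR y.
have := ceilRP x; have := ceilRP y; rewrite hz hw => h1 h2.
case: (Rle_dec (IZR z) (IZR w)) => // h; have := @IZR_lt_le w z; lra.
Qed.

Lemma ceilR_lt x y : ceilR x < y -> ceilR x + 1 <= ceilR y.
Proof.
move=> xy; have [z hz] := ceilR_IZR x; have [w hw] := ceilR_IZR y.
have := ceilRP y; rewrite hz hw in xy * => h1.
by apply: IZR_lt_le; lra.
Qed.

(** [n = [m^(1/g)]] means that [m] lies in the interval from [n^g] (included) to [(n + 1)^g]
    (excluded), and the least integer to test is the ceiling of [n^g]. *)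
Lemma floor_power_ceil g n : 0 < g -> (0 < n)%N ->
  floor_power g n <-> ceilR (INR n `^ g) < (INR n + 1) `^ g.
Proof.
move=> g0 n0; have hn := INR_ge1 n0; have hc := ceilRP (INR n `^ g).
have ig : 0 < / g by apply: Rinv_0_lt_compat.
have inv1 x : 0 < x -> (x `^ g) `^ (1 / g) = x.
  by move=> x0; rewrite pw_pw (_ : g * (1 / g) = 1) ?pw_1 //; field; lra.
have inv2 x : 0 < x -> (x `^ (1 / g)) `^ g = x.
  by move=> x0; rewrite pw_pw (_ : 1 / g * g = 1) ?pw_1 //; field; lra.
have g1 : 0 <= 1 / g by rewrite /Rdiv; lra.
split.
  move=> [m [m1 hm]]; have hm0 : 0 < INR m by apply: lt_0_INR; lia.
  have [h1 h2] := base_Int_part (INR m `^ (1 / g)).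
  rewrite -hm -INR_IZR_INZ in h1 h2.
  have h3 : INR n `^ g <= INR m.
    by rewrite -(inv2 (INR m)) //; apply: pw_base; lra.
  have h4 : INR m < (INR n + 1) `^ g.
    by rewrite -(inv2 (INR m)) //; apply: Rlt_Rpower_l => //; split; [apply: pw_gt0 | lra].
  apply: Rle_lt_trans h4; have [z hz] := ceilR_IZR (INR n `^ g).
  rewrite hz in hc *; rewrite [INR m]INR_IZR_INZ in h3 *.
  case: (Rle_dec (IZR z) (IZR (Z.of_nat m))) => // h.
  by have := @IZR_lt_le (Z.of_nat m) z; lra.
move=> h; have [z hz] := ceilR_IZR (INR n `^ g); rewrite hz in hc h.
have z0 : (0 < z)%Z.
  by apply: lt_IZR; have := pw_ge1 (x := INR n) (a := g); lra.
have hzn : IZR z = INR (Z.to_nat z) by rewrite INR_IZR_INZ Z2Nat.id //; lia.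
exists (Z.to_nat z); split; first by lia.
apply: Int_part_spec; rewrite -INR_IZR_INZ -hzn; split.
  suff : IZR z `^ (1 / g) < INR n + 1 by lra.
  rewrite -(inv1 (INR n + 1)); last lra.
  by apply: Rlt_Rpower_l; [rewrite /Rdiv; lra | split; [apply: IZR_lt | ]].
rewrite -{1}(inv1 (INR n)); last lra.
by apply: pw_base => //; split; [apply: pw_gt0 | lra].
Qed.

Lemma floor_power_1 n : (0 < n)%N -> floor_power 1 n.
Proof.
move=> n0; exists n; split; first lia.
apply: Int_part_spec; rewrite -INR_IZR_INZ.
have -> : 1 / 1 = 1 by field.
by rewrite pw_1; [lra | apply: INR_gt0].
Qed.

Lemma psind_le_ceil g n : 0 < g -> (0 < n)%N ->
  psind g n <= ceilR (INR n.+1 `^ g) - ceilR (INR n `^ g).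
Proof.
move=> g0 n0; have hn := INR_ge1 n0; rewrite /psind S_INR.
have hmon : INR n `^ g <= (INR n + 1) `^ g by apply: pw_base; lra.
rewrite /ind; destruct (excluded_middle_informative (floor_power g n)) as [h|h] => /=.
  by have := ceilR_lt (proj1 (floor_power_ceil g0 n0) h); lra.
by have := ceilR_le hmon; lra.
Qed.

(** Each member [n] raises the ceiling of [n^g] by at least 1, so the sum telescopes. *)
Lemma psind_sum g Y : 0 < g -> (0 < Y)%N -> \Rsum_(1 <= n < Y) psind g n <= INR Y `^ g.
Proof.
move=> g0 Y0; have hY := INR_ge1 Y0.
apply: (Rle_trans _ (ceilR (INR Y `^ g) - 1)); last by have := ceilRP (INR Y `^ g); lra.
case: Y Y0 hY => // Y _ _; elim: Y => [|Y IH].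
  by rewrite big_geq //= pw_1l; have := ceilRP 1; lra.
rewrite big_nat_recr //=.
by have := psind_le_ceil g0 (ltn0Sn Y); move: IH; rewrite /=; lra.
Qed.

Lemma psw_ge0 g n : 0 < g -> 0 <= psw g n.
Proof.
move=> g0; apply: Rmult_le_pos; last by have := ind_01 (floor_power g n); rewrite /psind; lra.
by apply: Rmult_le_pos; [left; apply: Rinv_0_lt_compat | apply: pw_ge0].
Qed.

Lemma psw_sum g Y : 0 < g <= 1 -> (0 < Y)%N -> \Rsum_(1 <= n < Y) psw g n <= INR Y / g.
Proof.
move=> hg Y0; have hY := INR_ge1 Y0.
apply: (Rle_trans _ (\Rsum_(1 <= n < Y) (/ g * INR Y `^ (1 - g) * psind g n))).
  apply: Rsum_le_nat => n hn _; apply: Rmult_le_compat_r.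
    by have := ind_01 (floor_power g n); rewrite /psind; lra.
  apply: Rmult_le_compat_l; first by left; apply: Rinv_0_lt_compat; lra.
  by apply: pw_base; last lra; split; [apply: INR_gt0; lia | apply: INR_le; lia].
rewrite -Rsum_mull.
apply: (Rle_trans _ (/ g * INR Y `^ (1 - g) * INR Y `^ g)).
  apply: Rmult_le_compat_l; last by apply: psind_sum => //; lra.
  by apply: Rmult_le_pos; [left; apply: Rinv_0_lt_compat; lra | apply: pw_ge0].
rewrite Rmult_assoc -pw_add (_ : 1 - g + g = 1); last ring.
by rewrite pw_1; [rewrite /Rdiv; lra | lra].
Qed.

Lemma psw_sq_sum g Y : 0 < g <= 1 -> (0 < Y)%N ->
  \Rsum_(1 <= n < Y) psw g n ^ 2 <= / g ^ 2 * INR Y `^ (2 - g).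
Proof.
move=> hg Y0; have hY := INR_ge1 Y0; have ig : 0 < / g by apply: Rinv_0_lt_compat; lra.
apply: (Rle_trans _ (\Rsum_(1 <= n < Y) (/ g * INR Y `^ (1 - g) * psw g n))).
  apply: Rsum_le_nat => n hn _; rewrite /= Rmult_1_r; apply: Rmult_le_compat_r.
    by apply: psw_ge0; lra.
  rewrite /psw -[X in _ <= X]Rmult_1_r; apply: Rmult_le_compat.
  - by apply: Rmult_le_pos; [lra | apply: pw_ge0].
  - by have := ind_01 (floor_power g n); rewrite /psind; lra.
  - apply: Rmult_le_compat_l; first lra.
    by apply: pw_base; last lra; split; [apply: INR_gt0; lia | apply: INR_le; lia].
  - by have := ind_01 (floor_power g n); rewrite /psind; lra.
rewrite -Rsum_mull.
apply: (Rle_trans _ (/ g * INR Y `^ (1 - g) * (INR Y / g))).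
  apply: Rmult_le_compat_l; last by apply: psw_sum.
  by apply: Rmult_le_pos; [lra | apply: pw_ge0].
have -> : 2 - g = 1 - g + 1 by ring.
by rewrite pw_add pw_1; [right; field; lra | lra].
Qed.

Lemma psw_1 n : (0 < n)%N -> psw 1 n = 1.
Proof.
move=> n0; rewrite /psw /psind ind_true; last exact: floor_power_1.
by rewrite Rminus_diag pw_0; field.
Qed.

Lemma pw_diff_bounds g a b n : 0 < g < 1 -> (0 < a)%N -> (a <= n)%N -> (n < b)%N ->
  g * INR b `^ (g - 1) <= (INR n + 1) `^ g - INR n `^ g <= g * INR a `^ (g - 1).
Proof.
move=> hg a0 an nb; have ha := INR_ge1 a0; have han := INR_le an; have hnb := INR_lt nb.
have [xi [h1 h2]] := dif_pw [:: 1%N] g (x := INR n) ltac:(lra).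
move: h1 h2; rewrite /= /pw => h1 ->.
have -> : 1 * 1 * (g * 1) * xi `^ (g - 1) = g * xi `^ (g - 1) by ring.
by split; (apply: Rmult_le_compat_l; [lra | apply: pw_baseN; lra]).
Qed.

(** Membership as a condition modulo 1: with [z] the ceiling of [n^g], the number [- n^g + z] is the
    fractional part of [- n^g], to be compared with a window of length [(n + 1)^g - n^g]. This is
    the form that [fejer_block] takes. *)
Lemma ps_window g n : 0 < g < 1 -> (0 < n)%N ->
  (psind g n = 1 /\ exists z : Z, 0 <= - INR n `^ g + IZR z < (INR n + 1) `^ g - INR n `^ g) \/
  (psind g n = 0 /\ exists z : Z, (INR n + 1) `^ g - INR n `^ g <= - INR n `^ g + IZR z < 1).
Proof.
move=> hg n0; have hc := ceilRP (INR n `^ g); have [z hz] := ceilR_IZR (INR n `^ g).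
have hfp := floor_power_ceil (proj1 hg) n0.
case: (Rlt_dec (ceilR (INR n `^ g)) ((INR n + 1) `^ g)) => h; [left | right]; split.
- by apply: ind_true; apply/hfp.
- by exists z; rewrite -hz; lra.
- by apply: ind_false => /hfp.
- by exists z; rewrite -hz; lra.
Qed.

(** On a block that is short compared with [a], both the window length, about [g a^(g - 1)], and the
    weight, about [a^(1 - g) / g], are nearly constant, and their product is 1. The relative
    variation [Y / a] accounts for the first error term. *)
Lemma ps_block (g : R) (H Y a b : nat) (c : nat -> C) (rho T : R) :
  0 < g < 1 -> (0 < H)%N -> 0 < rho <= 1 / 2 -> 0 <= T ->
  (0 < Y)%N -> (Y <= a)%N -> (a <= b)%N -> (b <= a + Y)%N ->
  (forall n, (a <= n < b)%N -> Cmod (c n) <= 1) ->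
  (forall d, (0 < d < H)%N ->
     Cmod (\Csum_(a <= n < b) (c n * e (INR d * INR n `^ g))) <= T /\
     Cmod (\Csum_(a <= n < b) (c n * e (- (INR d * INR n `^ g)))) <= T) ->
  (forall d, (0 < d < H)%N -> Cmod (\Csum_(a <= n < b) e (INR d * INR n `^ g)) <= T) ->
  Cmod (\Csum_(a <= n < b) (c n * RtoC (psw g n - 1))) <=
  3 * INR Y ^ 2 / INR a + 2 / g * INR a `^ (1 - g) *
    (INR Y * (6 * rho + 3 / INR H + 3 / (INR H * rho ^ 2)) + 6 * T * (1 + ln (INR H))).
Proof.
move=> hg H0 hrho T0 Y0 Ya ab baY hc hT1 hT2.
have a0 : (0 < a)%N by lia.
have ha := INR_ge1 a0; have hY := INR_ge1 Y0; have hYa := INR_le Ya; have hab := INR_le ab.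
have hH := INR_ge1 H0.
have hbY : INR b <= INR a + INR Y by rewrite -plus_INR; apply: INR_le.
pose dp := g * INR a `^ (g - 1); pose dm := g * INR b `^ (g - 1).
have hpa : 0 < INR a `^ (g - 1) <= 1.
  by split; [apply: pw_gt0 | apply: pw_le1; lra].
have hdp : 0 < dp <= 1 by rewrite /dp; nra.
have hdm : 0 <= dm <= dp.
  split; first by apply: Rmult_le_pos; [lra | apply: pw_ge0].
  by apply: Rmult_le_compat_l; [lra | apply: pw_baseN; lra].
(* [dm / dp = (b / a)^(g - 1)], and as [g - 1 >= -1] this is at least [a / b >= 1 - Y / a]. *)
have hdd : dp - dm <= dp * (INR Y / INR a).
  have h1 : INR a / INR b <= (INR b / INR a) `^ (g - 1).
    have -> : INR a / INR b = (INR b / INR a) `^ (-1).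
      rewrite (_ : -1 = - (1)); last by [].
      by rewrite pw_opp pw_1; [field; lra | apply: Rdiv_lt_0_compat; lra].
    apply: pw_le; last lra.
    by apply: (Rmult_le_reg_r (INR a)); [lra | rewrite /Rdiv Rmult_assoc Rinv_l; lra].
  have h2 : dm = dp * (INR b / INR a) `^ (g - 1).
    rewrite /dm /dp Rmult_assoc -pw_mulb; [| lra | apply: Rdiv_lt_0_compat; lra].
    by congr (_ * Rpower _ _); field; lra.
  have h3 : 1 - INR Y / INR a <= INR a / INR b.
    apply: (Rmult_le_reg_r (INR a * INR b)); first by apply: Rmult_lt_0_compat; lra.
    have -> : (1 - INR Y / INR a) * (INR a * INR b) = (INR a - INR Y) * INR b by field; lra.
    have -> : INR a / INR b * (INR a * INR b) = INR a * INR a by field; lra.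
    by nra.
  by rewrite h2; nra.
set eps := 6 * rho + 3 / INR H + 3 / (INR H * rho ^ 2).
set T' := 6 * T * (1 + ln (INR H)).
have hlnH : 0 <= ln (INR H) by rewrite -ln_1; apply: ln_le; lra.
have hT' : 0 <= T' by apply: Rmult_le_pos; lra.
have heps : 0 <= eps.
  have : 0 <= 3 / INR H by apply: Rdiv_le_0_compat; lra.
  have : 0 <= 3 / (INR H * rho ^ 2).
    by apply: Rdiv_le_0_compat; [lra | apply: Rmult_lt_0_compat; [lra | apply: pow_lt; lra]].
  by rewrite /eps; lra.
pose E := INR Y * (dp * (INR Y / INR a) + eps) + T'.
have hYa0 : 0 <= INR Y / INR a <= 1.
  by split; [apply: Rdiv_le_0_compat; lra | apply: Rdiv_le_r; lra].
have hE : 0 <= E.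
  by apply: Rplus_le_le_0_compat => //; apply: Rmult_le_pos; [lra | nra].
have main (s : nat -> C) :
  (forall n, (a <= n < b)%N -> Cmod (s n) <= 1) ->
  (forall d, (0 < d < H)%N ->
     Cmod (\Csum_(a <= n < b) (s n * e (INR d * INR n `^ g))) <= T /\
     Cmod (\Csum_(a <= n < b) (s n * e (- (INR d * INR n `^ g)))) <= T) ->
  Cmod (\Csum_(a <= n < b) (s n * RtoC (psind g n - dp))) <= E.
  move=> hs hT.
  have hsw d (s' : nat -> C) : \Csum_(a <= n < b) (s' n * e (INR d * - INR n `^ g)) = \Csum_(a <= n < b) (s' n * e (- (INR d * INR n `^ g))).
    by apply: eq_bigr => n _; congr (_ * e _)%C; ring.
  have hsw2 d (s' : nat -> C) : \Csum_(a <= n < b) (s' n * e (- (INR d * - INR n `^ g))) = \Csum_(a <= n < b) (s' n * e (INR d * INR n `^ g)).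
    by apply: eq_bigr => n _; congr (_ * e _)%C; ring.
  have h1 (s' : nat -> C) : \Csum_(a <= n < b) s' n = \Csum_(a <= n < b) (RtoC 1 * s' n).
    by apply: eq_bigr => n _; ring.
  have hconj d : Cmod (\Csum_(a <= n < b) e (- (INR d * INR n `^ g))) = Cmod (\Csum_(a <= n < b) e (INR d * INR n `^ g)).
    by rewrite -Cmod_conj Csum_conj; congr Cmod; apply: eq_bigr => n _; rewrite e_conj; congr e; ring.
  have h := @fejer_block H s (fun n => - INR n `^ g) (psind g) a b dm dp rho T H0 hrho hdm (proj2 hdp) T0 ab hs.
  apply: (Rle_trans _ _ _ (h _ _ _)) => [n hn|d hd|d hd|].
  - have hn0 : (0 < n)%N by lia.
    have hb := pw_diff_bounds (b := b) hg a0 (n := n) ltac:(lia) ltac:(lia).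
    case: (ps_window hg hn0) => -[hi [z hz]]; [left | right]; split => //; exists z; rewrite /dp /dm; lra.
  - by rewrite hsw hsw2; case: (hT d hd).
  - rewrite (h1 (fun n => e (INR d * - INR n `^ g))) (h1 (fun n => e (- (INR d * - INR n `^ g)))).
    rewrite hsw hsw2 -(h1 (fun n => e (- (INR d * INR n `^ g)))) -(h1 (fun n => e (INR d * INR n `^ g))) hconj.
    by split; apply: hT2.
  apply: Rplus_le_compat_r.
  have hbaY : INR (b - a) <= INR Y by apply: INR_le; lia.
  apply: Rmult_le_compat => //; first exact: pos_INR; last by rewrite /eps; lra.
  have -> : dp - dm + 6 * rho + 3 / INR H + 3 / (INR H * rho ^ 2) = (dp - dm) + eps by rewrite /eps; ring.
  lra.
have m1 := main c hc hT1.
have hconj d : Cmod (\Csum_(a <= n < b) e (- (INR d * INR n `^ g))) = Cmod (\Csum_(a <= n < b) e (INR d * INR n `^ g)).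
  by rewrite -Cmod_conj Csum_conj; congr Cmod; apply: eq_bigr => n _; rewrite e_conj; congr e; ring.
have h1 (s' : nat -> C) : \Csum_(a <= n < b) (RtoC 1 * s' n) = \Csum_(a <= n < b) s' n.
  by apply: eq_bigr => n _; ring.
(* The case of coefficients 1 bounds the number of members of the block; this controls the error
   made by freezing the weight. *)
have m2 : \Rsum_(a <= n < b) psind g n <= INR Y * dp + E.
  have := main (fun=> RtoC 1) (fun n _ => Req_le _ _ Cmod_1).
  rewrite (h1 (fun n => RtoC (psind g n - dp))) -Csum_RtoC Cmod_R RsumB Rsum_const_nat => h.
  have hbaY : INR (b - a) <= INR Y by apply: INR_le; lia.
  have h2 : Rabs (\Rsum_(a <= n < b) psind g n - INR (b - a) * dp) <= E.
    apply: h => d hd; rewrite (h1 (fun n => e (INR d * INR n `^ g))) (h1 (fun n => e (- (INR d * INR n `^ g)))) hconj.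
    by split; apply: hT2.
  have h3 := Rle_abs (\Rsum_(a <= n < b) psind g n - INR (b - a) * dp).
  by nra.
set A := / g * INR a `^ (1 - g).
have hA : 0 < A by apply: Rmult_lt_0_compat; [apply: Rinv_0_lt_compat; lra | apply: pw_gt0].
have hAdp : A * dp = 1.
  have : INR a `^ (1 - g) * INR a `^ (g - 1) = 1.
    by rewrite -pw_add (_ : 1 - g + (g - 1) = 0) ?pw_0 //; ring.
  by move=> h; transitivity (INR a `^ (1 - g) * INR a `^ (g - 1)) => //; rewrite /A /dp; field; lra.
have -> : \Csum_(a <= n < b) (c n * RtoC (psw g n - 1)) =
  (RtoC A * \Csum_(a <= n < b) (c n * RtoC (psind g n - dp)) +
   \Csum_(a <= n < b) (c n * RtoC ((/ g * INR n `^ (1 - g) - A) * psind g n)))%C.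
  rewrite Csum_mull -big_split /=; apply: eq_bigr => n _.
  have -> : psw g n - 1 = A * (psind g n - dp) + (/ g * INR n `^ (1 - g) - A) * psind g n.
    by rewrite /psw -hAdp; ring.
  by rewrite RtoC_plus RtoC_mult; ring.
apply: Rle_trans (Cmod_triangle _ _) _.
rewrite Cmod_mult Cmod_R (Rabs_pos_eq A); last lra.
have m3 : Cmod (\Csum_(a <= n < b) (c n * RtoC ((/ g * INR n `^ (1 - g) - A) * psind g n))) <=
   A * (INR Y / INR a) * (INR Y * dp + E).
  apply: Rle_trans (Cmod_sum _ _ _) _.
  apply: (Rle_trans _ (\Rsum_(a <= n < b) (A * (INR Y / INR a) * psind g n))).
    apply: Rsum_le_nat => n hn _; rewrite Cmod_mult Cmod_R Rabs_mult.
    have hp := ind_01 (floor_power g n); rewrite -/(psind g n) in hp.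
    rewrite (Rabs_pos_eq (psind g n)); last lra.
    have han : INR a <= INR n by apply: INR_le; lia.
    have hnb : INR n <= INR b by apply: INR_le; lia.
    have h3 : INR n `^ (1 - g) <= INR a `^ (1 - g) * (1 + INR Y / INR a).
      have hq : INR n = INR a * (INR n / INR a) by field; lra.
      have hq1 : 1 <= INR n / INR a.
        by apply: (Rmult_le_reg_r (INR a)); [lra | rewrite /Rdiv Rmult_assoc Rinv_l; lra].
      rewrite {1}hq pw_mulb; try lra.
      apply: Rmult_le_compat_l; first exact: pw_ge0.
      apply: (Rle_trans _ ((INR n / INR a) `^ 1)); first by apply: pw_le; lra.
      rewrite pw_1; last lra.
      have -> : 1 + INR Y / INR a = (INR a + INR Y) / INR a by field; lra.
      by apply: Rmult_le_compat_r; [left; apply: Rinv_0_lt_compat; lra | lra].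
    have h4 : INR a `^ (1 - g) <= INR n `^ (1 - g) by apply: pw_base; lra.
    have h5 : 0 < / g by apply: Rinv_0_lt_compat; lra.
    have h6 : 0 <= / g * INR n `^ (1 - g) - A <= A * (INR Y / INR a) by rewrite /A; split; nra.
    rewrite (Rabs_pos_eq (_ - A)); last lra.
    have h7 := hc n hn; have h8 := Cmod_ge_0 (c n).
    rewrite -[X in _ <= X]Rmult_1_l; apply: Rmult_le_compat => //; first by nra.
    by nra.
  rewrite -Rsum_mull; apply: Rmult_le_compat_l => //.
  by apply: Rmult_le_pos; lra.
have m4 : A * E <= A * E by lra.
apply: (Rle_trans _ (A * E + A * (INR Y / INR a) * (INR Y * dp + E))).
  by apply: Rplus_le_compat => //; apply: Rmult_le_compat_l; lra.
have -> : 3 * INR Y ^ 2 / INR a = A * dp * (3 * INR Y * (INR Y / INR a)) by rewrite hAdp; field; lra.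
have -> : 2 / g * INR a `^ (1 - g) = 2 * A by rewrite /A; field; lra.
have -> : A * E + A * (INR Y / INR a) * (INR Y * dp + E) =
  A * (E + (INR Y / INR a) * E + dp * INR Y * (INR Y / INR a)) by ring.
have -> : A * dp * (3 * INR Y * (INR Y / INR a)) + 2 * A * (INR Y * eps + T') =
  A * (3 * dp * INR Y * (INR Y / INR a) + 2 * (INR Y * eps + T')) by ring.
apply: Rmult_le_compat_l; first lra.
have : (INR Y / INR a) * E <= 1 * E by apply: Rmult_le_compat_r; lra.
by rewrite /E; lra.
Qed.

Lemma sum_blocks (F : nat -> C) (Y E J : nat) : (0 < Y)%N -> (0 < E)%N ->
  \Csum_(1 <= n < minn (J.+1 * Y) E) F n =
  (\Csum_(1 <= n < minn Y E) F n +
   \Csum_(1 <= j < J.+1) \Csum_(minn (j * Y) E <= n < minn (j.+1 * Y) E) F n)%C.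
Proof.
move=> Y0 E0; elim: J => [|J IH].
  by rewrite mul1n (big_geq (m := 1) (n := 1)) // Cplus_0_r.
rewrite (big_cat_nat (n := minn (J.+1 * Y) E)) /=; try (by rewrite ?leq_min; nia).
by rewrite IH [in RHS]big_nat_recr //= Cplus_assoc.
Qed.

(** Blocks of length [Y]: the initial one is bounded trivially through [psw_sum], and on the block
    starting at [j Y] the variation error [3 Y^2 / (j Y)] sums to the logarithm. *)
Lemma ps_sum (g : R) (H Y E : nat) (c : nat -> C) (rho T : R) :
  0 < g < 1 -> (0 < H)%N -> 0 < rho <= 1 / 2 -> 0 <= T -> (0 < Y <= E)%N ->
  (forall n, (0 < n < E)%N -> Cmod (c n) <= 1) ->
  (forall a b d, (0 < a <= b)%N -> (b <= E)%N -> (0 < d < H)%N ->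
     Cmod (\Csum_(a <= n < b) (c n * e (INR d * INR n `^ g))) <= T /\
     Cmod (\Csum_(a <= n < b) (c n * e (- (INR d * INR n `^ g)))) <= T) ->
  (forall a b d, (0 < a <= b)%N -> (b <= E)%N -> (0 < d < H)%N ->
     Cmod (\Csum_(a <= n < b) e (INR d * INR n `^ g)) <= T) ->
  Cmod (\Csum_(1 <= n < E) (c n * RtoC (psw g n - 1))) <=
  2 / g * INR Y + 3 * INR Y * (1 + ln (INR (E %/ Y))) + 2 / g * INR E `^ (1 - g) *
    (INR E * (6 * rho + 3 / INR H + 3 / (INR H * rho ^ 2)) +
     INR (E %/ Y) * (6 * T * (1 + ln (INR H)))).
Proof.
move=> hg H0 hrho T0 /andP[Y0 YE] hc hT1 hT2.
set eps := 6 * rho + 3 / INR H + 3 / (INR H * rho ^ 2).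
have hH := INR_ge1 H0.
have heps : 0 <= eps.
  have : 0 <= 3 / INR H by apply: Rdiv_le_0_compat; lra.
  have : 0 <= 3 / (INR H * rho ^ 2).
    by apply: Rdiv_le_0_compat; [lra | apply: Rmult_lt_0_compat; [lra | apply: pow_lt; lra]].
  by rewrite /eps; lra.
have hlnH : 0 <= ln (INR H) by rewrite -ln_1; apply: ln_le; lra.
set T' := 6 * T * (1 + ln (INR H)).
have hT' : 0 <= T' by apply: Rmult_le_pos; lra.
have E0 : (0 < E)%N by lia.
pose J := (E %/ Y)%N; have hJ : (J * Y <= E < J.+1 * Y)%N.
  by rewrite leq_trunc_div /= ltn_ceil.
have J1 : (0 < J)%N by rewrite divn_gt0.
have hY := INR_ge1 Y0; have hE := INR_ge1 E0.
have := sum_blocks (fun n => (c n * RtoC (psw g n - 1))%C) J Y0 E0.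
have -> : minn (J.+1 * Y) E = E by lia.
have -> : minn Y E = Y by lia.
move=> ->; apply: Rle_trans (Cmod_triangle _ _) _.
have ig : 1 <= / g by rewrite -[X in X <= _]Rinv_1; apply: Rinv_le_contravar; lra.
have b0 : Cmod (\Csum_(1 <= n < Y) (c n * RtoC (psw g n - 1))) <= 2 / g * INR Y.
  apply: Rle_trans (Cmod_sum _ _ _) _.
  apply: (Rle_trans _ (\Rsum_(1 <= n < Y) (psw g n + 1))).
    apply: Rsum_le_nat => n hn _; rewrite Cmod_mult Cmod_R.
    have h1 := psw_ge0 n (proj1 hg); have h2 := hc n ltac:(lia).
    have h3 : Rabs (psw g n - 1) <= psw g n + 1 by apply: Rabs_le; lra.
    have h4 := Rabs_pos (psw g n - 1).
    by have := Cmod_ge_0 (c n); nra.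
  rewrite big_split /= Rsum_const_nat.
  have h := psw_sum (g := g) ltac:(lra) Y0.
  have h2 : INR (Y - 1) <= INR Y by apply: INR_le; lia.
  have h3 : INR Y * 1 <= INR Y * / g by apply: Rmult_le_compat_l; lra.
  by rewrite /Rdiv in h *; lra.
rewrite -/J Rplus_assoc; apply: Rplus_le_compat => //.
apply: Rle_trans (Cmod_sum _ _ _) _.
set W := 2 / g * INR E `^ (1 - g) * (INR Y * eps + T').
apply: (Rle_trans _ (\Rsum_(1 <= j < J.+1) (3 * INR Y * / INR j + W))).
  apply: Rsum_le_nat => j hj _.
  have j0 : (0 < j)%N by lia.
  have hjR := INR_ge1 j0.
  have hjY : (j * Y <= E)%N by nia.
  have -> : minn (j * Y) E = (j * Y)%N by lia.
  set b := minn _ _.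
  have hb : (j * Y <= b)%N /\ (b <= j * Y + Y)%N /\ (b <= E)%N by rewrite /b; nia.
  have hjY0 : (0 < j * Y)%N by nia.
  apply: Rle_trans (@ps_block g H Y (j * Y) b c rho T hg H0 hrho T0 Y0 _ _ _ _ _ _) _; try lia; try nia.
  - by move=> n hn; apply: hc; lia.
  - by move=> d hd; apply: hT1; lia.
  - by move=> d hd; apply: hT2; lia.
  apply: Rplus_le_compat.
    by rewrite mult_INR; right; field; lra.
  rewrite /W -/eps -/T'; apply: Rmult_le_compat_r.
    by apply: Rplus_le_le_0_compat => //; apply: Rmult_le_pos; lra.
  apply: Rmult_le_compat_l; first by rewrite /Rdiv; lra.
  by apply: pw_base; last lra; split; [apply: INR_gt0 | apply: INR_le].
rewrite big_split /= Rsum_const_nat -Rsum_mull.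
apply: Rplus_le_compat.
  by apply: Rmult_le_compat_l; [lra | apply: harmonic_le].
have -> : (J.+1 - 1 = J)%N by lia.
rewrite /W.
have -> : INR J * (2 / g * INR E `^ (1 - g) * (INR Y * eps + T')) =
  2 / g * INR E `^ (1 - g) * (INR J * INR Y * eps + INR J * T') by ring.
apply: Rmult_le_compat_l.
  by apply: Rmult_le_pos; [rewrite /Rdiv; lra | apply: pw_ge0].
apply: Rplus_le_compat_r; apply: Rmult_le_compat_r => //.
by rewrite -mult_INR; apply: INR_le; lia.
Qed.

Lemma ln2N_le s : 0 < s -> exists K, 0 < K /\ forall N : nat, (0 < N)%N ->
  1 + ln (2 * INR N) <= K * INR N `^ s.
Proof.
move=> s0; exists (2 + / s); split.
  by have := Rinv_0_lt_compat _ s0; lra.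
move=> N N0; have hN := INR_ge1 N0.
have h1 := ln_le_pw hN s0; have h2 := pw_ge1 hN (Rlt_le _ _ s0).
rewrite ln_mult; try lra.
have h3 : ln 2 <= 1 by have := exp_ineq1_le (ln 2); rewrite exp_ln; lra.
have h4 := Rinv_0_lt_compat _ s0.
by rewrite /Rdiv in h1; nra.
Qed.

(** Choice of parameters: blocks of length about N^(1 - d') with d' slightly above [de], frequencies
    up to N^eta, smoothing width N^(- eta / 3) / 2. The condition on [si] says that N^(d')
    exponential sums of size N^(1 - si), weighted by N^(1 - g), stay below N^(1 - d'); the condition
    on [eta] says the same of the smoothing error N N^(- eta / 3). *)
Lemma ps_power (g de si eta K : R) :
  0 < g < 1 -> 0 < de -> 1 - g + 2 * de < si -> 3 * (1 - g + de) < eta -> eta <= 1 -> 0 <= K ->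
  exists K', 0 < K' /\ forall (N : nat) (c : nat -> C), (0 < N)%N ->
  (forall n, (0 < n <= N)%N -> Cmod (c n) <= 1) ->
  (forall E d, (0 < E <= N.+1)%N -> (0 < d)%N -> INR d <= INR N `^ eta ->
     [/\ Cmod (\Csum_(1 <= n < E) (c n * e (INR d * INR n `^ g))) <= K * INR N `^ (1 - si),
      Cmod (\Csum_(1 <= n < E) (c n * e (- (INR d * INR n `^ g)))) <= K * INR N `^ (1 - si) &
      Cmod (\Csum_(1 <= n < E) e (INR d * INR n `^ g)) <= K * INR N `^ (1 - si)]) ->
  forall E, (0 < E <= N.+1)%N ->
  Cmod (\Csum_(1 <= n < E) (c n * RtoC (psw g n - 1))) <= K' * INR N `^ (1 - de).
Proof.
move=> hg de0 hsi heta eta1 K0.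
(* The slack in the two strict inequalities yields a factor N^s, which absorbs the logarithms. *)
have [s [s0 hs1 hs2]] : exists s, [/\ 0 < s, 1 - g + 2 * (de + s) <= si & 3 * (1 - g + (de + s)) <= eta].
  exists (Rmin ((si - (1 - g + 2 * de)) / 2) ((eta - 3 * (1 - g + de)) / 3)); split.
  - by apply: Rmin_glb_lt; lra.
  - by have := Rmin_l ((si - (1 - g + 2 * de)) / 2) ((eta - 3 * (1 - g + de)) / 3); lra.
  - by have := Rmin_r ((si - (1 - g + 2 * de)) / 2) ((eta - 3 * (1 - g + de)) / 3); lra.
have [KL [KL0 hKL]] := ln2N_le s0.
pose K1 := 2 / g + 3 * KL + 4 / g * (36 * KL + 48 * K * KL).
have ig : 0 < / g by apply: Rinv_0_lt_compat; lra.
have hK1 : 0 < K1.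
  have h1 : 0 < 2 / g by rewrite /Rdiv; lra.
  have h2 : 0 <= 4 / g * (36 * KL + 48 * K * KL).
    by apply: Rmult_le_pos; [rewrite /Rdiv; lra | nra].
  by rewrite /K1; lra.
exists K1; split => // N c N0 hc hT E hE.
have hN := INR_ge1 N0.
set d' := de + s in hs1 hs2.
set q := INR N `^ (1 - d').
have hq1 : 1 <= q by apply: pw_ge1; lra.
have [Y0 [hY1 hY2]] := nfloorP (x := q) ltac:(lra).
have Y00 : (0 < Y0)%N by case: (Y0) hY2 => //=; lra.
have hY := INR_ge1 Y00.
set LN := 1 + ln (2 * INR N).
have hLN : 1 <= LN <= KL * INR N `^ s.
  split; last exact: hKL.
  by have : ln 1 <= ln (2 * INR N) by [apply: ln_le; lra]; rewrite ln_1 /LN; lra.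
have hqde : q * INR N `^ s = INR N `^ (1 - de).
  by rewrite -pw_add; congr Rpower; rewrite /d'; ring.
have hqL : q * LN <= KL * INR N `^ (1 - de).
  by rewrite -hqde; nra.
have hqd : q <= INR N `^ (1 - de) by apply: pw_le => //; rewrite /d'; lra.
have hEN : INR E <= 2 * INR N.
  by apply: (Rle_trans _ (INR N.+1)); [apply: INR_le; lia | rewrite S_INR; lra].
have E0 : (0 < E)%N by lia.
have hE1 := INR_ge1 E0.
case: (leqP Y0 E) => YE; last first.
  apply: Rle_trans (Cmod_sum _ _ _) _.
  apply: (Rle_trans _ (\Rsum_(1 <= n < E) (psw g n + 1))).
    apply: Rsum_le_nat => n hn _; rewrite Cmod_mult Cmod_R.
    have h1 := psw_ge0 n (proj1 hg); have h2 := hc n ltac:(lia).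
    have h3 : Rabs (psw g n - 1) <= psw g n + 1 by apply: Rabs_le; lra.
    have h4 := Rabs_pos (psw g n - 1).
    by have := Cmod_ge_0 (c n); nra.
  rewrite big_split /= Rsum_const_nat.
  have h := psw_sum (g := g) ltac:(lra) E0.
  have h2 : INR (E - 1) <= INR E by apply: INR_le; lia.
  have h4 : INR E <= q by apply: Rle_trans hY1; apply: INR_le; lia.
  have h5 : 1 <= / g by rewrite -[X in X <= _]Rinv_1; apply: Rinv_le_contravar; lra.
  have h3 : INR E * 1 <= INR E * / g by apply: Rmult_le_compat_l; lra.
  apply: (Rle_trans _ (2 * / g * INR E)); first by rewrite /Rdiv in h; lra.
  apply: Rmult_le_compat; try lra.
  have h6 : 0 <= 4 / g * (36 * KL + 48 * K * KL).
    by apply: Rmult_le_pos; [rewrite /Rdiv; lra | nra].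
  by rewrite /K1 /Rdiv in h6 *; lra.
set w := INR N `^ eta.
have hw1 : 1 <= w by apply: pw_ge1; lra.
have [H0 [hH1 hH2]] := nfloorP (x := w) ltac:(lra).
(* With [H] of size t^3 and [rho = 1 / (2 t)] the errors [rho] and [1 / (H rho^2)] balance. *)
set t := INR N `^ (eta / 3).
have ht1 : 1 <= t by apply: pw_ge1; lra.
have hwt : w = t ^ 3 by rewrite /w /t pw_pow; congr Rpower; rewrite /=; field.
pose rho := / (2 * t).
have hrho : 0 < rho <= 1 / 2.
  split; first by apply: Rinv_0_lt_compat; lra.
  by rewrite /rho Rinv_mult; have : / t <= 1; [rewrite -[X in _ <= X]Rinv_1; apply: Rinv_le_contravar; lra | lra].
pose T := 2 * K * INR N `^ (1 - si).
have hT0 : 0 <= T by apply: Rmult_le_pos; [lra | apply: pw_ge0].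
have sub (s' : nat -> C) a b : (0 < a <= b)%N -> (b <= E)%N ->
  (forall E', (0 < E' <= N.+1)%N -> Cmod (\Csum_(1 <= n < E') s' n) <= K * INR N `^ (1 - si)) ->
  Cmod (\Csum_(a <= n < b) s' n) <= T.
  move=> hab hb h.
  have -> : \Csum_(a <= n < b) s' n = (\Csum_(1 <= n < b) s' n - \Csum_(1 <= n < a) s' n)%C.
    by rewrite [in RHS](big_cat_nat (n := a)) /=; [ring | lia | lia].
  apply: Rle_trans (Cmod_triangle _ _) _; rewrite Cmod_opp /T.
  have h1 := h a ltac:(lia); have h2 := h b ltac:(lia); lra.
have hdw d : (0 < d < H0.+1)%N -> INR d <= w.
  by move=> hd; apply: Rle_trans hH1; apply: INR_le; lia.
apply: Rle_trans (@ps_sum g H0.+1 Y0 E c rho T hg isT hrho hT0 _ _ _ _) _.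
- lia.
- by move=> n hn; apply: hc; lia.
- move=> a b d hab hb hd; split; apply: sub => // E' hE';
    by case: (hT E' d hE' ltac:(lia) (hdw d hd)).
- move=> a b d hab hb hd; apply: sub => // E' hE';
    by case: (hT E' d hE' ltac:(lia) (hdw d hd)).
have hJ : INR (E %/ Y0) <= 4 * INR N `^ d'.
  have h1 : INR (E %/ Y0) * INR Y0 <= 2 * INR N.
    by rewrite -mult_INR; apply: Rle_trans hEN; apply: INR_le; exact: leq_trunc_div.
  have h2 : q <= 2 * INR Y0 by lra.
  have h3 : q * INR N `^ d' = INR N.
    by rewrite -pw_add (_ : 1 - d' + d' = 1) ?pw_1 //; [lra | ring].
  have h4 := pos_INR (E %/ Y0).
  apply: (Rmult_le_reg_l q); first lra.
  have -> : q * (4 * INR N `^ d') = 4 * INR N by rewrite -{2}h3; ring.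
  by nra.
have hJ0 := pos_INR (E %/ Y0).
have hlnJ : 1 + ln (INR (E %/ Y0)) <= LN.
  apply: Rplus_le_compat_l; apply: ln_le.
    by apply: INR_gt0; rewrite divn_gt0.
  by apply: Rle_trans hEN; apply: INR_le; exact: leq_div.
have hHw : w <= INR H0.+1 <= 2 * INR N.
  rewrite S_INR; split; first lra.
  by have : w <= INR N `^ 1 by [apply: pw_le]; rewrite pw_1; lra.
have hlnH : 1 + ln (INR H0.+1) <= LN.
  by apply: Rplus_le_compat_l; apply: ln_le; lra.
have heps : 6 * rho + 3 / INR H0.+1 + 3 / (INR H0.+1 * rho ^ 2) <= 18 * / t.
  have h1 : / INR H0.+1 <= / t ^ 3 by rewrite -hwt; apply: Rinv_le_contravar; lra.
  have h2 : / t ^ 3 <= / t by apply: Rinv_le_contravar; [lra | nra].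
  have h3 : 3 / (INR H0.+1 * rho ^ 2) = 12 * t ^ 2 * / INR H0.+1.
    by rewrite /rho; field; lra.
  have h4 : 12 * t ^ 2 * / INR H0.+1 <= 12 * t ^ 2 * / t ^ 3.
    by apply: Rmult_le_compat_l => //; nra.
  have h5 : 12 * t ^ 2 * / t ^ 3 = 12 * / t by field; lra.
  have h6 : 6 * rho = 3 * / t by rewrite /rho; field; lra.
  rewrite h3 h6 /Rdiv; lra.
have hEg : INR E `^ (1 - g) <= 2 * INR N `^ (1 - g).
  apply: (Rle_trans _ ((2 * INR N) `^ (1 - g))); first by apply: pw_base; lra.
  rewrite pw_mulb; [|lra|lra]; apply: Rmult_le_compat_r; first exact: pw_ge0.
  by rewrite -[X in _ <= X](pw_1 (x := 2)); [apply: pw_le; lra | lra].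
have e1 : INR N `^ (1 - g) * (INR N * / t) <= q.
  rewrite /t -pw_opp -[X in _ * (X * _)](pw_1 (x := INR N)); last lra.
  by rewrite -!pw_add; apply: pw_le => //; lra.
have e2 : INR N `^ (1 - g) * (INR N `^ d' * INR N `^ (1 - si)) <= q.
  by rewrite -!pw_add; apply: pw_le => //; lra.
set eps := _ + _ + _ in heps *.
have m1 : 2 / g * INR Y0 <= 2 / g * INR N `^ (1 - de).
  by apply: Rmult_le_compat_l; [rewrite /Rdiv; lra | lra].
have m2 : 3 * INR Y0 * (1 + ln (INR (E %/ Y0))) <= 3 * KL * INR N `^ (1 - de).
  apply: (Rle_trans _ (3 * q * LN)); last by lra.
  have : 0 <= ln (INR (E %/ Y0)).
    by rewrite -ln_1; apply: ln_le; [lra | apply: INR_ge1; rewrite divn_gt0].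
  by move=> h; apply: Rmult_le_compat; lra.
have hlnH0 : 0 <= ln (INR H0.+1) by rewrite -ln_1; apply: ln_le; [lra | apply: INR_ge1].
have hit : 0 < / t by apply: Rinv_0_lt_compat; lra.
have m3 : INR E * eps + INR (E %/ Y0) * (6 * T * (1 + ln (INR H0.+1))) <=
   36 * (INR N * / t) * LN + 48 * K * (INR N `^ d' * INR N `^ (1 - si)) * LN.
  apply: Rplus_le_compat.
    apply: (Rle_trans _ (36 * (INR N * / t) * 1)).
      rewrite Rmult_1_r; apply: (Rle_trans _ (INR E * (18 * / t))).
        by apply: Rmult_le_compat_l; lra.
      by have -> : 36 * (INR N * / t) = 2 * INR N * (18 * / t) by [ring]; apply: Rmult_le_compat_r; lra.
    apply: Rmult_le_compat_l; last lra.
    by apply: Rmult_le_pos; [lra | apply: Rmult_le_pos; lra].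
  apply: (Rle_trans _ (4 * INR N `^ d' * (6 * T * LN))).
    apply: Rmult_le_compat => //; first by apply: Rmult_le_pos; lra.
    by apply: Rmult_le_compat_l; lra.
  by right; rewrite /T; ring.
apply: (Rle_trans _ (2 / g * INR N `^ (1 - de) + 3 * KL * INR N `^ (1 - de) + 4 / g * (36 * KL + 48 * K * KL) * INR N `^ (1 - de))); last first.
  by rewrite /K1; right; ring.
apply: Rplus_le_compat; first lra.
apply: (Rle_trans _ (2 / g * (2 * INR N `^ (1 - g)) * (36 * (INR N * / t) * LN + 48 * K * (INR N `^ d' * INR N `^ (1 - si)) * LN))).
  apply: Rmult_le_compat => //.
  - by apply: Rmult_le_pos; [rewrite /Rdiv; lra | apply: pw_ge0].
  - apply: Rplus_le_le_0_compat.
      apply: Rmult_le_pos; first lra.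
      have : 0 <= 3 / INR H0.+1 by apply: Rdiv_le_0_compat; lra.
      have : 0 <= 3 / (INR H0.+1 * rho ^ 2).
        by apply: Rdiv_le_0_compat; [lra | apply: Rmult_lt_0_compat; [lra | apply: pow_lt; lra]].
      by rewrite /eps; lra.
    by apply: Rmult_le_pos => //; apply: Rmult_le_pos; lra.
  - by apply: Rmult_le_compat_l; [rewrite /Rdiv; lra | ].
have -> : 2 / g * (2 * INR N `^ (1 - g)) * (36 * (INR N * / t) * LN + 48 * K * (INR N `^ d' * INR N `^ (1 - si)) * LN) =
  4 / g * (36 * ((INR N `^ (1 - g) * (INR N * / t)) * LN) + 48 * K * ((INR N `^ (1 - g) * (INR N `^ d' * INR N `^ (1 - si))) * LN)).
  by rewrite /Rdiv; ring.
rewrite [X in _ <= X]Rmult_assoc; apply: Rmult_le_compat_l; first by rewrite /Rdiv; lra.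
have f1 : (INR N `^ (1 - g) * (INR N * / t)) * LN <= KL * INR N `^ (1 - de).
  by apply: Rle_trans hqL; apply: Rmult_le_compat_r; lra.
have f2 : (INR N `^ (1 - g) * (INR N `^ d' * INR N `^ (1 - si))) * LN <= KL * INR N `^ (1 - de).
  by apply: Rle_trans hqL; apply: Rmult_le_compat_r; lra.
have f4 := Rmult_le_compat_l (48 * K) _ _ ltac:(lra) f2.
by lra.
Qed.

(** * Multiplicative functions and Vaughan's identity *)

Section Multiples.
Variables (T : Type) (idx : T) (op : Monoid.com_law idx).

Lemma big_multiples (F : nat -> T) (m X : nat) : (0 < m)%N ->
  \big[op/idx]_(1 <= n < X.+1 | m %| n) F n = \big[op/idx]_(1 <= k < (X %/ m).+1) F (m * k)%N.
Proof.
move=> m0; elim: X => [|X IH]; first by rewrite div0n !big_geq.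
rewrite big_mkcond big_nat_recr //= -big_mkcond /= IH divnS //.
case: ifP => h; last by rewrite add0n Monoid.mulm1.
have hX : (m * (X %/ m).+1 = X.+1)%N.
  by have := divnS X m0; rewrite h add1n => h'; rewrite -h' mulnC divnK.
by rewrite add1n [in RHS]big_nat_recr //= hX.
Qed.

Lemma big_divisors_bound (F : nat -> T) (n X : nat) : (0 < n)%N -> (n <= X)%N ->
  \big[op/idx]_(1 <= d < X.+1 | d %| n) F d = \big[op/idx]_(1 <= d < n.+1 | d %| n) F d.
Proof.
move=> n0 nX; rewrite (big_cat_nat (n := n.+1)) //=.
rewrite [X in op _ X]big_nat_cond [X in op _ X]big1 ?Monoid.mulm1 // => d /andP[hd /dvdn_leq h].
by have := h n0; lia.
Qed.

(* Both sides range over the pairs (m, k) with m k <= X. *)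
Lemma big_dirichlet (g : nat -> nat -> T) (X : nat) :
  \big[op/idx]_(1 <= m < X.+1) \big[op/idx]_(1 <= k < (X %/ m).+1) g m (m * k)%N =
  \big[op/idx]_(1 <= n < X.+1) \big[op/idx]_(1 <= m < n.+1 | m %| n) g m n.
Proof.
transitivity (\big[op/idx]_(1 <= m < X.+1) \big[op/idx]_(1 <= n < X.+1 | m %| n) g m n).
  by apply: eq_big_nat => m hm; rewrite big_multiples //; lia.
rewrite (exchange_big_dep xpredT) //=.
apply: eq_big_nat => n hn.
by rewrite big_divisors_bound //; lia.
Qed.

End Multiples.

(** * The Moebius and von Mangoldt functions *)

Definition mu (n : nat) : R :=
  if all (fun p => logn p n == 1%N) (primes n) then (-1) ^ (size (primes n)) else 0.

Lemma mu_1 : mu 1 = 1.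
Proof. by rewrite /mu /=. Qed.

Lemma Rabs_mu n : Rabs (mu n) <= 1.
Proof.
rewrite /mu; case: ifP => _; last by rewrite Rabs_R0; lra.
by rewrite -RPow_abs Rabs_Ropp Rabs_R1 pow1; lra.
Qed.

Lemma mu_mulp p k : prime p -> (0 < k)%N -> ~~ (p %| k) -> mu (p * k) = - mu k.
Proof.
move=> pp k0 pk; have p0 := prime_gt0 pp.
have hperm : perm_eq (primes (p * k)) (p :: primes k).
  apply: uniq_perm; first exact: primes_uniq.
    by rewrite /= primes_uniq andbT mem_primes pp k0 /= (negbTE pk).
  by move=> q; rewrite primesM // inE primes_prime // inE.
rewrite /mu (perm_all _ hperm) (perm_size hperm) /=.
have -> : logn p (p * k) == 1%N.
  by rewrite lognM // logn_prime // eqxx (lognE p k) pp k0 (negbTE pk).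
have -> : all (fun q => logn q (p * k) == 1%N) (primes k) = all (fun q => logn q k == 1%N) (primes k).
  apply: eq_in_all => q hq; rewrite lognM // logn_prime //.
  by case: (eqVneq q p) => [hqp|_] //; move: hq; rewrite hqp mem_primes (negbTE pk) !andbF.
by rewrite /=; case: ifP => _; lra.
Qed.

Lemma mu_sq p k : prime p -> (0 < k)%N -> p %| k -> mu (p * k) = 0.
Proof.
move=> pp k0 pk; have p0 := prime_gt0 pp.
rewrite /mu; case: ifP => // /allP h.
have /h : p \in primes (p * k) by rewrite mem_primes pp muln_gt0 p0 k0 dvdn_mulr.
rewrite lognM // logn_prime // eqxx.
have : (0 < logn p k)%N by rewrite logn_gt0 mem_primes pp k0.
by case: (logn p k).
Qed.

(** Divisors divisible by p^2 do not count, and the others pair up as [d] and [p d] with [d]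
    dividing [m] and opposite signs. The divisor sums of [mu] and of [mu ln] both follow by a choice
    of [f]. *)
Lemma mu_split (f : nat -> R) (p a m : nat) : prime p -> (0 < m)%N -> ~~ (p %| m) ->
  \Rsum_(1 <= d < (p ^ a.+1 * m).+1 | d %| p ^ a.+1 * m) (mu d * f d) =
  \Rsum_(1 <= d < m.+1 | d %| m) (mu d * (f d - f (p * d)%N)).
Proof.
move=> pp m0 pm; have p0 := prime_gt0 pp; have p1 := prime_gt1 pp.
set n := (p ^ a.+1 * m)%N.
have n0 : (0 < n)%N by rewrite muln_gt0 expn_gt0 p0.
have hcop k : ~~ (p %| k) -> coprime k (p ^ a.+1).
  by move=> h; rewrite coprimeXr // coprime_sym prime_coprime.
have nE : n = (p * (p ^ a * m))%N by rewrite /n expnS mulnA.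
have hnp : (n %/ p = p ^ a * m)%N by rewrite nE mulKn.
have mn : (m <= n %/ p)%N by rewrite hnp leq_pmull // expn_gt0 p0.
rewrite (bigID (fun d => p %| d)) /=.
have -> : \Rsum_(1 <= d < n.+1 | (d %| n) && (p %| d)) (mu d * f d) =
   \Rsum_(1 <= k < m.+1 | k %| m) (- (mu k * f (p * k)%N)).
  transitivity (\Rsum_(1 <= d < n.+1 | p %| d) (if d %| n then mu d * f d else 0)).
    by rewrite -big_mkcondr; apply: eq_bigl => d; rewrite andbC.
  rewrite big_multiples // -(big_divisors_bound _ _ m0 mn) [RHS]big_mkcond /=.
  apply: eq_big_nat => k hk; have k0 : (0 < k)%N by lia.
  case: (boolP (p %| k)) => hpk.
    rewrite mu_sq // Rmult_0_l if_same.
    by case: ifP => // hkm; rewrite (dvdn_trans hpk hkm) in pm.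
  have -> : (p * k %| n) = (k %| m).
    rewrite nE dvdn_pmul2l // Gauss_dvdr //.
    by case: (a) => [|a']; [rewrite coprimen1 | rewrite coprimeXr // coprime_sym prime_coprime].
  by case: ifP => // _; rewrite mu_mulp //; ring.
have -> : \Rsum_(1 <= d < n.+1 | (d %| n) && ~~ (p %| d)) (mu d * f d) =
   \Rsum_(1 <= d < m.+1 | d %| m) (mu d * f d).
  have mn' : (m <= n)%N by rewrite (leq_trans mn) // leq_div.
  rewrite -(big_divisors_bound _ _ m0 mn').
  apply: eq_bigl => d; case: (boolP (p %| d)) => hpd; rewrite ?andbF ?andbT.
    by apply/esym/negbTE; apply: contra pm => h; apply: dvdn_trans h.
  by rewrite /n Gauss_dvdr // hcop.
by rewrite -big_split /=; apply: eq_bigr => d _; ring.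
Qed.

Lemma prime_split n : (1 < n)%N -> exists p a m,
  [/\ prime p, (0 < m)%N, ~~ (p %| m), n = (p ^ a.+1 * m)%N & p = pdiv n].
Proof.
move=> n1; have pp := pdiv_prime n1; have n0 : (0 < n)%N by lia.
have [m hm1 hm2] := pfactor_coprime pp n0.
exists (pdiv n), (logn (pdiv n) n).-1, m; split => //.
- by case: m hm2 hm1 => // h; rewrite h in n0.
- by rewrite -prime_coprime.
- rewrite prednK; first by rewrite mulnC.
  by rewrite logn_gt0 mem_primes pp n0 pdiv_dvd.
Qed.

Lemma sum_mu n : (0 < n)%N -> \Rsum_(1 <= d < n.+1 | d %| n) mu d = if n == 1%N then 1 else 0.
Proof.
move=> n0; case: eqP => [->|n1].
  by rewrite big_mkcond big_nat1 /= mu_1.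
have [p [a [m [pp m0 pm -> _]]]] := @prime_split n ltac:(lia).
have -> : \Rsum_(1 <= d < (p ^ a.+1 * m).+1 | d %| p ^ a.+1 * m) mu d =
  \Rsum_(1 <= d < (p ^ a.+1 * m).+1 | d %| p ^ a.+1 * m) (mu d * 1) by apply: eq_bigr => d _; ring.
by rewrite (mu_split (fun=> 1)) // big1 // => d _; ring.
Qed.

(** Defined as the convolution of [mu] with the logarithm; that it is ln p at powers of p and 0
    elsewhere is the content of [mangoldt_split]. *)
Definition mangoldt (n : nat) : R := \Rsum_(1 <= d < n.+1 | d %| n) (mu d * ln (INR (n %/ d))).

Lemma mangoldt_split p a m : prime p -> (0 < m)%N -> ~~ (p %| m) ->
  mangoldt (p ^ a.+1 * m) = if m == 1%N then ln (INR p) else 0.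
Proof.
move=> pp m0 pm; have p0 := prime_gt0 pp; have n0 : (0 < p ^ a.+1 * m)%N by rewrite muln_gt0 expn_gt0 p0.
rewrite /mangoldt (mu_split (fun d => ln (INR ((p ^ a.+1 * m) %/ d)))) //.
transitivity (ln (INR p) * \Rsum_(1 <= d < m.+1 | d %| m) mu d); last first.
  by rewrite sum_mu //; case: eqP => _; ring.
rewrite Rsum_mull big_nat_cond [RHS]big_nat_cond; apply: eq_bigr => d /andP[hd hdm].
have d0 : (0 < d)%N by lia.
have hq : (p ^ a.+1 * m %/ d = p * (p ^ a.+1 * m %/ (p * d)))%N.
  rewrite expnS -!mulnA divnMl // -muln_divA; last by apply: dvdn_mull.
  by [].
have hq0 : (0 < p ^ a.+1 * m %/ (p * d))%N.
  by rewrite divn_gt0 ?muln_gt0 ?p0 //; apply: dvdn_leq => //; rewrite expnS -mulnA dvdn_pmul2l // dvdn_mull.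
by rewrite hq mult_INR ln_mult; [ring | exact: INR_gt0 | exact: INR_gt0].
Qed.

Lemma mangoldt_1 : mangoldt 1 = 0.
Proof. by rewrite /mangoldt big_mkcond big_nat1 dvdnn divnn /= ln_1; ring. Qed.

Lemma mangoldt_prime p : prime p -> mangoldt p = ln (INR p).
Proof.
move=> pp; have := @mangoldt_split p 0 1 pp isT; rewrite expn1 muln1; apply.
by rewrite dvdn1; case: p pp => [|[|]].
Qed.

Lemma mangoldt_bound n : (0 < n)%N -> 0 <= mangoldt n <= ln (INR n).
Proof.
move=> n0; have hn : 0 <= ln (INR n) by rewrite -ln_1; apply: ln_le; [lra | apply: INR_ge1].
case: (leqP n 1) => n1; first by have -> : n = 1%N by [lia]; rewrite mangoldt_1 /= ln_1; lra.
have [p [a [m [pp m0 pm hE _]]]] := prime_split n1.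
rewrite {1 2}hE mangoldt_split //; case: eqP => hm; last lra.
have hp := INR_ge1 (prime_gt0 pp); split; first by rewrite -ln_1; apply: ln_le; lra.
apply: ln_le; first lra.
by apply: INR_le; rewrite hE hm muln1 expnS leq_pmulr // expn_gt0 prime_gt0.
Qed.

Lemma divisors_split (g : nat -> R) (p a m : nat) : prime p -> (0 < m)%N -> ~~ (p %| m) ->
  \Rsum_(1 <= d < (p ^ a.+1 * m).+1 | d %| p ^ a.+1 * m) g d =
  \Rsum_(1 <= d < m.+1 | d %| m) g d +
  \Rsum_(1 <= k < (p ^ a * m).+1 | k %| p ^ a * m) g (p * k)%N.
Proof.
move=> pp m0 pm; have p0 := prime_gt0 pp.
have n0 : (0 < p ^ a.+1 * m)%N by rewrite muln_gt0 expn_gt0 p0.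
have hnp : (p ^ a.+1 * m %/ p = p ^ a * m)%N by rewrite expnS -mulnA mulKn.
rewrite (bigID (fun d => p %| d)) /= Rplus_comm; congr (_ + _).
  have mn' : (m <= p ^ a.+1 * m)%N by rewrite leq_pmull // expn_gt0 p0.
  rewrite -(big_divisors_bound _ _ m0 mn').
  apply: eq_bigl => d; case: (boolP (p %| d)) => hpd; rewrite ?andbF ?andbT.
    by apply/esym/negbTE; apply: contra pm => h; apply: dvdn_trans h.
  by rewrite Gauss_dvdr // coprimeXr // coprime_sym prime_coprime.
transitivity (\Rsum_(1 <= d < (p ^ a.+1 * m).+1 | p %| d) (if d %| p ^ a.+1 * m then g d else 0)).
  by rewrite -big_mkcondr; apply: eq_bigl => d; rewrite andbC.
rewrite big_multiples // hnp [RHS]big_mkcond /=; apply: eq_bigr => k _.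
by rewrite expnS -mulnA dvdn_pmul2l.
Qed.

(** Strong induction on n = p^(a+1) m: the divisors of [m] give ln m, and the divisors divisible by
    p contribute ln p once for each of the a + 1 powers of p. *)
Lemma sum_mangoldt n : (0 < n)%N -> \Rsum_(1 <= d < n.+1 | d %| n) mangoldt d = ln (INR n).
Proof.
elim/ltn_ind: n => n IH n0; case: (leqP n 1) => n1.
  have -> : n = 1%N by lia.
  by rewrite big_mkcond big_nat1 /= mangoldt_1 ln_1.
have [p [a [m [pp m0 pm hE _]]]] := prime_split n1.
have p0 := prime_gt0 pp; have p1 := prime_gt1 pp.
have pk k : (0 < p ^ k)%N by rewrite expn_gt0 p0.
rewrite {1 2}hE divisors_split // IH //; last by rewrite hE ltn_Pmull // -(expn0 p) ltn_exp2l.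
have hE' : INR n = INR m * INR (p ^ a.+1) by rewrite -mult_INR hE mulnC.
rewrite hE' ln_mult; [congr (_ + _) | exact: INR_gt0 | exact: INR_gt0].
have base j : \Rsum_(1 <= k < m.+1 | k %| m) mangoldt (p ^ j.+1 * k) = ln (INR p).
  transitivity (\Rsum_(1 <= k < m.+1 | k %| m) (if k == 1%N then ln (INR p) else 0)).
    rewrite big_nat_cond [RHS]big_nat_cond; apply: eq_bigr => k /andP[hk hkm].
    apply: mangoldt_split => //; first lia.
    by apply: contra pm => h; apply: dvdn_trans hkm.
  rewrite big_mkcond big_ltn //= dvd1n big_nat_cond big1; first by ring.
  by move=> k /andP[hk _]; case: eqP => [|_]; [lia | rewrite if_same].
(* General [j] lets the induction on [b] move one factor p from [k] into the fixed power. *)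
have key b j : \Rsum_(1 <= k < (p ^ b * m).+1 | k %| p ^ b * m) mangoldt (p ^ j.+1 * k) =
    ln (INR (p ^ b.+1)).
  elim: b j => [|b IHb] j; first by rewrite expn0 mul1n base expn1.
  rewrite (divisors_split (fun k => mangoldt (p ^ j.+1 * k))) // base.
  have -> : \Rsum_(1 <= k < (p ^ b * m).+1 | k %| p ^ b * m) mangoldt (p ^ j.+1 * (p * k)) =
     \Rsum_(1 <= k < (p ^ b * m).+1 | k %| p ^ b * m) mangoldt (p ^ j.+2 * k).
    by apply: eq_bigr => k _; congr mangoldt; rewrite (expnS p j.+1) mulnA [(p ^ _ * p)%N]mulnC.
  rewrite IHb (expnS p b.+1) mult_INR ln_mult //; exact: INR_gt0.
by rewrite -(key a 0%N); apply: eq_bigr => k _; rewrite expn1.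
Qed.

(** * The divisor function and its bound *)

Definition tau (n : nat) : R := \Rsum_(1 <= d < n.+1 | d %| n) 1.

Lemma tau_pM p a m : prime p -> (0 < m)%N -> ~~ (p %| m) ->
  tau (p ^ a * m) = INR a.+1 * tau m.
Proof.
move=> pp m0 pm; elim: a => [|a IH]; first by rewrite expn0 mul1n Rmult_1_l.
rewrite /tau (divisors_split (fun=> 1)) // -/(tau m) -/(tau (p ^ a * m)) IH.
by rewrite !S_INR; ring.
Qed.

Lemma ln2_bounds : 1 / 2 <= ln 2 <= 1.
Proof.
split; last by have := exp_ineq1_le (ln 2); rewrite exp_ln; lra.
have := exp_ineq1_le (ln (1 / 2)); rewrite exp_ln; last lra.
have -> : 1 / 2 = / 2 by lra.
by rewrite ln_Rinv; lra.
Qed.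

(** By multiplicativity one compares [a + 1] with p^(a ep) at each prime power. The least prime is
    peeled off at every step, and [key] records a lower bound [q] for the remaining primes: [P0 - q]
    bounds the number of primes that can still cost a factor [c]. *)
Lemma tau_le (ep : R) : 0 < ep -> exists K, 1 <= K /\
  forall n, (0 < n)%N -> tau n <= K * INR n `^ ep.
Proof.
move=> ep0; have hl2 := ln2_bounds.
(* Chosen so that [a + 1 <= c * 2^(a ep)] for all [a], by exp x >= 1 + x. *)
pose c := 1 + / (ep * ln 2).
have hi : 0 < / (ep * ln 2) by apply: Rinv_0_lt_compat; nra.
have hc a : INR a + 1 <= c * 2 `^ (INR a * ep).
  have ha := pos_INR a.
  have h := exp_ineq1_le (INR a * ep * ln 2); rewrite -/(Rpower 2 (INR a * ep)) in h.
  have h2 : c * (1 + INR a * ep * ln 2) = 1 + / (ep * ln 2) + INR a * ep * ln 2 + INR a by rewrite /c; field; nra.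
  have h3 : c * (1 + INR a * ep * ln 2) <= c * 2 `^ (INR a * ep) by apply: Rmult_le_compat_l; rewrite /c; lra.
  have : 0 <= INR a * ep * ln 2 by apply: Rmult_le_pos; [nra | lra].
  by lra.
(* Beyond this threshold p^ep >= 2, and [a + 1 <= 2^a <= p^(a ep)] costs no constant. *)
have [P hP] := nfloorP (x := 2 `^ (/ ep)) ltac:(exact: pw_ge0).
pose P0 := P.+1.
have hP0 p : (P0 <= p)%N -> 2 <= INR p `^ ep.
  move=> hp; have -> : 2 = (2 `^ (/ ep)) `^ ep.
    by rewrite pw_pw (_ : / ep * ep = 1) ?pw_1; [|lra | field; lra].
  apply: pw_base; last lra; split; first exact: pw_gt0.
  by have := INR_le hp; rewrite /P0 S_INR; lra.
have c1 : 1 <= c by rewrite /c; lra.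
have key n q : (0 < n)%N -> (forall p, prime p -> p %| n -> (q <= p)%N) ->
    tau n <= c ^ (P0 - q) * INR n `^ ep.
  elim/ltn_ind: n q => n IH q n0 hq; case: (leqP n 1) => n1.
    have -> : n = 1%N by lia.
    rewrite /tau big_mkcond big_nat1 /= pw_1l Rmult_1_r.
    by apply: pow_R1_Rle.
  have [p [a [m [pp m0 pm hE hp]]]] := prime_split n1.
  have p0 := prime_gt0 pp; have p1 := prime_gt1 pp.
  have qp : (q <= p)%N by apply: hq => //; rewrite hE expnS -mulnA dvdn_mulr.
  have hm : tau m <= c ^ (P0 - p.+1) * INR m `^ ep.
    apply: IH => //.
      by rewrite hE ltn_Pmull // -(expn0 p) ltn_exp2l.
    move=> r pr rm; rewrite ltn_neqAle; apply/andP; split.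
      by apply: contra pm => /eqP ->.
    by rewrite hp; apply: pdiv_min_dvd; [exact: prime_gt1 | rewrite hE dvdn_mull].
  rewrite hE tau_pM // mult_INR pw_mulb; try exact: INR_gt0; last by apply: INR_gt0; rewrite expn_gt0 p0.
  have -> : INR (p ^ a.+1) `^ ep = INR p `^ (INR a.+1 * ep).
    have -> : INR (p ^ a.+1) = INR p ^ a.+1.
      by elim: (a.+1) => // k IHk; rewrite expnS mult_INR IHk.
    by rewrite -pw_nat ?pw_pw //; exact: INR_gt0.
  have hp2 : 2 <= INR p by apply: (INR_le p1).
  have ha := pos_INR a.+1.
  have ht : 0 <= tau m by apply: Rsum_ge0 => _ _; lra.
  have key2 : INR a.+2 * c ^ (P0 - p.+1) <= c ^ (P0 - q) * INR p `^ (INR a.+1 * ep).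
    case: (ltnP p P0) => hpP.
      have -> : (P0 - q = (P0 - p.+1) + (p - q).+1)%N by lia.
      rewrite pow_add [c ^ (p - q).+1]/=.
      have h1 : 1 <= c ^ (p - q) by apply: pow_R1_Rle.
      have h2 : INR a.+2 <= c * INR p `^ (INR a.+1 * ep).
        rewrite [INR a.+2]S_INR; apply: Rle_trans (hc a.+1) _.
        by apply: Rmult_le_compat_l; [lra | apply: pw_base; [lra | nra]].
      have h3 : 0 <= c ^ (P0 - p.+1) by apply: pow_le; lra.
      have h4 : c * INR p `^ (INR a.+1 * ep) <= c * c ^ (p - q) * INR p `^ (INR a.+1 * ep).
        apply: Rmult_le_compat_r; first exact: pw_ge0.
        by rewrite -[X in X <= _]Rmult_1_r; apply: Rmult_le_compat_l; lra.
      rewrite Rmult_comm Rmult_assoc; apply: Rmult_le_compat_l => //; lra.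
    have -> : (P0 - p.+1 = 0)%N by lia.
    rewrite Rmult_1_r.
    have h1 : 1 <= c ^ (P0 - q) by apply: pow_R1_Rle.
    have h2 : INR a.+2 <= INR p `^ (INR a.+1 * ep).
      rewrite Rmult_comm -pw_pw pw_nat; last exact: pw_gt0.
      apply: (Rle_trans _ (2 ^ a.+1)); last by apply: pow_incr; split; [lra | exact: hP0].
      elim: (a.+1) => [|k IHk]; first by rewrite /=; lra.
      rewrite S_INR [2 ^ k.+1]/=; have : 1 <= 2 ^ k by apply: pow_R1_Rle; lra.
      by lra.
    have h3 := pw_ge0 (INR p) (INR a.+1 * ep); nra.
  have hmp := pw_ge0 (INR m) ep.
  apply: (Rle_trans _ (INR a.+2 * (c ^ (P0 - p.+1) * INR m `^ ep))).
    by apply: Rmult_le_compat_l => //; exact: pos_INR.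
  rewrite -!Rmult_assoc; exact: Rmult_le_compat_r.
exists (c ^ P0); split; first by apply: pow_R1_Rle.
by move=> n n0; have := key n 0%N n0 (fun _ _ _ => leq0n _); rewrite subn0.
Qed.

Lemma abel (w F : nat -> C) (E : nat) (B : R) : (0 < E)%N -> 0 <= B ->
  (forall E', (0 < E' <= E)%N -> Cmod (\Csum_(1 <= n < E') F n) <= B) ->
  Cmod (\Csum_(1 <= n < E) (w n * F n)) <=
  B * (Cmod (w E.-1) + \Rsum_(1 <= n < E.-1) Cmod (w n - w n.+1)).
Proof.
move=> E0 B0 h.
case: E E0 h => [//|E] _ h /=.
case: E h => [|E] h.
  rewrite big_geq // Cmod_0; apply: Rmult_le_pos => //.
  by rewrite big_geq // Rplus_0_r; apply: Cmod_ge_0.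
pose G n := \Csum_(1 <= k < n.+1) F k.
have hG n : (n <= E.+1)%N -> Cmod (G n) <= B by move=> hn; apply: h; lia.
have -> : \Csum_(1 <= n < E.+2) (w n * F n) =
   (w E.+1 * G E.+1 + \Csum_(1 <= n < E.+1) ((w n - w n.+1) * G n))%C.
  elim: E {h hG} => [|E IH].
    by rewrite big_nat1 (big_geq (m := 1) (n := 1)) // /G big_nat1; ring.
  rewrite big_nat_recr // IH [in RHS]big_nat_recr //=.
  have -> : G E.+2 = (G E.+1 + F E.+2)%C by rewrite /G big_nat_recr.
  ring.
apply: Rle_trans (Cmod_triangle _ _) _.
rewrite Rmult_plus_distr_l; apply: Rplus_le_compat.
  by rewrite Cmod_mult Rmult_comm; apply: Rmult_le_compat_r; [exact: Cmod_ge_0 | exact: hG].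
apply: Rle_trans (Cmod_sum _ _ _) _; rewrite Rsum_mull; apply: Rsum_le_nat => n hn _.
by rewrite Cmod_mult Rmult_comm; apply: Rmult_le_compat_r; [exact: Cmod_ge_0 | apply: hG; lia].
Qed.

Lemma sum_abs_monotone (w : nat -> R) (m : nat) : (0 < m)%N ->
  (forall n, (0 < n < m)%N -> w n <= w n.+1) ->
  \Rsum_(1 <= n < m) Cmod (RtoC (w n) - RtoC (w n.+1)) = w m - w 1%N.
Proof.
case: m => // m _; elim: m => [|m IH] h; first by rewrite big_geq //; ring.
rewrite big_nat_recr //= IH; last by move=> n hn; apply: h; lia.
rewrite -RtoC_minus Cmod_R Rabs_left1; first by ring.
by have := h m.+1 ltac:(lia); lra.
Qed.

Lemma sqrt_pw x : 0 < x -> sqrt x = x `^ (/ 2).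
Proof. by move=> x0; rewrite Rpower_sqrt. Qed.

Lemma trunc_log_le x : (0 < x)%N -> INR (trunc_log 2 x) <= 2 * ln (INR x).
Proof.
move=> x0; have hl2 := ln2_bounds; have hx := INR_gt0 x0.
have h1 : INR (2 ^ trunc_log 2 x) <= INR x by apply: INR_le; apply: trunc_logP.
have h2 : INR (2 ^ trunc_log 2 x) = 2 ^ trunc_log 2 x.
  by elim: (trunc_log 2 x) => // k IH; rewrite expnS mult_INR IH.
have h3 : ln (2 ^ trunc_log 2 x) <= ln (INR x).
  by apply: ln_le; [apply: pow_lt; lra | rewrite -h2].
rewrite -pw_nat in h3; last lra.
rewrite /Rpower ln_exp in h3.
by have := pos_INR (trunc_log 2 x); nra.
Qed.

(** A non-prime [n] with [mangoldt n] nonzero is p^k with k >= 2, so [p <= sqrt x] and k is at most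
    the binary logarithm of x; each pair (p, k) costs at most ln x. *)
Lemma mangoldt_nonprime_sum x : (0 < x)%N ->
  \Rsum_(1 <= n < x.+1 | ~~ prime n) mangoldt n <= 2 * sqrt (INR x) * ln (INR x) ^ 2.
Proof.
move=> x0; have hx := INR_ge1 x0.
have hln : 0 <= ln (INR x) by rewrite -ln_1; apply: ln_le; lra.
have [s hs] := nfloorP (x := sqrt (INR x)) ltac:(exact: sqrt_pos).
pose L := trunc_log 2 x.
apply: (Rle_trans _ (\Rsum_(1 <= n < x.+1) \Rsum_(1 <= p < s.+1) \Rsum_(1 <= k < L.+1)
   (if n == (p ^ k)%N then ln (INR x) else 0))).
  rewrite big_mkcond; apply: Rsum_le_nat => n hn _.
  have pos0 p : 0 <= \Rsum_(1 <= k < L.+1) (if n == (p ^ k)%N then ln (INR x) else 0).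
    by apply: Rsum_ge0 => k _; case: ifP => _ //; lra.
  have pos : 0 <= \Rsum_(1 <= p < s.+1) \Rsum_(1 <= k < L.+1) (if n == (p ^ k)%N then ln (INR x) else 0).
    by apply: Rsum_ge0.
  case: (boolP (prime n)) => pn //=.
  case: (leqP n 1) => n1.
    have n1' : n = 1%N by lia.
    by rewrite {1}n1' mangoldt_1.
  have [p [a [m [pp m0 pm hE _]]]] := prime_split n1.
  rewrite {1}hE mangoldt_split //; case: eqP => hm1 //.
  have p0 := prime_gt0 pp; have p1 := prime_gt1 pp.
  rewrite hm1 muln1 in hE.
  have a0 : (0 < a)%N by case: (a) hE pn => // ->; rewrite expn1 pp.
  have hpx : (p ^ a.+1 <= x)%N by rewrite -hE; lia.
  have hps : (p <= s)%N.
    have h2 : (p ^ 2 <= x)%N by apply: leq_trans hpx; apply: leq_pexp2l.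
    have h3 : INR p <= sqrt (INR x).
      rewrite -(sqrt_Rsqr (INR p)); last exact: pos_INR.
      by apply: sqrt_le_1_alt; rewrite /Rsqr -mult_INR; apply: INR_le; move: h2; rewrite -mulnn; lia.
    rewrite -ltnS; apply/ltP; apply: Stdlib.Reals.RIneq.INR_lt; rewrite S_INR; lra.
  have haL : (a.+1 <= L)%N.
    apply: trunc_log_max => //; apply: leq_trans hpx.
    by rewrite leq_exp2r.
  rewrite (bigD1_seq p) ?mem_index_iota ?iota_uniq //=; last by lia.
  rewrite (bigD1_seq a.+1) ?mem_index_iota ?iota_uniq //=.
  rewrite {1}hE eqxx.
  have h1 : 0 <= \Rsum_(1 <= i < L.+1 | i != a.+1) (if n == (p ^ i)%N then ln (INR x) else 0).
    by apply: Rsum_ge0 => k _; case: ifP => _; lra.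
  have h2 : 0 <= \Rsum_(1 <= i < s.+1 | i != p) \Rsum_(1 <= k < L.+1) (if n == (i ^ k)%N then ln (INR x) else 0).
    by apply: Rsum_ge0.
  have h3 : ln (INR p) <= ln (INR x).
    apply: ln_le; first exact: INR_gt0.
    by apply: INR_le; apply: leq_trans hpx; rewrite expnS leq_pmulr // expn_gt0 p0.
  by lra.
rewrite exchange_big /=.
apply: (Rle_trans _ (\Rsum_(1 <= p < s.+1) (INR L * ln (INR x)))).
  apply: Rsum_le_nat => p hp _; rewrite exchange_big /=.
  have -> : INR L * ln (INR x) = INR (L.+1 - 1) * ln (INR x) by congr (INR _ * _); lia.
  rewrite -Rsum_const_nat; apply: Rsum_le_nat => k hk _.
  case: (boolP (p ^ k < x.+1)%N) => hpk; last first.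
    rewrite big_nat_cond big1; first lra.
    by move=> n /andP[hn _]; case: eqP => // h; lia.
  rewrite (bigD1_seq (p ^ k)%N) ?iota_uniq //=; last first.
    by rewrite mem_index_iota expn_gt0; lia.
  rewrite eqxx big1; first by lra.
  by move=> n /negbTE ->.
rewrite Rsum_const_nat.
have -> : (s.+1 - 1 = s)%N by lia.
have h1 := trunc_log_le x0; rewrite -/L in h1.
have h2 := pos_INR s; have h3 := pos_INR L.
apply: (Rle_trans _ (sqrt (INR x) * (2 * ln (INR x) * ln (INR x)))); last by right; ring.
apply: Rmult_le_compat; [lra | nra | lra | ].
by apply: Rmult_le_compat_r; lra.
Qed.

Lemma Cmult_minus_distr (a b c : C) : ((a - b) * c = a * c - b * c)%C.
Proof. ring. Qed.

(** * Regrouping of double sums and Vaughan's identity *)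

Section Hyperbola.
Variables (T : Type) (idx : T) (op : Monoid.com_law idx).

Lemma big_hyperbola (h : nat -> nat -> T) (X Y : nat) : (X <= Y)%N ->
  \big[op/idx]_(1 <= m < X.+1) \big[op/idx]_(1 <= k < (X %/ m).+1) h m k =
  \big[op/idx]_(1 <= m < Y.+1) \big[op/idx]_(1 <= k < Y.+1 | (m * k <= X)%N) h m k.
Proof.
move=> XY; rewrite [RHS](big_cat_nat (n := X.+1)) //= [X in op _ X]big_nat_cond.
rewrite [X in op _ X]big1 ?Monoid.mulm1; last first.
  move=> m /andP[hm _]; rewrite big_nat_cond big1 // => k /andP[hk hmk].
  by have := leq_pmulr m (n := k); lia.
apply: eq_big_nat => m hm; have m0 : (0 < m)%N by lia.
have hXm : ((X %/ m).+1 <= Y.+1)%N by rewrite ltnS (leq_trans (leq_div _ _)).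
rewrite (big_nat_widen _ _ _ _ _ hXm); apply: eq_bigl => k /=.
by rewrite ltnS leq_divRL // mulnC.
Qed.

Lemma big_hyperbola_swap (h : nat -> nat -> T) (X : nat) :
  \big[op/idx]_(1 <= m < X.+1) \big[op/idx]_(1 <= k < (X %/ m).+1) h m k =
  \big[op/idx]_(1 <= k < X.+1) \big[op/idx]_(1 <= m < (X %/ k).+1) h m k.
Proof.
rewrite (big_hyperbola _ (leqnn X)) (big_hyperbola (fun k m => h m k) (leqnn X)).
rewrite (exchange_big_dep_nat xpredT) //=; apply: eq_bigr => k _.
by apply: eq_bigl => m; rewrite mulnC.
Qed.

Lemma big_dyadic (G : nat -> T) (U L : nat) :
  \big[op/idx]_(U <= n < U * 2 ^ L) G n =
  \big[op/idx]_(0 <= i < L) \big[op/idx]_(U * 2 ^ i <= n < 2 * (U * 2 ^ i)) G n.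
Proof.
elim: L => [|L IH]; first by rewrite expn0 muln1 !big_geq.
have h : (0 < 2 ^ L)%N by rewrite expn_gt0.
have e2 : (U * 2 ^ L.+1 = 2 * (U * 2 ^ L))%N by rewrite expnS mulnCA.
by rewrite big_nat_recr //= -IH e2 [LHS](big_cat_nat (n := (U * 2 ^ L)%N)) //=; nia.
Qed.

End Hyperbola.

Section Vaughan.

Variables (F : nat -> C) (U x : nat).
Hypothesis U0 : (0 < U)%N.

Definition lam_hi (n : nat) : R := if (U < n)%N then mangoldt n else 0.
Definition lam_lo (n : nat) : R := if (n <= U)%N then mangoldt n else 0.
Definition mu_lo (n : nat) : R := if (n <= U)%N then mu n else 0.
(** The convolution of 1 with the part of [mu] beyond [U]. It vanishes up to [U], so that both
    variables of [type2_sum] exceed [U]. *)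
Definition mu_hi_conv (l : nat) : R := \Rsum_(1 <= d < l.+1 | d %| l) (mu d - mu_lo d).

Lemma mu_hi_convE l : (0 < l)%N ->
  mu_hi_conv l = (if l == 1%N then 1 else 0) - \Rsum_(1 <= d < l.+1 | d %| l) mu_lo d.
Proof. by move=> l0; rewrite /mu_hi_conv RsumB sum_mu. Qed.

Lemma mu_hi_conv_small l : (l <= U)%N -> mu_hi_conv l = 0.
Proof.
move=> lU; rewrite /mu_hi_conv big_nat_cond big1 // => d /andP[hd hdl].
by rewrite /mu_lo ifT; [ring | lia].
Qed.

Lemma mu_hi_conv_le l : Rabs (mu_hi_conv l) <= tau l.
Proof.
rewrite /mu_hi_conv /tau -Cmod_R Csum_RtoC.
apply: Rle_trans (Cmod_sum _ _ _) _; apply: Rsum_le => d _; rewrite Cmod_R /mu_lo.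
have := Rabs_mu d; case: ifP => _; last by rewrite Rminus_0_r.
by rewrite Rminus_diag Rabs_R0; lra.
Qed.

Lemma sum_lam_hi n : (0 < n)%N ->
  \Rsum_(1 <= d < n.+1 | d %| n) lam_hi d = ln (INR n) - \Rsum_(1 <= d < n.+1 | d %| n) lam_lo d.
Proof.
move=> n0; rewrite -sum_mangoldt // -RsumB; apply: eq_bigr => d _.
by rewrite /lam_hi /lam_lo; case: leqP => h; ring.
Qed.

Definition type2_sum : C :=
  \Csum_(1 <= m < x.+1) \Csum_(1 <= l < (x %/ m).+1) (RtoC (lam_hi m * mu_hi_conv l) * F (m * l)%N).

(** Convolve [lam_hi] with the unit, written as [mu] convolved with 1, and cut [mu] at [U]. The part
    beyond [U] is [type2_sum]. In the other part [lam_hi] convolved with 1 equals ln minus [lam_lo]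
    convolved with 1, which leaves two sums with a free inner variable. *)
Lemma vaughan :
  \Csum_(1 <= n < x.+1) (RtoC (lam_hi n) * F n) =
  (type2_sum +
   \Csum_(1 <= d < x.+1) (RtoC (mu_lo d) * \Csum_(1 <= n < (x %/ d).+1) (RtoC (ln (INR n)) * F (d * n)%N)) -
   \Csum_(1 <= d < x.+1) \Csum_(1 <= m < (x %/ d).+1)
      (RtoC (mu_lo d * lam_lo m) * \Csum_(1 <= k < (x %/ (d * m)).+1) F (d * m * k)%N))%C.
Proof.
pose Z := \Csum_(1 <= m < x.+1) \Csum_(1 <= l < (x %/ m).+1) \Csum_(1 <= d < l.+1 | d %| l)
   (RtoC (lam_hi m * mu_lo d) * F (m * l)%N).
have hII : type2_sum = (\Csum_(1 <= n < x.+1) (RtoC (lam_hi n) * F n) - Z)%C.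
  rewrite /type2_sum /Z -CsumB; apply: eq_big_nat => m hm.
  have m0 : (0 < m)%N by lia.
  have hX : (0 < x %/ m)%N by rewrite divn_gt0 //; lia.
  have -> : (RtoC (lam_hi m) * F m)%C =
     \Csum_(1 <= l < (x %/ m).+1) (RtoC (lam_hi m * (if l == 1%N then 1 else 0)) * F (m * l)%N).
    rewrite big_ltn // eqxx muln1 Rmult_1_r big_nat_cond big1; first by ring.
    by move=> l /andP[hl _]; rewrite ifF ?Rmult_0_r; [ring | lia].
  rewrite -CsumB; apply: eq_big_nat => l hl.
  rewrite mu_hi_convE; last lia.
  rewrite Rmult_minus_distr_l RtoC_minus Cmult_minus_distr; congr (_ - _)%C.
  rewrite Rsum_mull Csum_RtoC Csum_mulr; by apply: eq_bigr.
have hZ : Z = \Csum_(1 <= d < x.+1) \Csum_(1 <= n < (x %/ d).+1) \Csum_(1 <= m < n.+1 | m %| n)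
    (RtoC (lam_hi m * mu_lo d) * F (d * n)%N).
  rewrite /Z.
  transitivity (\Csum_(1 <= m < x.+1) \Csum_(1 <= d < (x %/ m).+1) \Csum_(1 <= k < (x %/ m %/ d).+1)
     (RtoC (lam_hi m * mu_lo d) * F (m * (d * k))%N)).
    apply: eq_bigr => m _.
    by rewrite -(big_dirichlet _ (fun d l => RtoC (lam_hi m * mu_lo d) * F (m * l)%N)%C).
  rewrite big_hyperbola_swap; apply: eq_bigr => d _.
  rewrite -(big_dirichlet _ (fun m n => RtoC (lam_hi m * mu_lo d) * F (d * n)%N)%C).
  by apply: eq_bigr => m _; rewrite divnAC; apply: eq_bigr => k _; rewrite mulnCA.
have hZ2 : Z = (\Csum_(1 <= d < x.+1) (RtoC (mu_lo d) * \Csum_(1 <= n < (x %/ d).+1) (RtoC (ln (INR n)) * F (d * n)%N)) -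
   \Csum_(1 <= d < x.+1) \Csum_(1 <= m < (x %/ d).+1)
      (RtoC (mu_lo d * lam_lo m) * \Csum_(1 <= k < (x %/ (d * m)).+1) F (d * m * k)%N))%C.
  rewrite hZ -CsumB; apply: eq_bigr => d _.
  have -> : \Csum_(1 <= m < (x %/ d).+1)
      (RtoC (mu_lo d * lam_lo m) * \Csum_(1 <= k < (x %/ (d * m)).+1) F (d * m * k)%N) =
     \Csum_(1 <= n < (x %/ d).+1) \Csum_(1 <= m < n.+1 | m %| n) (RtoC (mu_lo d * lam_lo m) * F (d * n)%N).
    rewrite -(big_dirichlet _ (fun m n => RtoC (mu_lo d * lam_lo m) * F (d * n)%N)%C).
    apply: eq_bigr => m _; rewrite Csum_mull divnMA; apply: eq_bigr => k _.
    by rewrite mulnA.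
  rewrite Csum_mull -CsumB; apply: eq_big_nat => n hn.
  have -> : \Csum_(1 <= m < n.+1 | m %| n) (RtoC (lam_hi m * mu_lo d) * F (d * n)%N) =
     (RtoC (mu_lo d * \Rsum_(1 <= m < n.+1 | m %| n) lam_hi m) * F (d * n)%N)%C.
    by rewrite Rsum_mull Csum_RtoC Csum_mulr; apply: eq_bigr => m _; rewrite Rmult_comm.
  have -> : \Csum_(1 <= m < n.+1 | m %| n) (RtoC (mu_lo d * lam_lo m) * F (d * n)%N) =
     (RtoC (mu_lo d * \Rsum_(1 <= m < n.+1 | m %| n) lam_lo m) * F (d * n)%N)%C.
    by rewrite Rsum_mull Csum_RtoC Csum_mulr; apply: eq_bigr.
  rewrite sum_lam_hi; last lia.
  by rewrite !RtoC_mult RtoC_minus; ring.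
rewrite hII {1}hZ2; ring.
Qed.

(* The support conditions m, l > U of the bilinear sum are made explicit by
   cutting it into dyadic boxes. *)
Lemma type2_sum_dyadic (L : nat) : (x < U.+1 * 2 ^ L)%N ->
  type2_sum = \Csum_(0 <= i < L) \Csum_(0 <= j < L)
    \Csum_(U.+1 * 2 ^ i <= m < 2 * (U.+1 * 2 ^ i))
      \Csum_(U.+1 * 2 ^ j <= l < 2 * (U.+1 * 2 ^ j) | (m * l <= x)%N)
        (RtoC (lam_hi m * mu_hi_conv l) * F (m * l)%N).
Proof.
move=> hL; rewrite /type2_sum.
pose Y := (U.+1 * 2 ^ L).-1; have hY : Y.+1 = (U.+1 * 2 ^ L)%N by rewrite /Y prednK // muln_gt0 expn_gt0.
have xY : (x <= Y)%N by lia.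
rewrite (big_hyperbola _ (fun m l => RtoC (lam_hi m * mu_hi_conv l) * F (m * l)%N)%C xY) hY.
have hU1 : (U.+1 <= U.+1 * 2 ^ L)%N by rewrite leq_pmulr // expn_gt0.
have cut (G : nat -> C) : (forall n, (n <= U)%N -> G n = RtoC 0) ->
    \Csum_(1 <= n < U.+1 * 2 ^ L) G n =
    \Csum_(0 <= i < L) \Csum_(U.+1 * 2 ^ i <= n < 2 * (U.+1 * 2 ^ i)) G n.
  move=> hG; rewrite -big_dyadic (big_cat_nat (n := U.+1)) //= big_nat_cond big1; first by ring.
  by move=> n /andP[hn _]; apply: hG; lia.
rewrite cut; last first.
  move=> m hm; rewrite big1 // => l _.
  by rewrite /lam_hi ifF; [rewrite Rmult_0_l; ring | lia].
apply: eq_bigr => i _.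
transitivity (\Csum_(U.+1 * 2 ^ i <= m < 2 * (U.+1 * 2 ^ i)) \Csum_(0 <= j < L)
      \Csum_(U.+1 * 2 ^ j <= l < 2 * (U.+1 * 2 ^ j) | (m * l <= x)%N)
        (RtoC (lam_hi m * mu_hi_conv l) * F (m * l)%N)); last by rewrite exchange_big.
apply: eq_bigr => m _; rewrite big_mkcond cut; last first.
  by move=> l hl; rewrite mu_hi_conv_small // Rmult_0_r; case: ifP => // _; ring.
by apply: eq_bigr => j _; rewrite -big_mkcond.
Qed.

End Vaughan.

Lemma sum_trunc_le (s : nat -> R) (x Z : nat) : (forall n, (0 < n <= Z)%N -> 0 <= s n) ->
  \Rsum_(1 <= n < x.+1) (if (n <= Z)%N then s n else 0) <= \Rsum_(1 <= n < Z.+1) s n.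
Proof.
move=> s0.
have -> : \Rsum_(1 <= n < Z.+1) s n = \Rsum_(1 <= n < Z.+1) (if (n <= Z)%N then s n else 0).
  by apply: eq_big_nat => n hn; rewrite ifT //; lia.
pose s' n := if (n <= Z)%N then s n else 0.
have h0 n : (0 < n)%N -> 0 <= s' n by rewrite /s'; case: (leqP n Z) => h hn; [apply: s0; lia | lra].
have ge0 m n : (0 < m)%N -> 0 <= \Rsum_(m <= i < n) s' i.
  by move=> m0; rewrite big_nat_cond; apply: Rsum_ge0 => i /andP[hi _]; apply: h0; lia.
case: (leqP x Z) => h.
  rewrite [X in _ <= X](big_cat_nat (n := x.+1)) //=.
  by have := ge0 x.+1 Z.+1 isT; rewrite /s'; lra.
rewrite (big_cat_nat (n := Z.+1)) //=; last by lia.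
rewrite [X in _ + X <= _]big_nat_cond [X in _ + X <= _]big1; first by lra.
by move=> n /andP[hn _]; rewrite ifF //; lia.
Qed.

Section VaughanBound.

Variables (N U : nat) (F : nat -> C) (t : nat -> R) (T1 T2 l D : R).
Hypotheses (U0 : (0 < U)%N) (F1 : forall n, Cmod (F n) <= 1) (T20 : 0 <= T2).
Hypothesis typeI : forall r y, (0 < r <= U * U)%N -> (r * y <= N)%N ->
  Cmod (\Csum_(1 <= k < y.+1) F (r * k)%N) <= t r.
Hypothesis sumT1 : \Rsum_(1 <= r < (U * U).+1) t r <= T1.
Hypothesis typeII : forall (M L x : nat) (a b : nat -> R), (U < L)%N -> (L <= M)%N ->
  (M * L <= x)%N -> (x <= N)%N -> (forall m, Rabs (a m) <= 1) -> (forall m, Rabs (b m) <= 1) ->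
  Cmod (\Csum_(M <= m < 2 * M) \Csum_(L <= k < 2 * L | (m * k <= x)%N)
     (RtoC (a m * b k) * F (m * k)%N)) <= T2.
Hypothesis l1 : 1 <= l.
Hypothesis hl : forall n, (0 < n <= N)%N -> 1 + ln (INR n) <= l.
Hypothesis D1 : 1 <= D.
Hypothesis hD : forall n, (0 < n <= N)%N -> tau n <= D.

Lemma typeI_ge0 r : (0 < r <= U * U)%N -> 0 <= t r.
Proof.
move=> hr; apply: Rle_trans (typeI (y := 0) hr _); last by rewrite muln0.
exact: Cmod_ge_0.
Qed.

Lemma mangoldt_le_l n : (0 < n <= N)%N -> 0 <= mangoldt n <= l.
Proof.
move=> hn; have := @mangoldt_bound n ltac:(lia); have := hl hn; lra.
Qed.

(** There are at most (2 l)^2 dyadic boxes. In each of them the coefficients are divided by [l] and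
    [D] to become at most 1, and the variables are exchanged when [M < L], since [typeII] wants the
    longer one outside. *)
Lemma type2_sum_le x : (0 < x <= N)%N -> Cmod (type2_sum F U x) <= 4 * l ^ 3 * D * T2.
Proof.
move=> hx; pose L0 := (trunc_log 2 x).+1.
have hL0 : INR L0 <= 2 * l.
  rewrite /L0 S_INR; have := @trunc_log_le x ltac:(lia); have := hl hx; lra.
rewrite (@type2_sum_dyadic F U x U0 L0); last first.
  by apply: (@leq_trans (2 ^ L0)); [exact: trunc_log_ltn | rewrite leq_pmull].
have box i j : Cmod (\Csum_(U.+1 * 2 ^ i <= m < 2 * (U.+1 * 2 ^ i))
      \Csum_(U.+1 * 2 ^ j <= k < 2 * (U.+1 * 2 ^ j) | (m * k <= x)%N)
        (RtoC (lam_hi U m * mu_hi_conv U k) * F (m * k)%N)) <= l * D * T2.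
  have hM : (U < U.+1 * 2 ^ i)%N by rewrite leq_pmulr // expn_gt0.
  have hL : (U < U.+1 * 2 ^ j)%N by rewrite leq_pmulr // expn_gt0.
  move: hM hL; set M := (_ * 2 ^ i)%N; set L := (_ * 2 ^ j)%N => hM hL.
  have lDT : 0 <= l * D * T2 by apply: Rmult_le_pos => //; nra.
  case: (leqP (M * L) x) => hML; last first.
    rewrite big_nat_cond big1 ?Cmod_0 // => m /andP[hm _].
    by rewrite big_nat_cond big1 // => k /andP[hk hmk]; nia.
  (* [typeII] wants bounded coefficients at every index, while [l] and [D] are bounds only up to
     [N]; hence the truncation. *)
  pose a m := if (0 < m <= N)%N then lam_hi U m / l else 0.
  pose b k := if (0 < k <= N)%N then mu_hi_conv U k / D else 0.
  have ha m : Rabs (a m) <= 1.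
    rewrite /a; case: ifP => hm; last by rewrite Rabs_R0; lra.
    rewrite /lam_hi; have h := mangoldt_le_l hm; case: ifP => _; last by rewrite /Rdiv Rmult_0_l Rabs_R0; lra.
    rewrite Rabs_pos_eq; last by apply: Rdiv_le_0_compat; lra.
    by apply: Rdiv_le_r; lra.
  have hb k : Rabs (b k) <= 1.
    rewrite /b; case: ifP => hk; last by rewrite Rabs_R0; lra.
    rewrite Rabs_div; last lra.
    rewrite (Rabs_pos_eq D); last lra.
    by apply: Rdiv_le_r; [lra | have := mu_hi_conv_le U k; have := hD hk; lra].
  have -> : \Csum_(M <= m < 2 * M) \Csum_(L <= k < 2 * L | (m * k <= x)%N)
        (RtoC (lam_hi U m * mu_hi_conv U k) * F (m * k)%N) =
     (RtoC (l * D) * \Csum_(M <= m < 2 * M) \Csum_(L <= k < 2 * L | (m * k <= x)%N)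
        (RtoC (a m * b k) * F (m * k)%N))%C.
    rewrite Csum_mull; apply: eq_big_nat => m hm.
    rewrite Csum_mull big_nat_cond [RHS]big_nat_cond; apply: eq_bigr => k /andP[hk hmk].
    have hmN : (0 < m <= N)%N by nia.
    have hkN : (0 < k <= N)%N by nia.
    rewrite /a /b hmN hkN Cmult_assoc -RtoC_mult; congr (RtoC _ * _)%C.
    by field; lra.
  rewrite Cmod_mult Cmod_R Rabs_pos_eq; last by nra.
  apply: Rmult_le_compat_l; first by nra.
  case: (leqP L M) => hLM; first by apply: (typeII (a := a) (b := b)) => //; lia.
  rewrite (exchange_big_dep_nat xpredT) //=.
  have -> : \Csum_(L <= k < 2 * L) \Csum_(M <= m < 2 * M | (m * k <= x)%N)
     (RtoC (a m * b k) * F (m * k)%N) =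
    \Csum_(L <= k < 2 * L) \Csum_(M <= m < 2 * M | (k * m <= x)%N)
     (RtoC (b k * a m) * F (k * m)%N).
    by apply: eq_bigr => k _; apply: eq_big => [m|m _]; rewrite mulnC // (Rmult_comm (a m)).
  by apply: (typeII (a := b) (b := a)) => //; lia.
have lDT : 0 <= l * D * T2 by apply: Rmult_le_pos => //; nra.
have hn := pos_INR L0.
apply: Rle_trans (Cmod_sum _ _ _) _.
apply: (Rle_trans _ (\Rsum_(0 <= i < L0) (INR L0 * (l * D * T2)))).
  apply: Rsum_le => i _; apply: Rle_trans (Cmod_sum _ _ _) _.
  rewrite -[in X in _ <= X](subn0 L0) -Rsum_const_nat ?subn0; apply: Rsum_le => j _; exact: box.
rewrite Rsum_const_nat subn0 -Rmult_assoc.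
have -> : 4 * l ^ 3 * D * T2 = (2 * l * (2 * l)) * (l * D * T2) by ring.
by apply: Rmult_le_compat_r => //; apply: Rmult_le_compat.
Qed.

Lemma log_sum_le d x : (0 < d <= U * U)%N -> (0 < x <= N)%N -> (d <= x)%N ->
  Cmod (\Csum_(1 <= n < (x %/ d).+1) (RtoC (ln (INR n)) * F (d * n)%N)) <= 2 * l * t d.
Proof.
move=> hd hx dx; have t0 := typeI_ge0 hd.
have hy : (0 < x %/ d)%N by rewrite divn_gt0; lia.
have hyN : (x %/ d <= N)%N by apply: leq_trans (leq_div _ _) _; lia.
apply: Rle_trans (@abel (fun n => RtoC (ln (INR n))) (fun n => F (d * n)%N) (x %/ d).+1 (t d) isT t0 _) _.
  case=> [//|E] hE; apply: typeI => //.
  by apply: (@leq_trans x); [rewrite mulnC; apply: leq_trans (leq_trunc_div x d); rewrite leq_mul2r; lia | lia].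
rewrite [_.-1]/= (@sum_abs_monotone (fun n => ln (INR n))) //; last first.
  by move=> n hn; apply: ln_le; [apply: INR_gt0; lia | apply: INR_le; lia].
have h1 := @hl (x %/ d) ltac:(lia).
have h2 : 0 <= ln (INR (x %/ d)) by rewrite -ln_1; apply: ln_le; [lra | apply: INR_ge1].
by rewrite /= ln_1 Cmod_R Rabs_pos_eq //; nra.
Qed.

Lemma lam_hi_sum_le x : (0 < x <= N)%N ->
  Cmod (\Csum_(1 <= n < x.+1) (RtoC (lam_hi U n) * F n)) <=
  4 * l ^ 3 * D * T2 + 2 * l * T1 + l * D * T1.
Proof.
move=> hx; rewrite vaughan //.
apply: Rle_trans (Cmod_triangle _ _) _; rewrite Cmod_opp.
apply: Rplus_le_compat.
  apply: Rle_trans (Cmod_triangle _ _) _; apply: Rplus_le_compat; first exact: type2_sum_le.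
  apply: Rle_trans (Cmod_sum _ _ _) _.
  apply: (Rle_trans _ (\Rsum_(1 <= d < x.+1) (if (d <= U * U)%N then 2 * l * t d else 0))).
    apply: Rsum_le_nat => d hd _; rewrite Cmod_mult Cmod_R /mu_lo.
    case: (leqP d U) => hdU; last first.
      rewrite Rabs_R0 Rmult_0_l; case: leqP => h; last lra.
      by apply: Rmult_le_pos; [lra | apply: typeI_ge0; lia].
    have hdUU : (d <= U * U)%N by nia.
    rewrite hdUU; have h1 := @log_sum_le d x ltac:(lia) hx ltac:(lia).
    have h2 := Rabs_mu d; have h3 := Rabs_pos (mu d).
    set c := Cmod _ in h1 *; have : 0 <= c by apply: Cmod_ge_0.
    by nra.
  apply: Rle_trans (sum_trunc_le _ _) _.
    by move=> n hn; apply: Rmult_le_pos; [lra | exact: typeI_ge0].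
  by rewrite -Rsum_mull; apply: Rmult_le_compat_l; lra.
(* The last sum of the identity is regrouped by [n = d m <= U^2]; there are at most [tau n <= D]
   factorizations of [n]. *)
pose g d n := if (d <= U)%N && (n %/ d <= U)%N then l * t n else 0.
apply: Rle_trans (Cmod_sum _ _ _) _.
apply: (Rle_trans _ (\Rsum_(1 <= d < x.+1) \Rsum_(1 <= m < (x %/ d).+1) g d (d * m)%N)).
  apply: Rsum_le_nat => d hd _; apply: Rle_trans (Cmod_sum _ _ _) _.
  apply: Rsum_le_nat => m hm _; rewrite Cmod_mult Cmod_R Rabs_mult /g /mu_lo /lam_lo.
  rewrite mulKn; last lia.
  have hdm : (d * m <= x)%N.
    by apply: leq_trans (leq_trunc_div x d); rewrite mulnC leq_mul2r; lia.
  case: (leqP d U) => hdU /=; last by rewrite Rabs_R0 !Rmult_0_l; lra.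
  case: (leqP m U) => hmU /=; last by rewrite Rabs_R0 Rmult_0_r Rmult_0_l; lra.
  have h1 : Cmod (\Csum_(1 <= k < (x %/ (d * m)).+1) F (d * m * k)%N) <= t (d * m)%N.
    apply: typeI; first by nia.
    by rewrite mulnC; apply: leq_trans (leq_trunc_div x _) _; lia.
  have h2 := Rabs_mu d; have h3 := Rabs_pos (mu d).
  have hmx : (m <= N)%N by nia.
  have h4 := @mangoldt_le_l m ltac:(lia).
  rewrite (Rabs_pos_eq (mangoldt m)); last lra.
  set c := Cmod _ in h1 *; have c0 : 0 <= c by apply: Cmod_ge_0.
  apply: Rmult_le_compat => //; first by apply: Rmult_le_pos; lra.
  by nra.
rewrite big_dirichlet.
apply: (Rle_trans _ (\Rsum_(1 <= n < x.+1) (if (n <= U * U)%N then l * D * t n else 0))).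
  apply: Rsum_le_nat => n hn _.
  case: (leqP n (U * U)) => hnU.
    have t0 := @typeI_ge0 n ltac:(lia).
    apply: (Rle_trans _ (\Rsum_(1 <= m < n.+1 | m %| n) (l * t n * 1))).
      by apply: Rsum_le => m _; rewrite /g; case: ifP => _; nra.
    rewrite -Rsum_mull -/(tau n).
    have -> : l * D * t n = l * t n * D by ring.
    by apply: Rmult_le_compat_l; [nra | apply: hD; lia].
  rewrite big_nat_cond big1; first lra.
  move=> m /andP[hm hmn]; rewrite /g ifF //; apply/negP => /andP[h1 h2].
  by have := divnK hmn; nia.
apply: Rle_trans (sum_trunc_le _ _) _.
  by move=> n hn; apply: Rmult_le_pos; [nra | exact: typeI_ge0].
by rewrite -Rsum_mull; apply: Rmult_le_compat_l; nra.
Qed.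

Let B := 4 * l ^ 3 * D * T2 + 2 * l * T1 + l * D * T1 + INR U * l + 2 * sqrt (INR N) * l ^ 2.

Lemma prime_log_sum_le x : (0 < x <= N)%N ->
  Cmod (\Csum_(1 <= n < x.+1) (if prime n then RtoC (ln (INR n)) * F n else RtoC 0)) <= B.
Proof.
move=> hx.
have -> : \Csum_(1 <= n < x.+1) (if prime n then RtoC (ln (INR n)) * F n else RtoC 0) =
  (\Csum_(1 <= n < x.+1) (RtoC (lam_hi U n) * F n) +
   (\Csum_(1 <= n < x.+1) (RtoC (lam_lo U n) * F n) -
    \Csum_(1 <= n < x.+1 | ~~ prime n) (RtoC (mangoldt n) * F n)))%C.
  rewrite [X in (_ - X)%C]big_mkcond -CsumB -big_split /=; apply: eq_bigr => n _.
  have -> : RtoC (lam_hi U n) = (RtoC (mangoldt n) - RtoC (lam_lo U n))%C.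
    by rewrite /lam_hi /lam_lo; case: leqP => _; ring.
  case: (boolP (prime n)) => pn /=; last by ring.
  by rewrite -(mangoldt_prime pn); ring.
apply: Rle_trans (Cmod_triangle _ _) _; rewrite /B !Rplus_assoc -!(Rplus_assoc (4 * _ * _ * _)).
rewrite -!Rplus_assoc (Rplus_assoc (_ + l * D * T1)).
apply: Rplus_le_compat; first exact: lam_hi_sum_le.
apply: Rle_trans (Cmod_triangle _ _) _; rewrite Cmod_opp; apply: Rplus_le_compat.
  apply: Rle_trans (Cmod_sum _ _ _) _.
  apply: (Rle_trans _ (\Rsum_(1 <= n < x.+1) (if (n <= U)%N then l else 0))).
    apply: Rsum_le_nat => n hn _; rewrite Cmod_mult Cmod_R /lam_lo.
    have h := @mangoldt_le_l n ltac:(lia); have h2 := F1 n; have h3 := Cmod_ge_0 (F n).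
    case: ifP => _; last by rewrite Rabs_R0; lra.
    by rewrite Rabs_pos_eq; nra.
  apply: Rle_trans (sum_trunc_le (s := fun=> l) _ _) _; first by move=> *; lra.
  rewrite Rsum_const_nat; have -> : (U.+1 - 1 = U)%N by lia.
  lra.
apply: Rle_trans (Cmod_sum _ _ _) _.
apply: (Rle_trans _ (\Rsum_(1 <= n < x.+1 | ~~ prime n) mangoldt n)).
  apply: Rsum_le_nat => n hn _; rewrite Cmod_mult Cmod_R.
  have h := @mangoldt_le_l n ltac:(lia); have h2 := F1 n; have h3 := Cmod_ge_0 (F n).
  by rewrite Rabs_pos_eq; nra.
apply: Rle_trans (mangoldt_nonprime_sum _) _; first lia.
have h1 := hl hx.
have h2 : 0 <= ln (INR x) by rewrite -ln_1; apply: ln_le; [lra | apply: INR_ge1; lia].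
have h3 : sqrt (INR x) <= sqrt (INR N) by apply: sqrt_le_1_alt; apply: INR_le; lia.
have h4 := sqrt_pos (INR x).
by apply: Rmult_le_compat; [lra | nra | lra | apply: pow_incr; lra].
Qed.

Lemma prime_sum_le x : (x <= N)%N ->
  Cmod (\Csum_(1 <= p < x.+1 | prime p) F p) <= 2 * B.
Proof.
move=> hx; case: (posnP x) => x0.
  rewrite x0 big_geq // Cmod_0.
  have h0 := @typeI_ge0 1 ltac:(nia).
  have hT1 : 0 <= T1.
    apply: Rle_trans sumT1; rewrite big_nat_cond; apply: Rsum_ge0 => r /andP[hr _].
    by apply: typeI_ge0; lia.
  have h1 : 0 <= l * D * T1 by apply: Rmult_le_pos => //; nra.
  have h2 : 0 <= 4 * l ^ 3 * D * T2.
    by apply: Rmult_le_pos => //; apply: Rmult_le_pos; [apply: Rmult_le_pos; [lra | apply: pow_le; lra] | lra].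
  have h3 : 0 <= INR U * l by apply: Rmult_le_pos; [exact: pos_INR | lra].
  have h4 : 0 <= 2 * sqrt (INR N) * l ^ 2.
    by apply: Rmult_le_pos; [have := sqrt_pos (INR N); lra | nra].
  by rewrite /B; nra.
(* Partial summation divides by ln p. The maximum with 2 keeps the weight finite at 1 and changes
   nothing at primes; the factor 2 of the bound is that of [/ ln 2 <= 2]. *)
pose w n := / ln (INR (maxn n 2)).
have hl2 := ln2_bounds.
have hmax n : ln 2 <= ln (INR (maxn n 2)).
  by apply: ln_le; [lra | apply: (@Stdlib.Reals.RIneq.le_INR 2); lia].
have -> : \Csum_(1 <= p < x.+1 | prime p) F p =
   \Csum_(1 <= n < x.+1) (RtoC (w n) * (if prime n then RtoC (ln (INR n)) * F n else RtoC 0)).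
  rewrite big_mkcond; apply: eq_bigr => n _; case: ifP => pn; last by ring.
  rewrite /w (maxn_idPl _); last exact: prime_gt1.
  have hn : ln 2 <= ln (INR n) by apply: ln_le; [lra | apply: (INR_le (prime_gt1 pn))].
  by rewrite Cmult_assoc -RtoC_mult Rinv_l; [ring | lra].
have hB : 0 <= B.
  by apply: Rle_trans (@prime_log_sum_le x ltac:(lia)); exact: Cmod_ge_0.
apply: Rle_trans (@abel (fun n => RtoC (w n)) _ x.+1 B isT hB _) _.
  case=> [//|E] hE; case: (posnP E) => E0.
    by rewrite E0 big_geq // Cmod_0.
  by apply: prime_log_sum_le; lia.
have -> : \Rsum_(1 <= n < x.+1.-1) Cmod (RtoC (w n) - RtoC (w n.+1)) = w 1%N - w x.
  transitivity (\Rsum_(1 <= n < x) Cmod (RtoC (- w n) - RtoC (- w n.+1))).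
    apply: eq_bigr => n _; rewrite -Cmod_opp !RtoC_opp; congr Cmod; ring.
  rewrite (@sum_abs_monotone (fun n => - w n)) //; first by ring.
  move=> n hn; apply: Ropp_le_contravar; apply: Rinv_le_contravar; first by have := hmax n; lra.
  by apply: ln_le; [apply: INR_gt0; lia | apply: INR_le; lia].
have hw n : 0 < w n by apply: Rinv_0_lt_compat; have := hmax n; lra.
rewrite [x.+1.-1]/= Cmod_R Rabs_pos_eq; last by have := hw x; lra.
have -> : w x + (w 1%N - w x) = w 1%N by ring.
rewrite Rmult_comm; apply: Rmult_le_compat_r => //.
have -> : 2 = / (1 / 2) by lra.
by apply: Rinv_le_contravar; [lra | have := hmax 1%N; lra].
Qed.

End VaughanBound.

Lemma vaughan_bound (ep : R) : 0 < ep -> exists K, 0 < K /\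
  forall (N U : nat) (F : nat -> C) (t : nat -> R) (T1 T2 : R),
  (0 < U)%N -> (0 < N)%N -> (forall n, Cmod (F n) <= 1) -> 0 <= T2 ->
  (forall r y, (0 < r <= U * U)%N -> (r * y <= N)%N ->
    Cmod (\Csum_(1 <= k < y.+1) F (r * k)%N) <= t r) ->
  \Rsum_(1 <= r < (U * U).+1) t r <= T1 ->
  (forall (M L x : nat) (a b : nat -> R), (U < L)%N -> (L <= M)%N ->
    (M * L <= x)%N -> (x <= N)%N -> (forall m, Rabs (a m) <= 1) -> (forall m, Rabs (b m) <= 1) ->
    Cmod (\Csum_(M <= m < 2 * M) \Csum_(L <= k < 2 * L | (m * k <= x)%N)
     (RtoC (a m * b k) * F (m * k)%N)) <= T2) ->
  forall x, (x <= N)%N ->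
  Cmod (\Csum_(1 <= p < x.+1 | prime p) F p) <=
    K * INR N `^ ep * (T1 + T2 + INR U + sqrt (INR N)).
Proof.
(* Up to three logarithms and one divisor bound occur together; each takes a quarter of [ep]. *)
move=> ep0; have e4 : 0 < ep / 4 by lra.
have [KL [KL0 hKL]] := ln2N_le e4; have [KD [KD1 hKD]] := tau_le e4.
exists (8 * KL ^ 3 * KD); split.
  by apply: Rmult_lt_0_compat; [apply: Rmult_lt_0_compat; [lra | apply: pow_lt] | lra].
move=> N U F t T1 T2 U0 N0 F1 T20 tI sT1 tII x hx.
have hN := INR_ge1 N0; have hz := pw_ge1 hN (Rlt_le _ _ e4).
pose l := 1 + ln (2 * INR N); pose D := KD * INR N `^ (ep / 4).
have hlN : l <= KL * INR N `^ (ep / 4) by exact: hKL.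
have l1 : 1 <= l.
  by have : ln 1 <= ln (2 * INR N) by [apply: ln_le; lra]; rewrite ln_1 /l; lra.
have D1 : 1 <= D by rewrite /D; nra.
have hl n : (0 < n <= N)%N -> 1 + ln (INR n) <= l.
  move=> hn; apply: Rplus_le_compat_l; apply: ln_le; first by apply: INR_gt0; lia.
  by have : INR n <= INR N by [apply: INR_le; lia]; lra.
have hD n : (0 < n <= N)%N -> tau n <= D.
  move=> hn; apply: Rle_trans (hKD n _) _; first lia.
  apply: Rmult_le_compat_l; first lra.
  by apply: pw_base; last lra; split; [apply: INR_gt0; lia | apply: INR_le; lia].
apply: Rle_trans (prime_sum_le U0 F1 T20 tI sT1 tII l1 hl D1 hD hx) _.
have hT1 : 0 <= T1.
  apply: Rle_trans sT1; rewrite big_nat_cond; apply: Rsum_ge0 => r /andP[hr _].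
  by apply: (typeI_ge0 (N := N) tI); lia.
have hs := sqrt_pos (INR N); have hU := pos_INR U.
set S := T1 + T2 + INR U + sqrt (INR N).
have hl2 : 1 <= l ^ 2 by nra.
have hlD : 1 <= l ^ 2 * D by nra.
have hl3 : l ^ 3 * D = l * (l ^ 2 * D) by ring.
have c1 : l <= l ^ 3 * D by rewrite hl3; nra.
have c2 : l * D <= l ^ 3 * D.
  have -> : l ^ 3 * D = (l * D) * l ^ 2 by ring.
  have : 1 <= l ^ 2 by nra.
  have : 0 < l * D by nra.
  by nra.
have c3 : l ^ 2 <= l ^ 3 * D.
  have -> : l ^ 3 * D = l ^ 2 * (l * D) by ring.
  have : 1 <= l * D by nra.
  have : 0 < l ^ 2 by nra.
  by nra.
apply: (Rle_trans _ (8 * (l ^ 3 * D) * S)).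
  have e1 := Rmult_le_compat_r T1 _ _ hT1 c1.
  have e2 := Rmult_le_compat_r T1 _ _ hT1 c2.
  have e3 := Rmult_le_compat_r (INR U) _ _ hU c1.
  have e5 := Rmult_le_compat_r (sqrt (INR N)) _ _ hs c3.
  have e6 : 0 <= l ^ 3 * D * T1 by apply: Rmult_le_pos => //; nra.
  have e7 : 0 <= l ^ 3 * D * INR U by apply: Rmult_le_pos => //; nra.
  have e8 : 0 <= l ^ 3 * D * sqrt (INR N) by apply: Rmult_le_pos => //; nra.
  by rewrite /S; lra.
apply: Rmult_le_compat_r; first by rewrite /S; lra.
have -> : 8 * KL ^ 3 * KD * INR N `^ ep = 8 * ((KL * INR N `^ (ep / 4)) ^ 3 * D).
  rewrite /D Rpow_mult_distr pw_pow.
  have -> : INR N `^ ep = INR N `^ (ep / 4 * INR 3) * INR N `^ (ep / 4).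
    by rewrite -pw_add; congr Rpower; rewrite /=; field.
  ring.
apply: Rmult_le_compat_l; first lra.
by apply: Rmult_le_compat_r; [lra | apply: pow_incr; lra].
Qed.

(** * Bilinear sums over dyadic boxes and sums over Piatetski-Shapiro numbers *)

Lemma Cconj_RtoC r : Cconj (RtoC r) = RtoC r.
Proof. by rewrite /Cconj /= Ropp_0. Qed.

Lemma Cmod_sum_le_count (G : nat -> C) (a b : nat) (P : pred nat) :
  (forall n, Cmod (G n) <= 1) -> Cmod (\Csum_(a <= n < b | P n) G n) <= INR (b - a).
Proof.
by move=> h; rewrite -[X in _ <= X]Rmult_1_r; apply: Cmod_sum_const => //; lra.
Qed.

Lemma dyadic_sum (G : nat -> C) (K0 y : nat) (B : R) : (0 < K0)%N -> (0 < y)%N -> 0 <= B ->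
  (forall n, Cmod (G n) <= 1) ->
  (forall M a b, (K0 <= M)%N -> (M <= y)%N -> (M <= a)%N -> (b <= 2 * M)%N ->
     Cmod (\Csum_(a <= k < b) G k) <= B) ->
  Cmod (\Csum_(1 <= k < y.+1) G k) <= INR K0 + (2 * ln (INR y) + 1) * B.
Proof.
move=> K00 y0 B0 G1 h.
have hln : 0 <= ln (INR y) by rewrite -ln_1; apply: ln_le; [lra | apply: INR_ge1].
have hB : 0 <= (2 * ln (INR y) + 1) * B by apply: Rmult_le_pos => //; lra.
case: (leqP K0 y) => hK; last first.
  apply: Rle_trans (Cmod_sum_le_count _ _ _ G1) _.
  by have : INR (y.+1 - 1) <= INR K0 by [apply: INR_le; lia]; lra.
rewrite (big_cat_nat (n := K0)) //=; last by lia.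
apply: Rle_trans (Cmod_triangle _ _) _; apply: Rplus_le_compat.
  apply: Rle_trans (Cmod_sum_le_count _ _ _ G1) _; apply: INR_le; lia.
pose L := (trunc_log 2 y).+1.
have hL : (y.+1 <= K0 * 2 ^ L)%N.
  by apply: (@leq_trans (2 ^ L)); [exact: trunc_log_ltn | rewrite leq_pmull].
pose G' k := if (k < y.+1)%N then G k else RtoC 0.
have -> : \Csum_(K0 <= k < y.+1) G k = \Csum_(K0 <= k < K0 * 2 ^ L) G' k.
  rewrite (big_nat_widen _ _ _ _ _ hL) big_mkcond; exact: eq_bigr.
rewrite big_dyadic; apply: Rle_trans (Cmod_sum _ _ _) _.
apply: (Rle_trans _ (\Rsum_(0 <= i < L) B)).
  apply: Rsum_le => i _; set M := (K0 * 2 ^ i)%N.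
  have hM : (K0 <= M)%N by rewrite leq_pmulr // expn_gt0.
  case: (leqP M y) => hMy; last first.
    rewrite big_nat_cond big1 ?Cmod_0 // => k /andP[hk _]; rewrite /G' ifF //; lia.
  have -> : \Csum_(M <= k < 2 * M) G' k = \Csum_(M <= k < minn (2 * M) y.+1) G k.
    have hm : (minn (2 * M) y.+1 <= 2 * M)%N by lia.
    rewrite [RHS](big_nat_widen _ _ _ _ _ hm) [RHS]big_mkcond; apply: eq_big_nat => k hk.
    by rewrite /G'; congr (if _ then _ else _); lia.
  by apply: (h M) => //; lia.
rewrite Rsum_const_nat subn0; apply: Rmult_le_compat_r => //.
by rewrite /L S_INR; have := trunc_log_le y0; lra.
Qed.

Lemma sum_blocks_from (F : nat -> C) (L B E J : nat) : (L <= E)%N ->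
  \Csum_(L <= n < minn (L + J * B) E) F n =
  \Csum_(0 <= j < J) \Csum_(minn (L + j * B) E <= n < minn (L + j.+1 * B) E) F n.
Proof.
move=> LE; elim: J => [|J IH].
  by rewrite mul0n addn0 !big_geq //; lia.
rewrite big_nat_recr //= -IH (big_cat_nat (n := minn (L + J * B) E)) //=; rewrite ?leq_min; nia.
Qed.

(** The inner variable is cut into blocks of length [B] before Cauchy-Schwarz over [m] and over the
    blocks, so that only pairs [k1, k2] of one block are correlated. A short block keeps [k1 - k2],
    and thereby the frequency of the correlation, small. *)
Lemma type2_cauchy (F : nat -> C) (M L B x : nat) (a b : nat -> R) (W : nat -> nat -> R) (V : R) :
  (0 < L)%N -> (0 < B)%N -> (forall m, Rabs (a m) <= 1) -> (forall m, Rabs (b m) <= 1) ->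
  (forall k1 k2 c, (L <= k1 < 2 * L)%N -> (L <= k2 < 2 * L)%N -> (c <= 2 * M)%N ->
     Cmod (\Csum_(M <= m < c) (F (m * k1)%N * Cconj (F (m * k2)%N))) <= W k1 k2) ->
  (forall j, \Rsum_(minn (L + j * B) (2 * L) <= k1 < minn (L + j.+1 * B) (2 * L))
      \Rsum_(minn (L + j * B) (2 * L) <= k2 < minn (L + j.+1 * B) (2 * L)) W k1 k2 <= V) ->
  Cmod (\Csum_(M <= m < 2 * M) \Csum_(L <= k < 2 * L | (m * k <= x)%N)
     (RtoC (a m * b k) * F (m * k)%N)) ^ 2 <= INR M * INR (L %/ B).+1 ^ 2 * V.
Proof.
move=> L0 B0 ha hb hW hV.
pose J := (L %/ B).+1.
have hJ : (L < J * B)%N by rewrite ltn_ceil.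
pose lo j := minn (L + j * B) (2 * L).
pose G m k := if (m * k <= x)%N then (RtoC (b k) * F (m * k)%N)%C else RtoC 0.
pose s m j := \Csum_(lo j <= k < lo j.+1) G m k.
have hS : \Csum_(M <= m < 2 * M) \Csum_(L <= k < 2 * L | (m * k <= x)%N)
     (RtoC (a m * b k) * F (m * k)%N) =
   \Csum_(M <= m < 2 * M) (RtoC (a m) * \Csum_(0 <= j < J) s m j).
  apply: eq_bigr => m _.
  rewrite -(@sum_blocks_from (G m) L B (2 * L) J); last lia.
  have -> : minn (L + J * B) (2 * L) = (2 * L)%N by lia.
  rewrite Csum_mull big_mkcond; apply: eq_bigr => k _; rewrite /G.
  by case: ifP => _; [rewrite RtoC_mult; ring | ring].
rewrite hS.
have hMM : INR (2 * M - M) = INR M by congr INR; lia.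
have h1 : Cmod (\Csum_(M <= m < 2 * M) (RtoC (a m) * \Csum_(0 <= j < J) s m j)) ^ 2 <=
   INR M * \Rsum_(M <= m < 2 * M) (INR J * \Rsum_(0 <= j < J) Cmod (s m j) ^ 2).
  apply: Rle_trans (Cauchy_1 _ _ _) _; rewrite hMM; apply: Rmult_le_compat_l; first exact: pos_INR.
  apply: Rsum_le => m _; rewrite Cmod_mult Cmod_R Rpow_mult_distr.
  have h2 := Cauchy_1 0 J (s m); rewrite subn0 in h2.
  have h3 : Rabs (a m) ^ 2 <= 1 by have := ha m; have := Rabs_pos (a m); nra.
  have h4 : 0 <= Cmod (\Csum_(0 <= j < J) s m j) ^ 2 by apply: pow2_ge_0.
  have h5 : 0 <= Rabs (a m) ^ 2 by apply: pow2_ge_0.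
  by nra.
apply: Rle_trans h1 _; rewrite [X in _ <= X]Rmult_assoc; apply: Rmult_le_compat_l; first exact: pos_INR.
rewrite -Rsum_mull exchange_big.
have -> : INR J ^ 2 * V = INR J * (INR (J - 0) * V) by rewrite subn0; ring.
apply: Rmult_le_compat_l; first exact: pos_INR.
rewrite -Rsum_const_nat; apply: Rsum_le => j _.
apply: Rle_trans (hV j); rewrite -/(lo j) -/(lo j.+1).
have hsq : \Rsum_(M <= m < 2 * M) Cmod (s m j) ^ 2 =
   Re (\Csum_(lo j <= k1 < lo j.+1) \Csum_(lo j <= k2 < lo j.+1) \Csum_(M <= m < 2 * M) (G m k1 * Cconj (G m k2))).
  transitivity (Re (RtoC (\Rsum_(M <= m < 2 * M) Cmod (s m j) ^ 2))) => //.
  congr Re; rewrite Csum_RtoC; under eq_bigr => m _ do rewrite Cmod_sqr_sum.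
  by rewrite exchange_big /=; apply: eq_bigr => k1 _; rewrite exchange_big.
rewrite hsq; apply: Rle_trans (Rle_abs _) _; apply: Rle_trans (re_le_Cmod _) _.
apply: Rle_trans (Cmod_sum _ _ _) _; apply: Rsum_le_nat => k1 hk1 _.
apply: Rle_trans (Cmod_sum _ _ _) _; apply: Rsum_le_nat => k2 hk2 _.
have hk1' : (L <= k1 < 2 * L)%N by move: hk1; rewrite /lo; lia.
have hk2' : (L <= k2 < 2 * L)%N by move: hk2; rewrite /lo; lia.
(* The two conditions [m k1 <= x] and [m k2 <= x] merge into one upper limit for [m]. *)
pose c := minn (2 * M) (x %/ maxn k1 k2).+1.
have hc : (c <= 2 * M)%N by rewrite /c; lia.
have -> : \Csum_(M <= m < 2 * M) (G m k1 * Cconj (G m k2)) =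
   (RtoC (b k1 * b k2) * \Csum_(M <= m < c) (F (m * k1)%N * Cconj (F (m * k2)%N)))%C.
  rewrite (big_nat_widen _ _ _ _ _ hc) Csum_mull [RHS]big_mkcond; apply: eq_big_nat => m hm.
  have hcond : (m < c)%N = ((m * k1 <= x) && (m * k2 <= x))%N.
    rewrite /c leq_min ltnS leq_divRL; last by lia.
    have -> : (m < 2 * M)%N by lia.
    by rewrite /= maxnMr geq_max.
  rewrite hcond /G; case: (m * k1 <= x)%N; case: (m * k2 <= x)%N => /=.
  - by rewrite Cmult_conj Cconj_RtoC RtoC_mult; ring.
  - by rewrite Cconj_RtoC; ring.
  - by ring.
  - by ring.
rewrite Cmod_mult Cmod_R Rabs_mult.
have h2 := hW k1 k2 c hk1' hk2' hc; set z := Cmod _ in h2 *.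
have z0 : 0 <= z by apply: Cmod_ge_0.
have h3 : Rabs (b k1) * Rabs (b k2) <= 1.
  rewrite -[X in _ <= X]Rmult_1_r; apply: Rmult_le_compat; try exact: Rabs_pos; exact: hb.
have h4 : 0 <= Rabs (b k1) * Rabs (b k2) by apply: Rmult_le_pos; exact: Rabs_pos.
nra.
Qed.

Lemma pw_absorb (K a b : R) : a < b -> exists N1, (0 < N1)%N /\
  forall N, (N1 <= N)%N -> K * INR N `^ a <= INR N `^ b.
Proof.
move=> ab; pose K1 := Rmax K 1.
have hK1 : 1 <= K1 by apply: Rmax_r.
have [n hn] := nfloorP (x := K1 `^ (/ (b - a))) ltac:(exact: pw_ge0).
exists n.+1; split => // N hN.
have h1 : K1 `^ (/ (b - a)) <= INR N by have := INR_le hN; rewrite S_INR; lra.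
have h2 : K1 <= INR N `^ (b - a).
  rewrite -[X in X <= _](_ : (K1 `^ (/ (b - a))) `^ (b - a) = K1).
    by apply: pw_base; last lra; split; [exact: pw_gt0 | ].
  by rewrite pw_pw Rinv_l ?pw_1; lra.
have -> : INR N `^ b = INR N `^ (b - a) * INR N `^ a by rewrite -pw_add; congr Rpower; ring.
apply: Rmult_le_compat_r; first exact: pw_ge0.
by apply: Rle_trans h2; exact: Rmax_l.
Qed.

Lemma nfloor_pw N s : (0 < N)%N -> 0 <= s -> exists n : nat,
  [/\ (0 < n)%N, INR n <= INR N `^ s & INR N `^ s <= 2 * INR n].
Proof.
move=> N0 s0; have h1 := pw_ge1 (INR_ge1 N0) s0.
have [n [hn1 hn2]] := nfloorP (x := INR N `^ s) ltac:(lra).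
have n0 : (0 < n)%N by case: (n) hn2 => //=; lra.
by exists n; split => //; have := INR_ge1 n0; lra.
Qed.

Lemma ln_le_ln x y : (0 < x)%N -> INR x <= y -> ln (INR x) <= ln y.
Proof. by move=> x0 h; apply: ln_le => //; exact: INR_gt0. Qed.

Lemma pos_ln n : (0 < n)%N -> 0 <= ln (INR n).
Proof. by move=> n0; rewrite -ln_1; apply: ln_le; [lra | exact: INR_ge1]. Qed.

(* [one_step] with [Rn] of size [z^rho]; the loss [z^w] comes from the size of [c]. *)
Lemma one_step_pw (g : R) (rho w ta : R) : 0 < g < 1 -> 0 <= w -> 0 < rho <= 1 -> 2 * ta < rho - w ->
  exists N1, (0 < N1)%N /\
  forall (N : nat) (al c : R) (M a b : nat), (N1 <= N)%N -> 0 < c ->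
  INR N `^ rho <= INR M -> (M <= a)%N -> (b <= 2 * M)%N ->
  c * INR N `^ rho * INR M `^ (g - 2) <= 1 / 2 ->
  INR M `^ (1 - g) / c <= 4 * INR N `^ w ->
  Cmod (\Csum_(a <= n < b) e (al * INR n + c * INR n `^ g)) <= INR M * INR N `^ (- ta).
Proof.
move=> hg w0 hrho hta; have [K [K0 hK]] := one_step hg.
pose s := (rho - w - 2 * ta) / 2; have s0 : 0 < s by rewrite /s; lra.
have [KL [KL0 hKL]] := ln2N_le s0.
have [N1 [N10 hN1]] := @pw_absorb (2 * K * (1 + 4 * KL)) (w + s - rho) (- (2 * ta)) ltac:(rewrite /s; lra).
exists N1; split => // N al c M a b hN c0 hM Ma bM hcond hc.
have N0 : (0 < N)%N by lia.
have hz := INR_ge1 N0.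
have [Rn [R0 hR1 hR2]] := nfloor_pw N0 (Rlt_le _ _ (proj1 hrho)).
have RM : (Rn <= M)%N by apply: le_of_INR; lra.
have hMpos : 0 < INR M by have := INR_ge1 R0; lra.
have hR := INR_ge1 R0.
have := hK al c M Rn a b c0 ltac:(apply/andP; split => //) Ma bM.
set S := Cmod _ => h.
have {}h := h (Rle_trans _ _ _ (Rmult_le_compat_r _ _ _ (pw_ge0 _ _) (Rmult_le_compat_l _ _ _ (Rlt_le _ _ c0) hR1)) hcond).
have hl0 := pos_ln R0.
have hlR : 1 + ln (INR Rn) <= KL * INR N `^ s.
  apply: Rle_trans (hKL N N0); apply: Rplus_le_compat_l; apply: ln_le_ln => //.
  apply: Rle_trans hR1 _; apply: (Rle_trans _ (INR N `^ 1)); first by apply: pw_le; lra.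
  by rewrite pw_1; lra.
have hz1 : 1 <= INR N `^ (w + s) by apply: pw_ge1; lra.
have h2 : (S / INR M) ^ 2 <= (INR N `^ (- ta)) ^ 2.
  apply: Rle_trans h _.
  have -> : (INR N `^ (- ta)) ^ 2 = INR N `^ (- (2 * ta)) by rewrite pw_pow; congr Rpower; rewrite /=; ring.
  apply: Rle_trans (hN1 N hN).
  have hM0 : 0 <= INR M `^ (1 - g) / c by apply: Rdiv_le_0_compat => //; exact: pw_ge0.
  have h3 : INR M `^ (1 - g) * (1 + ln (INR Rn)) / c <= 4 * KL * INR N `^ (w + s).
    have -> : INR M `^ (1 - g) * (1 + ln (INR Rn)) / c = (INR M `^ (1 - g) / c) * (1 + ln (INR Rn)) by field; lra.
    have -> : 4 * KL * INR N `^ (w + s) = (4 * INR N `^ w) * (KL * INR N `^ s) by rewrite pw_add; ring.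
    by apply: Rmult_le_compat => //; lra.
  have h4 : K / INR Rn <= 2 * K * INR N `^ (- rho).
    rewrite pw_opp; apply: Rdiv_le_r; first lra.
    have hp := pw_gt0 (INR N) rho.
    have -> : 2 * K * / INR N `^ rho * INR Rn = K * ((2 * INR Rn) / INR N `^ rho) by field; lra.
    have : 1 <= (2 * INR Rn) / INR N `^ rho.
      by apply: (Rmult_le_reg_r (INR N `^ rho)) => //; rewrite /Rdiv Rmult_assoc Rinv_l; lra.
    by nra.
  have h5 : 1 + INR M `^ (1 - g) * (1 + ln (INR Rn)) / c <= (1 + 4 * KL) * INR N `^ (w + s) by lra.
  apply: (Rle_trans _ ((2 * K * INR N `^ (- rho)) * ((1 + 4 * KL) * INR N `^ (w + s)))).
    apply: Rmult_le_compat => //; first by apply: Rdiv_le_0_compat; lra.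
    suff : 0 <= INR M `^ (1 - g) * (1 + ln (INR Rn)) / c by lra.
    by apply: Rdiv_le_0_compat => //; apply: Rmult_le_pos; [exact: pw_ge0 | lra].
  right; have -> : w + s - rho = - rho + (w + s) by ring.
  by rewrite (pw_add _ (- rho)); ring.
have h3 : S / INR M <= INR N `^ (- ta).
  apply: Rsqr_incr_0_var; last exact: pw_ge0.
  by rewrite /Rsqr; lra.
have -> : S = INR M * (S / INR M) by field; lra.
by apply: Rmult_le_compat_l; lra.
Qed.

(** * Sums over primes with phase [al p + h p^g] *)

Section PrimeExpSum.

Variable g : R.
Hypothesis hg : 973 / 1000 <= g < 1.

(** Ranges of [k] below N^(94/100) / r are counted trivially; in the dyadic ranges above them
    [M >= N^(69/100)], and differencing with shifts up to N^(1/4) saves N^(6/100). The exponent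
    27/1000 is the bound for [1 - g]. *)
Lemma typeI_pw : exists K N1, 0 < K /\ (0 < N1)%N /\ forall (N : nat) (al h : R) (r y : nat),
  (N1 <= N)%N -> 1 <= h <= INR N `^ (85 / 1000) -> (0 < r)%N -> INR r <= INR N `^ (1 / 4) ->
  (r * y <= N)%N ->
  Cmod (\Csum_(1 <= k < y.+1) e (al * INR (r * k) + h * INR (r * k) `^ g)) <=
  K * INR N `^ (941 / 1000) / INR r.
Proof.
have [N1 [N10 hN1]] := @one_step_pw g (1 / 4) (27 / 1000) (6 / 100) ltac:(lra) ltac:(lra) ltac:(lra) ltac:(lra).
have [N2 [N20 hN2]] := @pw_absorb 2 (- (45 / 1000)) 0 ltac:(lra).
have [KL [KL0 hKL]] := ln2N_le (s := 1 / 1000) ltac:(lra).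
exists (4 * KL), (maxn N1 N2); split; first lra.
split=> [|N al h r y hN hh r0 hr ry]; first by lia.
have N0 : (0 < N)%N by lia.
have hz := INR_ge1 N0; have hr1 := INR_ge1 r0.
have {}hN2 := hN2 N ltac:(lia); rewrite pw_0 in hN2.
set z := INR N in hh hr hN2 hz *.
pose Q := z / INR r.
have hQ : z `^ (3 / 4) <= Q.
  apply: (Rmult_le_reg_r (INR r)); first lra.
  have -> : Q * INR r = z by rewrite /Q; field; lra.
  apply: (Rle_trans _ (z `^ (3 / 4) * z `^ (1 / 4))).
    by apply: Rmult_le_compat_l => //; exact: pw_ge0.
  by rewrite -pw_add (_ : 3 / 4 + 1 / 4 = 1) ?pw_1; lra.
have Q0 : 0 < Q by apply: Rlt_le_trans hQ; exact: pw_gt0.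
pose q := Q * z `^ (- (6 / 100)).
have hq : z `^ (69 / 100) <= q.
  have -> : 69 / 100 = 3 / 4 + - (6 / 100) by field.
  by rewrite pw_add; apply: Rmult_le_compat_r => //; exact: pw_ge0.
have hq1 : 1 <= q by apply: Rle_trans hq; apply: pw_ge1; lra.
have [K0' [hK1 hK2]] := nfloorP (x := q) ltac:(lra).
pose K0 := K0'.+1.
have hK0 : q <= INR K0 <= 2 * q by rewrite /K0 S_INR; lra.
have qz : q * z `^ (1 / 1000) = z `^ (941 / 1000) / INR r.
  have -> : z `^ (941 / 1000) = z * (z `^ (- (6 / 100)) * z `^ (1 / 1000)).
    rewrite -{2}(pw_1 (x := z)); last lra.
    by rewrite -!pw_add; congr Rpower; field.
  by rewrite /q /Q; field; lra.
have hL := hKL N N0; rewrite -/z in hL.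
have hl2 := ln2_bounds.
have hlz : 0 <= ln z by rewrite /z; exact: pos_ln.
have hLz : 1 + ln z <= KL * z `^ (1 / 1000).
  by move: hL; rewrite ln_mult; lra.
case: (posnP y) => y0.
  rewrite y0 big_geq // Cmod_0; apply: Rdiv_le_0_compat; last lra.
  by apply: Rmult_le_pos; [lra | exact: pw_ge0].
have hyQ : INR y <= Q.
  apply: (Rmult_le_reg_r (INR r)); first lra.
  have -> : Q * INR r = z by rewrite /Q; field; lra.
  by rewrite -mult_INR; apply: INR_le; rewrite mulnC in ry; lia.
apply: Rle_trans (@dyadic_sum _ K0 y q isT y0 ltac:(lra) _ _) _.
- by move=> n; rewrite Cmod_e; lra.
- move=> M a b hM My Ma bM.
  have hMq : q <= INR M by apply: Rle_trans (proj1 hK0) _; exact: INR_le.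
  have hM0 : 0 < INR M by lra.
  have hMQ : INR M <= Q by apply: Rle_trans hyQ; exact: INR_le.
  pose c := h * INR r `^ g.
  have hrg : 1 <= INR r `^ g by apply: pw_ge1; lra.
  have hc1 : 1 <= c by rewrite /c; nra.
  have -> : \Csum_(a <= k < b) e (al * INR (r * k) + h * INR (r * k) `^ g) =
     \Csum_(a <= k < b) e (al * INR r * INR k + c * INR k `^ g).
    apply: eq_big_nat => k hk; have k0 : 0 < INR k by apply: INR_gt0; have := INR_gt0; lia.
    by rewrite mult_INR pw_mulb; [congr e; rewrite /c; ring | lra | lra].
  have hrM : INR r * INR M <= z.
    apply: (Rle_trans _ (INR r * Q)); first by apply: Rmult_le_compat_l; lra.
    by right; rewrite /Q; field; lra.
  apply: (Rle_trans _ (INR M * z `^ (- (6 / 100)))); last first.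
    by rewrite /q; apply: Rmult_le_compat_r => //; exact: pw_ge0.
  apply: (hN1 N _ c M a b) => //.
  - by lia.
  - by lra.
  - by rewrite -/z; apply: Rle_trans hMq; apply: Rle_trans hq; apply: pw_le; lra.
  (* Exponents: 85/1000 for [h], at most 1 for (r M)^g, 1/4 for the shifts and -138/100 for M^(-2),
     in all -45/1000. *)
  - apply: (Rle_trans _ (z `^ (- (45 / 1000)))); last by lra.
    have e1 : c * INR M `^ g <= z `^ (85 / 1000) * z.
      rewrite /c Rmult_assoc -pw_mulb; try lra.
      apply: Rmult_le_compat; [lra | exact: pw_ge0 | lra | ].
      apply: (Rle_trans _ (z `^ g)); first by apply: pw_base; [split; [nra | lra] | lra].
      by rewrite -[X in _ <= X](pw_1 (x := z)); [apply: pw_le; lra | lra].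
    have e2 : INR M `^ (- (2)) <= z `^ (- (138 / 100)).
      apply: (Rle_trans _ ((z `^ (69 / 100)) `^ (- (2)))).
        by apply: pw_baseN; [split; [exact: pw_gt0 | lra] | lra].
      by rewrite pw_pw; apply: pw_le; lra.
    have -> : c * INR N `^ (1 / 4) * INR M `^ (g - 2) = (c * INR M `^ g) * (z `^ (1 / 4) * INR M `^ (- (2))).
      by have -> : g - 2 = g + - (2) by [ring]; rewrite pw_add /z; ring.
    apply: (Rle_trans _ ((z `^ (85 / 1000) * z) * (z `^ (1 / 4) * z `^ (- (138 / 100))))).
      apply: Rmult_le_compat => //.
      + by apply: Rmult_le_pos; [lra | exact: pw_ge0].
      + by apply: Rmult_le_pos; exact: pw_ge0.
      + by apply: Rmult_le_compat_l => //; exact: pw_ge0.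
    have -> : z `^ (85 / 1000) * z = z `^ (1085 / 1000).
      by rewrite -{2}(pw_1 (x := z)) -?pw_add; [congr Rpower; field | lra].
    by rewrite -!pw_add; apply: pw_le; lra.
  - have e1 : INR M `^ (1 - g) <= z `^ (27 / 1000).
      apply: (Rle_trans _ (z `^ (1 - g))); last by apply: pw_le; lra.
      by apply: pw_base; [split; [lra | nra] | lra].
    apply: Rdiv_le_r; first lra.
    have : 0 <= z `^ (27 / 1000) by exact: pw_ge0.
    by rewrite -/z; nra.
have hly : ln (INR y) <= ln z.
  apply: ln_le_ln => //; apply: INR_le; nia.
have hq2 : (2 * ln (INR y) + 1) * q <= (2 * ln z + 1) * q by apply: Rmult_le_compat_r; lra.
have -> : 4 * KL * z `^ (941 / 1000) / INR r = 4 * KL * (z `^ (941 / 1000) / INR r) by rewrite /Rdiv; ring.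
rewrite -qz.
have h1 : (1 + ln z) * q <= KL * (q * z `^ (1 / 1000)) by nra.
nra.
Qed.

Lemma pw_sub_bounds k1 k2 : (0 < k2)%N -> (k2 < k1)%N ->
  g * INR (k1 - k2) * INR k1 `^ (g - 1) <= INR k1 `^ g - INR k2 `^ g <= INR (k1 - k2).
Proof.
move=> k0 hk; have h2 := INR_ge1 k0.
have [xi [h3 h4]] := dif_pw [:: (k1 - k2)%N] g (x := INR k2) ltac:(lra).
have hk' : INR k2 + INR (k1 - k2) = INR k1 by rewrite -plus_INR; congr INR; lia.
have hd := pos_INR (k1 - k2).
move: h3 h4; rewrite /= /pw addn0 hk' => h3 ->.
have -> : INR (k1 - k2) * 1 * (g * 1) * xi `^ (g - 1) = INR (k1 - k2) * (g * xi `^ (g - 1)) by ring.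
have -> : g * INR (k1 - k2) * INR k1 `^ (g - 1) = INR (k1 - k2) * (g * INR k1 `^ (g - 1)) by ring.
split; first by (apply: Rmult_le_compat_l => //; apply: Rmult_le_compat_l; [lra | apply: pw_baseN; lra]).
rewrite -[X in _ <= X]Rmult_1_r; apply: Rmult_le_compat_l => //.
have := @pw_le1 xi (g - 1) ltac:(lra) ltac:(lra); have := pw_ge0 xi (g - 1); nra.
Qed.

(** A correlation of two rows is again a linear phase plus [cc m^g] with [cc = h (k1^g - k2^g)]. The
    mean value theorem bounds [cc] below by [g k1^(g - 1)], and the block length [U] bounds it
    above; these are the two size conditions of [one_step_pw]. With shifts N^(26/100) the second one
    reads 85/1000 + 125/1000 + 260/1000 < 475/1000. *)
Lemma typeII_corr : exists N1, (0 < N1)%N /\ forall (N : nat) (al h : R) (U M L k1 k2 c : nat),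
  (N1 <= N)%N -> 1 <= h <= INR N `^ (85 / 1000) -> INR U <= INR N `^ (1 / 8) ->
  INR N `^ (475 / 1000) <= INR M -> (0 < L)%N -> (M * L <= N)%N ->
  (L <= k2)%N -> (k2 < k1)%N -> (k1 < 2 * L)%N -> (k1 < k2 + U)%N -> (c <= 2 * M)%N ->
  Cmod (\Csum_(M <= m < c) (e (al * INR (m * k1) + h * INR (m * k1) `^ g) *
     Cconj (e (al * INR (m * k2) + h * INR (m * k2) `^ g)))) <= INR M * INR N `^ (- (115 / 1000)).
Proof.
have [N1 [N10 hN1]] := @one_step_pw g (26 / 100) (27 / 1000) (115 / 1000) ltac:(lra) ltac:(lra) ltac:(lra) ltac:(lra).
have [N2 [N20 hN2]] := @pw_absorb 2 (- (5 / 1000)) 0 ltac:(lra).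
exists (maxn N1 N2); split => [|N al h U M L k1 k2 c hN hh hU hM L0 hML h1 h2 h3 h4 hc]; first lia.
have N0 : (0 < N)%N by lia.
have hz := INR_ge1 N0.
have {}hN2 := hN2 N ltac:(lia); rewrite pw_0 in hN2.
have hM1 : 1 <= INR M by apply: Rle_trans hM; apply: pw_ge1; lra.
have hk1 : 1 <= INR k1 by apply: INR_ge1; lia.
have hk2 : 1 <= INR k2 by apply: INR_ge1; lia.
pose cc := h * (INR k1 `^ g - INR k2 `^ g).
have [b1 b2] := @pw_sub_bounds k1 k2 ltac:(lia) h2.
have hd1 : 1 <= INR (k1 - k2) by apply: INR_ge1; lia.
have hdU : INR (k1 - k2) <= INR N `^ (1 / 8) by apply: Rle_trans hU; apply: INR_le; lia.
have hk1p := pw_gt0 (INR k1) (g - 1).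
have hlow : g * INR k1 `^ (g - 1) <= INR k1 `^ g - INR k2 `^ g.
  apply: Rle_trans b1; rewrite -[X in X * _ <= _]Rmult_1_r.
  by apply: Rmult_le_compat_r; [lra | apply: Rmult_le_compat_l; lra].
have hlow0 : 0 < g * INR k1 `^ (g - 1) by apply: Rmult_lt_0_compat; lra.
have hcc : 0 < cc by rewrite /cc; apply: Rmult_lt_0_compat; lra.
have -> : \Csum_(M <= m < c) (e (al * INR (m * k1) + h * INR (m * k1) `^ g) *
     Cconj (e (al * INR (m * k2) + h * INR (m * k2) `^ g))) =
   \Csum_(M <= m < c) e (al * (INR k1 - INR k2) * INR m + cc * INR m `^ g).
  apply: eq_big_nat => m hm; rewrite e_conj -e_add; congr e.
  have hm1 : INR M <= INR m by apply: INR_le; lia.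
  rewrite !mult_INR !pw_mulb; try lra.
  by rewrite /cc; ring.
apply: (hN1 N _ cc M M c) => //; first by lia.
- by apply: Rle_trans hM; apply: pw_le; lra.
- apply: (Rle_trans _ (INR N `^ (- (5 / 1000)))); last by lra.
  have hcc2 : cc <= INR N `^ (85 / 1000) * INR N `^ (1 / 8).
    by rewrite /cc; apply: Rmult_le_compat; lra.
  have hMg : INR M `^ (g - 2) <= INR N `^ (- (475 / 1000)).
    apply: (Rle_trans _ (INR M `^ (- (1)))); first by apply: pw_le; lra.
    have -> : - (475 / 1000) = 475 / 1000 * - (1) by ring.
    by rewrite -pw_pw; apply: pw_baseN; [split; [exact: pw_gt0 | ] | lra].
  apply: (Rle_trans _ ((INR N `^ (85 / 1000) * INR N `^ (1 / 8)) * INR N `^ (26 / 100) * INR N `^ (- (475 / 1000)))).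
    apply: Rmult_le_compat => //; try exact: pw_ge0.
      by apply: Rmult_le_pos; [lra | exact: pw_ge0].
    by apply: Rmult_le_compat_r => //; exact: pw_ge0.
  by rewrite -!pw_add; apply: pw_le; lra.
- have hcl : g * INR k1 `^ (g - 1) <= cc.
    rewrite /cc; apply: (Rle_trans _ _ _ hlow).
    have hD0 : 0 < INR k1 `^ g - INR k2 `^ g by lra.
    by have [hh1 _] := hh; nra.
  apply: Rdiv_le_r => //.
  apply: (Rle_trans _ (4 * INR N `^ (27 / 1000) * (g * INR k1 `^ (g - 1)))); last first.
    by apply: Rmult_le_compat_l => //; apply: Rmult_le_pos; [lra | exact: pw_ge0].
  have e1 : INR M `^ (1 - g) * INR k1 `^ (1 - g) <= 2 * INR N `^ (27 / 1000).
    rewrite -pw_mulb; try lra.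
    apply: (Rle_trans _ ((2 * INR N) `^ (1 - g))).
      apply: pw_base; last lra; split; first by apply: Rmult_lt_0_compat; lra.
      rewrite -mult_INR; change 2 with (INR 2); rewrite -mult_INR; apply: INR_le; nia.
    rewrite pw_mulb; try lra.
    apply: Rmult_le_compat; try exact: pw_ge0; last by apply: pw_le; lra.
    by rewrite -[X in _ <= X](pw_1 (x := 2)); [apply: pw_le; lra | lra].
  have e2 : INR k1 `^ (1 - g) * INR k1 `^ (g - 1) = 1.
    by rewrite -pw_add (_ : 1 - g + (g - 1) = 0) ?pw_0 //; ring.
  have -> : INR M `^ (1 - g) = INR M `^ (1 - g) * INR k1 `^ (1 - g) * INR k1 `^ (g - 1).
    by rewrite Rmult_assoc e2; ring.
  have -> : 4 * INR N `^ (27 / 1000) * (g * INR k1 `^ (g - 1)) = (4 * g * INR N `^ (27 / 1000)) * INR k1 `^ (g - 1) by ring.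
  apply: Rmult_le_compat_r; first lra.
  by have := pw_ge0 (INR N) (27 / 1000); nra.
Qed.

(** [type2_cauchy] with blocks of length [U]: in the square the diagonal pairs save 1 / U, about
    N^(-1/8), and the other pairs N^(-115/1000). Both beat N^(-1/10), whose square root is the
    saving. *)
Lemma typeII_pw : exists N1, (0 < N1)%N /\ forall (N : nat) (al h : R) (U M L x : nat) (a b : nat -> R),
  (N1 <= N)%N -> 1 <= h <= INR N `^ (85 / 1000) ->
  (0 < U)%N -> INR U <= INR N `^ (1 / 8) -> INR N `^ (1 / 8) <= 2 * INR U ->
  (U < L)%N -> (L <= M)%N -> (M * L <= x)%N -> (x <= N)%N ->
  (forall m, Rabs (a m) <= 1) -> (forall m, Rabs (b m) <= 1) ->
  Cmod (\Csum_(M <= m < 2 * M) \Csum_(L <= k < 2 * L | (m * k <= x)%N)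
     (RtoC (a m * b k) * e (al * INR (m * k) + h * INR (m * k) `^ g))) <= 4 * INR N `^ (95 / 100).
Proof.
have [N1 [N10 hN1]] := typeII_corr.
exists N1; split => // N al h U M L x a b hN hh U0 hU1 hU2 UL LM MLx xN ha hb.
have N0 : (0 < N)%N by lia.
have hz := INR_ge1 N0.
have hp95 := pw_ge0 (INR N) (95 / 100).
pose F n := e (al * INR n + h * INR n `^ g).
(* Small boxes are bounded by their number of points; in the others the longer side [M] is at least
   N^(475/1000), as [typeII_corr] requires. *)
case: (Rle_dec (INR (M * L)) (INR N `^ (95 / 100))) => hML.
  apply: Rle_trans (Cmod_sum _ _ _) _.
  apply: (Rle_trans _ (\Rsum_(M <= m < 2 * M) INR L)).
    apply: Rsum_le => m _.
    have -> : INR L = INR (2 * L - L) * 1 by rewrite Rmult_1_r; congr INR; lia.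
    apply: Cmod_sum_const => [|k hk _]; first lra.
    rewrite Cmod_mult Cmod_e Cmod_R Rabs_mult Rmult_1_r -[X in _ <= X]Rmult_1_r.
    by apply: Rmult_le_compat; try exact: Rabs_pos.
  rewrite Rsum_const_nat.
  have -> : (2 * M - M = M)%N by lia.
  by rewrite mult_INR in hML; lra.
have L0 : (0 < L)%N by lia.
have hM : INR N `^ (475 / 1000) <= INR M.
  apply: Rsqr_incr_0_var; last exact: pos_INR.
  rewrite /Rsqr -pw_add (_ : 475 / 1000 + 475 / 1000 = 95 / 100); last by field.
  apply: (Rle_trans _ (INR (M * L))); first lra.
  by rewrite -mult_INR; apply: INR_le; nia.
have hM0 : 0 <= INR M by exact: pos_INR.
set de := INR N `^ (- (115 / 1000)).
have hde : 0 < de by exact: pw_gt0.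
have hF1 n : Cmod (F n) <= 1 by rewrite Cmod_e; lra.
pose W k1 k2 := if (0 < ndist k1 k2 < U)%N then INR M * de else INR M.
pose V := INR U * (INR M + INR U * (INR M * de)).
have hW k1 k2 c : (L <= k1 < 2 * L)%N -> (L <= k2 < 2 * L)%N -> (c <= 2 * M)%N ->
     Cmod (\Csum_(M <= m < c) (F (m * k1)%N * Cconj (F (m * k2)%N))) <= W k1 k2.
  move=> hk1 hk2 hc; rewrite /W; case: ifP => hd; last first.
    apply: Rle_trans (Cmod_sum_le_count (G := fun m => (F (m * k1)%N * Cconj (F (m * k2)%N))%C) _ _ _ _) _.
      by move=> n; rewrite Cmod_mult Cmod_conj !Cmod_e; lra.
    by apply: INR_le; lia.
  case: (ltnP k2 k1) => hk.
    by apply: (hN1 N al h U M L k1 k2 c) => //; move: hd; rewrite /ndist; lia.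
  rewrite -Cmod_conj Csum_conj.
  have -> : \Csum_(M <= m < c) Cconj (F (m * k1)%N * Cconj (F (m * k2)%N)) =
            \Csum_(M <= m < c) (F (m * k2)%N * Cconj (F (m * k1)%N)).
    by apply: eq_bigr => m _; rewrite Cmult_conj Cconj_conj Cmult_comm.
  by apply: (hN1 N al h U M L k2 k1 c) => //; move: hd; rewrite /ndist; lia.
have hV j : \Rsum_(minn (L + j * U) (2 * L) <= k1 < minn (L + j.+1 * U) (2 * L))
      \Rsum_(minn (L + j * U) (2 * L) <= k2 < minn (L + j.+1 * U) (2 * L)) W k1 k2 <= V.
  set lo := minn (L + j * U) _; set hi := minn _ _.
  have hlh : (hi - lo <= U)%N by rewrite /hi /lo; nia.
  have hlh' := INR_le hlh.
  have hMde : 0 <= INR M * de by apply: Rmult_le_pos; lra.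
  have hUU := pos_INR U.
  apply: (Rle_trans _ (INR (hi - lo) * (INR M + INR U * (INR M * de)))); last first.
    by apply: Rmult_le_compat_r => //; nra.
  rewrite -Rsum_const_nat; apply: Rsum_le_nat => k1 hk1 _.
  rewrite (bigD1_seq k1) ?mem_index_iota ?iota_uniq //=.
  apply: Rplus_le_compat.
    by rewrite /W /ndist ifF; [lra | lia].
  apply: (Rle_trans _ (INR (hi - lo) * (INR M * de))); last by apply: Rmult_le_compat_r.
  apply: Rsum_le_const_nat => // k2 hk2 hne.
  by rewrite /W ifT; [lra | rewrite /ndist; lia].
have := type2_cauchy (F := F) x L0 U0 ha hb hW hV.
set S := Cmod _ => hS.
have hU0 := INR_ge1 U0.
have hJ : INR (L %/ U).+1 * INR U <= 2 * INR L.
  have -> : 2 * INR L = INR (2 * L) by rewrite mult_INR /=; ring.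
  rewrite -mult_INR; apply: INR_le; rewrite multE mulSn.
  by have := leq_trunc_div L U; lia.
have hJ0 := pos_INR (L %/ U).+1.
have hML2 : INR M * INR L <= INR N by rewrite -mult_INR; apply: INR_le; lia.
have hLp := pos_INR L.
have hiU : / INR U <= 2 * INR N `^ (- (125 / 1000)).
  have hp := pw_gt0 (INR N) (1 / 8).
  rewrite (_ : - (125 / 1000) = - (1 / 8)); last by field.
  rewrite pw_opp; apply: (Rmult_le_reg_r (INR U * INR N `^ (1 / 8))); first by apply: Rmult_lt_0_compat; lra.
  have -> : / INR U * (INR U * INR N `^ (1 / 8)) = INR N `^ (1 / 8) by field; lra.
  have -> : 2 * / INR N `^ (1 / 8) * (INR U * INR N `^ (1 / 8)) = 2 * INR U by field; lra.
  lra.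
have hS2 : S ^ 2 <= (4 * INR N `^ (95 / 100)) ^ 2.
  apply: Rle_trans hS _; rewrite /V.
  set J := INR (L %/ U).+1 in hJ hJ0 *.
  have -> : INR M * J ^ 2 * (INR U * (INR M + INR U * (INR M * de))) =
    INR M ^ 2 * ((J * INR U) ^ 2) * (/ INR U + de) by field; lra.
  have e1 : (J * INR U) ^ 2 <= (2 * INR L) ^ 2 by apply: pow_incr; split => //; apply: Rmult_le_pos; lra.
  have e2 : INR M ^ 2 * ((J * INR U) ^ 2) <= 4 * INR N ^ 2.
    apply: (Rle_trans _ (INR M ^ 2 * (2 * INR L) ^ 2)).
      by apply: Rmult_le_compat_l => //; apply: pow2_ge_0.
    have -> : INR M ^ 2 * (2 * INR L) ^ 2 = 4 * (INR M * INR L) ^ 2 by ring.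
    apply: Rmult_le_compat_l; first lra.
    by apply: pow_incr; split => //; apply: Rmult_le_pos.
  have e3 : / INR U + de <= 3 * INR N `^ (- (1 / 10)).
    have a1 : INR N `^ (- (125 / 1000)) <= INR N `^ (- (1 / 10)) by apply: pw_le; lra.
    have a2 : de <= INR N `^ (- (1 / 10)) by apply: pw_le; lra.
    lra.
  have e4 : 0 <= INR M ^ 2 * ((J * INR U) ^ 2) by apply: Rmult_le_pos; apply: pow2_ge_0.
  have e5 : 0 <= / INR U + de.
    by have : 0 < / INR U by [apply: Rinv_0_lt_compat; lra]; lra.
  apply: (Rle_trans _ ((4 * INR N ^ 2) * (3 * INR N `^ (- (1 / 10))))).
    exact: Rmult_le_compat.
  have -> : (4 * INR N `^ (95 / 100)) ^ 2 = 16 * (INR N ^ 2 * INR N `^ (- (1 / 10))).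
    have -> : INR N ^ 2 = INR N `^ (INR 2) by rewrite pw_nat //; lra.
    rewrite Rpow_mult_distr pw_pow -pw_add.
    by congr (_ * Rpower _ _); [ring | rewrite /=; field].
  have : 0 <= INR N ^ 2 * INR N `^ (- (1 / 10)) by apply: Rmult_le_pos; [apply: pow2_ge_0 | exact: pw_ge0].
  by nra.
apply: Rsqr_incr_0_var; last by lra.
by rewrite /Rsqr; lra.
Qed.

Lemma prime_exp_sum : exists K, 0 < K /\ forall (N : nat) (al h : R) (x : nat),
  (0 < N)%N -> 1 <= h <= INR N `^ (85 / 1000) -> (x <= N)%N ->
  Cmod (\Csum_(1 <= p < x.+1 | prime p) e (al * INR p + h * INR p `^ g)) <= K * INR N `^ (951 / 1000).
Proof.
have [K1 [N1 [K10 [N10 hI]]]] := typeI_pw.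
have [N2 [N20 hII]] := typeII_pw.
have [KV [KV0 hV]] := vaughan_bound (ep := 1 / 1000) ltac:(lra).
have [KL [KL0 hKL]] := ln2N_le (s := 1 / 1000) ltac:(lra).
pose Nm := maxn N1 N2.
exists (INR Nm + KV * (K1 * KL + 6)); split.
  have : 0 <= INR Nm by exact: pos_INR.
  have : 0 < KV * (K1 * KL + 6) by apply: Rmult_lt_0_compat => //; nra.
  lra.
move=> N al h x N0 hh xN; have hz := INR_ge1 N0.
have hp := pw_ge1 (a := 951 / 1000) hz ltac:(lra).
have hNm := pos_INR Nm.
have hKK : 0 < KV * (K1 * KL + 6) by apply: Rmult_lt_0_compat => //; nra.
case: (leqP Nm N) => hN; last first.
  apply: Rle_trans (Cmod_sum_le_count _ _ _ _) _; first by move=> n; rewrite Cmod_e; lra.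
  have : INR (x.+1 - 1) <= INR Nm by apply: INR_le; lia.
  by nra.
(* The moduli of type I reach [U^2 <= N^(1/4)], the limit in [typeI_pw], and [U] serves as block
   length in [typeII_pw]. *)
have [U [U0 hU1 hU2]] := nfloor_pw (s := 1 / 8) N0 ltac:(lra).
pose t r := K1 * INR N `^ (941 / 1000) * / INR r.
have hU4 r : (r <= U * U)%N -> INR r <= INR N `^ (1 / 4).
  move=> hr; apply: (Rle_trans _ (INR (U * U))); first exact: INR_le.
  rewrite mult_INR (_ : 1 / 4 = 1 / 8 + 1 / 8); last field.
  by rewrite pw_add; apply: Rmult_le_compat => //; exact: pos_INR.
have hT1 : \Rsum_(1 <= r < (U * U).+1) t r <= K1 * KL * INR N `^ (95 / 100).
  rewrite -Rsum_mull.
  have h1 := harmonic_le (R := (U * U)%N) ltac:(nia).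
  have h2 : 1 + ln (INR (U * U)) <= KL * INR N `^ (1 / 1000).
    apply: Rle_trans (hKL N N0); apply: Rplus_le_compat_l; apply: ln_le_ln; first nia.
    apply: Rle_trans (hU4 _ (leqnn _)) _.
    have : INR N `^ (1 / 4) <= INR N `^ 1 by apply: pw_le; lra.
    by rewrite pw_1; lra.
  apply: (Rle_trans _ (K1 * INR N `^ (941 / 1000) * (KL * INR N `^ (1 / 1000)))).
    by apply: Rmult_le_compat_l; [apply: Rmult_le_pos; [lra | exact: pw_ge0] | lra].
  have -> : K1 * INR N `^ (941 / 1000) * (KL * INR N `^ (1 / 1000)) = K1 * KL * INR N `^ (942 / 1000).
    have -> : 942 / 1000 = 941 / 1000 + 1 / 1000 by field.
    by rewrite pw_add; ring.
  by apply: Rmult_le_compat_l; [nra | apply: pw_le; lra].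
have := hV N U (fun n => e (al * INR n + h * INR n `^ g)) t _ (4 * INR N `^ (95 / 100)) U0 N0
  (fun n => Req_le _ _ (Cmod_e _)) ltac:(have := pw_ge0 (INR N) (95 / 100); lra) _ hT1 _ x xN.
move=> H; apply: Rle_trans (H _ _) _.
- move=> r y hr hry; apply: hI => //; try lia.
  by apply: hU4; lia.
- move=> M L x' a b h1 h2 h3 h4 h5 h6; apply: (hII N al h U M L x' a b) => //; lia.
have e1 : INR U <= INR N `^ (95 / 100) by apply: Rle_trans hU1 _; apply: pw_le; lra.
have e2 : sqrt (INR N) <= INR N `^ (95 / 100) by rewrite sqrt_pw; [apply: pw_le; lra | lra].
have -> : (INR Nm + KV * (K1 * KL + 6)) * INR N `^ (951 / 1000) =
  INR Nm * INR N `^ (951 / 1000) + KV * INR N `^ (1 / 1000) * ((K1 * KL + 6) * INR N `^ (95 / 100)).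
  have -> : 951 / 1000 = 1 / 1000 + 95 / 100 by field.
  by rewrite pw_add; ring.
have : 0 <= INR Nm * INR N `^ (951 / 1000) by apply: Rmult_le_pos; lra.
have : KV * INR N `^ (1 / 1000) * (K1 * KL * INR N `^ (95 / 100) + 4 * INR N `^ (95 / 100) + INR U + sqrt (INR N)) <=
  KV * INR N `^ (1 / 1000) * ((K1 * KL + 6) * INR N `^ (95 / 100)).
  by apply: Rmult_le_compat_l; [apply: Rmult_le_pos; [lra | exact: pw_ge0] | lra].
lra.
Qed.

End PrimeExpSum.

Lemma pow_le_reg n x y : 0 <= y -> x ^ n.+1 <= y ^ n.+1 -> x <= y.
Proof.
move=> y0 h; case: (Rle_dec x y) => // hxy.
have hlt k : y ^ k.+1 < x ^ k.+1.
  elim: k => [|k IH]; first by rewrite !pow_1; lra.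
  rewrite -(tech_pow_Rmult y) -(tech_pow_Rmult x).
  have : 0 <= y ^ k.+1 by apply: pow_le.
  by nra.
by have := hlt n; lra.
Qed.

Lemma int_exp_sum (g : R) : 973 / 1000 <= g < 1 -> exists K, 0 < K /\
  forall (N : nat) (h : R) (E : nat), (0 < N)%N -> 1 <= h <= INR N `^ (85 / 1000) ->
  (0 < E <= N.+1)%N ->
  Cmod (\Csum_(1 <= n < E) e (h * INR n `^ g)) <= K * INR N `^ (951 / 1000).
Proof.
move=> hg; have [K [N1 [K0 [N10 hI]]]] := typeI_pw hg.
exists (INR N1 + K); split; first by have := pos_INR N1; lra.
move=> N h E N0 hh hE; have hz := INR_ge1 N0.
have hp := pw_ge1 (a := 951 / 1000) hz ltac:(lra).
have hN1 := pos_INR N1.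
case: (leqP N1 N) => hN; last first.
  apply: Rle_trans (Cmod_sum_le_count _ _ _ _) _; first by move=> n; rewrite Cmod_e; lra.
  have : INR (E - 1) <= INR N1 by apply: INR_le; lia.
  by nra.
case: E hE => [|y] hE; first by lia.
have := hI N 0 h 1%N y hN hh isT _ _.
have -> : \Csum_(1 <= k < y.+1) e (0 * INR (1 * k) + h * INR (1 * k) `^ g) = \Csum_(1 <= k < y.+1) e (h * INR k `^ g).
  by apply: eq_bigr => k _; rewrite mul1n; congr e; ring.
move=> H; apply: Rle_trans (H _ _) _.
- by apply: pw_ge1; lra.
- by lia.
have h1 : INR N `^ (941 / 1000) <= INR N `^ (951 / 1000) by apply: pw_le; lra.
have -> : K * INR N `^ (941 / 1000) / INR 1 = K * INR N `^ (941 / 1000) by rewrite [INR 1]/=; field.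
nra.
Qed.

Lemma Cmod_conj_sum (G : nat -> C) (P : pred nat) a b :
  Cmod (\Csum_(a <= n < b | P n) Cconj (G n)) = Cmod (\Csum_(a <= n < b | P n) G n).
Proof. by rewrite -Csum_conj Cmod_conj. Qed.

(** The conditions are those of [ps_power]: 49/1000 is the saving in [prime_exp_sum], and 85/1000
    the exponent of its range of [h]. For [g = 1] the weights equal 1 and the sum vanishes. *)
Lemma ps_prime_sum (g de : R) : 973 / 1000 <= g <= 1 -> 0 < de -> 1 - g + 2 * de < 49 / 1000 ->
  3 * (1 - g + de) < 85 / 1000 -> exists K, 0 < K /\
  forall (N : nat) (al : R) (x : nat), (0 < N)%N -> (x <= N)%N ->
  Cmod (\Csum_(1 <= p < x.+1 | prime p) (RtoC (psw g p - 1) * e (al * INR p))) <= K * INR N `^ (1 - de).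
Proof.
move=> hg de0 h1 h2; case: (Req_dec g 1) => g1.
  exists 1; split; first lra.
  move=> N al x N0 xN; rewrite big_nat_cond big1.
    by rewrite Cmod_0 Rmult_1_l; exact: pw_ge0.
  by move=> p /andP[hp _]; rewrite g1 psw_1 ?Rminus_diag; [ring | lia].
have [K1 [K10 hK1]] := @prime_exp_sum g ltac:(lra).
have [K2 [K20 hK2]] := @int_exp_sum g ltac:(lra).
have [K [K0 hK]] := @ps_power g de (49 / 1000) (85 / 1000) (K1 + K2) ltac:(lra) de0 h1 h2 ltac:(lra) ltac:(lra).
exists K; split => // N al x N0 xN.
pose c n := if prime n then e (al * INR n) else RtoC 0.
have -> : \Csum_(1 <= p < x.+1 | prime p) (RtoC (psw g p - 1) * e (al * INR p)) =
   \Csum_(1 <= n < x.+1) (c n * RtoC (psw g n - 1)).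
  rewrite big_mkcond; apply: eq_bigr => n _; rewrite /c; case: ifP => _; ring.
have hp := pw_ge0 (INR N) (951 / 1000).
have e1 : 1 - 49 / 1000 = 951 / 1000 by field.
apply: (hK N c N0) => [n hn|E d hE d0 hd|]; last lia.
  by rewrite /c; case: ifP => _; rewrite ?Cmod_e ?Cmod_0; lra.
have hd1 : 1 <= INR d <= INR N `^ (85 / 1000) by split => //; exact: INR_ge1.
case: E hE => [|E] hE; first lia.
rewrite e1; split.
- have -> : \Csum_(1 <= n < E.+1) (c n * e (INR d * INR n `^ g)) =
     \Csum_(1 <= p < E.+1 | prime p) e (al * INR p + INR d * INR p `^ g).
    rewrite [RHS]big_mkcond; apply: eq_bigr => n _; rewrite /c; case: ifP => _; last by ring.
    by rewrite -e_add.
  by have := hK1 N al (INR d) E N0 hd1 ltac:(lia); nra.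
- have -> : \Csum_(1 <= n < E.+1) (c n * e (- (INR d * INR n `^ g))) =
     \Csum_(1 <= p < E.+1 | prime p) Cconj (e (- al * INR p + INR d * INR p `^ g)).
    rewrite [RHS]big_mkcond; apply: eq_bigr => n _; rewrite /c; case: ifP => _; last by ring.
    by rewrite e_conj -e_add; congr e; ring.
  by rewrite Cmod_conj_sum; have := hK1 N (- al) (INR d) E N0 hd1 ltac:(lia); nra.
- by have := hK2 N (INR d) E.+1 N0 hd1 hE; nra.
Qed.

(** Over all integers differencing alone suffices, with shifts up to N^(9/10) in dyadic ranges
    [M >= N^(94/100)]. The smallness condition reads 105/1000 + 27/10 - 282/100 < 0, and the eighth
    power gains the exponent 9/10 - 23/100, more than the 8 * 6/100 needed. *)
Lemma cube_exp_sum (g : R) : 973 / 1000 <= g < 1 -> exists K, 0 < K /\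
  forall (N : nat) (al h : R) (E : nat), (0 < N)%N -> 1 <= h <= INR N `^ (105 / 1000) ->
  (0 < E <= N.+1)%N ->
  Cmod (\Csum_(1 <= n < E) e (al * INR n ^ 3 + h * INR n `^ g)) <= K * INR N `^ (945 / 1000).
Proof.
move=> hg; have [K [K0 hK]] := @three_step g ltac:(lra).
have [KL [KL0 hKL]] := ln2N_le (s := 1 / 1000) ltac:(lra).
have [N1 [N10 hN1]] := @pw_absorb (2 * K * (1 + 4 * KL ^ 3)) (- (6 / 10)) (- (6 / 100 * 8)) ltac:(lra).
have [N2 [N20 hN2]] := @pw_absorb 4 (- (15 / 1000)) 0 ltac:(lra).
pose Nm := maxn N1 N2.
exists (INR Nm + 2 + 2 * KL); split; first by have := pos_INR Nm; lra.
move=> N al h E N0 hh hE; have hz := INR_ge1 N0.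
have hp := pw_ge1 (a := 945 / 1000) hz ltac:(lra).
have hNm := pos_INR Nm.
case: (leqP Nm N) => hN; last first.
  apply: Rle_trans (Cmod_sum_le_count _ _ _ _) _; first by move=> n; rewrite Cmod_e; lra.
  have : INR (E - 1) <= INR Nm by apply: INR_le; lia.
  by nra.
have {}hN1 := hN1 N ltac:(lia); have {}hN2 := hN2 N ltac:(lia); rewrite pw_0 in hN2.
case: E hE => [|y] hE; first by lia.
case: (posnP y) => y0.
  by rewrite y0 big_geq // Cmod_0; apply: Rmult_le_pos; lra.
have [K0' [hK01 hK02]] := nfloorP (x := INR N `^ (94 / 100)) ltac:(exact: pw_ge0).
pose M0 := K0'.+1.
have hq1 : 1 <= INR N `^ (94 / 100) by apply: pw_ge1; lra.
have hM0 : INR N `^ (94 / 100) <= INR M0 <= 2 * INR N `^ (94 / 100) by rewrite /M0 S_INR; lra.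
have [Rn [R0 hR1 hR2]] := nfloor_pw (s := 9 / 10) N0 ltac:(lra).
have hR := INR_ge1 R0; have hlR := pos_ln R0.
have hlz : 0 <= ln (INR N) by exact: pos_ln.
have hLz : 1 + ln (INR N) <= KL * INR N `^ (1 / 1000).
  by have := hKL N N0; have := ln2_bounds; rewrite ln_mult; lra.
have hRN : INR Rn <= INR N.
  apply: Rle_trans hR1 _; have : INR N `^ (9 / 10) <= INR N `^ 1 by apply: pw_le; lra.
  by rewrite pw_1; lra.
apply: Rle_trans (@dyadic_sum _ M0 y (INR N `^ (94 / 100)) isT y0 ltac:(lra) _ _) _.
- by move=> n; rewrite Cmod_e; lra.
- move=> M a b hM My Ma bM.
  have hMq : INR N `^ (94 / 100) <= INR M by apply: Rle_trans (proj1 hM0) _; exact: INR_le.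
  have hMN : INR M <= INR N by apply: INR_le; lia.
  have hMpos : 0 < INR M by lra.
  have RM : (Rn <= M)%N.
    by apply: le_of_INR; apply: Rle_trans hR1 _; apply: Rle_trans hMq; apply: pw_le; lra.
  have := hK al h M Rn a b ltac:(lra) ltac:(apply/andP; split => //) Ma bM.
  set S := Cmod _ => H.
  have hcond : h * INR Rn ^ 3 * INR M `^ (g - 4) <= 1 / 4.
    apply: (Rle_trans _ (INR N `^ (- (15 / 1000)))); last lra.
    have e1 : INR Rn ^ 3 <= INR N `^ (27 / 10).
      have -> : INR N `^ (27 / 10) = (INR N `^ (9 / 10)) ^ 3 by rewrite pw_pow; congr Rpower; rewrite /=; field.
      by apply: pow_incr; lra.
    have e2 : INR M `^ (g - 4) <= INR N `^ (- (282 / 100)).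
      apply: (Rle_trans _ (INR M `^ (- (3)))); first by apply: pw_le; lra.
      have -> : - (282 / 100) = 94 / 100 * - (3) by field.
      by rewrite -pw_pw; apply: pw_baseN; [split; [exact: pw_gt0 | ] | lra].
    apply: (Rle_trans _ (INR N `^ (105 / 1000) * INR N `^ (27 / 10) * INR N `^ (- (282 / 100)))).
      apply: Rmult_le_compat => //; try exact: pw_ge0.
        by apply: Rmult_le_pos; [lra | apply: pow_le; lra].
      by apply: Rmult_le_compat; try lra; apply: pow_le; lra.
    by rewrite -!pw_add; apply: pw_le; lra.
  have {}H := H hcond.
  have hM3 : INR M `^ (3 - g) <= INR N `^ (2027 / 1000).
    apply: (Rle_trans _ (INR N `^ (3 - g))); last by apply: pw_le; lra.
    by apply: pw_base; lra.
  have hL3 : (1 + ln (INR Rn)) ^ 3 <= KL ^ 3 * INR N `^ (3 / 1000).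
    have -> : KL ^ 3 * INR N `^ (3 / 1000) = (KL * INR N `^ (1 / 1000)) ^ 3.
      by rewrite Rpow_mult_distr pw_pow; congr (_ * Rpower _ _); rewrite /=; field.
    apply: pow_incr; split; first lra.
    by apply: Rle_trans hLz; apply: Rplus_le_compat_l; apply: ln_le_ln.
  have hiR : / INR Rn <= 2 * INR N `^ (- (9 / 10)).
    have hpp := pw_gt0 (INR N) (9 / 10).
    rewrite pw_opp; apply: (Rmult_le_reg_r (INR Rn * INR N `^ (9 / 10))); first by apply: Rmult_lt_0_compat; lra.
    have -> : / INR Rn * (INR Rn * INR N `^ (9 / 10)) = INR N `^ (9 / 10) by field; lra.
    have -> : 2 * / INR N `^ (9 / 10) * (INR Rn * INR N `^ (9 / 10)) = 2 * INR Rn by field; lra.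
    lra.
  have hiR0 : 0 < / INR Rn by apply: Rinv_0_lt_compat; lra.
  have hiR2 : / INR Rn ^ 2 <= 4 * INR N `^ (- (18 / 10)).
    rewrite -pow_inv; have -> : 4 * INR N `^ (- (18 / 10)) = (2 * INR N `^ (- (9 / 10))) ^ 2.
      by rewrite Rpow_mult_distr pw_pow; congr (_ * Rpower _ _); [ring | rewrite /=; field].
    by apply: pow_incr; lra.
  have hpp := pw_ge1 (a := 23 / 100) hz ltac:(lra).
  have hih : / h <= 1 by rewrite -[X in _ <= X]Rinv_1; apply: Rinv_le_contravar; lra.
  have hih0 : 0 < / h by apply: Rinv_0_lt_compat; lra.
  have hZ : INR M `^ (3 - g) * (1 + ln (INR Rn)) ^ 3 / (h * INR Rn ^ 2) <= 4 * KL ^ 3 * INR N `^ (23 / 100).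
    rewrite /Rdiv Rinv_mult.
    apply: (Rle_trans _ ((INR N `^ (2027 / 1000) * (KL ^ 3 * INR N `^ (3 / 1000))) * (1 * (4 * INR N `^ (- (18 / 10)))))).
      apply: Rmult_le_compat.
      - by apply: Rmult_le_pos; [exact: pw_ge0 | apply: pow_le; lra].
      - by apply: Rmult_le_pos; [lra | left; apply: Rinv_0_lt_compat; apply: pow_lt; lra].
      - by apply: Rmult_le_compat => //; [exact: pw_ge0 | apply: pow_le; lra].
      - by apply: Rmult_le_compat => //; [lra | left; apply: Rinv_0_lt_compat; apply: pow_lt; lra].
    have -> : (INR N `^ (2027 / 1000) * (KL ^ 3 * INR N `^ (3 / 1000))) * (1 * (4 * INR N `^ (- (18 / 10)))) =
      4 * KL ^ 3 * (INR N `^ (2027 / 1000) * INR N `^ (3 / 1000) * INR N `^ (- (18 / 10))) by ring.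
    apply: Rmult_le_compat_l; first by apply: Rmult_le_pos; [lra | apply: pow_le; lra].
    by rewrite -!pw_add; apply: pw_le; lra.
  have hKL3 : 0 <= KL ^ 3 by apply: pow_le; lra.
  have h8 : (S / INR M) ^ 8 <= (INR N `^ (- (6 / 100))) ^ 8.
    apply: Rle_trans H _.
    have -> : (INR N `^ (- (6 / 100))) ^ 8 = INR N `^ (- (6 / 100 * 8)) by rewrite pw_pow; congr Rpower; rewrite /=; field.
    apply: Rle_trans hN1.
    apply: (Rle_trans _ ((K * (2 * INR N `^ (- (9 / 10)))) * ((1 + 4 * KL ^ 3) * INR N `^ (23 / 100)))).
      apply: Rmult_le_compat.
      - by apply: Rdiv_le_0_compat; lra.
      - have : 0 <= INR M `^ (3 - g) * (1 + ln (INR Rn)) ^ 3 / (h * INR Rn ^ 2).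
          apply: Rdiv_le_0_compat; first by apply: Rmult_le_pos; [exact: pw_ge0 | apply: pow_le; lra].
          by apply: Rmult_lt_0_compat; [lra | apply: pow_lt; lra].
        lra.
      - by apply: Rmult_le_compat_l; lra.
      - lra.
    have -> : (K * (2 * INR N `^ (- (9 / 10)))) * ((1 + 4 * KL ^ 3) * INR N `^ (23 / 100)) =
       2 * K * (1 + 4 * KL ^ 3) * (INR N `^ (- (9 / 10)) * INR N `^ (23 / 100)) by ring.
    apply: Rmult_le_compat_l; first by apply: Rmult_le_pos; lra.
    by rewrite -pw_add; apply: pw_le; lra.
  have hSM : S / INR M <= INR N `^ (- (6 / 100)).
    by apply: (@pow_le_reg 7) => //; exact: pw_ge0.
  have -> : S = INR M * (S / INR M) by field; lra.
  apply: (Rle_trans _ (INR N * INR N `^ (- (6 / 100)))).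
    apply: Rmult_le_compat; try lra.
    by apply: Rdiv_le_0_compat => //; exact: Cmod_ge_0.
  by rewrite -{1}(pw_1 (x := INR N)) -?pw_add; [apply: pw_le; lra | lra].
have hly : ln (INR y) <= ln (INR N) by apply: ln_le_ln => //; apply: INR_le; lia.
have e2 : INR N `^ (945 / 1000) >= INR N `^ (1 / 1000) * INR N `^ (94 / 100).
  by rewrite -pw_add; apply: Rle_ge; apply: pw_le; lra.
have e3 : INR N `^ (94 / 100) <= INR N `^ (945 / 1000) by apply: pw_le; lra.
have e4 : (1 + ln (INR N)) * INR N `^ (94 / 100) <= KL * INR N `^ (1 / 1000) * INR N `^ (94 / 100).
  by apply: Rmult_le_compat_r => //; lra.
have e5 : (2 * ln (INR y) + 1) * INR N `^ (94 / 100) <= 2 * ((1 + ln (INR N)) * INR N `^ (94 / 100)).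
  by nra.
have e6 : KL * INR N `^ (1 / 1000) * INR N `^ (94 / 100) <= KL * INR N `^ (945 / 1000).
  by rewrite Rmult_assoc; apply: Rmult_le_compat_l; lra.
have e7 : 0 <= INR Nm * INR N `^ (945 / 1000) by apply: Rmult_le_pos; lra.
lra.
Qed.

(** The sum runs over all integers: it will compare the weighted cubic sum with the complete Weyl
    sum inside [bilinear_moment], where primality has already been dropped. The numbers 55/1000 and
    105/1000 come from [cube_exp_sum]. *)
Lemma ps_cube_sum (g de : R) : 973 / 1000 <= g <= 1 -> 0 < de -> 1 - g + 2 * de < 55 / 1000 ->
  3 * (1 - g + de) < 105 / 1000 -> exists K, 0 < K /\
  forall (N : nat) (al : R) (x : nat), (0 < N)%N -> (x <= N)%N ->
  Cmod (\Csum_(1 <= n < x.+1) (RtoC (psw g n - 1) * e (al * INR n ^ 3))) <= K * INR N `^ (1 - de).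
Proof.
move=> hg de0 h1 h2; case: (Req_dec g 1) => g1.
  exists 1; split; first lra.
  move=> N al x N0 xN; rewrite big_nat_cond big1.
    by rewrite Cmod_0 Rmult_1_l; exact: pw_ge0.
  by move=> p /andP[hp _]; rewrite g1 psw_1 ?Rminus_diag; [ring | lia].
have [K1 [K10 hK1]] := @cube_exp_sum g ltac:(lra).
have [K [K0 hK]] := @ps_power g de (55 / 1000) (105 / 1000) K1 ltac:(lra) de0 h1 h2 ltac:(lra) ltac:(lra).
exists K; split => // N al x N0 xN.
pose c n := e (al * INR n ^ 3).
have -> : \Csum_(1 <= p < x.+1) (RtoC (psw g p - 1) * e (al * INR p ^ 3)) =
   \Csum_(1 <= n < x.+1) (c n * RtoC (psw g n - 1)).
  by apply: eq_bigr => n _; rewrite /c; ring.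
have e1 : 1 - 55 / 1000 = 945 / 1000 by field.
apply: (hK N c N0) => [n hn|E d hE d0 hd|]; last lia.
  by rewrite /c Cmod_e; lra.
have hd1 : 1 <= INR d <= INR N `^ (105 / 1000) by split => //; exact: INR_ge1.
rewrite e1; split.
- have -> : \Csum_(1 <= n < E) (c n * e (INR d * INR n `^ g)) =
     \Csum_(1 <= n < E) e (al * INR n ^ 3 + INR d * INR n `^ g).
    by apply: eq_bigr => n _; rewrite /c -e_add.
  exact: hK1.
- have -> : \Csum_(1 <= n < E) (c n * e (- (INR d * INR n `^ g))) =
     \Csum_(1 <= n < E) Cconj (e (- al * INR n ^ 3 + INR d * INR n `^ g)).
    by apply: eq_bigr => n _; rewrite /c e_conj -e_add; congr e; ring.
  by rewrite Cmod_conj_sum; exact: hK1.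
- have -> : \Csum_(1 <= n < E) e (INR d * INR n `^ g) =
     \Csum_(1 <= n < E) e (0 * INR n ^ 3 + INR d * INR n `^ g).
    by apply: eq_bigr => n _; congr e; ring.
  exact: hK1.
Qed.

(** * The linear sum over primes on minor arcs *)

Lemma Rabs_IZR_ge1 (z : Z) : z <> 0%Z -> 1 <= Rabs (IZR z).
Proof. by move=> hz; rewrite -abs_IZR; apply: IZR_le; lia. Qed.

(** What the minor arc estimate retains of a rational approximation with denominator [q]: small
    multiples of [al] keep away from the integers. *)
Definition spaced (al : R) (q : nat) : Prop :=
  forall (d : nat) (z : Z), (0 < d)%N -> (2 * d <= q)%N -> / (2 * INR q) <= Rabs (al * INR d - IZR z).

(** [a d / q] is at distance at least 1 / q from the integers, and replacing it by [al d] moves it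
    by at most d / q^2 <= 1 / (2 q). *)
Lemma spaced_rational (al : R) (a : Z) (q : nat) : (0 < q)%N -> Z.gcd a (Z.of_nat q) = 1%Z ->
  Rabs (al - IZR a / INR q) <= / (INR q ^ 2) -> spaced al q.
Proof.
move=> q0 hcop hal d z d0 hd.
have hq := INR_ge1 q0; have hd1 := INR_ge1 d0.
have hdq : 2 * INR d <= INR q by rewrite -(mult_INR 2); apply: INR_le.
have hne : (a * Z.of_nat d - z * Z.of_nat q <> 0)%Z.
  move=> h.
  have hdiv : (Z.of_nat q | a * Z.of_nat d)%Z by exists z; lia.
  have hg : Z.gcd (Z.of_nat q) a = 1%Z by rewrite Z.gcd_comm.
  have := Z.gauss _ _ _ hdiv hg.
  by move/Z.divide_pos_le => /(_ ltac:(lia)); lia.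
have h1 := Rabs_IZR_ge1 hne.
rewrite minus_IZR !mult_IZR -!INR_IZR_INZ in h1.
have e1 : al * INR d - IZR z = (IZR a * INR d - IZR z * INR q) / INR q + (al - IZR a / INR q) * INR d by field; lra.
have h2 : Rabs ((al - IZR a / INR q) * INR d) <= / (2 * INR q).
  rewrite Rabs_mult (Rabs_pos_eq (INR d)); last lra.
  apply: (Rle_trans _ (/ (INR q ^ 2) * (INR q / 2))).
    by apply: Rmult_le_compat; [exact: Rabs_pos | lra | exact: hal | lra].
  by right; field; lra.
have h3 : / INR q <= Rabs ((IZR a * INR d - IZR z * INR q) / INR q).
  rewrite Rabs_div; last lra.
  rewrite (Rabs_pos_eq (INR q)); last lra.
  rewrite -[X in X <= _]Rmult_1_l; apply: Rmult_le_compat_r => //.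
  by left; apply: Rinv_0_lt_compat; lra.
have h4 := Rabs_triang_inv ((IZR a * INR d - IZR z * INR q) / INR q) (- ((al - IZR a / INR q) * INR d)).
rewrite Rabs_Ropp in h4.
have e2 : (IZR a * INR d - IZR z * INR q) / INR q - - ((al - IZR a / INR q) * INR d) = al * INR d - IZR z by rewrite e1; ring.
rewrite e2 in h4.
have e3 : / INR q = / (2 * INR q) + / (2 * INR q) by field; lra.
lra.
Qed.

(** * Sums of min(Y, 1 / |sin|) over well spaced points *)

Section Windows.

Variables (al be Y : R) (q : nat) (G : nat -> R).
Hypotheses (q0 : (0 < q)%N) (hsp : spaced al q) (Y0 : 0 <= Y).
Hypothesis G0 : forall m, 0 <= G m <= Y.
Hypothesis Gsin : forall m, G m * Rabs (sin (PI * (al * INR m + be))) <= 1.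

Let fr (m : nat) : R := al * INR m + be - IZR (Int_part (al * INR m + be)).

Lemma fr_bounds m : 0 <= fr m < 1.
Proof. by rewrite /fr; have := base_Int_part (al * INR m + be); lra. Qed.

Lemma sin_PI_addZ x (z : Z) : Rabs (sin (PI * (x + IZR z))) = Rabs (sin (PI * x)).
Proof.
have h k : Rabs (sin (PI * (x + INR k))) = Rabs (sin (PI * x)).
  elim: k => [|k IH]; first by rewrite Rplus_0_r.
  have -> : PI * (x + INR k.+1) = PI * (x + INR k) + PI by rewrite S_INR; ring.
  by rewrite neg_sin Rabs_Ropp.
have h' k y : Rabs (sin (PI * (y - INR k))) = Rabs (sin (PI * y)).
  elim: k y => [|k IH] y; first by rewrite Rminus_0_r.
  have -> : PI * (y - INR k.+1) = PI * ((y - 1) - INR k) by rewrite S_INR; ring.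
  rewrite IH -(Rabs_Ropp (sin (PI * (y - 1)))) -neg_sin; congr (Rabs (sin _)); ring.
case: z => [|p|p].
- by rewrite Rplus_0_r.
- by rewrite -positive_nat_Z -INR_IZR_INZ h.
- rewrite -Pos2Z.opp_pos opp_IZR -positive_nat_Z -INR_IZR_INZ; exact: h'.
Qed.

Let cell (m : nat) : nat := Z.to_nat (Int_part (2 * INR q * fr m)).

Lemma cellP m : INR (cell m) <= 2 * INR q * fr m < INR (cell m) + 1.
Proof.
have hq := INR_ge1 q0; have hf := fr_bounds m.
have [h1 h2] := base_Int_part (2 * INR q * fr m).
have hz : (0 <= Int_part (2 * INR q * fr m))%Z.
  have : (-1 < Int_part (2 * INR q * fr m))%Z.
    by apply: lt_IZR; have : 0 <= 2 * INR q * fr m; [nra | lra].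
  by lia.
have hc : INR (cell m) = IZR (Int_part (2 * INR q * fr m)) by rewrite /cell INR_IZR_INZ Z2Nat.id.
by rewrite hc; lra.
Qed.

Lemma cell_lt m : (cell m < 2 * q)%N.
Proof.
have hq := INR_ge1 q0; have hf := fr_bounds m; have hc := cellP m.
apply/ltP; apply: Stdlib.Reals.RIneq.INR_lt; rewrite mult_INR; change (INR 2) with 2; nra.
Qed.

Lemma cell_inj m m' : (m < m')%N -> (2 * (m' - m) <= q)%N -> cell m <> cell m'.
Proof.
move=> hm hd hc; have h1 := cellP m; have h2 := cellP m'; rewrite hc in h1.
have hq := INR_ge1 q0.
pose z1 := Int_part (al * INR m' + be); pose z2 := Int_part (al * INR m + be).
have h := hsp (d := (m' - m)%N) (z1 - z2)%Z ltac:(lia) hd.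
rewrite INRB in h; last lia.
rewrite minus_IZR in h.
have e1 : al * (INR m' - INR m) - (IZR z1 - IZR z2) = fr m' - fr m by rewrite /fr /z1 /z2; ring.
rewrite e1 in h.
have h3 : Rabs (fr m' - fr m) < / (2 * INR q).
  apply: (Rmult_lt_reg_l (2 * INR q)); first lra.
  rewrite Rinv_r; last lra.
  rewrite -(Rabs_pos_eq (2 * INR q)); last lra.
  rewrite -Rabs_mult.
  by apply: Rabs_def1; lra.
lra.
Qed.

(** Bound for [G] when the fractional part lies in the j-th of 2 q cells: its distance to the
    integers is then at least min(j, 2q - 1 - j) / (2q), and the inverse of a minimum is at most the
    sum of the inverses. The two cells touching an integer take the trivial bound [Y]. *)
Let bd (j : nat) : R :=
  if (j == 0%N) || (j == (2 * q).-1) then Y else 2 * INR q * (/ INR j + / INR ((2 * q).-1 - j)).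

Lemma bd_ge0 j : (j < 2 * q)%N -> 0 <= bd j.
Proof.
move=> hj; rewrite /bd; case: ifP => // h.
have hq := INR_ge1 q0.
have h1 : 0 < / INR j by apply: Rinv_0_lt_compat; apply: INR_gt0; lia.
have h2 : 0 < / INR ((2 * q).-1 - j) by apply: Rinv_0_lt_compat; apply: INR_gt0; lia.
by apply: Rmult_le_pos; lra.
Qed.

Lemma G_le_bd m : G m <= bd (cell m).
Proof.
rewrite /bd; case: ifP => h; first by case: (G0 m).
have hc := cellP m; have hl := cell_lt m; have hq := INR_ge1 q0.
have h1 : 0 < INR (cell m) by apply: INR_gt0; lia.
have h2 : 0 < INR ((2 * q).-1 - cell m) by apply: INR_gt0; lia.
have e1 : INR ((2 * q).-1 - cell m) + INR (cell m) + 1 = 2 * INR q.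
  by rewrite -plus_INR -S_INR; change 2 with (INR 2); rewrite -mult_INR; congr INR; lia.
have hs x y : 0 < x -> 0 < y -> x <= 2 * INR q * fr m -> y <= 2 * INR q * (1 - fr m) ->
    x + y <= 2 * INR q -> G m <= 2 * INR q * (/ x + / y).
  move=> x0 y0 hx hy hxy.
  pose g := Rmin (x / (2 * INR q)) (y / (2 * INR q)).
  have gx : g <= x / (2 * INR q) by exact: Rmin_l.
  have gy : g <= y / (2 * INR q) by exact: Rmin_r.
  have hgx : 0 < x / (2 * INR q) by apply: Rdiv_lt_0_compat; lra.
  have hgy : 0 < y / (2 * INR q) by apply: Rdiv_lt_0_compat; lra.
  have g0 : 0 < g by apply: Rmin_glb_lt.
  have hx' : x / (2 * INR q) <= fr m by apply: Rdiv_le_r; lra.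
  have hy' : y / (2 * INR q) <= 1 - fr m by apply: Rdiv_le_r; lra.
  have hsin : g <= sin (PI * fr m) by apply: sin_PI_ge; lra.
  have hGs := Gsin m.
  have efr : al * INR m + be = fr m + IZR (Int_part (al * INR m + be)) by rewrite /fr; ring.
  rewrite {1}efr sin_PI_addZ Rabs_pos_eq in hGs; last lra.
  have hG := G0 m.
  have hGg : G m * g <= 1 by nra.
  have hGi : G m <= / g.
    by apply: (Rmult_le_reg_r g) => //; rewrite Rinv_l; lra.
  apply: Rle_trans hGi _; rewrite Rmult_plus_distr_l.
  have i1 : / (x / (2 * INR q)) = 2 * INR q * / x by field; lra.
  have i2 : / (y / (2 * INR q)) = 2 * INR q * / y by field; lra.
  have p1 : 0 < / (x / (2 * INR q)) by apply: Rinv_0_lt_compat.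
  have p2 : 0 < / (y / (2 * INR q)) by apply: Rinv_0_lt_compat.
  by rewrite /g /Rmin; case: Rle_dec => _; lra.
by apply: hs => //; lra.
Qed.

Lemma sum_bd : \Rsum_(0 <= j < 2 * q) bd j <= 2 * Y + 4 * INR q * (1 + ln (2 * INR q)).
Proof.
have hq := INR_ge1 q0.
have e0 : (2 * q = (2 * q).-2.+2)%N by lia.
set n := (2 * q).-2 in e0.
have hlast : bd n.+1 = Y.
  by rewrite /bd (_ : n.+1 = (2 * q).-1) ?eqxx ?orbT //; lia.
rewrite e0 big_nat_recr //= big_ltn // hlast {1}/bd /=.
have hmid : \Rsum_(1 <= j < n.+1) bd j <= 4 * INR q * (1 + ln (2 * INR q)).
  have -> : \Rsum_(1 <= j < n.+1) bd j = \Rsum_(1 <= j < n.+1) (2 * INR q * (/ INR j + / INR (n.+1 - j))).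
    apply: eq_big_nat => j hj; rewrite /bd ifF; last by lia.
    by congr (_ * (_ + / INR _)); lia.
  rewrite -Rsum_mull big_split /=.
  have hrev : \Rsum_(1 <= j < n.+1) / INR (n.+1 - j) = \Rsum_(1 <= j < n.+1) / INR j.
    rewrite big_nat_rev /=; apply: eq_big_nat => j hj; congr (/ INR _); lia.
  rewrite hrev.
  have h := harmonic_lt (R := n.+1) isT.
  have h2 : ln (INR n.+1) <= ln (2 * INR q).
    by apply: ln_le_ln => //; change 2 with (INR 2); rewrite -mult_INR; apply: INR_le; lia.
  have h3 : \Rsum_(1 <= j < n.+1) / INR j <= 1 + ln (2 * INR q) by lra.
  have -> : 4 * INR q * (1 + ln (2 * INR q)) = 2 * INR q * ((1 + ln (2 * INR q)) + (1 + ln (2 * INR q))) by ring.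
  by apply: Rmult_le_compat_l; lra.
lra.
Qed.

(** By [cell_inj] the points of so short a window occupy distinct cells, so each cell bound is used
    at most once. *)
Lemma window_sum w W : (2 * W.-1 <= q)%N ->
  \Rsum_(w <= m < w + W) G m <= 2 * Y + 4 * INR q * (1 + ln (2 * INR q)).
Proof.
move=> hW; apply: Rle_trans sum_bd.
apply: (Rle_trans _ (\Rsum_(w <= m < w + W) \Rsum_(0 <= j < 2 * q) (if cell m == j then bd j else 0))).
  apply: Rsum_le_nat => m hm _.
  rewrite (bigD1_seq (cell m)) ?mem_index_iota ?iota_uniq ?cell_lt //= eqxx big1.
    by rewrite Rplus_0_r; exact: G_le_bd.
  by move=> j hj; rewrite ifF //; apply/negbTE; rewrite eq_sym.
rewrite exchange_big; apply: Rsum_le_nat => j hj _.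
have b0 : 0 <= bd j by apply: bd_ge0.
case: (boolP (has (fun m => cell m == j) (index_iota w (w + W)))) => [/hasP[m0 hm0 /eqP hc]|/hasPn hn].
  rewrite (bigD1_seq m0) ?iota_uniq //= hc eqxx big_seq_cond big1; first lra.
  move=> m /andP[hm hne]; case: eqP => // hcm.
  move: hm hm0; rewrite !mem_index_iota => hm hm0.
  case: (ltngtP m m0) => hmm.
  - by case: (@cell_inj m m0) => //; [lia | rewrite hc].
  - by case: (@cell_inj m0 m) => //; [lia | rewrite hc].
  - by move: hne; rewrite hmm eqxx.
rewrite big_seq_cond big1; first lra.
by move=> m /andP[/hn /negbTE -> _].
Qed.

Lemma windows_sum w K : (0 < K)%N ->
  \Rsum_(w <= m < w + K) G m <=
  (2 * INR K / INR q + 1) * (2 * Y + 4 * INR q * (1 + ln (2 * INR q))).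
Proof.
move=> K0; have hq := INR_ge1 q0.
pose W := (q %/ 2).+1.
have hW : (2 * W.-1 <= q)%N by rewrite /= mulnC leq_trunc_div.
have W0 : (0 < W)%N by [].
set X := 2 * Y + _.
have hX : 0 <= X.
  have : 0 <= ln (2 * INR q) by rewrite -ln_1; apply: ln_le; lra.
  by rewrite /X => h; apply: Rplus_le_le_0_compat; [lra | nra].
have key J : \Rsum_(w <= m < w + J * W) G m <= INR J * X.
  elim: J => [|J IH]; first by rewrite mul0n addn0 big_geq //= Rmult_0_l; lra.
  rewrite (big_cat_nat (n := (w + J * W)%N)) /=; try lia.
  have -> : (w + J.+1 * W = w + J * W + W)%N by lia.
  have h := window_sum (w + J * W) hW; rewrite -/X in h.
  by rewrite -/(INR J.+1) S_INR; lra.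
apply: (Rle_trans _ (\Rsum_(w <= m < w + (K %/ W).+1 * W) G m)).
  have hK : (w + K <= w + (K %/ W).+1 * W)%N by rewrite leq_add2l ltnW // ltn_ceil.
  rewrite [X in _ <= X](big_cat_nat (n := (w + K)%N)) //=; last by lia.
  have : 0 <= \Rsum_(w + K <= i < w + (K %/ W).+1 * W) G i by apply: Rsum_ge0 => i _; case: (G0 i).
  lra.
apply: (Rle_trans _ _ _ (key _)); apply: Rmult_le_compat_r => //.
rewrite S_INR; apply: Rplus_le_compat_r.
apply: (Rmult_le_reg_r (INR q)); first lra.
have -> : 2 * INR K / INR q * INR q = INR (2 * K) by rewrite mult_INR; change (INR 2) with 2; field; lra.
rewrite -mult_INR; apply: INR_le.
have h1 := leq_trunc_div K W.
have h2 : (q <= 2 * W)%N by have := ltn_ceil q (d := 2) isT; rewrite /W; lia.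
by nia.
Qed.

End Windows.

Lemma sin_PI_dist th g : 0 <= g <= 1 / 2 -> (forall z : Z, g <= Rabs (th - IZR z)) ->
  g <= Rabs (sin (PI * th)).
Proof.
move=> hg h; have [h1 h2] := base_Int_part th.
set n := Int_part th in h1 h2.
have a1 := h n; have a2 := h (n + 1)%Z; rewrite plus_IZR in a2.
rewrite Rabs_pos_eq in a1; last lra.
rewrite Rabs_left1 in a2; last lra.
have -> : th = (th - IZR n) + IZR n by ring.
rewrite sin_PI_addZ; apply: Rle_trans (Rle_abs _).
by apply: sin_PI_ge; lra.
Qed.

(** The minimum of [M] and 1 / s; the test is needed because [/ 0] is 0 rather than infinite. *)
Definition geom_cap (M s : R) : R := if Rlt_dec 0 s then Rmin M (/ s) else M.

Lemma geom_cap_bounds M s : 0 <= M -> 0 <= s -> 0 <= geom_cap M s <= M /\ geom_cap M s * s <= 1.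
Proof.
move=> M0 s0; rewrite /geom_cap; destruct (Rlt_dec 0 s) as [h|h] => /=; last first.
  by have -> : s = 0 by [lra]; lra.
have hs : 0 < / s by apply: Rinv_0_lt_compat.
split; first by split; [apply: Rmin_glb; lra | exact: Rmin_l].
apply: (Rle_trans _ (/ s * s)); last by rewrite Rinv_l; lra.
by apply: Rmult_le_compat_r; [lra | exact: Rmin_r].
Qed.

Lemma geom_cap_ge M s x : 0 <= s -> x <= M -> x * s <= 1 -> x <= geom_cap M s.
Proof.
move=> s0 xM xs; rewrite /geom_cap; destruct (Rlt_dec 0 s) as [h|h] => //=.
apply: Rmin_glb => //; apply: (Rmult_le_reg_r s) => //; rewrite Rinv_l; lra.
Qed.

(** Vaughan's method with [U] about N^(eta/4). In the square of a type II sum the quantities 1/q,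
    1/M, 1/L and q/(M L) are all O(N^(- eta/4)); a logarithm costs N^(eta/36), leaving N^(-2 eta/9),
    hence N^(- eta/9) for the sum itself. The factor N^(eta/90) of [vaughan_bound] reduces this to
    N^(- eta/10). *)
Lemma minor_arc_bound (eta : R) : 0 < eta <= 1 / 2 -> exists K, 0 < K /\
  forall (N q : nat) (al : R) (x : nat), (0 < N)%N -> (0 < q)%N -> spaced al q ->
  INR N `^ eta <= INR q <= INR N `^ (1 - eta) -> (x <= N)%N ->
  Cmod (\Csum_(1 <= p < x.+1 | prime p) e (al * INR p)) <= K * INR N `^ (1 - eta / 10).
Proof.
move=> heta.
have [KV [KV0 hV]] := vaughan_bound (ep := eta / 90) ltac:(lra).
have [KL [KL0 hKL]] := ln2N_le (s := eta / 36) ltac:(lra).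
have [N1 [N10 hN1]] := @pw_absorb 2 (eta / 2) eta ltac:(lra).
pose C2 := 112 * KL + 1.
exists (INR N1 + KV * (4 + C2)); split.
  have := pos_INR N1; have : 0 < KV * (4 + C2) by apply: Rmult_lt_0_compat; rewrite /C2; lra.
  lra.
move=> N q al x N0 q0 hsp hqN xN.
have hz := INR_ge1 N0; have hq := INR_ge1 q0.
have hp := pw_ge1 (a := 1 - eta / 10) hz ltac:(lra).
have hKK : 0 < KV * (4 + C2) by apply: Rmult_lt_0_compat; rewrite /C2; lra.
case: (leqP N1 N) => hN; last first.
  apply: Rle_trans (Cmod_sum_le_count _ _ _ _) _; first by move=> n; rewrite Cmod_e; lra.
  have : INR (x.+1 - 1) <= INR N1 by apply: INR_le; lia.
  by have := pos_INR N1; nra.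
have {}hN1 := hN1 N hN.
have [U [U0 hU1 hU2]] := nfloor_pw (s := eta / 4) N0 ltac:(lra).
have hUU r : (r <= U * U)%N -> INR r <= INR N `^ (eta / 2).
  move=> hr; apply: (Rle_trans _ (INR (U * U))); first exact: INR_le.
  rewrite mult_INR (_ : eta / 2 = eta / 4 + eta / 4); last field.
  by rewrite pw_add; apply: Rmult_le_compat => //; exact: pos_INR.
have hi2q : 0 <= / (2 * INR q) <= 1 / 2.
  split; first by left; apply: Rinv_0_lt_compat; lra.
  have -> : 1 / 2 = / (2 * 1) by field.
  by apply: Rinv_le_contravar; lra.
(* As [2 r <= 2 U^2 <= q], [spaced] keeps [al r] at distance 1 / (2 q) from the integers, and a
   geometric sum of any length is at most 2 q. *)
pose t (r : nat) := 2 * INR q.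
have tI r y : (0 < r <= U * U)%N -> (r * y <= N)%N ->
    Cmod (\Csum_(1 <= k < y.+1) e (al * INR (r * k))) <= t r.
  move=> hr hy.
  have hrq : (2 * r <= q)%N.
    apply: le_of_INR; rewrite mult_INR; change (INR 2) with 2.
    by have := hUU r ltac:(lia); lra.
  have hs : / (2 * INR q) <= Rabs (sin (PI * (al * INR r))).
    by apply: sin_PI_dist => // w; apply: hsp => //; lia.
  have := geom_bound (al * INR r) 1 y.+1.
  have -> : \Csum_(1 <= k < y.+1) e (INR k * (al * INR r)) = \Csum_(1 <= k < y.+1) e (al * INR (r * k)).
    by apply: eq_bigr => k _; rewrite mult_INR; congr e; ring.
  set S := Cmod _ => h.
  have S0 : 0 <= S by apply: Cmod_ge_0.
  have h2 : S * / (2 * INR q) <= 1 by nra.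
  apply: (Rmult_le_reg_r (/ (2 * INR q))); first by apply: Rinv_0_lt_compat; lra.
  by rewrite /t Rinv_r; lra.
have hT1 : \Rsum_(1 <= r < (U * U).+1) t r <= 2 * INR N `^ (1 - eta / 2).
  rewrite /t Rsum_const_nat.
  have -> : ((U * U).+1 - 1 = U * U)%N by lia.
  have h1 := hUU _ (leqnn (U * U)); have h2 := pos_INR (U * U).
  apply: (Rle_trans _ (INR N `^ (eta / 2) * (2 * INR N `^ (1 - eta)))).
    by apply: Rmult_le_compat; lra.
  have -> : INR N `^ (eta / 2) * (2 * INR N `^ (1 - eta)) = 2 * (INR N `^ (eta / 2) * INR N `^ (1 - eta)) by ring.
  by rewrite -pw_add; right; congr (_ * Rpower _ _); field.
pose T2 := C2 * INR N `^ (1 - eta / 9).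
have hC2 : 1 <= C2 by rewrite /C2; lra.
have hp9 := pw_ge0 (INR N) (1 - eta / 9).
have tII (M L x' : nat) (a b : nat -> R) : (U < L)%N -> (L <= M)%N ->
    (M * L <= x')%N -> (x' <= N)%N -> (forall m, Rabs (a m) <= 1) -> (forall m, Rabs (b m) <= 1) ->
    Cmod (\Csum_(M <= m < 2 * M) \Csum_(L <= k < 2 * L | (m * k <= x')%N)
     (RtoC (a m * b k) * e (al * INR (m * k)))) <= T2.
  move=> UL LM MLx xN' ha hb.
  case: (Rle_dec (INR (M * L)) (INR N `^ (1 - eta / 4))) => hML.
    apply: Rle_trans (Cmod_sum _ _ _) _.
    apply: (Rle_trans _ (\Rsum_(M <= m < 2 * M) INR L)).
      apply: Rsum_le => m _.
      have -> : INR L = INR (2 * L - L) * 1 by rewrite Rmult_1_r; congr INR; lia.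
      apply: Cmod_sum_const => [|k hk _]; first lra.
      rewrite Cmod_mult Cmod_e Cmod_R Rabs_mult Rmult_1_r -[X in _ <= X]Rmult_1_r.
      by apply: Rmult_le_compat; try exact: Rabs_pos.
    rewrite Rsum_const_nat.
    have -> : (2 * M - M = M)%N by lia.
    rewrite mult_INR in hML.
    have : INR N `^ (1 - eta / 4) <= INR N `^ (1 - eta / 9) by apply: pw_le; lra.
    by rewrite /T2; nra.
  have L0 : (0 < L)%N by lia.
  have hM := INR_ge1 (leq_trans L0 LM); have hL := INR_ge1 L0.
  pose F n := e (al * INR n).
  pose sn k1 k2 := Rabs (sin (PI * (al * INR k2 + - (al * INR k1)))).
  pose W (k1 k2 : nat) := geom_cap (INR M) (sn k1 k2).
  have sn0 k1 k2 : 0 <= sn k1 k2 by exact: Rabs_pos.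
  have hW k1 k2 c : (L <= k1 < 2 * L)%N -> (L <= k2 < 2 * L)%N -> (c <= 2 * M)%N ->
     Cmod (\Csum_(M <= m < c) (F (m * k1)%N * Cconj (F (m * k2)%N))) <= W k1 k2.
    move=> hk1 hk2 hc; apply: geom_cap_ge => //.
      apply: Rle_trans (Cmod_sum_le_count (G := fun m => (F (m * k1)%N * Cconj (F (m * k2)%N))%C) _ _ _ _) _.
        by move=> n; rewrite Cmod_mult Cmod_conj /F !Cmod_e; lra.
      by apply: INR_le; lia.
    have := geom_bound (- (al * INR k2 + - (al * INR k1))) M c.
    rewrite Ropp_mult_distr_r_reverse sin_neg Rabs_Ropp -/(sn k1 k2).
    suff -> : \Csum_(M <= k < c) e (INR k * - (al * INR k2 + - (al * INR k1))) =
      \Csum_(M <= m < c) (F (m * k1)%N * Cconj (F (m * k2)%N)) by [].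
    by apply: eq_bigr => m _; rewrite /F e_conj -e_add !mult_INR; congr e; ring.
  pose X := (2 * INR L / INR q + 1) * (2 * INR M + 4 * INR q * (1 + ln (2 * INR q))).
  have hl0 : 0 <= ln (2 * INR q) by rewrite -ln_1; apply: ln_le; lra.
  have X0 : 0 <= X.
    apply: Rmult_le_pos; last by apply: Rplus_le_le_0_compat; [lra | nra].
    by have : 0 <= 2 * INR L / INR q by [apply: Rdiv_le_0_compat; lra]; lra.
  (* With block length [L] there is a single nonempty block, [j = 0]; for fixed [k1] the sum over
     [k2] is one for [windows_sum]. *)
  have hV' j : \Rsum_(minn (L + j * L) (2 * L) <= k1 < minn (L + j.+1 * L) (2 * L))
      \Rsum_(minn (L + j * L) (2 * L) <= k2 < minn (L + j.+1 * L) (2 * L)) W k1 k2 <= INR L * X.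
    case: j => [|j]; last first.
      by rewrite big_geq; [apply: Rmult_le_pos; lra | nia].
    have -> : minn (L + 0 * L) (2 * L) = L by lia.
    have -> : minn (L + 1 * L) (2 * L) = (L + L)%N by lia.
    have -> : INR L * X = INR (L + L - L) * X by congr (INR _ * _); lia.
    rewrite -Rsum_const_nat; apply: Rsum_le => k1 _.
    apply: (windows_sum (al := al) (be := - (al * INR k1))) => //.
    - by lra.
    - by move=> m; case: (geom_cap_bounds (M := INR M) (s := sn k1 m) ltac:(lra) (sn0 _ _)).
    - by move=> m; case: (geom_cap_bounds (M := INR M) (s := sn k1 m) ltac:(lra) (sn0 _ _)).
  have := type2_cauchy (F := F) x' L0 L0 ha hb hW hV'.
  set S := Cmod _; rewrite divnn L0 => hS.
  have hMLr : INR (M * L) = INR M * INR L by rewrite mult_INR.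
  set lq := 1 + ln (2 * INR q) in X X0 hV' hS.
  have hlq : lq <= KL * INR N `^ (eta / 36).
    apply: Rle_trans (hKL N N0); apply: Rplus_le_compat_l; apply: ln_le; first lra.
    have : INR N `^ (1 - eta) <= INR N `^ 1 by apply: pw_le; lra.
    by rewrite pw_1; lra.
  have lq1 : 1 <= lq by rewrite /lq; lra.
  have hiL : / INR L <= 2 * INR N `^ (- (eta / 4)).
    have hpp := pw_gt0 (INR N) (eta / 4).
    rewrite pw_opp; apply: (Rmult_le_reg_r (INR L * INR N `^ (eta / 4))); first by apply: Rmult_lt_0_compat; lra.
    have -> : / INR L * (INR L * INR N `^ (eta / 4)) = INR N `^ (eta / 4) by field; lra.
    have -> : 2 * / INR N `^ (eta / 4) * (INR L * INR N `^ (eta / 4)) = 2 * INR L by field; lra.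
    by have := INR_lt UL; lra.
  have hiM : / INR M <= / INR L by apply: Rinv_le_contravar; [lra | exact: INR_le].
  have hiq : / INR q <= INR N `^ (- (eta / 4)).
    apply: (Rle_trans _ (INR N `^ (- eta))); last by apply: pw_le; lra.
    by rewrite pw_opp; apply: Rinv_le_contravar; [exact: pw_gt0 | lra].
  have hqML : INR q / (INR M * INR L) <= INR N `^ (- (eta / 4)).
    apply: Rdiv_le_r; first by apply: Rmult_lt_0_compat; lra.
    apply: (Rle_trans _ (INR N `^ (- (eta / 4)) * INR N `^ (1 - eta / 4))).
      by rewrite -pw_add; apply: (Rle_trans _ _ _ (proj2 hqN)); apply: pw_le; lra.
    by apply: Rmult_le_compat_l; [exact: pw_ge0 | rewrite -hMLr; lra].
  have hMLN : INR M * INR L <= INR N by rewrite -hMLr; apply: INR_le; lia.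
  set w := INR N `^ (- (eta / 4)) in hiL hiq hqML.
  have w0 : 0 <= w by exact: pw_ge0.
  have hS2 : S ^ 2 <= T2 ^ 2.
    apply: Rle_trans hS _.
    have -> : INR M * INR (true.+1) ^ 2 * (INR L * X) =
      4 * (INR M * INR L) ^ 2 * (4 * / INR q + 8 * lq * / INR M + 2 * / INR L + 4 * lq * (INR q / (INR M * INR L))).
      by rewrite /X /=; field; lra.
    have e1 : 4 * (INR M * INR L) ^ 2 <= 4 * INR N ^ 2.
      apply: Rmult_le_compat_l; first lra.
      by apply: pow_incr; split => //; apply: Rmult_le_pos; lra.
    have e2 : 4 * / INR q + 8 * lq * / INR M + 2 * / INR L + 4 * lq * (INR q / (INR M * INR L)) <= 28 * (lq * w).
      have a1 : w <= lq * w by nra.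
      have a2 : lq * / INR M <= lq * (2 * w) by apply: Rmult_le_compat_l; lra.
      have a3 : lq * (INR q / (INR M * INR L)) <= lq * w by apply: Rmult_le_compat_l; lra.
      lra.
    have e3 : 0 <= 4 * / INR q + 8 * lq * / INR M + 2 * / INR L + 4 * lq * (INR q / (INR M * INR L)).
      have a1 : 0 < / INR q by apply: Rinv_0_lt_compat; lra.
      have a2 : 0 < / INR M by apply: Rinv_0_lt_compat; lra.
      have a3 : 0 <= lq * (INR q / (INR M * INR L)).
        by apply: Rmult_le_pos; [lra | apply: Rdiv_le_0_compat; [lra | apply: Rmult_lt_0_compat; lra]].
      have a4 : 0 <= lq * / INR M by apply: Rmult_le_pos; lra.
      lra.
    apply: (Rle_trans _ (4 * INR N ^ 2 * (28 * (lq * w)))).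
      apply: Rmult_le_compat => //; apply: Rmult_le_pos; [lra | exact: pow2_ge_0].
    have e4 : lq * w <= KL * INR N `^ (- (2 * eta / 9)).
      apply: (Rle_trans _ (KL * INR N `^ (eta / 36) * w)); first exact: Rmult_le_compat_r.
      by rewrite Rmult_assoc /w -pw_add; right; congr (_ * Rpower _ _); field.
    have -> : T2 ^ 2 = C2 ^ 2 * (INR N ^ 2 * INR N `^ (- (2 * eta / 9))).
      rewrite /T2 Rpow_mult_distr pw_pow -(pw_nat 2 (x := INR N)); last lra.
      by rewrite -pw_add; congr (_ * Rpower _ _); rewrite /=; field.
    have e5 : 112 * KL <= C2 ^ 2 by rewrite /C2; nra.
    have e6 : 0 <= INR N ^ 2 by exact: pow2_ge_0.
    have e7 : 0 <= INR N ^ 2 * INR N `^ (- (2 * eta / 9)) by apply: Rmult_le_pos => //; exact: pw_ge0.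
    have e8 := Rmult_le_compat_l (112 * INR N ^ 2) _ _ ltac:(lra) e4.
    have e9 := Rmult_le_compat_r _ _ _ e7 e5.
    lra.
  apply: (@pow_le_reg 1) => //.
  by apply: Rmult_le_pos; lra.
have hT20 : 0 <= T2 by apply: Rmult_le_pos; lra.
have := hV N U (fun n => e (al * INR n)) t _ T2 U0 N0 (fun n => Req_le _ _ (Cmod_e _)) hT20 tI hT1 tII x xN.
move=> h; apply: Rle_trans h _.
have e1 : INR N `^ (1 - eta / 2) <= INR N `^ (1 - eta / 9) by apply: pw_le; lra.
have e2 : INR U <= INR N `^ (1 - eta / 9) by apply: Rle_trans hU1 _; apply: pw_le; lra.
have e3 : sqrt (INR N) <= INR N `^ (1 - eta / 9) by rewrite sqrt_pw; [apply: pw_le; lra | lra].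
have -> : (INR N1 + KV * (4 + C2)) * INR N `^ (1 - eta / 10) =
  INR N1 * INR N `^ (1 - eta / 10) + KV * INR N `^ (eta / 90) * ((4 + C2) * INR N `^ (1 - eta / 9)).
  have -> : 1 - eta / 10 = eta / 90 + (1 - eta / 9) by field.
  by rewrite pw_add; ring.
have : 0 <= INR N1 * INR N `^ (1 - eta / 10) by apply: Rmult_le_pos; [exact: pos_INR | lra].
have : KV * INR N `^ (eta / 90) * (2 * INR N `^ (1 - eta / 2) + T2 + INR U + sqrt (INR N)) <=
  KV * INR N `^ (eta / 90) * ((4 + C2) * INR N `^ (1 - eta / 9)).
  by apply: Rmult_le_compat_l; [apply: Rmult_le_pos; [lra | exact: pw_ge0] | rewrite /T2; lra].
lra.
Qed.

(** Pigeonhole: two of the Q + 1 multiples [al j], j = 0, ..., Q, have fractional parts in the same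
    of Q cells. *)
Lemma dirichlet_approx (al : R) (Q : nat) : (0 < Q)%N -> exists (a : Z) (q : nat),
  [/\ (0 < q <= Q)%N, Z.gcd a (Z.of_nat q) = 1%Z & Rabs (al - IZR a / INR q) <= / (INR q * INR Q)].
Proof.
move=> Q0; have hQ := INR_ge1 Q0.
pose fr (j : nat) := al * INR j - IZR (Int_part (al * INR j)).
have hfr j : 0 <= fr j < 1 by rewrite /fr; have := base_Int_part (al * INR j); lra.
pose cell j := Z.to_nat (Int_part (INR Q * fr j)).
have hcell j : INR (cell j) <= INR Q * fr j < INR (cell j) + 1.
  have hf := hfr j; have [h1 h2] := base_Int_part (INR Q * fr j).
  have hz : (0 <= Int_part (INR Q * fr j))%Z.
    have : (-1 < Int_part (INR Q * fr j))%Z.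
      by apply: lt_IZR; have : 0 <= INR Q * fr j; [nra | lra].
    by lia.
  have hc : INR (cell j) = IZR (Int_part (INR Q * fr j)) by rewrite /cell INR_IZR_INZ Z2Nat.id.
  by rewrite hc; lra.
have cell_lt j : (cell j < Q)%N.
  have hf := hfr j; have hc := hcell j.
  by apply/ltP; apply: Stdlib.Reals.RIneq.INR_lt; nra.
pose f (i : 'I_Q.+1) : 'I_Q := Ordinal (cell_lt i).
have [i [j [hij hc]]] : exists i j : 'I_Q.+1, (i < j)%N /\ cell i = cell j.
  have : ~ injective f by move/leq_card; rewrite !card_ord ltnn.
  move/injectiveP/injectivePn => [i [j hij hf]].
  have hc : cell i = cell j by move: hf => /(f_equal val).
  case: (ltngtP i j) => h; [by exists i, j | by exists j, i | ].
  by move/val_inj: h hij => ->; rewrite eqxx.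
pose q0 := (j - i)%N; pose a0 := (Int_part (al * INR j) - Int_part (al * INR i))%Z.
have q00 : (0 < q0 <= Q)%N by have := ltn_ord j; rewrite /q0; lia.
have h0 : Rabs (al * INR q0 - IZR a0) <= / INR Q.
  have e1 : al * INR q0 - IZR a0 = fr j - fr i.
    rewrite /q0 /a0 /fr INRB; last lia.
    by move: (Int_part _) (Int_part _) => z1 z2; rewrite minus_IZR; ring.
  rewrite e1; have hi := hcell i; have hj := hcell j; rewrite hc in hi.
  apply: (Rmult_le_reg_l (INR Q)); first lra.
  rewrite Rinv_r; last lra.
  rewrite -{1}(Rabs_pos_eq (INR Q)); last lra.
  by rewrite -Rabs_mult; apply: Rabs_le; lra.
(* The fraction found is reduced to lowest terms, as [spaced_rational] needs; passing from q0 to q =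
   q0 / G only weakens the required bound. *)
pose G := Z.gcd a0 (Z.of_nat q0).
have hG : (0 < G)%Z.
  have : G <> 0%Z by move/Z.gcd_eq_0_r; lia.
  by have := Z.gcd_nonneg a0 (Z.of_nat q0); rewrite -/G; lia.
have [a ha] : (G | a0)%Z by exact: Z.gcd_divide_l.
have [q' hq'] : (G | Z.of_nat q0)%Z by exact: Z.gcd_divide_r.
have q'0 : (0 < q')%Z by nia.
pose q := Z.to_nat q'.
have hqz : Z.of_nat q = q' by rewrite /q Z2Nat.id; lia.
have hq0 : (0 < q)%N by lia.
have hqq0 : INR q0 = IZR G * INR q by rewrite !INR_IZR_INZ hqz hq' mult_IZR; ring.
have hG1 : 1 <= IZR G by apply: IZR_le; lia.
have hq := INR_ge1 hq0.
exists a, q; split.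
- by apply/andP; split => //; nia.
- rewrite hqz.
  have e1 : (G * Z.gcd a q' = G)%Z.
    rewrite -Z.gcd_mul_mono_l_nonneg; last lia.
    by rewrite /G; congr Z.gcd; lia.
  by nia.
- have e1 : al - IZR a / INR q = (al * INR q0 - IZR a0) / (IZR G * INR q).
    by rewrite hqq0 ha mult_IZR; field; lra.
  rewrite e1 Rabs_div; last by nra.
  rewrite (Rabs_pos_eq (IZR G * INR q)); last by nra.
  rewrite Rinv_mult /Rdiv Rmult_comm; apply: Rmult_le_compat => //; try exact: Rabs_pos.
    by left; apply: Rinv_0_lt_compat; nra.
  by apply: Rinv_le_contravar; nra.
Qed.

(** * Hua's eighth moment for cubes *)

Lemma orth (D : nat) (n : Z) : (0 < D)%N ->
  \Csum_(0 <= k < D) e (INR k * (IZR n / INR D)) =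
  RtoC (if (n mod Z.of_nat D =? 0)%Z then INR D else 0).
Proof.
move=> D0; have hD := INR_ge1 D0.
case: Z.eqb_spec => hn.
  have [m hm] : exists m, n = (m * Z.of_nat D)%Z.
    by exists (n / Z.of_nat D)%Z; have := Z.div_mod n (Z.of_nat D) ltac:(lia); lia.
  rewrite (eq_bigr (fun=> RtoC 1)).
    by rewrite Csum_const_nat subn0; ring.
  move=> k _; rewrite -(e_IZR (Z.of_nat k * m)) mult_IZR -INR_IZR_INZ; congr e.
  by rewrite hm mult_IZR -INR_IZR_INZ; field; lra.
set th := IZR n / INR D.
have hg := geom_e th (leq0n D).
have h1 : e (INR D * th) = RtoC 1.
  have -> : INR D * th = IZR n by rewrite /th; field; lra.
  exact: e_IZR.
rewrite h1 Rmult_0_l e_0 in hg.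
have hne : (1 - e th)%C <> 0.
  apply/Cmod_gt_0; rewrite Cmod_1_sub_e.
  (* [sin_PI_dist] takes distances up to 1/2 only, so [D = 1] is set apart; there every [n] is 0
     modulo [D], against [hn]. *)
  have hs : / INR D <= Rabs (sin (PI * th)) \/ INR D = 1.
    case: (Req_dec (INR D) 1) => hD1; [by right | left].
    apply: sin_PI_dist.
      have D2 : (2 <= D)%N by case: (D) D0 hD1 => [|[|]] //=; lra.
      split; first by left; apply: Rinv_0_lt_compat; lra.
      have -> : 1 / 2 = / INR 2 by rewrite /=; field.
      by apply: Rinv_le_contravar; [exact: INR_gt0 | exact: INR_le].
    move=> z; have -> : th - IZR z = IZR (n - z * Z.of_nat D) / INR D.
      by rewrite minus_IZR mult_IZR -INR_IZR_INZ /th; field; lra.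
    rewrite Rabs_div; last lra.
    rewrite (Rabs_pos_eq (INR D)); last lra.
    rewrite -[X in X <= _]Rmult_1_l; apply: Rmult_le_compat_r.
      by left; apply: Rinv_0_lt_compat; lra.
    apply: Rabs_IZR_ge1 => h; apply: hn.
    have -> : n = (z * Z.of_nat D)%Z by lia.
    by rewrite Z.mod_mul //; lia.
  case: hs => [hs | hD1].
    by have : 0 < / INR D by [apply: Rinv_0_lt_compat; lra]; lra.
  have D1 : D = 1%N by apply: INR_eq.
  by case: hn; rewrite D1 Z.mod_1_r.
have := f_equal (fun z => (/ (1 - e th) * z)%C) hg.
rewrite Cmult_assoc Cinv_l // Cmult_1_l => ->.
ring.
Qed.

Lemma orth0 (D : nat) (n : Z) : (0 < D)%N -> (- Z.of_nat D < n < Z.of_nat D)%Z ->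
  \Csum_(0 <= k < D) e (INR k * (IZR n / INR D)) = RtoC (if (n =? 0)%Z then INR D else 0).
Proof.
move=> D0 hn; rewrite orth //; congr RtoC.
case: (Z.eqb_spec n 0) => [->|h]; first by rewrite Z.mod_0_l ?Z.eqb_refl //; lia.
rewrite ifF //; apply/negbTE; apply/negP => /Z.eqb_spec /Z.mod_divide => /(_ ltac:(lia)) [m hm].
by case: (Z.lt_trichotomy m 0) => [hm0|[hm0|hm0]]; [nia | rewrite hm0 in hm; lia | nia].
Qed.

Lemma parseval (D E : nat) (c : nat -> C) : (0 < D)%N -> (E <= D)%N ->
  \Rsum_(0 <= k < D) Cmod (\Csum_(1 <= n < E) (c n * e (INR k / INR D * INR n))) ^ 2 =
  INR D * \Rsum_(1 <= n < E) Cmod (c n) ^ 2.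
Proof.
move=> D0 ED; have hD := INR_ge1 D0.
suff h : RtoC (\Rsum_(0 <= k < D) Cmod (\Csum_(1 <= n < E) (c n * e (INR k / INR D * INR n))) ^ 2) =
   RtoC (INR D * \Rsum_(1 <= n < E) Cmod (c n) ^ 2) by case: h.
rewrite Csum_RtoC; under eq_bigr => k _ do rewrite Cmod_sqr_sum.
rewrite exchange_big /= RtoC_mult Csum_RtoC Csum_mull.
apply: eq_big_nat => n hn; rewrite exchange_big /=.
rewrite (bigD1_seq n) ?mem_index_iota ?iota_uniq //=.
have -> : \Csum_(0 <= k < D) (c n * e (INR k / INR D * INR n) * Cconj (c n * e (INR k / INR D * INR n))) =
    RtoC (INR D * Cmod (c n) ^ 2).
  rewrite (eq_bigr (fun=> (c n * Cconj (c n))%C)).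
    by rewrite Csum_const_nat subn0 RtoC_mult Cmod2_conj.
  by move=> k _; rewrite Cmult_conj e_conj; have h := e_opp_mul (INR k / INR D * INR n);
    set u := e _ in h *; set v := e _ in h *; transitivity (c n * Cconj (c n) * (u * v))%C; [ring | by rewrite h Cmult_1_r].
rewrite [X in (_ + X)%C](_ : _ = RtoC 0) ?Cplus_0_r; first by rewrite RtoC_mult.
rewrite big_seq_cond big1 // => m /andP[].
rewrite mem_index_iota => hm hmn.
transitivity (c n * Cconj (c m) * \Csum_(0 <= k < D) e (INR k * (IZR (Z.of_nat n - Z.of_nat m) / INR D)))%C.
  rewrite Csum_mull; apply: eq_bigr => k _; rewrite Cmult_conj e_conj.
  have -> : e (INR k * (IZR (Z.of_nat n - Z.of_nat m) / INR D)) = (e (INR k / INR D * INR n) * e (- (INR k / INR D * INR m)))%C.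
    by rewrite -e_add minus_IZR -!INR_IZR_INZ; congr e; field; lra.
  ring.
rewrite orth0 //; last by lia.
rewrite (_ : (_ =? 0)%Z = false); first by ring.
by apply/Z.eqb_neq; move/eqP: hmn; lia.
Qed.

Lemma Rsum_const_seq (I : Type) (r : seq I) c : \Rsum_(i <- r) c = INR (size r) * c.
Proof.
elim: r => [|x r IH]; first by rewrite big_nil /=; ring.
by rewrite big_cons IH [size (_ :: _)]/= S_INR; ring.
Qed.

Definition indb (b : bool) : R := if b then 1 else 0.

Lemma count_le_size (T S : eqType) (r : seq T) (P : pred T) (g : T -> S) (s : seq S) :
  uniq r -> (forall x, x \in r -> P x -> g x \in s) ->
  (forall x y, x \in r -> y \in r -> P x -> P y -> g x = g y -> x = y) ->
  \Rsum_(x <- r) indb (P x) <= INR (size s).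
Proof.
move=> ur hs hinj.
have -> : \Rsum_(x <- r) indb (P x) = INR (size (filter P r)).
  elim: (r) => [|x r' IH]; first by rewrite big_nil.
  by rewrite big_cons IH [filter _ (_ :: _)]/=; case: (P x); rewrite /indb ?[size (_ :: _)]/= ?S_INR; ring.
rewrite -(size_map g); apply: INR_le; apply: uniq_leq_size.
  rewrite map_inj_in_uniq ?filter_uniq //.
  move=> x y; rewrite !mem_filter => /andP[px xr] /andP[py yr]; exact: hinj.
by move=> y /mapP[x]; rewrite mem_filter => /andP[px xr] ->; exact: hs.
Qed.

Lemma tau_divisors n : (0 < n)%N -> tau n = INR (size (divisors n)).
Proof.
move=> n0; rewrite /tau big_mkcond.
have -> : size (divisors n) = size (filter (fun d => d %| n) (index_iota 1 n.+1)).
  apply: perm_size; apply: uniq_perm; [exact: divisors_uniq | by rewrite filter_uniq ?iota_uniq |].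
  move=> d; rewrite -dvdn_divisors // mem_filter mem_index_iota.
  case: (boolP (d %| n)) => //= h; have := dvdn_leq n0 h; have := dvdn_gt0 n0 h; lia.
elim: (index_iota _ _) => [|x r' IH]; first by rewrite big_nil.
rewrite big_cons IH [filter _ (_ :: _)]/=; case: (x %| n); last exact: Rplus_0_l.
by rewrite -[size (_ :: _)]/((size _).+1) S_INR Rplus_comm.
Qed.

Section Hua.

Variables (P D : nat) (tm : R).
Hypotheses (P0 : (0 < P)%N) (hD : (20 * P ^ 3 < D)%N) (tm1 : 1 <= tm).
Hypothesis htau : forall w, (0 < w <= 10 * P ^ 3)%N -> tau w <= tm.

Definition cubeZ (z : nat) : Z := Z.of_nat (z ^ 3).
Definition ek (k : nat) (n : Z) : C := e (INR k * (IZR n / INR D)).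
Definition Wk (k : nat) : C := \Csum_(1 <= z < P.+1) ek k (cubeZ z).
Definition dz (x : nat * nat) : Z := (cubeZ x.1 - cubeZ x.2)%Z.
Definition prs : seq (nat * nat) := [seq (z, z') | z <- index_iota 1 P.+1, z' <- index_iota 1 P.+1].

Let D0 : (0 < D)%N. Proof. by lia. Qed.

Lemma ek_add k m n : ek k (m + n) = (ek k m * ek k n)%C.
Proof. by rewrite /ek -e_add plus_IZR; congr e; rewrite /Rdiv; ring. Qed.

Lemma ek_conj k m : Cconj (ek k m) = ek k (- m).
Proof. by rewrite /ek e_conj opp_IZR; congr e; rewrite /Rdiv; ring. Qed.

Lemma prs_uniq : uniq prs.
Proof. by apply: allpairs_uniq; [exact: iota_uniq | exact: iota_uniq | case=> a b [c d]]. Qed.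

Lemma mem_prs x : (x \in prs) = (0 < x.1 <= P)%N && (0 < x.2 <= P)%N.
Proof.
case: x => a b; apply/allpairsP/idP => [[[c d] /= [hc hd [-> ->]]]|/= h].
  by move: hc hd; rewrite !mem_index_iota; lia.
by exists (a, b); rewrite !mem_index_iota; split => //=; lia.
Qed.

Lemma size_prs : size prs = (P * P)%N.
Proof. by rewrite size_allpairs !size_iota; congr (_ * _)%N; lia. Qed.

Lemma cube_mono x y : (x <= y)%N -> (x ^ 3 <= y ^ 3)%N.
Proof. by move=> h; rewrite leq_exp2r. Qed.

Lemma cube_le x : (x <= P)%N -> (x ^ 3 <= P ^ 3)%N.
Proof. by move=> h; rewrite leq_exp2r. Qed.

Lemma dz_bound x : x \in prs -> (Z.abs (dz x) <= Z.of_nat (P ^ 3))%Z.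
Proof.
rewrite mem_prs /dz /cubeZ => h.
have [h1 h2] : (x.1 <= P)%N /\ (x.2 <= P)%N by lia.
move: (cube_le h1) (cube_le h2); move: (x.1 ^ 3)%N (x.2 ^ 3)%N (P ^ 3)%N => u v w; lia.
Qed.

Lemma W2E k : RtoC (Cmod (Wk k) ^ 2) = \Csum_(x <- prs) ek k (dz x).
Proof.
rewrite /Wk Cmod_sqr_sum /prs big_allpairs; apply: eq_bigr => z _; apply: eq_bigr => z' _.
by rewrite ek_conj -ek_add.
Qed.

(** A Fourier coefficient of |W|^4, counting representations of [- n] by two differences of cubes.
    [D] exceeds all frequencies that occur, so congruence modulo [D] is equality. *)
Definition cnt (n : Z) : R := \Rsum_(x <- prs) \Rsum_(y <- prs) indb (dz x + dz y + n =? 0)%Z.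

Lemma W4E n : (Z.abs n <= Z.of_nat (10 * P ^ 3))%Z ->
  \Csum_(0 <= k < D) (RtoC (Cmod (Wk k) ^ 4) * ek k n) = RtoC (INR D * cnt n).
Proof.
move=> hn.
transitivity (\Csum_(0 <= k < D) \Csum_(x <- prs) \Csum_(y <- prs) ek k (dz x + dz y + n)).
  apply: eq_bigr => k _.
  have -> : RtoC (Cmod (Wk k) ^ 4) = (RtoC (Cmod (Wk k) ^ 2) * RtoC (Cmod (Wk k) ^ 2))%C.
    by rewrite -RtoC_mult; congr RtoC; ring.
  rewrite !W2E !Csum_mulr; apply: eq_bigr => x _.
  rewrite Csum_mull Csum_mulr; apply: eq_bigr => y _.
  by rewrite !ek_add.
rewrite exchange_big /= /cnt RtoC_mult Csum_RtoC Csum_mull.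
rewrite big_seq [RHS]big_seq; apply: eq_bigr => x hx.
rewrite exchange_big /= Csum_RtoC Csum_mull big_seq [RHS]big_seq; apply: eq_bigr => y hy.
have h1 := dz_bound hx; have h2 := dz_bound hy.
rewrite orth0 //; last by lia.
by rewrite -RtoC_mult /indb; case: ifP => _; congr RtoC; ring.
Qed.

(** With f = a - b the difference of cubes is f (3 b^2 + 3 b f + f^2), strictly increasing in b. *)
Lemma cube_diff_inj a b a' b' : (b < a)%N -> (b' < a')%N -> (a - b = a' - b')%N ->
  (a ^ 3 - b ^ 3 = a' ^ 3 - b' ^ 3)%N -> a = a' /\ b = b'.
Proof.
move=> h1 h2 hd; have -> : a = (b + (a - b))%N by lia.
have -> : a' = (b' + (a - b))%N by lia.
have : (0 < a - b)%N by lia.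
move: (a - b)%N {h1 h2 hd} => f f0.
have ex c : ((c + f) ^ 3 - c ^ 3 = f * (3 * c * c + 3 * c * f + f * f))%N.
  have -> : ((c + f) ^ 3 = c ^ 3 + f * (3 * c * c + 3 * c * f + f * f))%N.
    by rewrite !expnS !expn0; lia.
  by rewrite addKn.
rewrite !ex => /eqP; rewrite eqn_pmul2l // => /eqP h.
by case: (ltngtP b b') => hb; [nia | nia | subst].
Qed.

(** A solution is determined by [|a - b|], a divisor of [|v|]; the sign of [v] decides which of the
    two is larger. *)
Lemma count_dz v : v <> 0%Z -> (Z.abs v <= Z.of_nat (10 * P ^ 3))%Z ->
  \Rsum_(y <- prs) indb (dz y =? v)%Z <= tm.
Proof.
move=> v0 hv; pose w := Z.to_nat (Z.abs v).
have w0 : (0 < w <= 10 * P ^ 3)%N by rewrite /w; lia.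
apply: Rle_trans (htau w0); rewrite tau_divisors; last lia.
apply: (count_le_size (g := fun y => ndist y.1 y.2)); first exact: prs_uniq.
  move=> [a b] hy /Z.eqb_spec; rewrite /dz /cubeZ /= => h.
  rewrite -dvdn_divisors; last lia.
  rewrite /ndist; case: (leqP b a) => hab.
    have -> : (a - b + (b - a) = a - b)%N by lia.
    have -> : w = (a ^ 3 - b ^ 3)%N.
      move: h (cube_mono hab); rewrite /w; move: (a ^ 3)%N (b ^ 3)%N => A B; lia.
    by rewrite subn_exp dvdn_mulr.
  have -> : (a - b + (b - a) = b - a)%N by lia.
  have -> : w = (b ^ 3 - a ^ 3)%N.
    move: h (cube_mono (ltnW hab)); rewrite /w; move: (a ^ 3)%N (b ^ 3)%N => A B; lia.
  by rewrite subn_exp dvdn_mulr.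
move=> [a b] [a' b'] _ _ /Z.eqb_spec h /Z.eqb_spec h' /=.
rewrite /ndist; move: h h'; rewrite /dz /cubeZ /= => h h' hd.
have lt3 x y : (x < y)%N -> (x ^ 3 < y ^ 3)%N by move=> hxy; rewrite ltn_exp2r.
case: (ltngtP a b) => hab; last by exfalso; apply: v0; rewrite -h hab; lia.
- have l1 := lt3 _ _ hab.
  have hab' : (a' < b')%N.
    rewrite ltnNge; apply/negP => /cube_mono hc.
    by move: h h' l1 hc; move: (a ^ 3)%N (b ^ 3)%N (a' ^ 3)%N (b' ^ 3)%N => A B A' B'; lia.
  have l2 := lt3 _ _ hab'.
  have h3 : (b ^ 3 - a ^ 3 = b' ^ 3 - a' ^ 3)%N.
    by move: h h' l1 l2; move: (a ^ 3)%N (b ^ 3)%N (a' ^ 3)%N (b' ^ 3)%N => A B A' B'; lia.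
  by have [-> ->] := @cube_diff_inj b a b' a' hab hab' ltac:(lia) h3.
- have l1 := lt3 _ _ hab.
  have hab' : (b' < a')%N.
    rewrite ltnNge; apply/negP => /cube_mono hc.
    by move: h h' l1 hc; move: (a ^ 3)%N (b ^ 3)%N (a' ^ 3)%N (b' ^ 3)%N => A B A' B'; lia.
  have l2 := lt3 _ _ hab'.
  have h3 : (a ^ 3 - b ^ 3 = a' ^ 3 - b' ^ 3)%N.
    by move: h h' l1 l2; move: (a ^ 3)%N (b ^ 3)%N (a' ^ 3)%N (b' ^ 3)%N => A B A' B'; lia.
  by have [-> ->] := @cube_diff_inj a b a' b' hab hab' ltac:(lia) h3.
Qed.

Lemma count_dz0 : \Rsum_(y <- prs) indb (dz y =? 0)%Z <= INR P.
Proof.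
have -> : INR P = INR (size (index_iota 1 P.+1)) by rewrite size_iota; congr INR; lia.
have inj a b : cubeZ a = cubeZ b -> a = b.
  rewrite /cubeZ => h; have {}h : (a ^ 3 = b ^ 3)%N by lia.
  by apply/eqP; rewrite -(eqn_exp2r a b (e := 3)) // h.
apply: (count_le_size (g := fun y => y.1)); first exact: prs_uniq.
  by move=> [a b]; rewrite mem_prs mem_index_iota /=; lia.
move=> [a b] [a' b'] _ _ /Z.eqb_spec h /Z.eqb_spec h' /= haa.
move: h h'; rewrite /dz /= => h h'.
have hab : a = b by apply: inj; lia.
have hab' : a' = b' by apply: inj; lia.
by subst.
Qed.

Lemma cnt0_le : cnt 0 <= INR P ^ 2 * (1 + tm).
Proof.
have hP := INR_ge1 P0.
apply: (Rle_trans _ (\Rsum_(x <- prs) (INR P * indb (dz x =? 0)%Z + tm))).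
  apply: Rsum_le_seq => x hx _.
  case: (Z.eqb_spec (dz x) 0) => h.
    rewrite /indb Rmult_1_r.
    have -> : \Rsum_(y <- prs) (if (dz x + dz y + 0 =? 0)%Z then 1 else 0) = \Rsum_(y <- prs) indb (dz y =? 0)%Z.
      by apply: eq_bigr => y _; rewrite /indb; congr (if _ then _ else _); lia.
    by have := count_dz0; lra.
  rewrite [indb false]/= Rmult_0_r Rplus_0_l.
  have -> : \Rsum_(y <- prs) indb (dz x + dz y + 0 =? 0)%Z = \Rsum_(y <- prs) indb (dz y =? - dz x)%Z.
    by apply: eq_bigr => y _; congr indb; lia.
  by apply: count_dz; have := dz_bound hx; lia.
rewrite big_split /= -Rsum_mull.
have h1 : \Rsum_(i <- prs) tm = INR P ^ 2 * tm.
  by rewrite Rsum_const_seq size_prs mult_INR; ring.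
have h2 := Rmult_le_compat_l (INR P) _ _ ltac:(lra) count_dz0.
rewrite h1; lra.
Qed.

(** The frequencies in |V_d|^2. They factor as 3 d (z - z') (z + z' + d), and this makes their
    values countable by divisors. *)
Definition tri (d z z' : nat) : Z := ((cubeZ (z + d) - cubeZ z) - (cubeZ (z' + d) - cubeZ z'))%Z.

Lemma triE d z z' : tri d z z' =
  (3 * Z.of_nat d * (Z.of_nat z - Z.of_nat z') * (Z.of_nat z + Z.of_nat z' + Z.of_nat d))%Z.
Proof. by rewrite /tri /cubeZ !expnS !expn0; lia. Qed.

Lemma tri_abs d a b :
  Z.abs (tri d a b) = Z.of_nat (3 * d * ndist a b * (a + b + d)).
Proof.
rewrite triE !Nat2Z.inj_mul !Nat2Z.inj_add !Z.abs_mul.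
have -> : Z.abs (Z.of_nat a - Z.of_nat b) = Z.of_nat (ndist a b) by rewrite /ndist; lia.
have -> : Z.abs (Z.of_nat a + Z.of_nat b + Z.of_nat d) = (Z.of_nat a + Z.of_nat b + Z.of_nat d)%Z by lia.
have -> : Z.abs (Z.of_nat d) = Z.of_nat d by lia.
by rewrite /ndist Nat2Z.inj_add.
Qed.

Lemma tri_sign d a b : (0 < d)%N -> (a < b)%N = (tri d a b <? 0)%Z.
Proof.
move=> d0; rewrite triE; apply/idP/idP => [h | /Z.ltb_lt h].
  apply/Z.ltb_lt; apply: Z.mul_neg_pos; last lia.
  by apply: Z.mul_pos_neg; lia.
rewrite ltnNge; apply/negP => hc; suff : (0 <= 3 * Z.of_nat d * (Z.of_nat a - Z.of_nat b) * (Z.of_nat a + Z.of_nat b + Z.of_nat d))%Z by lia.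
by apply: Z.mul_nonneg_nonneg; [apply: Z.mul_nonneg_nonneg|]; lia.
Qed.

(** A solution is determined by [d] and [|z - z'|], both divisors of [|v|]: the cofactor then gives
    z + z', and the sign of [v] orders z and z'. *)
Lemma count_tri v : v <> 0%Z -> (Z.abs v <= Z.of_nat (10 * P ^ 3))%Z ->
  \Rsum_(1 <= d < P) \Rsum_(x <- prs) indb (tri d x.1 x.2 =? v)%Z <= tm ^ 2.
Proof.
move=> v0 hv; pose w := Z.to_nat (Z.abs v).
have w0 : (0 < w <= 10 * P ^ 3)%N by rewrite /w; lia.
have ht := htau w0.
have -> : \Rsum_(1 <= d < P) \Rsum_(x <- prs) indb (tri d x.1 x.2 =? v)%Z =
   \Rsum_(y <- [seq (d, x) | d <- index_iota 1 P, x <- prs]) indb (tri y.1 y.2.1 y.2.2 =? v)%Z.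
  by rewrite big_allpairs.
have t0 : 0 <= tau w by apply: Rsum_ge0 => _ _; lra.
apply: (Rle_trans _ (tau w ^ 2)); last by apply: pow_incr.
rewrite tau_divisors; last lia.
have -> : INR (size (divisors w)) ^ 2 = INR (size [seq (a, b) | a <- divisors w, b <- divisors w]).
  by rewrite size_allpairs mult_INR; ring.
apply: (count_le_size (g := fun y => (y.1, ndist y.2.1 y.2.2))).
- by apply: allpairs_uniq; [exact: iota_uniq | exact: prs_uniq | case=> a b [c d]].
- move=> [d [a b]] /allpairsP[[d1 x1] /= [hd1 hx1 [hdd haa]]] /Z.eqb_spec /= h.
  have hw : w = (3 * d * ndist a b * (a + b + d))%N by rewrite /w -h tri_abs Nat2Z.id.
  apply/allpairsP; exists (d, ndist a b); split => //=; rewrite -dvdn_divisors; try lia; rewrite hw.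
    by rewrite -!mulnA dvdn_mull // dvdn_mulr.
  by rewrite dvdn_mulr // dvdn_mull.
- move=> [d [a b]] [d' [a' b']] hm hm' /Z.eqb_spec h /Z.eqb_spec h' /= [hdd hn].
  subst d'; move: h h' => /= h h'.
  have d0 : (0 < d)%N.
    by move: hm => /allpairsP[[d1 x1] /= [hd1 _ [-> _]]]; move: hd1; rewrite mem_index_iota; lia.
  have hw : w = (3 * d * ndist a b * (a + b + d))%N by rewrite /w -h tri_abs Nat2Z.id.
  have hw' : w = (3 * d * ndist a b * (a' + b' + d))%N by rewrite /w -h' tri_abs Nat2Z.id hn.
  have hs : (a + b = a' + b')%N.
    have : (0 < 3 * d * ndist a b)%N by move: w0; rewrite hw; case: (3 * d * ndist a b)%N.
    move: hw'; rewrite hw; move: (3 * d * ndist a b)%N => m /eqP hm1 m0.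
    by move: hm1; rewrite eqn_pmul2l // => /eqP; lia.
  have hlt : (a < b)%N = (a' < b')%N by rewrite (@tri_sign d a b d0) (@tri_sign d a' b' d0) h h'.
  move: hn hlt; rewrite /ndist => hn hlt.
  by congr (_, (_, _)); lia.
Qed.

Lemma cnt_ge0 n : 0 <= cnt n.
Proof. by apply: Rsum_ge0 => x _; apply: Rsum_ge0 => y _; rewrite /indb; case: (_ =? _)%Z; lra. Qed.

Definition Vk (k d : nat) : C := \Csum_(1 <= z < P.+1 - d) (ek k (cubeZ (z + d)) * Cconj (ek k (cubeZ z))).

(** Weyl differencing with all shifts below [P], then Cauchy-Schwarz over the shifts. *)
Lemma W4_le k : Cmod (Wk k) ^ 4 <= 8 * INR P ^ 2 + 32 * INR P * \Rsum_(1 <= d < P) Cmod (Vk k d) ^ 2.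
Proof.
have hP := INR_ge1 P0.
have h := @van_der_corput (fun z => ek k (cubeZ z)) 1 P.+1 P ltac:(lia) P0 _.
have {}h := h (fun n _ => Req_le _ _ (Cmod_e _)).
have hs : 0 <= \Rsum_(1 <= d < P) Cmod (Vk k d) by apply: Rsum_ge0 => d _; exact: Cmod_ge_0.
have h2 : Cmod (Wk k) ^ 2 <= 2 * INR P + 4 * \Rsum_(1 <= d < P) Cmod (Vk k d).
  apply: (Rmult_le_reg_l (INR P)); first lra.
  apply: (Rle_trans _ _ _ h); rewrite subSS subn0 plus_INR /Vk; lra.
have h3 := Cauchy_R1 1 P (fun d => Cmod (Vk k d)).
have h4 : INR (P - 1) <= INR P by apply: INR_le; lia.
have h5 : 0 <= \Rsum_(1 <= d < P) Cmod (Vk k d) ^ 2 by apply: Rsum_ge0 => d _; exact: pow2_ge_0.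
have h6 := Rmult_le_compat_r _ _ _ h5 h4.
move: h2 h3 h5 h6 hs; set s := \Rsum_(1 <= d < P) Cmod (Vk k d); set q := \Rsum_(1 <= d < P) _ => h2 h3 h5 h6 hs.
have h7 : (Cmod (Wk k) ^ 2) ^ 2 <= (2 * INR P + 4 * s) ^ 2.
  by apply: pow_incr; split; [exact: pow2_ge_0 | ].
have h8 := pow2_ge_0 (2 * INR P - 4 * s).
have -> : Cmod (Wk k) ^ 4 = (Cmod (Wk k) ^ 2) ^ 2 by ring.
nra.
Qed.

Lemma VW_sum d : (0 < d < P)%N ->
  \Rsum_(0 <= k < D) (Cmod (Wk k) ^ 4 * Cmod (Vk k d) ^ 2) <=
  INR D * \Rsum_(x <- prs) cnt (tri d x.1 x.2).
Proof.
move=> hd; have hD1 := INR_ge1 D0.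
have -> : \Rsum_(0 <= k < D) (Cmod (Wk k) ^ 4 * Cmod (Vk k d) ^ 2) =
    INR D * \Rsum_(1 <= z < P.+1 - d) \Rsum_(1 <= z' < P.+1 - d) cnt (tri d z z').
  suff h : RtoC (\Rsum_(0 <= k < D) (Cmod (Wk k) ^ 4 * Cmod (Vk k d) ^ 2)) =
     RtoC (INR D * \Rsum_(1 <= z < P.+1 - d) \Rsum_(1 <= z' < P.+1 - d) cnt (tri d z z')) by case: h.
  transitivity (\Csum_(0 <= k < D) \Csum_(1 <= z < P.+1 - d) \Csum_(1 <= z' < P.+1 - d)
      (RtoC (Cmod (Wk k) ^ 4) * ek k (tri d z z'))).
    rewrite Csum_RtoC; apply: eq_bigr => k _.
    rewrite RtoC_mult /Vk Cmod_sqr_sum Csum_mull; apply: eq_bigr => z _.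
    rewrite Csum_mull; apply: eq_bigr => z' _; congr (_ * _)%C.
    rewrite !Cmult_conj Cconj_conj !ek_conj -!ek_add; congr ek; rewrite /tri; lia.
  rewrite exchange_big /= RtoC_mult Csum_RtoC Csum_mull.
  apply: eq_big_nat => z hz; rewrite exchange_big /= Csum_RtoC Csum_mull.
  apply: eq_big_nat => z' hz'; rewrite W4E ?RtoC_mult //.
  have := @cube_le (z + d) ltac:(lia); have := @cube_le (z' + d) ltac:(lia).
  have := @cube_mono z (z + d) ltac:(lia); have := @cube_mono z' (z' + d) ltac:(lia).
  rewrite /tri /cubeZ; move: (z ^ 3)%N (z' ^ 3)%N ((z + d) ^ 3)%N ((z' + d) ^ 3)%N (P ^ 3)%N => a b c f g; lia.
apply: Rmult_le_compat_l; first lra.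
(* [cnt] is nonnegative, so the ranges up to P - d may be enlarged to P, which gives a sum over
   [prs]. *)
rewrite /prs big_allpairs [X in _ <= X](big_cat_nat (n := (P.+1 - d)%N)) /=; try lia.
rewrite -[X in X <= _]Rplus_0_r; apply: Rplus_le_compat; last first.
  by apply: Rsum_ge0 => z _; apply: Rsum_ge0 => z' _; exact: cnt_ge0.
apply: Rsum_le => z _.
rewrite [X in _ <= X](big_cat_nat (n := (P.+1 - d)%N)) /=; try lia.
rewrite -[X in X <= _]Rplus_0_r; apply: Rplus_le_compat; first lra.
by apply: Rsum_ge0 => z' _; exact: cnt_ge0.
Qed.

(** Pairs with z = z' have frequency 0 and give [cnt 0], for at most P values of d and P of z. For z
    and z' distinct, each of the P^4 choices of the other four cubes leaves at most [tm^2] triples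
    (d, z, z'). *)
Lemma cnt_tri_sum :
  \Rsum_(1 <= d < P) \Rsum_(x <- prs) cnt (tri d x.1 x.2) <= INR P ^ 2 * cnt 0 + INR P ^ 4 * tm ^ 2.
Proof.
have hP := INR_ge1 P0.
pose off (x : nat * nat) := indb (x.1 != x.2).
apply: (Rle_trans _ (\Rsum_(1 <= d < P) \Rsum_(x <- prs) (indb (x.1 == x.2) * cnt 0) +
   \Rsum_(1 <= d < P) \Rsum_(x <- prs) \Rsum_(u <- prs) \Rsum_(y <- prs)
      (off x * indb (dz u + dz y + tri d x.1 x.2 =? 0)%Z))).
  right; rewrite -big_split /=; apply: eq_bigr => d _.
  rewrite -big_split /=; apply: eq_bigr => x _.
  rewrite /off; case: eqP => hx.
    have -> : tri d x.1 x.2 = 0%Z by rewrite triE hx Z.sub_diag Z.mul_0_r.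
    rewrite {1 2}/indb Rmult_1_l big1 ?Rplus_0_r // => u _.
    by rewrite big1 // => y _; rewrite /indb /=; ring.
  rewrite [indb false]/= Rmult_0_l Rplus_0_l /cnt; apply: eq_bigr => u _; apply: eq_bigr => y _.
  by rewrite /indb /=; ring.
apply: Rplus_le_compat.
  rewrite Rsum_const_nat.
  have h1 : \Rsum_(x <- prs) indb (x.1 == x.2) <= INR P.
    have -> : INR P = INR (size (index_iota 1 P.+1)) by rewrite size_iota; congr INR; lia.
    apply: (count_le_size (g := fun y => y.1)); first exact: prs_uniq.
      by move=> [a b]; rewrite mem_prs mem_index_iota /=; lia.
    by move=> [a b] [a' b'] _ _ /= /eqP -> /eqP -> ->.
  have h0 : 0 <= \Rsum_(x <- prs) indb (x.1 == x.2).
    by apply: Rsum_ge0 => x _; rewrite /indb; case: eqP; lra.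
  rewrite -Rsum_mulr; have hc := cnt_ge0 0.
  have h2 : INR (P - 1) <= INR P by apply: INR_le; lia.
  have := Rmult_le_compat _ _ _ _ (pos_INR _) h0 h2 h1 => h3.
  have := Rmult_le_compat_r _ _ _ hc h3; nra.
transitivity (\Rsum_(u <- prs) \Rsum_(y <- prs) \Rsum_(1 <= d < P) \Rsum_(x <- prs)
      (off x * indb (dz u + dz y + tri d x.1 x.2 =? 0)%Z)).
  right; rewrite (eq_bigr _ (fun d _ => exchange_big _ _ _ _ _ _)) /=.
  rewrite exchange_big /=; apply: eq_bigr => u _.
  rewrite (eq_bigr _ (fun d _ => exchange_big _ _ _ _ _ _)) /=.
  by rewrite exchange_big.
have -> : INR P ^ 4 * tm ^ 2 = \Rsum_(u <- prs) \Rsum_(y <- prs) tm ^ 2.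
  by rewrite !Rsum_const_seq size_prs mult_INR; ring.
apply: Rsum_le_seq => u hu _; apply: Rsum_le_seq => y hy _.
(* [count_tri] excludes the value 0, which is not attained when z and z' differ. *)
case: (Z.eq_dec (dz u + dz y) 0) => hv.
  rewrite big_seq big1; first exact: pow2_ge_0.
  move=> d; rewrite mem_index_iota => hd; rewrite big1 // => x _.
  rewrite /off; case: eqP => hx; first by rewrite /indb /=; ring.
  rewrite hv Z.add_0_l (_ : (_ =? _)%Z = false); first by rewrite /indb; ring.
  apply/Z.eqb_neq => h0; have := tri_abs d x.1 x.2; rewrite h0.
  have hn : (0 < ndist x.1 x.2)%N by rewrite /ndist; lia.
  have : (0 < 3 * d * ndist x.1 x.2 * (x.1 + x.2 + d))%N by rewrite !muln_gt0; lia.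
  move: (3 * d * ndist x.1 x.2 * (x.1 + x.2 + d))%N => m; rewrite [Z.abs 0]/=; lia.
apply: (Rle_trans _ _ _ _ (@count_tri (- (dz u + dz y)) _ _)); try lia.
  apply: Rsum_le => d _; apply: Rsum_le => x _.
  have -> : (dz u + dz y + tri d x.1 x.2 =? 0)%Z = (tri d x.1 x.2 =? - (dz u + dz y))%Z by lia.
  by rewrite /off /indb; do 2!case: ifP => _; lra.
have := dz_bound hu; have := dz_bound hy; move: (P ^ 3)%N => m; lia.
Qed.

(** Multiply [W4_le] by |W|^4: the first term becomes the fourth moment, and [VW_sum] turns the
    second into the count of [cnt_tri_sum]. The constant is 112 = 8 * 2 + 32 * 3. *)
Lemma eighth_moment :
  \Rsum_(0 <= k < D) Cmod (Wk k) ^ 8 <= 112 * INR D * INR P ^ 5 * tm ^ 2.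
Proof.
have hP := INR_ge1 P0; have hD1 := INR_ge1 D0.
have hW4 : \Rsum_(0 <= k < D) Cmod (Wk k) ^ 4 = INR D * cnt 0.
  suff h : RtoC (\Rsum_(0 <= k < D) Cmod (Wk k) ^ 4) = RtoC (INR D * cnt 0) by case: h.
  rewrite Csum_RtoC -W4E; last by rewrite [Z.abs 0]/=; lia.
  apply: eq_bigr => k _; rewrite /ek /Rdiv Rmult_0_l Rmult_0_r e_0; ring.
apply: (Rle_trans _ (8 * INR P ^ 2 * \Rsum_(0 <= k < D) Cmod (Wk k) ^ 4 +
   32 * INR P * \Rsum_(1 <= d < P) \Rsum_(0 <= k < D) (Cmod (Wk k) ^ 4 * Cmod (Vk k d) ^ 2))).
  have pt k : Cmod (Wk k) ^ 8 <= 8 * INR P ^ 2 * Cmod (Wk k) ^ 4 +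
      32 * INR P * \Rsum_(1 <= d < P) (Cmod (Wk k) ^ 4 * Cmod (Vk k d) ^ 2).
    have h0 : 0 <= Cmod (Wk k) ^ 4 by apply: pow_le; exact: Cmod_ge_0.
    rewrite -Rsum_mull; have := Rmult_le_compat_l _ _ _ h0 (W4_le k); set q := \Rsum_(1 <= d < P) _.
    have -> : Cmod (Wk k) ^ 8 = Cmod (Wk k) ^ 4 * Cmod (Wk k) ^ 4 by ring.
    lra.
  apply: (Rle_trans _ _ _ (Rsum_le _ (fun k _ => pt k))).
  by rewrite big_split -!Rsum_mull exchange_big; apply: Rle_refl.
have h1 : \Rsum_(1 <= d < P) \Rsum_(0 <= k < D) (Cmod (Wk k) ^ 4 * Cmod (Vk k d) ^ 2) <=
   INR D * (INR P ^ 2 * cnt 0 + INR P ^ 4 * tm ^ 2).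
  apply: (Rle_trans _ (\Rsum_(1 <= d < P) (INR D * \Rsum_(x <- prs) cnt (tri d x.1 x.2)))).
    by apply: Rsum_le_nat => d hd _; apply: VW_sum; lia.
  rewrite -Rsum_mull; apply: Rmult_le_compat_l; [lra | exact: cnt_tri_sum].
have hc := cnt0_le; rewrite hW4.
have hc2 : cnt 0 <= 2 * INR P ^ 2 * tm ^ 2.
  apply: (Rle_trans _ _ _ hc).
  have -> : 2 * INR P ^ 2 * tm ^ 2 = INR P ^ 2 * (2 * tm ^ 2) by ring.
  by apply: Rmult_le_compat_l; [exact: pow2_ge_0 | nra].
set q := \Rsum_(1 <= d < P) _ in h1 *.
have h2 : 32 * INR P * q <= 32 * INR P * (INR D * (INR P ^ 2 * (2 * INR P ^ 2 * tm ^ 2) + INR P ^ 4 * tm ^ 2)).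
  apply: Rmult_le_compat_l; first lra; apply: (Rle_trans _ _ _ h1).
  apply: Rmult_le_compat_l; first lra; apply: Rplus_le_compat_r.
  by apply: Rmult_le_compat_l; [exact: pow2_ge_0 | ].
have h3 : 8 * INR P ^ 2 * (INR D * cnt 0) <= 8 * INR P ^ 2 * (INR D * (2 * INR P ^ 2 * tm ^ 2)).
  apply: Rmult_le_compat_l; first nra; apply: Rmult_le_compat_l; lra.
have h4 : INR D * tm ^ 2 * INR P ^ 4 * 1 <= INR D * tm ^ 2 * INR P ^ 4 * INR P.
  apply: Rmult_le_compat_l => //; apply: Rmult_le_pos; last by apply: pow_le; lra.
  by apply: Rmult_le_pos; [lra | exact: pow2_ge_0].
nra.
Qed.

End Hua.

Lemma INR_expn n k : INR (n ^ k)%N = INR n ^ k.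
Proof. by elim: k => // k IH; rewrite expnS mult_INR IH. Qed.

Definition cubeW (P : nat) (x : R) : C := \Csum_(1 <= z < P.+1) e (x * INR z ^ 3).

Lemma hua_moment eps : 0 < eps -> exists K, 0 < K /\ forall P D, (0 < P)%N -> (20 * P ^ 3 < D)%N ->
  \Rsum_(0 <= k < D) Cmod (cubeW P (INR k / INR D)) ^ 8 <= K * INR D * INR P `^ (5 + eps).
Proof.
move=> eps0; have [C [C1 hC]] := @tau_le (eps / 6) ltac:(lra); have C0 : 0 < C by lra.
pose M := 1 + C * 10 `^ (eps / 6).
have M1 : 1 <= M by have := Rmult_le_pos _ _ (Rlt_le _ _ C0) (pw_ge0 10 (eps / 6)); rewrite /M; lra.
exists (112 * M ^ 2); split; first by nra.
move=> P D P0 hD; have hP := INR_ge1 P0; have hD0 : 1 <= INR D by apply: INR_ge1; lia.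
(* The divisor bound with exponent eps/6 at integers up to 10 P^3 gives P^(eps/2), and [tm] enters
   squared. *)
pose tm := M * INR P `^ (eps / 2).
have hpe := @pw_ge1 (INR P) (eps / 2) hP ltac:(lra).
have tm1 : 1 <= tm by rewrite /tm; nra.
have ht w : (0 < w <= 10 * P ^ 3)%N -> tau w <= tm.
  move=> hw; apply: (Rle_trans _ (C * INR w `^ (eps / 6))); first by apply: hC; lia.
  have hb : INR w `^ (eps / 6) <= 10 `^ (eps / 6) * INR P `^ (eps / 2).
    apply: (Rle_trans _ ((10 * INR P ^ 3) `^ (eps / 6))).
      apply: pw_base; last lra; split; first by apply: INR_gt0; lia.
      have -> : 10 * INR P ^ 3 = INR (10 * P ^ 3).
        by rewrite mult_INR INR_expn; congr (_ * _); rewrite /=; ring.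
      by apply: INR_le; lia.
    rewrite pw_mulb; [|lra|apply: pow_lt; lra].
    rewrite -(pw_nat 3); last lra.
    by rewrite pw_pw; right; congr (_ * _ `^ _); rewrite /=; field.
  have := Rmult_le_compat_l _ _ _ (Rlt_le _ _ C0) hb; rewrite /tm /M.
  nra.
have h := eighth_moment P0 hD tm1 ht.
apply: (Rle_trans _ _ _ _ (Rle_trans _ _ _ h _)).
  right; apply: eq_bigr => k _; congr (Cmod _ ^ 8); apply: eq_bigr => z _.
  rewrite /ek /cubeZ -INR_IZR_INZ INR_expn; congr e; rewrite /Rdiv; ring.
right; rewrite pw_add /tm Rpow_mult_distr pw_pow.
have -> : INR P `^ 5 = INR P ^ 5 by rewrite -pw_nat; [congr (_ `^ _); rewrite /=; ring | lra].
have -> : eps / 2 * INR 2 = eps by rewrite /=; field.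
ring.
Qed.

(** * A bilinear moment inequality *)

(** Up to l = k the range is merely reversed; beyond it the arguments are negative and are moved up
    by one period. *)
Lemma periodic_shift_sum (D k : nat) (f : R -> R) : (forall x, f (x + 1) = f x) -> (k < D)%N ->
  \Rsum_(0 <= l < D) f ((INR k - INR l) / INR D) = \Rsum_(0 <= j < D) f (INR j / INR D).
Proof.
move=> hf kD; have hD : 0 < INR D by apply: INR_gt0; lia.
rewrite (big_cat_nat (n := k.+1)) /=; try lia.
rewrite [RHS](big_cat_nat (n := k.+1)) /=; try lia.
congr (_ + _).
  rewrite big_nat_rev; apply: eq_big_nat => l hl.
  by rewrite -INRB; [congr (f (INR _ / _)); lia | lia].
rewrite big_nat_rev; apply: eq_big_nat => l hl.
rewrite -hf; congr f; rewrite -(Rinv_r (INR D)); last lra.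
have -> : INR l = INR k + INR D - INR (k.+1 + D - l.+1).
  by rewrite -plus_INR -INRB; [congr INR; lia | lia].
rewrite /Rdiv; ring.
Qed.

Lemma cubeW_periodic P x : cubeW P (x + 1) = cubeW P x.
Proof.
apply: eq_bigr => z _; rewrite -(e_addZ (x * INR z ^ 3) (Z.of_nat (z ^ 3))) -INR_IZR_INZ INR_expn.
by congr e; ring.
Qed.

Lemma cubeW_opp P x : Cmod (cubeW P (- x)) = Cmod (cubeW P x).
Proof.
rewrite -[RHS]Cmod_conj /cubeW Csum_conj; congr Cmod; apply: eq_bigr => z _.
by rewrite e_conj; congr e; ring.
Qed.

Lemma eighth_power_le y t : 0 <= y -> 0 < t -> y <= t + y ^ 8 / t ^ 7.
Proof.
move=> y0 t0; have h7 : 0 < t ^ 7 by apply: pow_lt.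
have h8 : 0 <= y ^ 8 by apply: pow_le.
case: (Rle_dec y t) => h.
  by have : 0 <= y ^ 8 / t ^ 7 by [apply: Rdiv_le_0_compat]; lra.
have : y <= y ^ 8 / t ^ 7; last lra.
apply: (Rmult_le_reg_r (t ^ 7)) => //.
have -> : y ^ 8 / t ^ 7 * t ^ 7 = y * y ^ 7 by field; lra.
by apply: Rmult_le_compat_l => //; apply: pow_incr; lra.
Qed.

(* Cauchy-Schwarz over the primes, extended by positivity to all integers,
   turns the sum into a bilinear form in G whose kernel is a Weyl sum. *)
Lemma bilinear_moment (P D : nat) (u : nat -> R) (A E t : R) (G : nat -> C) :
  (0 < D)%N -> (forall z, 0 <= u z) -> \Rsum_(1 <= z < P.+1) u z <= A ->
  (forall x, Cmod (\Csum_(1 <= z < P.+1) (RtoC (u z) * e (x * INR z ^ 3)) - cubeW P x) <= E) ->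
  0 < t ->
  Cmod (\Csum_(0 <= k < D) (G k * \Csum_(1 <= p < P.+1 | prime p) (RtoC (u p) * e (INR k / INR D * INR p ^ 3)))) ^ 2 <=
  A * ((E + t) * (\Rsum_(0 <= k < D) Cmod (G k)) ^ 2 +
       / t ^ 7 * (\Rsum_(0 <= k < D) Cmod (G k) ^ 2) * \Rsum_(0 <= k < D) Cmod (cubeW P (INR k / INR D)) ^ 8).
Proof.
move=> D0 u0 hA hE t0; have hD : 0 < INR D by apply: INR_gt0.
pose H z := \Csum_(0 <= k < D) (G k * e (INR k / INR D * INR z ^ 3)).
have -> : \Csum_(0 <= k < D) (G k * \Csum_(1 <= p < P.+1 | prime p) (RtoC (u p) * e (INR k / INR D * INR p ^ 3))) =
    \Csum_(1 <= p < P.+1 | prime p) (RtoC (sqrt (u p)) * (RtoC (sqrt (u p)) * H p)).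
  under eq_bigr => k _ do rewrite Csum_mull.
  rewrite exchange_big; apply: eq_bigr => p _.
  rewrite Cmult_assoc -RtoC_mult sqrt_sqrt // Csum_mull; apply: eq_bigr => k _.
  ring.
apply: (Rle_trans _ _ _ (Cauchy_C _ _ _ _)).
have hs p : Cmod (RtoC (sqrt (u p))) ^ 2 = u p.
  by rewrite Cmod_R pow2_abs -Rsqr_pow2 Rsqr_sqrt.
rewrite (eq_bigr _ (fun p _ => hs p)).
have hs2 p : Cmod (RtoC (sqrt (u p)) * H p) ^ 2 = u p * Cmod (H p) ^ 2.
  by rewrite Cmod_mult Rpow_mult_distr hs.
rewrite (eq_bigr _ (fun p _ => hs2 p)).
have f0 z : 0 <= u z * Cmod (H z) ^ 2 by apply: Rmult_le_pos; [ | exact: pow2_ge_0].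
apply: Rmult_le_compat.
- by apply: Rsum_ge0 => p _.
- by apply: Rsum_ge0 => p _.
- apply: (Rle_trans _ _ _ _ hA); apply: Rsum_pred_le => //.
apply: (Rle_trans _ (\Rsum_(1 <= z < P.+1) (u z * Cmod (H z) ^ 2))).
  exact: Rsum_pred_le.
pose dd k l := (INR k - INR l) / INR D.
pose U x := \Csum_(1 <= z < P.+1) (RtoC (u z) * e (x * INR z ^ 3)).
have hU : \Rsum_(1 <= z < P.+1) (u z * Cmod (H z) ^ 2) <=
    \Rsum_(0 <= k < D) \Rsum_(0 <= l < D) (Cmod (G k) * Cmod (G l) * Cmod (U (dd k l))).
  apply: (Rle_trans _ (Cmod (RtoC (\Rsum_(1 <= z < P.+1) (u z * Cmod (H z) ^ 2))))).
    by rewrite Cmod_R; exact: Rle_abs.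
  have -> : RtoC (\Rsum_(1 <= z < P.+1) (u z * Cmod (H z) ^ 2)) =
    \Csum_(0 <= k < D) \Csum_(0 <= l < D) (G k * Cconj (G l) * U (dd k l)).
    rewrite Csum_RtoC.
    transitivity (\Csum_(1 <= z < P.+1) \Csum_(0 <= k < D) \Csum_(0 <= l < D)
        (G k * Cconj (G l) * (RtoC (u z) * e (dd k l * INR z ^ 3)))).
      apply: eq_bigr => z _; rewrite RtoC_mult Cmod_sqr_sum Csum_mull; apply: eq_bigr => k _.
      rewrite Csum_mull; apply: eq_bigr => l _.
      rewrite Cmult_conj e_conj.
      have -> : dd k l * INR z ^ 3 = INR k / INR D * INR z ^ 3 + - (INR l / INR D * INR z ^ 3).
        by rewrite /dd /Rdiv; ring.
      rewrite e_add; ring.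
    rewrite exchange_big; apply: eq_bigr => k _; rewrite exchange_big; apply: eq_bigr => l _.
    by rewrite /U Csum_mull.
  apply: (Rle_trans _ _ _ (Cmod_sum _ _ _)); apply: Rsum_le => k _.
  apply: (Rle_trans _ _ _ (Cmod_sum _ _ _)); apply: Rsum_le => l _.
  by rewrite !Cmod_mult Cmod_conj; apply: Rle_refl.
apply: (Rle_trans _ _ _ hU).
pose w8 x := Cmod (cubeW P x) ^ 8.
have hw0 x : 0 <= w8 x by apply: pow_le; exact: Cmod_ge_0.
have h7 : 0 < / t ^ 7 by apply: Rinv_0_lt_compat; apply: pow_lt.
(* In the part with the eighth power the arithmetic-geometric mean separates [G k] from [G l]; the
   sum over the index that no longer occurs then runs over a full period of the kernel. *)
have pt k l : Cmod (G k) * Cmod (G l) * Cmod (U (dd k l)) <=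
   (E + t) * (Cmod (G k) * Cmod (G l)) +
   (/ t ^ 7 / 2 * (Cmod (G k) ^ 2 * w8 (dd k l)) +
    / t ^ 7 / 2 * (Cmod (G l) ^ 2 * w8 (dd k l))).
  set x := dd k l.
  have h1 : Cmod (U x) <= E + t + / t ^ 7 * w8 x.
    have -> : U x = ((U x - cubeW P x) + cubeW P x)%C by ring.
    apply: (Rle_trans _ _ _ (Cmod_triangle _ _)).
    have := hE x; have := eighth_power_le (Cmod_ge_0 (cubeW P x)) t0; rewrite /w8 /Rdiv -/(U x); lra.
  have g1 := Cmod_ge_0 (G k); have g2 := Cmod_ge_0 (G l).
  have g3 := Rmult_le_compat_l _ _ _ (Rmult_le_pos _ _ g1 g2) h1.
  have g4 := Rmult_le_compat_l _ _ _ (Rmult_le_pos _ _ (Rlt_le _ _ h7) (hw0 x)) (pow2_ge_0 (Cmod (G k) - Cmod (G l))).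
  by lra.
apply: (Rle_trans _ _ _ (Rsum_le _ (fun k _ => Rsum_le _ (fun l _ => pt k l)))).
have -> : \Rsum_(0 <= k < D) \Rsum_(0 <= l < D)
   ((E + t) * (Cmod (G k) * Cmod (G l)) +
   (/ t ^ 7 / 2 * (Cmod (G k) ^ 2 * w8 (dd k l)) +
    / t ^ 7 / 2 * (Cmod (G l) ^ 2 * w8 (dd k l)))) =
   (E + t) * (\Rsum_(0 <= k < D) Cmod (G k) * \Rsum_(0 <= l < D) Cmod (G l)) +
   (/ t ^ 7 / 2 * \Rsum_(0 <= k < D) (Cmod (G k) ^ 2 * \Rsum_(0 <= l < D) w8 (dd k l)) +
    / t ^ 7 / 2 * \Rsum_(0 <= l < D) (Cmod (G l) ^ 2 * \Rsum_(0 <= k < D) w8 (dd k l))).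
  have -> : \Rsum_(0 <= l < D) (Cmod (G l) ^ 2 * \Rsum_(0 <= k < D) w8 (dd k l)) =
      \Rsum_(0 <= k < D) \Rsum_(0 <= l < D) (Cmod (G l) ^ 2 * w8 (dd k l)).
    by rewrite exchange_big; apply: eq_bigr => l _; rewrite Rsum_mull.
  rewrite Rsum_mulr !Rsum_mull -!big_split; apply: eq_bigr => k _.
  by rewrite !Rsum_mull -!big_split.
have hper x : w8 (x + 1) = w8 x by rewrite /w8 cubeW_periodic.
have heven x : w8 (- x) = w8 x by rewrite /w8 cubeW_opp.
have e1 : \Rsum_(0 <= k < D) (Cmod (G k) ^ 2 * \Rsum_(0 <= l < D) w8 (dd k l)) =
   \Rsum_(0 <= k < D) Cmod (G k) ^ 2 * \Rsum_(0 <= k < D) w8 (INR k / INR D).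
  by rewrite Rsum_mulr; apply: eq_big_nat => k hk; rewrite /dd periodic_shift_sum //; lia.
have e2 : \Rsum_(0 <= l < D) (Cmod (G l) ^ 2 * \Rsum_(0 <= k < D) w8 (dd k l)) =
   \Rsum_(0 <= k < D) Cmod (G k) ^ 2 * \Rsum_(0 <= k < D) w8 (INR k / INR D).
  rewrite Rsum_mulr; apply: eq_big_nat => l hl; congr (_ * _).
  rewrite -(@periodic_shift_sum D l w8 hper) //.
  by apply: eq_bigr => k _; rewrite -heven; congr w8; rewrite /dd /Rdiv; ring.
rewrite e1 e2 -/(w8 _); right; rewrite /w8; field; lra.
Qed.

(** * The cubic sum near rationals *)

Lemma Cmod_e_sub_lip x y : Cmod (e x - e y) <= 2 * PI * Rabs (y - x).
Proof.
have -> : (e x - e y = e x * (1 - e (y - x)))%C.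
  have -> : e y = (e x * e (y - x))%C by rewrite -e_add; congr e; ring.
  ring.
by rewrite Cmod_mult Cmod_e Rmult_1_l; exact: Cmod_1_sub_e_lip.
Qed.

Lemma cube_phase_variation (P : nat) (be : R) : (0 < P)%N ->
  \Rsum_(1 <= n < P) Cmod (e (be * INR n ^ 3) - e (be * INR n.+1 ^ 3)) <= 2 * PI * Rabs be * INR P ^ 3.
Proof.
move=> P0; have hp := PI_RGT_0; have hb := Rabs_pos be.
apply: (Rle_trans _ (2 * PI * Rabs be * \Rsum_(1 <= n < P) (INR n.+1 ^ 3 - INR n ^ 3))).
  rewrite Rsum_mull; apply: Rsum_le => n _.
  apply: (Rle_trans _ _ _ (Cmod_e_sub_lip _ _)).
  rewrite -Rmult_minus_distr_l Rabs_mult (Rabs_pos_eq (_ - _)); first by rewrite Rmult_assoc; lra.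
  have := pos_INR n; rewrite S_INR => hn.
  have -> : (INR n + 1) ^ 3 - INR n ^ 3 = 3 * INR n ^ 2 + 3 * INR n + 1 by ring.
  nra.
apply: Rmult_le_compat_l; first by nra.
have -> : \Rsum_(1 <= n < P) (INR n.+1 ^ 3 - INR n ^ 3) = INR P ^ 3 - 1.
  case: P P0 => // P _; elim: P => [|P IH]; first by rewrite big_geq //=; ring.
  by rewrite big_nat_recr // -[LHS]/(_ + _) IH; ring.
lra.
Qed.

(** p^3 modulo q depends only on p modulo q, and the sum over [h] detects the class of p. The cubic
    phase at a / q becomes a combination of linear phases in p. *)
Lemma cube_character_expansion (a : Z) (q p : nat) : (0 < q)%N ->
  e (IZR a / INR q * INR p ^ 3) =
  \Csum_(0 <= r < q) \Csum_(0 <= h < q)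
    (RtoC (/ INR q) * e (IZR a / INR q * INR r ^ 3) * e (- (INR h / INR q * INR r)) * e (INR h / INR q * INR p)).
Proof.
move=> q0; have hq := INR_gt0 q0.
have inner r : \Csum_(0 <= h < q)
    (RtoC (/ INR q) * e (IZR a / INR q * INR r ^ 3) * e (- (INR h / INR q * INR r)) * e (INR h / INR q * INR p)) =
    (RtoC (/ INR q) * e (IZR a / INR q * INR r ^ 3) *
      RtoC (if ((Z.of_nat p - Z.of_nat r) mod Z.of_nat q =? 0)%Z then INR q else 0))%C.
  rewrite -orth // Csum_mull; apply: eq_bigr => h _.
  rewrite -Cmult_assoc -e_add minus_IZR -!INR_IZR_INZ; congr (_ * e _)%C.
  by field; lra.
rewrite (eq_bigr _ (fun r _ => inner r)).
rewrite (bigD1_seq (p %% q)%N) ?mem_index_iota ?iota_uniq ?ltn_mod // -[RHS]/(Cplus _ _).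
rewrite [X in (_ + X)%C](_ : _ = RtoC 0).
  rewrite Cplus_0_r.
  have -> : ((Z.of_nat p - Z.of_nat (p %% q)) mod Z.of_nat q =? 0)%Z = true.
    apply/Z.eqb_spec; have {1}-> : p = (p %/ q * q + p %% q)%N by exact: divn_eq.
    have -> : (Z.of_nat (p %/ q * q + p %% q) - Z.of_nat (p %% q) = Z.of_nat (p %/ q) * Z.of_nat q)%Z by lia.
    by apply: Z.mod_mul; lia.
  have -> : e (IZR a / INR q * INR p ^ 3) = e (IZR a / INR q * INR (p %% q) ^ 3).
    have hle : (p %% q <= p)%N by exact: leq_mod.
    have [m hm] : exists m, (p ^ 3 = (p %% q) ^ 3 + m * q)%N.
      have : (q %| p ^ 3 - (p %% q) ^ 3)%N.
        rewrite subn_exp dvdn_mulr //.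
        by rewrite {1}(divn_eq p q) addnK dvdn_mull.
      move/dvdnP => [m hm]; exists m; rewrite -hm subnKC //.
      by rewrite leq_exp2r.
    rewrite -!INR_expn hm plus_INR (mult_INR m).
    rewrite -(e_addZ (IZR a / INR q * INR ((p %% q) ^ 3)) (a * Z.of_nat m)) mult_IZR -INR_IZR_INZ.
    by congr e; field; lra.
  have h : (RtoC (/ INR q) * RtoC (INR q) = 1)%C by rewrite -RtoC_mult Rinv_l //; lra.
  set w := e _; transitivity (w * (RtoC (/ INR q) * RtoC (INR q)))%C; [by rewrite h Cmult_1_r | ring].
rewrite big_seq_cond big1 // => r /andP[].
rewrite mem_index_iota => hr hne.
rewrite (_ : (_ =? 0)%Z = false) ?Cmult_0_r //.
apply/Z.eqb_neq => /Z.mod_divide => /(_ ltac:(lia)) [m hm].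
move/negP: hne; apply; apply/eqP.
have h1 := divn_eq p q; have h2 : (p %% q < q)%N by rewrite ltn_mod.
move: h1 h2; move: (p %/ q)%N (p %% q)%N => d s h1 h2.
have h3 : ((m - Z.of_nat d) * Z.of_nat q = Z.of_nat s - Z.of_nat r)%Z by lia.
case: (Z.lt_trichotomy (m - Z.of_nat d) 0) => [h|[h|h]]; nia.
Qed.

(** The expansion has q^2 terms of weight 1 / q, hence the factor [q]; partial summation removes
    e(be n^3) at the cost of its total variation. *)
Lemma major_arc_bound (c : nat -> R) (P q : nat) (a : Z) (B be : R) : (0 < P)%N -> (0 < q)%N -> 0 <= B ->
  (forall al x, (x <= P)%N -> Cmod (\Csum_(1 <= p < x.+1 | prime p) (RtoC (c p) * e (al * INR p))) <= B) ->
  Cmod (\Csum_(1 <= p < P.+1 | prime p) (RtoC (c p) * e ((IZR a / INR q + be) * INR p ^ 3))) <=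
  INR q * B * (1 + 2 * PI * Rabs be * INR P ^ 3).
Proof.
move=> P0 q0 B0 hc; have hq := INR_gt0 q0.
have -> : \Csum_(1 <= p < P.+1 | prime p) (RtoC (c p) * e ((IZR a / INR q + be) * INR p ^ 3)) =
  \Csum_(0 <= r < q) \Csum_(0 <= h < q)
    (RtoC (/ INR q) * e (IZR a / INR q * INR r ^ 3) * e (- (INR h / INR q * INR r)) *
     \Csum_(1 <= p < P.+1) (e (be * INR p ^ 3) * (if prime p then RtoC (c p) * e (INR h / INR q * INR p) else RtoC 0))).
  transitivity (\Csum_(1 <= p < P.+1 | prime p) \Csum_(0 <= r < q) \Csum_(0 <= h < q)
    ((RtoC (/ INR q) * e (IZR a / INR q * INR r ^ 3) * e (- (INR h / INR q * INR r))) *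
     (e (be * INR p ^ 3) * (RtoC (c p) * e (INR h / INR q * INR p))))).
    apply: eq_bigr => p _; rewrite Rmult_plus_distr_r e_add (cube_character_expansion a p q0) Csum_mulr Csum_mull.
    apply: eq_bigr => r _; rewrite Csum_mulr Csum_mull; apply: eq_bigr => h _; ring.
  rewrite exchange_big; apply: eq_bigr => r _; rewrite exchange_big; apply: eq_bigr => h _.
  rewrite -Csum_mull big_mkcond; congr (_ * _)%C; apply: eq_bigr => p _.
  by case: (prime p); rewrite // Cmult_0_r.
have hv : 0 <= 1 + 2 * PI * Rabs be * INR P ^ 3.
  have := PI_RGT_0; have := Rabs_pos be; have := pow_le _ 3 (pos_INR P).
  move=> h1 h2 h3; have := Rmult_le_pos _ _ (Rmult_le_pos _ _ (Rlt_le _ _ h3) h2) h1; lra.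
have inner h : Cmod (\Csum_(1 <= p < P.+1) (e (be * INR p ^ 3) *
     (if prime p then RtoC (c p) * e (INR h / INR q * INR p) else RtoC 0))) <=
     B * (1 + 2 * PI * Rabs be * INR P ^ 3).
  apply: (Rle_trans _ _ _ (@abel _ _ P.+1 B (ltn0Sn _) B0 _)).
    move=> E' hE'; rewrite -big_mkcond.
    have := hc (INR h / INR q) E'.-1 ltac:(lia); by rewrite prednK //; lia.
  rewrite /= Cmod_e; apply: Rmult_le_compat_l => //; apply: Rplus_le_compat_l.
  exact: cube_phase_variation.
apply: (Rle_trans _ (INR (q - 0) * (INR (q - 0) * (/ INR q * (B * (1 + 2 * PI * Rabs be * INR P ^ 3)))))).
  have h0 : 0 <= / INR q * (B * (1 + 2 * PI * Rabs be * INR P ^ 3)).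
    apply: Rmult_le_pos; first by left; apply: Rinv_0_lt_compat.
    exact: Rmult_le_pos.
  apply: Cmod_sum_const => [|r _ _]; first by apply: Rmult_le_pos; [exact: pos_INR | ].
  apply: Cmod_sum_const => [|h _ _] //.
  rewrite !Cmod_mult !Cmod_e Cmod_R !Rmult_1_r Rabs_pos_eq; last by left; apply: Rinv_0_lt_compat.
  by apply: Rmult_le_compat_l; [left; apply: Rinv_0_lt_compat | exact: inner].
rewrite subn0; right; field; lra.
Qed.

(** * The discrete circle method *)

(** Since [psw 1] is 1 at positive integers, the parameter [g = 1] gives the unweighted sum, and T
    and S are instances of one definition. *)
Definition W1 (g : R) (N : nat) (x : R) : C :=
  \Csum_(1 <= p < N.+1 | prime p) (RtoC (psw g p) * e (x * INR p)).
Definition W3 (g : R) (P : nat) (x : R) : C :=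
  \Csum_(1 <= p < P.+1 | prime p) (RtoC (psw g p) * e (x * INR p ^ 3)).

Lemma W1_moment (g : R) (N D : nat) : 0 < g <= 1 -> (0 < N)%N -> (N < D)%N ->
  \Rsum_(0 <= k < D) Cmod (W1 g N (INR k / INR D)) ^ 2 <= INR D * (4 / g ^ 2 * INR N `^ (2 - g)).
Proof.
move=> hg N0 ND; have hN := INR_ge1 N0.
pose c p := if prime p then RtoC (psw g p) else RtoC 0.
have -> : \Rsum_(0 <= k < D) Cmod (W1 g N (INR k / INR D)) ^ 2 =
    \Rsum_(0 <= k < D) Cmod (\Csum_(1 <= n < N.+1) (c n * e (INR k / INR D * INR n))) ^ 2.
  apply: eq_bigr => k _; congr (Cmod _ ^ 2); rewrite /W1 big_mkcond; apply: eq_bigr => p _.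
  by rewrite /c; case: (prime p); rewrite ?Cmult_0_l.
rewrite parseval //; last lia.
apply: Rmult_le_compat_l; first exact: pos_INR.
apply: (Rle_trans _ (\Rsum_(1 <= n < N.+1) psw g n ^ 2)).
  apply: Rsum_le => n _; rewrite /c; case: (prime n); rewrite Cmod_R pow2_abs; first lra.
  have := pow2_ge_0 (psw g n); lra.
apply: (Rle_trans _ _ _ (psw_sq_sum hg (ltn0Sn N))).
have hi : 0 < / g ^ 2 by apply: Rinv_0_lt_compat; apply: pow_lt; lra.
have -> : 4 / g ^ 2 * INR N `^ (2 - g) = / g ^ 2 * (4 * INR N `^ (2 - g)) by rewrite /Rdiv; ring.
apply: Rmult_le_compat_l; first lra.
apply: (Rle_trans _ ((2 * INR N) `^ (2 - g))).
  by apply: pw_base; rewrite ?S_INR; lra.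
rewrite pw_mulb; try lra; apply: Rmult_le_compat_r; first exact: pw_ge0.
apply: (Rle_trans _ (2 `^ 2)); first by apply: pw_le; lra.
by rewrite -[X in _ `^ X]/(INR 2) pw_nat /=; lra.
Qed.

Lemma W1_diff (g de : R) : 973 / 1000 <= g <= 1 -> 0 < de -> 1 - g + 2 * de < 49 / 1000 ->
  3 * (1 - g + de) < 85 / 1000 -> exists K, 0 < K /\
  forall N x, (0 < N)%N -> Cmod (W1 g N x - W1 1 N x) <= K * INR N `^ (1 - de).
Proof.
move=> h1 h2 h3 h4; have [K [K0 hK]] := ps_prime_sum h1 h2 h3 h4.
exists K; split => // N x N0; have := hK N x N N0 (leqnn N).
rewrite /W1 -CsumB; congr (Cmod _ <= _); rewrite [RHS]big_nat_cond [LHS]big_nat_cond.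
apply: eq_bigr => p /andP[hp _]; rewrite psw_1; last lia.
rewrite RtoC_minus; ring.
Qed.

(** P and the cube root of N agree up to a factor 2. For negative [s] it is the upper bound for N
    that counts, hence [Rabs s] in the constant. *)
Lemma cube_root_pw (s : R) : exists C, 0 < C /\ forall N P, (0 < P)%N ->
  INR P ^ 3 <= INR N <= 8 * INR P ^ 3 -> INR P `^ s <= C * INR N `^ (s / 3).
Proof.
exists (8 `^ (Rabs s / 3)); split; first exact: pw_gt0.
move=> N P P0 hNP; have hP := INR_ge1 P0.
have hP3 : 0 < INR P ^ 3 by apply: pow_lt; lra.
have -> : INR P `^ s = (INR P ^ 3) `^ (s / 3).
  rewrite -(pw_nat 3); last lra.
  by rewrite pw_pw; congr (_ `^ _); rewrite /=; field.
case: (Rle_dec 0 s) => hs.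
  rewrite -[X in X <= _]Rmult_1_l; apply: Rmult_le_compat; try lra; try exact: pw_ge0.
    by apply: pw_ge1; [lra | rewrite Rabs_pos_eq; lra].
  by apply: pw_base; lra.
rewrite Rabs_left; last lra.
have -> : 8 `^ (- s / 3) = (/ 8) `^ (s / 3).
  have -> : / 8 = 8 `^ (- 1) by rewrite pw_opp pw_1; lra.
  by rewrite pw_pw; congr (_ `^ _); field.
rewrite -pw_mulb; try lra.
by apply: pw_baseN; lra.
Qed.

(** [bilinear_moment] with threshold [t = P^(1 - ka)], the size of the error in comparing weighted
    and complete cubic sums. There [A] has order P and the eighth moment order D P^(5 + ep), so the
    second term carries P t^(-7) P^(5 + ep) = P^(-1 + 7 ka + ep). *)
Lemma cube_bilinear (g ka ep : R) : 973 / 1000 <= g <= 1 -> 0 < ka -> 1 - g + 2 * ka < 55 / 1000 ->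
  3 * (1 - g + ka) < 105 / 1000 -> 0 < ep -> exists K, 0 < K /\
  forall (N P D : nat) (G : nat -> C) (X Y : R), (0 < P)%N -> INR P ^ 3 <= INR N <= 8 * INR P ^ 3 ->
  (20 * N < D)%N -> 0 <= X -> 0 <= Y ->
  \Rsum_(0 <= k < D) Cmod (G k) <= INR D * X -> \Rsum_(0 <= k < D) Cmod (G k) ^ 2 <= INR D * Y ->
  Cmod (\Csum_(0 <= k < D) (G k * W3 g P (INR k / INR D))) ^ 2 <=
  K * INR D ^ 2 * (INR N `^ (2 / 3 - ka / 3) * X ^ 2 + INR N `^ (- (1 / 3) + (7 * ka + ep) / 3) * Y).
Proof.
move=> hg ka0 h1 h2 ep0.
have [KE [KE0 hE]] := ps_cube_sum hg ka0 h1 h2.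
have [KH [KH0 hH]] := hua_moment ep0.
have [C1 [C10 hC1]] := cube_root_pw (2 - ka).
have [C2 [C20 hC2]] := cube_root_pw (- 1 + 7 * ka + ep).
pose K := 2 / g * (KE + 1) * C1 + 2 / g * KH * C2.
have hg0 : 0 < 2 / g by apply: Rdiv_lt_0_compat; lra.
have K1 : 0 <= 2 / g * (KE + 1) * C1 by do 2!(apply: Rmult_le_pos; try lra).
have K2 : 0 < 2 / g * KH * C2 by do 2!(apply: Rmult_lt_0_compat; try lra).
exists K; split; first by rewrite /K; lra.
move=> N P D G X Y P0 hNP hD X0 Y0 hX hY.
have hP := INR_ge1 P0.
have D0 : (0 < D)%N by lia.
have hDr := INR_ge1 D0.
have hPD : (20 * P ^ 3 < D)%N.
  have : (P ^ 3 <= N)%N by apply: le_of_INR; rewrite INR_expn; lra.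
  move: (P ^ 3)%N => m; lia.
have hA : \Rsum_(1 <= z < P.+1) psw g z <= 2 / g * INR P.
  apply: (Rle_trans _ _ _ (psw_sum (g := g) ltac:(lra) (ltn0Sn P))).
  rewrite S_INR /Rdiv Rmult_comm (Rmult_comm 2) Rmult_assoc.
  by apply: Rmult_le_compat_l; [left; apply: Rinv_0_lt_compat; lra | lra].
have hEP x : Cmod (\Csum_(1 <= z < P.+1) (RtoC (psw g z) * e (x * INR z ^ 3)) - cubeW P x) <= KE * INR P `^ (1 - ka).
  have := hE P x P P0 (leqnn P); rewrite /cubeW -CsumB; congr (Cmod _ <= _).
  apply: eq_bigr => z _; rewrite RtoC_minus; ring.
have hu z : 0 <= psw g z by apply: psw_ge0; lra.
have := @bilinear_moment P D (psw g) _ _ (INR P `^ (1 - ka)) G D0 hu hA hEP (pw_gt0 _ _).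
rewrite -/(W3 _ _ _) => hb; apply: (Rle_trans _ _ _ hb).
have s1 : 0 <= \Rsum_(0 <= k < D) Cmod (G k) by apply: Rsum_ge0 => k _; exact: Cmod_ge_0.
have s2 : 0 <= \Rsum_(0 <= k < D) Cmod (G k) ^ 2 by apply: Rsum_ge0 => k _; exact: pow2_ge_0.
have hW := hH P D P0 hPD.
have s3 : 0 <= \Rsum_(0 <= k < D) Cmod (cubeW P (INR k / INR D)) ^ 8.
  by apply: Rsum_ge0 => k _; apply: pow_le; exact: Cmod_ge_0.
move: hX hY hW s1 s2 s3.
set A1 := \Rsum_(0 <= k < D) Cmod (G k); set A2 := \Rsum_(0 <= k < D) Cmod (G k) ^ 2.
set A3 := \Rsum_(0 <= k < D) _ => hX hY hW s1 s2 s3 {hb}.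
have i7 : / (INR P `^ (1 - ka)) ^ 7 = INR P `^ (- (7 * (1 - ka))).
  by rewrite pw_opp pw_pow; congr (/ (_ `^ _)); rewrite /=; ring.
have b1 : (KE * INR P `^ (1 - ka) + INR P `^ (1 - ka)) * A1 ^ 2 <=
    (KE + 1) * INR P `^ (1 - ka) * (INR D ^ 2 * X ^ 2).
  have -> : KE * INR P `^ (1 - ka) + INR P `^ (1 - ka) = (KE + 1) * INR P `^ (1 - ka) by ring.
  apply: Rmult_le_compat_l; first by apply: Rmult_le_pos; [lra | exact: pw_ge0].
  by rewrite -Rpow_mult_distr; apply: pow_incr.
have b2 : / (INR P `^ (1 - ka)) ^ 7 * A2 * A3 <=
    INR P `^ (- (7 * (1 - ka))) * (INR D * Y) * (KH * INR D * INR P `^ (5 + ep)).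
  rewrite i7; apply: Rmult_le_compat => //.
    by apply: Rmult_le_pos => //; exact: pw_ge0.
  by apply: Rmult_le_compat_l => //; exact: pw_ge0.
have hA0 : 0 <= 2 / g * INR P by apply: Rmult_le_pos; lra.
apply: (Rle_trans _ _ _ (Rmult_le_compat_l _ _ _ hA0 (Rplus_le_compat _ _ _ _ b1 b2))).
have e1 : INR P * INR P `^ (1 - ka) = INR P `^ (2 - ka).
  by rewrite -{1}(pw_1 (x := INR P)); [rewrite -pw_add; congr (_ `^ _); ring | lra].
have e2 : INR P * (INR P `^ (- (7 * (1 - ka))) * INR P `^ (5 + ep)) = INR P `^ (- 1 + 7 * ka + ep).
  by rewrite -{1}(pw_1 (x := INR P)); [rewrite -!pw_add; congr (_ `^ _); ring | lra].
have c1 := hC1 N P P0 hNP; have c2 := hC2 N P P0 hNP.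
have e3 : INR N `^ ((2 - ka) / 3) = INR N `^ (2 / 3 - ka / 3) by congr (_ `^ _); field.
have e4 : INR N `^ ((- 1 + 7 * ka + ep) / 3) = INR N `^ (- (1 / 3) + (7 * ka + ep) / 3) by congr (_ `^ _); field.
rewrite e3 in c1; rewrite e4 in c2.
have -> : 2 / g * INR P * ((KE + 1) * INR P `^ (1 - ka) * (INR D ^ 2 * X ^ 2) +
   INR P `^ (- (7 * (1 - ka))) * (INR D * Y) * (KH * INR D * INR P `^ (5 + ep))) =
   INR D ^ 2 * (2 / g * (KE + 1) * X ^ 2 * (INR P * INR P `^ (1 - ka)) +
     2 / g * KH * Y * (INR P * (INR P `^ (- (7 * (1 - ka))) * INR P `^ (5 + ep)))) by ring.
rewrite e1 e2.
have d1 : 2 / g * (KE + 1) * X ^ 2 * INR P `^ (2 - ka) <= 2 / g * (KE + 1) * X ^ 2 * (C1 * INR N `^ (2 / 3 - ka / 3)).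
  apply: Rmult_le_compat_l => //; apply: Rmult_le_pos; last exact: pow2_ge_0.
  by apply: Rmult_le_pos; lra.
have d2 : 2 / g * KH * Y * INR P `^ (- 1 + 7 * ka + ep) <= 2 / g * KH * Y * (C2 * INR N `^ (- (1 / 3) + (7 * ka + ep) / 3)).
  apply: Rmult_le_compat_l => //; apply: Rmult_le_pos => //.
  by apply: Rmult_le_pos; lra.
move: d1 d2; set n1 := INR N `^ _; set n2 := INR N `^ _ => d1 d2.
have n10 : 0 <= n1 by exact: pw_ge0.
have n20 : 0 <= n2 by exact: pw_ge0.
have D2 : 0 <= INR D ^ 2 by exact: pow2_ge_0.
apply: (Rle_trans _ _ _ (Rmult_le_compat_l _ _ _ D2 (Rplus_le_compat _ _ _ _ d1 d2))).
have -> : K * INR D ^ 2 * (n1 * X ^ 2 + n2 * Y) = INR D ^ 2 * (K * (n1 * X ^ 2 + n2 * Y)) by ring.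
apply: Rmult_le_compat_l => //.
have p1 : 0 <= 2 / g * KH * C2 * (n1 * X ^ 2).
  by apply: Rmult_le_pos; [lra | apply: Rmult_le_pos => //; exact: pow2_ge_0].
have p2 : 0 <= 2 / g * (KE + 1) * C1 * (n2 * Y).
  by apply: Rmult_le_pos; [lra | apply: Rmult_le_pos].
rewrite /K; lra.
Qed.

Lemma sqrt_bound (x K d z c : R) : 0 <= K -> 0 <= d -> x ^ 2 <= K * d ^ 2 * z `^ (2 * c) ->
  x <= (1 + K) * d * z `^ c.
Proof.
move=> K0 d0 h; apply: (@pow_le_reg 1).
  by apply: Rmult_le_pos; [apply: Rmult_le_pos; lra | exact: pw_ge0].
apply: (Rle_trans _ _ _ h).
rewrite !Rpow_mult_distr pw_pow.
have -> : c * INR 2 = 2 * c by rewrite /=; ring.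
apply: Rmult_le_compat_r; first exact: pw_ge0.
by apply: Rmult_le_compat_r; [exact: pow2_ge_0 | nra].
Qed.

(** Mean squares alone give X = N^(1 + a) for the first moment of the product, while the uniform
    bound for the difference of the W1 enters the second moment Y. With [ka = 6 a + s] the first
    term of [cube_bilinear] has exponent 8/3 - s/3; the second one does not exceed it exactly when
    [16 a + 3 s <= 2 de], for [h >= 1 - 2 a]. *)
Lemma linear_difference_term (g h g3 a de s : R) :
  973 / 1000 <= g <= 1 -> 0 < h <= 1 -> 973 / 1000 <= g3 <= 1 ->
  (1 - g) + (1 - h) <= 2 * a -> 0 < s ->
  0 < de -> 1 - g + 2 * de < 49 / 1000 -> 3 * (1 - g + de) < 85 / 1000 ->
  1 - g3 + 2 * (6 * a + s) < 55 / 1000 -> 3 * (1 - g3 + (6 * a + s)) < 105 / 1000 ->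
  16 * a + 3 * s <= 2 * de ->
  exists K, 0 < K /\ forall (N P D : nat) (ph : nat -> C), (0 < P)%N -> INR P ^ 3 <= INR N <= 8 * INR P ^ 3 ->
  (20 * N < D)%N -> (forall k, Cmod (ph k) <= 1) ->
  Cmod (\Csum_(0 <= k < D) ((W1 g N (INR k / INR D) - W1 1 N (INR k / INR D)) * W1 h N (INR k / INR D) * ph k *
     W3 g3 P (INR k / INR D))) <= K * INR D * INR N `^ (4 / 3 - s / 6).
Proof.
move=> hg hh hg3 hgh s0 de0 h1 h2 h3 h4 h5.
have a0 : 0 <= a by lra.
have [KL [KL0 hL]] := W1_diff hg de0 h1 h2.
have [KB [KB0 hB]] := @cube_bilinear g3 (6 * a + s) s hg3 ltac:(lra) h3 h4 s0.
pose Mg := 4 / g ^ 2; pose Mh := 4 / h ^ 2.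
have Mg0 : 0 < Mg by apply: Rdiv_lt_0_compat; [lra | apply: pow_lt; lra].
have Mh0 : 0 < Mh by apply: Rdiv_lt_0_compat; [lra | apply: pow_lt; lra].
pose M := (2 * Mg + 8) * Mh.
have M0 : 0 < M by apply: Rmult_lt_0_compat; lra.
pose K0 := KB * ((1 + M) ^ 2 + KL ^ 2 * Mh).
have K00 : 0 < K0.
  apply: Rmult_lt_0_compat => //; have := pow2_ge_0 KL => hk.
  have := Rmult_le_pos _ _ hk (Rlt_le _ _ Mh0); nra.
exists (1 + K0); split; first lra.
move=> N P D ph P0 hNP hD hph.
have N0 : (0 < N)%N.
  by apply: le_of_INR; have := INR_ge1 P0; have := pow_R1_Rle _ 3 (INR_ge1 P0); rewrite /=; lra.
have hN := INR_ge1 N0; have hDr : 1 <= INR D by apply: INR_ge1; lia.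
pose x k := INR k / INR D.
pose G k := ((W1 g N (x k) - W1 1 N (x k)) * W1 h N (x k) * ph k)%C.
have mh := W1_moment hh N0 (D := D) ltac:(lia).
have mg := @W1_moment g N D ltac:(lra) N0 ltac:(lia).
have m1 := @W1_moment 1 N D ltac:(lra) N0 ltac:(lia).
have gG k : Cmod (G k) <= Cmod (W1 g N (x k) - W1 1 N (x k)) * Cmod (W1 h N (x k)).
  rewrite /G !Cmod_mult -[X in _ <= X]Rmult_1_r; apply: Rmult_le_compat_l => //.
  by apply: Rmult_le_pos; exact: Cmod_ge_0.
have md : \Rsum_(0 <= k < D) Cmod (W1 g N (x k) - W1 1 N (x k)) ^ 2 <= INR D * ((2 * Mg + 8) * INR N `^ (2 - g)).
  apply: (Rle_trans _ (\Rsum_(0 <= k < D) (2 * Cmod (W1 g N (x k)) ^ 2 + 2 * Cmod (W1 1 N (x k)) ^ 2))).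
    apply: Rsum_le => k _.
    have h6 : Cmod (W1 g N (x k) - W1 1 N (x k)) <= Cmod (W1 g N (x k)) + Cmod (W1 1 N (x k)).
      by apply: (Rle_trans _ _ _ (Cmod_triangle _ _)); rewrite Cmod_opp; lra.
    have h7 := pow_incr _ _ 2 (conj (Cmod_ge_0 _) h6).
    have h8 := pow2_ge_0 (Cmod (W1 g N (x k)) - Cmod (W1 1 N (x k))).
    by lra.
  rewrite big_split -!Rsum_mull -[X in X <= _]/(Rplus _ _).
  have h6 : INR N `^ (2 - 1) <= INR N `^ (2 - g) by apply: pw_le; lra.
  have h7 := Rmult_le_compat_l (INR D) _ _ ltac:(lra) h6.
  have e1 : 4 / 1 ^ 2 = 4 by field.
  by move: mg m1; rewrite -/Mg e1 /x; lra.
have Da : INR D * INR D = INR D ^ 2 by ring.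
have hX : \Rsum_(0 <= k < D) Cmod (G k) <= INR D * ((1 + M) * INR N `^ (1 + a)).
  apply: (Rle_trans _ ((1 + M) * INR D * INR N `^ (1 + a))); last by right; ring.
  apply: sqrt_bound; [lra | lra |].
  apply: (Rle_trans _ ((\Rsum_(0 <= k < D) (Cmod (W1 g N (x k) - W1 1 N (x k)) * Cmod (W1 h N (x k)))) ^ 2)).
    apply: pow_incr; split; first by apply: Rsum_ge0 => k _; exact: Cmod_ge_0.
    by apply: Rsum_le => k _.
  apply: (Rle_trans _ _ _ (Cauchy_R _ _ _ _)).
  apply: (Rle_trans _ ((INR D * ((2 * Mg + 8) * INR N `^ (2 - g))) * (INR D * (Mh * INR N `^ (2 - h))))).
    by apply: Rmult_le_compat => //; apply: Rsum_ge0 => k _; exact: pow2_ge_0.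
  have -> : INR D * ((2 * Mg + 8) * INR N `^ (2 - g)) * (INR D * (Mh * INR N `^ (2 - h))) =
     M * INR D ^ 2 * (INR N `^ (2 - g) * INR N `^ (2 - h)) by rewrite /M; ring.
  rewrite -pw_add; apply: Rmult_le_compat_l; first by apply: Rmult_le_pos; [lra | exact: pow2_ge_0].
  by apply: pw_le; lra.
have hY : \Rsum_(0 <= k < D) Cmod (G k) ^ 2 <= INR D * (KL ^ 2 * Mh * INR N `^ (2 - 2 * de + (2 - h))).
  apply: (Rle_trans _ (\Rsum_(0 <= k < D) ((KL * INR N `^ (1 - de)) ^ 2 * Cmod (W1 h N (x k)) ^ 2))).
    apply: Rsum_le => k _; rewrite -Rpow_mult_distr; apply: pow_incr; split; first exact: Cmod_ge_0.
    apply: (Rle_trans _ _ _ (gG k)); apply: Rmult_le_compat_r; [exact: Cmod_ge_0 | exact: hL].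
  rewrite -Rsum_mull Rpow_mult_distr pw_pow.
  have -> : (1 - de) * INR 2 = 2 - 2 * de by rewrite /=; ring.
  rewrite pw_add.
  have c0 : 0 <= KL ^ 2 * INR N `^ (2 - 2 * de) by apply: Rmult_le_pos; [exact: pow2_ge_0 | exact: pw_ge0].
  by have := Rmult_le_compat_l _ _ _ c0 mh; rewrite -/Mh /x; lra.
have hX0 : 0 <= (1 + M) * INR N `^ (1 + a) by apply: Rmult_le_pos; [lra | exact: pw_ge0].
have hY0 : 0 <= KL ^ 2 * Mh * INR N `^ (2 - 2 * de + (2 - h)).
  by apply: Rmult_le_pos; [apply: Rmult_le_pos; [exact: pow2_ge_0 | lra] | exact: pw_ge0].
apply: sqrt_bound; [lra | lra |].
apply: (Rle_trans _ _ _ (hB N P D G _ _ P0 hNP hD hX0 hY0 hX hY)).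
rewrite Rpow_mult_distr pw_pow.
have -> : (1 + a) * INR 2 = 2 + 2 * a by rewrite /=; ring.
have -> : INR N `^ (2 / 3 - (6 * a + s) / 3) * ((1 + M) ^ 2 * INR N `^ (2 + 2 * a)) =
   (1 + M) ^ 2 * (INR N `^ (2 / 3 - (6 * a + s) / 3) * INR N `^ (2 + 2 * a)) by ring.
have -> : INR N `^ (- (1 / 3) + (7 * (6 * a + s) + s) / 3) * (KL ^ 2 * Mh * INR N `^ (2 - 2 * de + (2 - h))) =
  KL ^ 2 * Mh * (INR N `^ (- (1 / 3) + (7 * (6 * a + s) + s) / 3) * INR N `^ (2 - 2 * de + (2 - h))) by ring.
rewrite -!pw_add.
have q1 : INR N `^ (2 / 3 - (6 * a + s) / 3 + (2 + 2 * a)) <= INR N `^ (2 * (4 / 3 - s / 6)) by apply: pw_le; lra.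
have q2 : INR N `^ (- (1 / 3) + (7 * (6 * a + s) + s) / 3 + (2 - 2 * de + (2 - h))) <= INR N `^ (2 * (4 / 3 - s / 6)).
  by apply: pw_le; lra.
have -> : K0 * INR D ^ 2 * INR N `^ (2 * (4 / 3 - s / 6)) =
  KB * INR D ^ 2 * ((1 + M) ^ 2 * INR N `^ (2 * (4 / 3 - s / 6)) + KL ^ 2 * Mh * INR N `^ (2 * (4 / 3 - s / 6))).
  by rewrite /K0; ring.
apply: Rmult_le_compat_l; first by apply: Rmult_le_pos; [lra | exact: pow2_ge_0].
apply: Rplus_le_compat; apply: Rmult_le_compat_l => //; first exact: pow2_ge_0.
by apply: Rmult_le_pos; [exact: pow2_ge_0 | lra].
Qed.

(** The factor 2 allows for the rounding of the order [Q >= N^(1 - eta) / 2] in Dirichlet's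
    theorem. *)
Definition major (eta : R) (N : nat) (al : R) : Prop :=
  exists (a : Z) (q : nat), [/\ (0 < q)%N, INR q <= INR N `^ eta &
    INR q * Rabs (al - IZR a / INR q) * INR N <= 2 * INR N `^ eta].

(** Dirichlet approximation of order about N^(1 - eta): a denominator below N^eta would put [al] on
    a major arc, so [q] lies in the range of [minor_arc_bound]. *)
Lemma minor_arc (eta : R) : 0 < eta <= 1 / 2 -> exists K, 0 < K /\
  forall N al, (0 < N)%N -> ~ major eta N al -> Cmod (W1 1 N al) <= K * INR N `^ (1 - eta / 10).
Proof.
move=> heta; have [K [K0 hK]] := minor_arc_bound heta.
exists K; split => // N al N0 hm; have hN := INR_ge1 N0.
have [Q [Q0 Q1 Q2]] := @nfloor_pw N (1 - eta) N0 ltac:(lra).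
have [a [q [hq hcop hal]]] := dirichlet_approx al Q0.
have hqr : 0 < INR q by apply: INR_gt0; lia.
have hQr : 0 < INR Q by apply: INR_gt0; lia.
have hqQ : INR q <= INR Q by apply: INR_le; lia.
have hNe := pw_gt0 (INR N) eta.
have hprod : INR N `^ (1 - eta) * INR N `^ eta = INR N.
  by rewrite -pw_add (_ : 1 - eta + eta = 1) ?pw_1; lra.
have hsp : spaced al q.
  apply: (spaced_rational (a := a)) => //; first lia.
  apply: (Rle_trans _ _ _ hal); apply: Rinv_le_contravar; first by apply: pow_lt.
  by rewrite /= Rmult_1_r; apply: Rmult_le_compat_l; lra.
have hbig : INR N `^ eta <= INR q.
  apply: Rnot_lt_le => hlt; apply: hm; exists a, q; split; [lia | lra |].
  have h1 : INR q * Rabs (al - IZR a / INR q) <= / INR Q.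
    apply: (Rle_trans _ _ _ (Rmult_le_compat_l _ _ _ (Rlt_le _ _ hqr) hal)).
    by right; field; lra.
  apply: (Rle_trans _ (/ INR Q * INR N)); first by apply: Rmult_le_compat_r; lra.
  apply: (Rmult_le_reg_l (INR Q)) => //.
  have -> : INR Q * (/ INR Q * INR N) = INR N by field; lra.
  by rewrite -[X in X <= _]hprod; have := Rmult_le_compat_r _ _ _ (Rlt_le _ _ hNe) Q2; lra.
have := hK N q al N N0 ltac:(lia) hsp ltac:(lra) (leqnn N).
congr (Cmod _ <= _); rewrite /W1 [RHS]big_nat_cond [LHS]big_nat_cond.
apply: eq_bigr => p /andP[hp _]; rewrite psw_1; last lia.
by rewrite Cmult_1_l.
Qed.

(** The linear discrepancy saves P^(- de), and the definition of [major] limits the loss in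
    [major_arc_bound] to N^eta; there is a gain when eta < de / 3. *)
Lemma major_arc (g de eta : R) : 973 / 1000 <= g <= 1 -> 0 < de -> 1 - g + 2 * de < 49 / 1000 ->
  3 * (1 - g + de) < 85 / 1000 -> exists K, 0 < K /\
  forall N P al, (0 < P)%N -> INR P ^ 3 <= INR N <= 8 * INR P ^ 3 -> major eta N al ->
  Cmod (W3 g P al - W3 1 P al) <= K * INR N `^ (eta + (1 - de) / 3).
Proof.
move=> h1 h2 h3 h4; have [KL [KL0 hL]] := ps_prime_sum h1 h2 h3 h4.
have [C1 [C10 hC1]] := cube_root_pw (1 - de).
have hp := PI_RGT_0.
exists (KL * C1 * (1 + 4 * PI)); split.
  by apply: Rmult_lt_0_compat; [apply: Rmult_lt_0_compat | lra].
move=> N P al P0 hNP [a [q [q0 hq hal]]].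
have hqr := INR_gt0 q0; have hP := INR_ge1 P0.
pose B := KL * INR P `^ (1 - de).
have B0 : 0 <= B by apply: Rmult_le_pos; [lra | exact: pw_ge0].
have -> : (W3 g P al - W3 1 P al = \Csum_(1 <= p < P.+1 | prime p) (RtoC (psw g p - 1) *
   e ((IZR a / INR q + (al - IZR a / INR q)) * INR p ^ 3)))%C.
  rewrite Rplus_minus /W3 -CsumB [RHS]big_nat_cond [LHS]big_nat_cond.
  apply: eq_bigr => p /andP[hp' _]; rewrite (@psw_1 p); last lia.
  rewrite RtoC_minus; ring.
apply: (Rle_trans _ _ _ (@major_arc_bound (fun p => psw g p - 1) P q a B (al - IZR a / INR q) P0 q0 B0 _)).
  by move=> be x hx; apply: hL.
have hP3 : 0 <= INR P ^ 3 by apply: pow_le; lra.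
have hb := Rabs_pos (al - IZR a / INR q).
move: hal hb; set be := Rabs _ => hal hb.
have b1 : INR q * be * INR P ^ 3 <= 2 * INR N `^ eta.
  apply: (Rle_trans _ _ _ _ hal); apply: Rmult_le_compat_l; last lra.
  by apply: Rmult_le_pos; lra.
have b2 : INR q * (1 + 2 * PI * be * INR P ^ 3) <= (1 + 4 * PI) * INR N `^ eta.
  have := Rmult_le_compat_l (2 * PI) _ _ ltac:(lra) b1; lra.
have c1 := hC1 N P P0 hNP.
have b3 : B <= KL * (C1 * INR N `^ ((1 - de) / 3)) by apply: Rmult_le_compat_l; lra.
have hN0 := pw_ge0 (INR N) eta.
have -> : INR q * B * (1 + 2 * PI * be * INR P ^ 3) = B * (INR q * (1 + 2 * PI * be * INR P ^ 3)) by ring.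
apply: (Rle_trans _ (B * ((1 + 4 * PI) * INR N `^ eta))); first exact: Rmult_le_compat_l.
rewrite pw_add.
have -> : KL * C1 * (1 + 4 * PI) * (INR N `^ eta * INR N `^ ((1 - de) / 3)) =
   KL * (C1 * INR N `^ ((1 - de) / 3)) * ((1 + 4 * PI) * INR N `^ eta) by ring.
by apply: Rmult_le_compat_r => //; apply: Rmult_le_pos; lra.
Qed.

(** Here the first moment X = N has no loss, so a small [ka] will do. With [ka = ep = eta/20] the
    second term pays 8 eta/60 out of the saving eta/5 in Y, and the first saves eta/60, which
    becomes eta/120 after the square root. *)
Lemma minor_arcs_term (g eta : R) : 973 / 1000 <= g <= 1 -> 0 < eta <= 1 / 1000 ->
  1 - g < 54 / 1000 -> 3 * (1 - g) < 104 / 1000 ->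
  exists K, 0 < K /\ forall (N P D : nat) (ph : nat -> C), (0 < P)%N -> INR P ^ 3 <= INR N <= 8 * INR P ^ 3 ->
  (20 * N < D)%N -> (forall k, Cmod (ph k) <= 1) -> (forall k, major eta N (INR k / INR D) -> ph k = RtoC 0) ->
  Cmod (\Csum_(0 <= k < D) (W1 1 N (INR k / INR D) * W1 1 N (INR k / INR D) * ph k *
     W3 g P (INR k / INR D))) <= K * INR D * INR N `^ (4 / 3 - eta / 120).
Proof.
move=> hg heta h1 h2.
have [KL [KL0 hL]] := @minor_arc eta ltac:(lra).
have [KB [KB0 hB]] := @cube_bilinear g (eta / 20) (eta / 20) hg ltac:(lra) ltac:(lra) ltac:(lra) ltac:(lra).
pose K0 := KB * (4 ^ 2 + KL ^ 2 * 4).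
have K00 : 0 < K0 by apply: Rmult_lt_0_compat => //; have := pow2_ge_0 KL; lra.
exists (1 + K0); split; first lra.
move=> N P D ph P0 hNP hD hph hmaj.
have N0 : (0 < N)%N.
  by apply: le_of_INR; have := INR_ge1 P0; have := pow_R1_Rle _ 3 (INR_ge1 P0); rewrite /=; lra.
have hN := INR_ge1 N0; have hDr : 1 <= INR D by apply: INR_ge1; lia.
pose x k := INR k / INR D.
pose G k := (W1 1 N (x k) * W1 1 N (x k) * ph k)%C.
have m1 := @W1_moment 1 N D ltac:(lra) N0 ltac:(lia).
have e1 : 4 / 1 ^ 2 * INR N `^ (2 - 1) = 4 * INR N.
  by rewrite (_ : 2 - 1 = 1) ?pw_1; [field | lra | ring].
rewrite e1 in m1.
have gG k : Cmod (G k) <= Cmod (W1 1 N (x k)) ^ 2.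
  have -> : Cmod (W1 1 N (x k)) ^ 2 = Cmod (W1 1 N (x k)) * Cmod (W1 1 N (x k)) * 1 by ring.
  rewrite /G !Cmod_mult; apply: Rmult_le_compat_l => //.
  by apply: Rmult_le_pos; exact: Cmod_ge_0.
have gG2 k : Cmod (G k) <= KL * INR N `^ (1 - eta / 10) * Cmod (W1 1 N (x k)).
  have c0 := Cmod_ge_0 (W1 1 N (x k)).
  have d0 : 0 <= KL * INR N `^ (1 - eta / 10) by apply: Rmult_le_pos; [lra | exact: pw_ge0].
  case: (classic (major eta N (x k))) => hm.
    by rewrite /G hmaj // Cmult_0_r Cmod_0; apply: Rmult_le_pos.
  apply: (Rle_trans _ _ _ (gG k)); rewrite /= Rmult_1_r; apply: Rmult_le_compat_r => //.
  exact: hL.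
have hX : \Rsum_(0 <= k < D) Cmod (G k) <= INR D * (4 * INR N).
  by apply: (Rle_trans _ _ _ _ m1); apply: Rsum_le => k _; exact: gG.
have hY : \Rsum_(0 <= k < D) Cmod (G k) ^ 2 <= INR D * (KL ^ 2 * 4 * INR N `^ (3 - eta / 5)).
  apply: (Rle_trans _ (\Rsum_(0 <= k < D) ((KL * INR N `^ (1 - eta / 10)) ^ 2 * Cmod (W1 1 N (x k)) ^ 2))).
    by apply: Rsum_le => k _; rewrite -Rpow_mult_distr; apply: pow_incr; split; [exact: Cmod_ge_0 | exact: gG2].
  rewrite -Rsum_mull Rpow_mult_distr pw_pow.
  have -> : (1 - eta / 10) * INR 2 = 2 - eta / 5 by rewrite /=; field.
  have -> : 3 - eta / 5 = (2 - eta / 5) + 1 by ring.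
  rewrite pw_add pw_1; last lra.
  have c0 : 0 <= KL ^ 2 * INR N `^ (2 - eta / 5) by apply: Rmult_le_pos; [exact: pow2_ge_0 | exact: pw_ge0].
  by have := Rmult_le_compat_l _ _ _ c0 m1; rewrite /x; lra.
have hX0 : 0 <= 4 * INR N by lra.
have hK4 : 0 <= KL ^ 2 * 4 by have := pow2_ge_0 KL; lra.
have hY0 : 0 <= KL ^ 2 * 4 * INR N `^ (3 - eta / 5) by apply: Rmult_le_pos => //; exact: pw_ge0.
apply: sqrt_bound; [lra | lra |].
apply: (Rle_trans _ _ _ (hB N P D G _ _ P0 hNP hD hX0 hY0 hX hY)).
rewrite Rpow_mult_distr -(pw_nat 2 (x := INR N)); last lra.
have -> : INR 2 = 2 by rewrite /=; ring.
have -> : INR N `^ (2 / 3 - eta / 20 / 3) * (4 ^ 2 * INR N `^ 2) =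
   4 ^ 2 * (INR N `^ (2 / 3 - eta / 20 / 3) * INR N `^ 2) by ring.
have -> : INR N `^ (- (1 / 3) + (7 * (eta / 20) + eta / 20) / 3) * (KL ^ 2 * 4 * INR N `^ (3 - eta / 5)) =
  KL ^ 2 * 4 * (INR N `^ (- (1 / 3) + (7 * (eta / 20) + eta / 20) / 3) * INR N `^ (3 - eta / 5)) by ring.
rewrite -!pw_add.
have q1 : INR N `^ (2 / 3 - eta / 20 / 3 + 2) <= INR N `^ (2 * (4 / 3 - eta / 120)) by apply: pw_le; lra.
have q2 : INR N `^ (- (1 / 3) + (7 * (eta / 20) + eta / 20) / 3 + (3 - eta / 5)) <= INR N `^ (2 * (4 / 3 - eta / 120)).
  by apply: pw_le; lra.
have -> : K0 * INR D ^ 2 * INR N `^ (2 * (4 / 3 - eta / 120)) =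
  KB * INR D ^ 2 * (4 ^ 2 * INR N `^ (2 * (4 / 3 - eta / 120)) + KL ^ 2 * 4 * INR N `^ (2 * (4 / 3 - eta / 120))).
  by rewrite /K0; ring.
apply: Rmult_le_compat_l; first by apply: Rmult_le_pos; [lra | exact: pow2_ge_0].
by apply: Rplus_le_compat; apply: Rmult_le_compat_l => //; lra.
Qed.

Lemma cubic_difference_term (g : R) : 1 - g < 27 / 1000 -> g <= 1 ->
  exists K, 0 < K /\ forall (N P D : nat) (ph : nat -> C), (0 < P)%N -> INR P ^ 3 <= INR N <= 8 * INR P ^ 3 ->
  (20 * N < D)%N -> (forall k, Cmod (ph k) <= 1) ->
  Cmod (\Csum_(0 <= k < D) (W1 1 N (INR k / INR D) * W1 1 N (INR k / INR D) * ph k *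
     (W3 g P (INR k / INR D) - W3 1 P (INR k / INR D)))) <= K * INR D * INR N `^ (4 / 3 - 1 / 1200000).
Proof.
(* On the major arcs [de = 1/1000] saves N^(-1/3000), so [eta] must be smaller than 1/3000; the
   minor arcs then give eta/120 = 1/1200000. *)
move=> h1 h2; pose eta := 1 / 10000.
have [K1 [K10 hK1]] := @minor_arcs_term g eta ltac:(lra) ltac:(rewrite /eta; lra) ltac:(lra) ltac:(lra).
have [K2 [K20 hK2]] := @minor_arcs_term 1 eta ltac:(lra) ltac:(rewrite /eta; lra) ltac:(lra) ltac:(lra).
have [K3 [K30 hK3]] := @major_arc g (1 / 1000) eta ltac:(lra) ltac:(lra) ltac:(lra) ltac:(lra).
exists (K1 + K2 + 4 * K3); split; first lra.
move=> N P D ph P0 hNP hD hph.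
have N0 : (0 < N)%N.
  by apply: le_of_INR; have := INR_ge1 P0; have := pow_R1_Rle _ 3 (INR_ge1 P0); rewrite /=; lra.
have hN := INR_ge1 N0; have hDr : 1 <= INR D by apply: INR_ge1; lia.
pose x k := INR k / INR D.
(* Arcs are selected through the bounded factor [ph]. On the minor arcs [W3 g] and [W3 1] are
   estimated separately, on the major arcs their difference. *)
pose mi k := if excluded_middle_informative (major eta N (x k)) then RtoC 0 else ph k.
pose ma k := if excluded_middle_informative (major eta N (x k)) then ph k else RtoC 0.
have hmi k : Cmod (mi k) <= 1.
  by rewrite /mi; destruct (excluded_middle_informative _); rewrite ?Cmod_0; [lra | exact: hph].
have hmi0 k : major eta N (INR k / INR D) -> mi k = RtoC 0.
  by rewrite /mi /x => h; destruct (excluded_middle_informative _).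
have b1 := hK1 N P D mi P0 hNP hD hmi hmi0.
have b2 := hK2 N P D mi P0 hNP hD hmi hmi0.
have e0 : 4 / 3 - eta / 120 = 4 / 3 - 1 / 1200000 by rewrite /eta; field.
rewrite e0 in b1 b2.
have m1 := @W1_moment 1 N D ltac:(lra) N0 ltac:(lia).
have e1 : 4 / 1 ^ 2 * INR N `^ (2 - 1) = 4 * INR N.
  by rewrite (_ : 2 - 1 = 1) ?pw_1; [field | lra | ring].
rewrite e1 in m1.
have b3 : Cmod (\Csum_(0 <= k < D) (W1 1 N (x k) * W1 1 N (x k) * ma k * (W3 g P (x k) - W3 1 P (x k)))) <=
    4 * K3 * INR D * INR N `^ (4 / 3 - 1 / 1200000).
  pose Z := K3 * INR N `^ (eta + (1 - 1 / 1000) / 3).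
  have Z0 : 0 <= Z by apply: Rmult_le_pos; [lra | exact: pw_ge0].
  apply: (Rle_trans _ (\Rsum_(0 <= k < D) (Z * Cmod (W1 1 N (x k)) ^ 2))).
    apply: (Rle_trans _ _ _ (Cmod_sum _ _ _)); apply: Rsum_le => k _.
    have c0 := pow2_ge_0 (Cmod (W1 1 N (x k))).
    rewrite /ma; destruct (excluded_middle_informative _) as [hm|hm] => /=; last first.
      by rewrite Cmult_0_r Cmult_0_l Cmod_0; apply: Rmult_le_pos.
    rewrite !Cmod_mult Rmult_1_r.
    have d1 := hph k; have d2 := hK3 N P (x k) P0 hNP hm.
    have d3 : Cmod (ph k) * Cmod (W3 g P (x k) - W3 1 P (x k)) <= 1 * Z.
      by apply: Rmult_le_compat => //; exact: Cmod_ge_0.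
    have := Rmult_le_compat_l _ _ _ c0 d3; rewrite /= ; lra.
  rewrite -Rsum_mull.
  apply: (Rle_trans _ (Z * (INR D * (4 * INR N)))); first exact: Rmult_le_compat_l.
  have -> : Z * (INR D * (4 * INR N)) = 4 * K3 * INR D * (INR N `^ (eta + (1 - 1 / 1000) / 3) * INR N `^ 1).
    by rewrite /Z pw_1; [ring | lra].
  rewrite -pw_add; apply: Rmult_le_compat_l; first by apply: Rmult_le_pos; lra.
  by apply: pw_le; rewrite /eta; lra.
have -> : \Csum_(0 <= k < D) (W1 1 N (INR k / INR D) * W1 1 N (INR k / INR D) * ph k *
     (W3 g P (INR k / INR D) - W3 1 P (INR k / INR D))) =
  (\Csum_(0 <= k < D) (W1 1 N (INR k / INR D) * W1 1 N (INR k / INR D) * mi k * W3 g P (INR k / INR D)) -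
   \Csum_(0 <= k < D) (W1 1 N (INR k / INR D) * W1 1 N (INR k / INR D) * mi k * W3 1 P (INR k / INR D)) +
   \Csum_(0 <= k < D) (W1 1 N (x k) * W1 1 N (x k) * ma k * (W3 g P (x k) - W3 1 P (x k))))%C.
  rewrite -CsumB -big_split; apply: eq_bigr => k _; rewrite -[RHS]/(Cplus _ _) /mi /ma -/(x k).
  by destruct (excluded_middle_informative _) => /=; ring.
apply: (Rle_trans _ _ _ (Cmod_triangle _ _)).
apply: (Rle_trans _ _ _ (Rplus_le_compat_r _ _ _ (Cmod_triangle _ _))).
rewrite Cmod_opp; lra.
Qed.

Lemma discrete_estimate (g1 g2 g3 d1 d3 : R) :
  0 < g1 <= 1 -> 0 < g2 <= 1 -> 0 < g3 <= 1 ->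
  (g1 + g2) / 2 + d1 / 40 > 1 -> (g1 + g2) / 2 + d3 / 3 > 1 ->
  73 * (1 - g1) + 86 * d1 < 9 -> 73 * (1 - g2) + 86 * d1 < 9 ->
  1714 * (1 - g3) + 1725 * d3 < 46 ->
  exists K, 0 < K /\ forall (N P D : nat) (ph : nat -> C), (0 < P)%N -> INR P ^ 3 <= INR N <= 8 * INR P ^ 3 ->
  (20 * N < D)%N -> (forall k, Cmod (ph k) <= 1) ->
  Cmod (\Csum_(0 <= k < D) (W1 g1 N (INR k / INR D) * W1 g2 N (INR k / INR D) * W3 g3 P (INR k / INR D) * ph k) -
        \Csum_(0 <= k < D) (W1 1 N (INR k / INR D) * W1 1 N (INR k / INR D) * W3 1 P (INR k / INR D) * ph k)) <=
  K * INR D * INR N `^ (4 / 3 - 1 / 1200000).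
Proof.
move=> h1 h2 h3 c1 c2 c3 c4 c5.
pose a := ((1 - g1) + (1 - g2)) / 2.
have a1 : (1 - g1) + (1 - g2) <= 2 * a by rewrite /a; lra.
have a0 : 0 <= a by rewrite /a; lra.
(* The mean of the two conditions is 73 a + 86 d1 < 9, and d1 > 40 a; as 73 + 86 * 40 = 3513 this
   gives a < 9 / 3513. *)
have ab : a < 25626 / 10000000 by rewrite /a; lra.
have ad : 3 * a < d3 by rewrite /a; lra.
(* [de = 21/1000] is large enough for [16 a + 3 s <= 2 de] and, because 1 - g1 <= 2 a, small enough
   for [1 - g1 + 2 de < 49/1000]. The two conditions on g3 follow from 1714 (1 - g3) + 5175 a <
   46. *)
have [K1 [K10 hK1]] := @linear_difference_term g1 g2 g3 a (21 / 1000) (3 / 10000)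
  ltac:(lra) h2 ltac:(lra) ltac:(lra) ltac:(lra) ltac:(lra) ltac:(lra) ltac:(lra) ltac:(lra) ltac:(lra) ltac:(lra).
have [K2 [K20 hK2]] := @linear_difference_term g2 1 g3 a (21 / 1000) (3 / 10000)
  ltac:(lra) ltac:(lra) ltac:(lra) ltac:(lra) ltac:(lra) ltac:(lra) ltac:(lra) ltac:(lra) ltac:(lra) ltac:(lra) ltac:(lra).
have [K3 [K30 hK3]] := @cubic_difference_term g3 ltac:(lra) ltac:(lra).
exists (K1 + K2 + K3); split; first lra.
move=> N P D ph P0 hNP hD hph.
have hN : 1 <= INR N by have := pow_R1_Rle _ 3 (INR_ge1 P0); lra.
have b1 := hK1 N P D ph P0 hNP hD hph.
have b2 := hK2 N P D ph P0 hNP hD hph.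
have b3 := hK3 N P D ph P0 hNP hD hph.
have hpw : INR N `^ (4 / 3 - 3 / 10000 / 6) <= INR N `^ (4 / 3 - 1 / 1200000) by apply: pw_le; lra.
have hD0 := pos_INR D.
have b1' := Rmult_le_compat_l (K1 * INR D) _ _ ltac:(apply: Rmult_le_pos; lra) hpw.
have b2' := Rmult_le_compat_l (K2 * INR D) _ _ ltac:(apply: Rmult_le_pos; lra) hpw.
rewrite -CsumB.
rewrite (eq_bigr (fun k =>
  ((W1 g1 N (INR k / INR D) - W1 1 N (INR k / INR D)) * W1 g2 N (INR k / INR D) * ph k * W3 g3 P (INR k / INR D) +
  ((W1 g2 N (INR k / INR D) - W1 1 N (INR k / INR D)) * W1 1 N (INR k / INR D) * ph k * W3 g3 P (INR k / INR D) +
   W1 1 N (INR k / INR D) * W1 1 N (INR k / INR D) * ph k * (W3 g3 P (INR k / INR D) - W3 1 P (INR k / INR D)))))%C);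
  last by move=> k _; ring.
rewrite big_split big_split -[X in Cmod X]/(Cplus _ (Cplus _ _)).
apply: (Rle_trans _ _ _ (Cmod_triangle _ _)).
apply: (Rle_trans _ _ _ (Rplus_le_compat_l _ _ _ (Cmod_triangle _ _))).
apply: (Rle_trans _ _ _ (Rplus_le_compat _ _ _ _ b1 (Rplus_le_compat _ _ _ _ b2 b3))).
lra.
Qed.

(** * From the integral to the discrete average *)

Lemma is_primeP p : reflect (is_prime p) (prime p).
Proof.
apply: (iffP primeP) => [[p1 h] | h].
  apply/prime_alt; split; first lia.
  move=> n hn [m hm].
  have /h : (Z.to_nat n %| p)%N by apply/dvdnP; exists (Z.to_nat m); nia.
  by case/orP => /eqP; lia.
have [p1 _] := h; split; first lia.
move=> d /dvdnP[m hm].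
have := prime_divisors _ h (Z.of_nat d); case; first by exists (Z.of_nat m); lia.
  by lia.
case=> [?|[?|?]]; apply/orP; [left | right | lia]; apply/eqP; lia.
Qed.

Lemma sum_n_bigop (u : nat -> C) n : sum_n u n = \Csum_(0 <= m < n.+1) u m.
Proof.
elim: n => [|n IH]; first by rewrite sum_O big_nat1.
by rewrite sum_Sn IH [RHS]big_nat_recr.
Qed.

Lemma sum_le_bigop (x : R) (A : nat -> Prop) (f : nat -> C) :
  sum_le x A f = \Csum_(0 <= m < (Z.to_nat (Int_part x)).+1)
    (if excluded_middle_informative (A m) then f m else RtoC 0).
Proof.
rewrite /sum_le sum_n_bigop; apply: eq_bigr => m _.
by destruct (excluded_middle_informative (A m)).
Qed.

Lemma Int_part_INR n : Int_part (INR n) = Z.of_nat n.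
Proof. by symmetry; apply: Int_part_spec; rewrite -INR_IZR_INZ; lra. Qed.

Lemma prime_sum_bigop (A : nat -> Prop) (n : nat) (x : R) (f : nat -> C) :
  Z.to_nat (Int_part x) = n ->
  sum_le x (fun p => is_prime p /\ A p) f =
  \Csum_(1 <= p < n.+1 | prime p) (RtoC (ind (A p)) * f p).
Proof.
move=> hn; rewrite sum_le_bigop hn big_ltn // [RHS]big_mkcond.
destruct (excluded_middle_informative (is_prime 0 /\ A 0%N)) as [h0|h0].
  by have /is_primeP := proj1 h0.
rewrite -[LHS]/(Cplus _ _) Cplus_0_l; apply: eq_bigr => p _; rewrite /ind.
case: is_primeP => hp; destruct (excluded_middle_informative (A p)) as [ha|ha];
  destruct (excluded_middle_informative (is_prime p /\ A p)) as [hpa|hpa]; try (exfalso; tauto);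
  by rewrite /= ?Cmult_1_l ?Cmult_0_l.
Qed.

Lemma sum_le_ext (x : R) (A B : nat -> Prop) (f : nat -> C) : (forall p, A p <-> B p) ->
  sum_le x A f = sum_le x B f.
Proof.
move=> h; rewrite !sum_le_bigop; apply: eq_bigr => m _; have hm := h m.
destruct (excluded_middle_informative (A m)); destruct (excluded_middle_informative (B m)); first [by [] | exfalso; tauto].
Qed.

Lemma T_bigop (g x al : R) (n k : nat) : Z.to_nat (Int_part x) = n ->
  (RtoC (1 / g) * sum_le x (PS_prime g) (fun p => RtoC (INR p `^ (1 - g)) * e (al * INR p ^ k)))%C =
  \Csum_(1 <= p < n.+1 | prime p) (RtoC (psw g p) * e (al * INR p ^ k)).
Proof.
move=> hn; rewrite /PS_prime (@prime_sum_bigop (floor_power g) _ _ _ hn) Csum_mull; apply: eq_bigr => p _.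
rewrite /psw /psind /Rdiv Rmult_1_l !RtoC_mult; ring.
Qed.

Lemma S_bigop (x al : R) (n k : nat) : Z.to_nat (Int_part x) = n ->
  sum_le x is_prime (fun p => e (al * INR p ^ k)) =
  \Csum_(1 <= p < n.+1 | prime p) (RtoC (psw 1 p) * e (al * INR p ^ k)).
Proof.
move=> hn; rewrite (@sum_le_ext x is_prime (fun p => is_prime p /\ True)); last by move=> p; tauto.
rewrite (@prime_sum_bigop (fun=> True) _ _ _ hn) [RHS]big_nat_cond [LHS]big_nat_cond.
apply: eq_bigr => p /andP[hp _]; rewrite psw_1; last lia.
by rewrite ind_true.
Qed.

Definition cubeP N := Z.to_nat (Int_part (cube_root N)).

Lemma sum_le_eq (x : R) (A : nat -> Prop) (f f' : nat -> C) : (forall p, f p = f' p) ->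
  sum_le x A f = sum_le x A f'.
Proof. by move=> h; rewrite !sum_le_bigop; apply: eq_bigr => m _; rewrite h. Qed.

Lemma T1E g N al : T1 g N al = W1 g N al.
Proof.
have hn : Z.to_nat (Int_part (INR N)) = N by rewrite Int_part_INR Nat2Z.id.
transitivity (\Csum_(1 <= p < N.+1 | prime p) (RtoC (psw g p) * e (al * INR p ^ 1))).
  rewrite -(T_bigop _ _ _ hn) /T1; congr (_ * _)%C; apply: sum_le_eq => p.
  by rewrite pow_1.
by apply: eq_bigr => p _; rewrite pow_1.
Qed.

Lemma S1E N al : S1 N al = W1 1 N al.
Proof.
have hn : Z.to_nat (Int_part (INR N)) = N by rewrite Int_part_INR Nat2Z.id.
transitivity (\Csum_(1 <= p < N.+1 | prime p) (RtoC (psw 1 p) * e (al * INR p ^ 1))).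
  by rewrite -(S_bigop _ _ hn) /S1; apply: sum_le_eq => p; rewrite pow_1.
by apply: eq_bigr => p _; rewrite pow_1.
Qed.

Lemma T3E g N al : T3 g N al = W3 g (cubeP N) al.
Proof. exact: T_bigop. Qed.

Lemma S3E N al : S3 N al = W3 1 (cubeP N) al.
Proof. exact: S_bigop. Qed.

Lemma cubeP_bounds N : (0 < N)%N ->
  (0 < cubeP N)%N /\ INR (cubeP N) ^ 3 <= INR N <= 8 * INR (cubeP N) ^ 3.
Proof.
move=> N0; have hN := INR_ge1 N0.
have hc : 1 <= cube_root N by apply: pw_ge1; lra.
have hc3 : cube_root N ^ 3 = INR N.
  by rewrite /cube_root pw_pow (_ : 1 / 3 * INR 3 = 1) ?pw_1; [ | lra | rewrite /=; field].
have [h1 h2] := base_Int_part (cube_root N).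
have hI : (0 < Int_part (cube_root N))%Z by apply: lt_IZR; lra.
have hP : INR (cubeP N) = IZR (Int_part (cube_root N)).
  by rewrite INR_IZR_INZ /cubeP Z2Nat.id //; lia.
rewrite -hP in h1 h2.
have P0 : (0 < cubeP N)%N by rewrite /cubeP; lia.
have hP1 := INR_ge1 P0.
split => //; rewrite -hc3; split; first by apply: pow_incr; lra.
have -> : 8 * INR (cubeP N) ^ 3 = (2 * INR (cubeP N)) ^ 3 by ring.
by apply: pow_incr; lra.
Qed.

(** Pairs of a coefficient and a frequency, with repetitions allowed, so that products require no
    collecting of terms. *)
Definition trig_poly (d : Z) (f : R -> C) : Prop :=
  exists s : seq (C * Z), all (fun y => Z.abs y.2 <=? d)%Z s /\
    forall x, f x = \Csum_(y <- s) (y.1 * e (IZR y.2 * x)).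

Lemma trig_poly_monomial d n f c : (Z.abs n <= d)%Z -> (forall x, f x = c * e (IZR n * x))%C -> trig_poly d f.
Proof.
move=> hn hf; exists [:: (c, n)]; split; first by rewrite /= andbT; apply/Z.leb_spec0.
by move=> x; rewrite big_seq1.
Qed.

Lemma trig_poly_sum d (I : Type) (r : seq I) (Q : pred I) (F : I -> R -> C) :
  (forall i, Q i -> trig_poly d (F i)) -> trig_poly d (fun x => \Csum_(i <- r | Q i) F i x).
Proof.
move=> h; elim: r => [|i r [s [hs he]]]; first by exists [::]; split => // x; rewrite !big_nil.
case: (boolP (Q i)) => hi; last by exists s; split => // x; rewrite big_cons (negbTE hi).
have [s' [hs' he']] := h i hi.
exists (s' ++ s); split; first by rewrite all_cat hs' hs.
by move=> x; rewrite big_cons hi big_cat he he'.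
Qed.

Lemma trig_poly_mul d d' f g : trig_poly d f -> trig_poly d' g -> trig_poly (d + d') (fun x => f x * g x)%C.
Proof.
move=> [s [hs hf]] [s' [hs' hg]].
exists [seq ((y.1 * z.1)%C, (y.2 + z.2)%Z) | y <- s, z <- s']; split.
  elim: s hs {hf} => //= y s IH /andP[/Z.leb_spec0 hy hs]; rewrite all_cat IH // andbT all_map.
  apply: sub_all hs' => z /Z.leb_spec0 hz /=; apply/Z.leb_spec0; lia.
move=> x; rewrite hf hg Csum_mulr big_allpairs_dep; apply: eq_bigr => y _.
rewrite Csum_mull; apply: eq_bigr => z _ /=.
rewrite plus_IZR Rmult_plus_distr_r e_add; ring.
Qed.

Lemma is_RInt_trig_monomial (c : C) (n : Z) (a : R) :
  is_RInt (V := C_R_NormedModule) (fun x => c * e (IZR n * x))%C a (a + 1) (if (n =? 0)%Z then c else RtoC 0).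
Proof.
case: c => u v.
apply: (is_RInt_ext (V := C_R_NormedModule)
  (fun x => (u * cos (2 * PI * IZR n * x) - v * sin (2 * PI * IZR n * x),
             u * sin (2 * PI * IZR n * x) + v * cos (2 * PI * IZR n * x)))).
  by move=> x _; rewrite /e /Cmult /= !Rmult_assoc.
have -> : (if (n =? 0)%Z then (u, v) else RtoC 0) = ((if (n =? 0)%Z then u else 0), (if (n =? 0)%Z then v else 0)).
  by case: (n =? 0)%Z.
have hp := PI_RGT_0.
case: Z.eqb_spec => hn.
  rewrite hn; apply: (is_RInt_fct_extend_pair (U := R_NormedModule) (V := R_NormedModule)) => /=.
    apply: (is_RInt_ext (fun=> u)).
      by move=> x _; rewrite Rmult_0_r Rmult_0_l cos_0 sin_0 Rmult_1_r Rmult_0_r Rminus_0_r.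
    have := @is_RInt_const R_NormedModule a (a + 1) u; congr is_RInt.
    by rewrite /scal /= /mult /=; ring.
  apply: (is_RInt_ext (fun=> v)).
    by move=> x _; rewrite Rmult_0_r Rmult_0_l cos_0 sin_0 Rmult_1_r Rmult_0_r Rplus_0_l.
  have := @is_RInt_const R_NormedModule a (a + 1) v; congr is_RInt.
  by rewrite /scal /= /mult /=; ring.
have w0 : 2 * PI * IZR n <> 0.
  by apply: Rmult_integral_contrapositive_currified; [lra | exact: IZR_neq].
set w := 2 * PI * IZR n in w0 *.
have sE : sin (w * (a + 1)) = sin (w * a).
  have := f_equal snd (e_addZ (IZR n * a) n); rewrite /e /=.
  have -> : 2 * PI * (IZR n * a + IZR n) = w * (a + 1) by rewrite /w; ring.
  by have -> : 2 * PI * (IZR n * a) = w * a by rewrite /w; ring.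
have cE : cos (w * (a + 1)) = cos (w * a).
  have := f_equal fst (e_addZ (IZR n * a) n); rewrite /e /=.
  have -> : 2 * PI * (IZR n * a + IZR n) = w * (a + 1) by rewrite /w; ring.
  by have -> : 2 * PI * (IZR n * a) = w * a by rewrite /w; ring.
have key (p q : R) : is_RInt (V := R_NormedModule) (fun x => p * cos (w * x) + q * sin (w * x)) a (a + 1) 0.
  have -> : 0 = minus ((p * sin (w * (a + 1)) - q * cos (w * (a + 1))) / w) ((p * sin (w * a) - q * cos (w * a)) / w).
    by rewrite sE cE /minus /plus /opp /=; ring.
  apply: (is_RInt_derive (fun x => (p * sin (w * x) - q * cos (w * x)) / w)).
    by move=> x _; auto_derive => //; field.
  move=> x _; apply: ex_derive_continuous; by auto_derive.
apply: (is_RInt_fct_extend_pair (U := R_NormedModule) (V := R_NormedModule)) => /=.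
  apply: is_RInt_ext (key u (- v)) => x _; rewrite /=; lra.
apply: is_RInt_ext (key v u) => x _; rewrite /=; lra.
Qed.

(** Both sides are the coefficient of frequency 0, because no other frequency of modulus at most d <
    D is a multiple of D. *)
Lemma is_RInt_trig_poly (d : Z) (D : nat) (f : R -> C) (a : R) : (d < Z.of_nat D)%Z -> (0 < D)%N -> trig_poly d f ->
  is_RInt (V := C_R_NormedModule) f a (a + 1) (RtoC (/ INR D) * \Csum_(0 <= k < D) f (Rdiv (INR k) (INR D)))%C.
Proof.
move=> hD D0 [s [hs hf]]; have hDr := INR_gt0 D0.
apply: (is_RInt_ext (V := C_R_NormedModule) (fun x => \Csum_(y <- s) (y.1 * e (IZR y.2 * x)))) => [x _|].
  by rewrite hf.
rewrite (eq_bigr (fun k : nat => \Csum_(y <- s) (y.1 * e (IZR y.2 * (INR k / INR D))))); last by move=> k _; rewrite hf.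
clear f hf.
elim: s hs => [|y s IH] /=.
  move=> _; apply: (is_RInt_ext (V := C_R_NormedModule) (fun=> RtoC 0)); first by move=> x _; rewrite big_nil.
  rewrite big1 ?Cmult_0_r; last by move=> k _; rewrite big_nil.
  have := @is_RInt_const C_R_NormedModule a (a + 1) (RtoC 0); congr is_RInt.
  by rewrite /scal /= /prod_scal /scal /= /mult /= !Rmult_0_r.
move=> /andP[/Z.leb_spec0 hy hs].
apply: (is_RInt_ext (V := C_R_NormedModule) (fun x => plus (y.1 * e (IZR y.2 * x))%C (\Csum_(z <- s) (z.1 * e (IZR z.2 * x))))).
  by move=> x _; rewrite big_cons.
have -> : (RtoC (/ INR D) * \Csum_(0 <= k < D) \Csum_(z <- y :: s) (z.1 * e (IZR z.2 * (INR k / INR D))))%C =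
   plus (if (y.2 =? 0)%Z then y.1 else RtoC 0)
     (RtoC (/ INR D) * \Csum_(0 <= k < D) \Csum_(z <- s) (z.1 * e (IZR z.2 * (INR k / INR D))))%C.
  rewrite (eq_bigr (fun k => y.1 * e (INR k * (IZR y.2 / INR D)) + \Csum_(z <- s) (z.1 * e (IZR z.2 * (INR k / INR D))))%C).
    rewrite big_split -Csum_mull orth0 //; last lia.
    rewrite -[X in (_ * X)%C]/(Cplus _ _) Cmult_plus_distr_l; congr Cplus.
    case: (y.2 =? 0)%Z; last by rewrite !Cmult_0_r.
    rewrite (Cmult_comm y.1) Cmult_assoc -RtoC_mult Rinv_l ?Cmult_1_l //; lra.
  move=> k _; rewrite big_cons -[LHS]/(Cplus _ _); congr (_ * e _ + _)%C.
  by rewrite /Rdiv; ring.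
apply: (is_RInt_plus (V := C_R_NormedModule)); last exact: IH.
exact: is_RInt_trig_monomial.
Qed.

Lemma CRInt_trig_poly (d : Z) (D : nat) (f : R -> C) (a : R) : (d < Z.of_nat D)%Z -> (0 < D)%N -> trig_poly d f ->
  CRInt f a (a + 1) = (RtoC (/ INR D) * \Csum_(0 <= k < D) f (Rdiv (INR k) (INR D)))%C.
Proof.
move=> h1 h2 h3; exact: (is_RInt_unique (V := C_R_CompleteNormedModule) _ _ _ _ (is_RInt_trig_poly a h1 h2 h3)).
Qed.

Lemma trig_poly_W1 g N : trig_poly (Z.of_nat N) (W1 g N).
Proof.
rewrite /W1 /=.
have h : trig_poly (Z.of_nat N) (fun x => \Csum_(1 <= p < N.+1 | prime p && (p <= N)%N) (RtoC (psw g p) * e (x * INR p))).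
  apply: trig_poly_sum => p /andP[_ hp].
  apply: (@trig_poly_monomial _ (Z.of_nat p) _ (RtoC (psw g p))); first lia.
  by move=> x; rewrite -INR_IZR_INZ Rmult_comm.
case: h => s [hs he]; exists s; split => // x; rewrite -he /W1 big_nat_cond [RHS]big_nat_cond.
apply: eq_bigl => p; lia.
Qed.

Lemma trig_poly_W3 g P N : INR P ^ 3 <= INR N -> trig_poly (Z.of_nat N) (W3 g P).
Proof.
move=> hP.
have h : trig_poly (Z.of_nat N) (fun x => \Csum_(1 <= p < P.+1 | prime p && (p <= P)%N) (RtoC (psw g p) * e (x * INR p ^ 3))).
  apply: trig_poly_sum => p /andP[_ hp].
  apply: (@trig_poly_monomial _ (Z.of_nat (p ^ 3)) _ (RtoC (psw g p))).
    have h1 : (p ^ 3 <= P ^ 3)%N by rewrite leq_exp2r.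
    have h2 : (P ^ 3 <= N)%N by apply: le_of_INR; rewrite INR_expn.
    move: h1 h2; move: (p ^ 3)%N (P ^ 3)%N => u v; lia.
  by move=> x; rewrite -INR_IZR_INZ INR_expn Rmult_comm.
case: h => s [hs he]; exists s; split => // x; rewrite -he /W3 big_nat_cond [RHS]big_nat_cond.
apply: eq_bigl => p; lia.
Qed.

(** The degree is at most 4 N. The larger number 20 N + 1 of points is the one required by
    [hua_moment], with P^3 <= N. *)
Lemma CRInt_product (g1 g2 g3 : R) (N : nat) (c : R) : (0 < N)%N ->
  CRInt (fun x => W1 g1 N x * W1 g2 N x * W3 g3 (cubeP N) x * e (- INR N * x))%C c (c + 1) =
  (RtoC (/ INR (20 * N).+1) * \Csum_(0 <= k < (20 * N).+1)
     (W1 g1 N (INR k / INR (20 * N).+1) * W1 g2 N (INR k / INR (20 * N).+1) *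
      W3 g3 (cubeP N) (INR k / INR (20 * N).+1) * e (- INR N * (INR k / INR (20 * N).+1))))%C.
Proof.
move=> N0; have [P0 hP] := cubeP_bounds N0.
apply: (@CRInt_trig_poly (Z.of_nat N + Z.of_nat N + Z.of_nat N + Z.of_nat N)); [lia | lia |].
apply: trig_poly_mul; last first.
  apply: (@trig_poly_monomial _ (- Z.of_nat N) _ (RtoC 1)); first lia.
  by move=> x; rewrite Cmult_1_l opp_IZR -INR_IZR_INZ.
apply: trig_poly_mul; last by apply: trig_poly_W3; lra.
by apply: trig_poly_mul; exact: trig_poly_W1.
Qed.

Lemma log_power_absorb (B w : R) : 0 < B -> 0 < w -> exists K, 0 < K /\
  forall N, (3 <= N)%N -> INR N `^ (- w) <= K * ln (INR N) `^ (- B).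
Proof.
move=> B0 w0; pose v := w / B.
have v0 : 0 < v by apply: Rdiv_lt_0_compat.
exists ((/ v) `^ B); split; first exact: pw_gt0.
move=> N hN; have h3 : 3 <= INR N by have := INR_le hN; rewrite /=; lra.
have hl : 0 < ln (INR N) by rewrite -ln_1; apply: ln_increasing; lra.
have h := @ln_le_pw (INR N) v ltac:(lra) v0.
have h1 : ln (INR N) `^ B <= (/ v) `^ B * INR N `^ w.
  apply: (Rle_trans _ ((INR N `^ v / v) `^ B)); first by apply: pw_base; lra.
  rewrite /Rdiv pw_mulb; [|exact: pw_gt0|exact: Rinv_0_lt_compat].
  rewrite pw_pw (_ : v * B = w); last by rewrite /v; field; lra.
  by rewrite Rmult_comm; lra.
rewrite !pw_opp; have p1 := pw_gt0 (ln (INR N)) B; have p2 := pw_gt0 (INR N) w.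
apply: (Rmult_le_reg_r (ln (INR N) `^ B * INR N `^ w)); first exact: Rmult_lt_0_compat.
have -> : / INR N `^ w * (ln (INR N) `^ B * INR N `^ w) = ln (INR N) `^ B by field; lra.
have -> : (/ v) `^ B * / ln (INR N) `^ B * (ln (INR N) `^ B * INR N `^ w) = (/ v) `^ B * INR N `^ w by field; lra.
exact: h1.
Qed.

Lemma integral_difference (g1 g2 g3 d1 d3 B : R) :
  0 < g1 <= 1 -> 0 < g2 <= 1 -> 0 < g3 <= 1 ->
  (g1 + g2) / 2 + d1 / 40 > 1 -> (g1 + g2) / 2 + d3 / 3 > 1 ->
  73 * (1 - g1) + 86 * d1 < 9 -> 73 * (1 - g2) + 86 * d1 < 9 ->
  1714 * (1 - g3) + 1725 * d3 < 46 -> 0 < B ->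
  exists K, forall N c, (3 <= N)%coq_nat ->
  Cmod (CRInt (fun x => T1 g1 N x * T1 g2 N x * T3 g3 N x * e (- INR N * x))%C c (c + 1) -
        CRInt (fun x => S1 N x * S1 N x * S3 N x * e (- INR N * x))%C c (c + 1)) <=
  K * (INR N `^ (4 / 3) * ln (INR N) `^ (- B)).
Proof.
move=> h1 h2 h3 c1 c2 c3 c4 c5 B0.
have [K [K0 hK]] := discrete_estimate h1 h2 h3 c1 c2 c3 c4 c5.
have [L [L0 hL]] := @log_power_absorb B (1 / 1200000) B0 ltac:(lra).
exists (K * L) => N c /leP hN; have N0 : (0 < N)%N by lia.
have [P0 hP] := cubeP_bounds N0.
have ext f g : (forall x, f x = g x) -> CRInt f c (c + 1) = CRInt g c (c + 1).
  by move=> h; apply: (RInt_ext (V := C_R_CompleteNormedModule)) => x _; exact: h.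
rewrite (ext _ (fun x => W1 g1 N x * W1 g2 N x * W3 g3 (cubeP N) x * e (- INR N * x))%C); last by move=> x; rewrite !T1E T3E.
rewrite (ext (fun x => S1 N x * S1 N x * S3 N x * e (- INR N * x))%C
  (fun x => W1 1 N x * W1 1 N x * W3 1 (cubeP N) x * e (- INR N * x))%C); last by move=> x; rewrite !S1E S3E.
rewrite !CRInt_product //.
have hDr : 0 < INR (20 * N).+1 by apply: INR_gt0.
have hb := hK N (cubeP N) (20 * N).+1 (fun k => e (- INR N * (INR k / INR (20 * N).+1))) P0 hP (ltnSn _)
  (fun k => Req_le _ _ (Cmod_e _)).
move: hb hDr; move: (20 * N).+1 => D hb hDr.
have factor (x y z : C) : (x * y - x * z = x * (y - z))%C by ring.
rewrite factor Cmod_mult Cmod_R Rabs_pos_eq; last by left; exact: Rinv_0_lt_compat.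
apply: (Rle_trans _ (/ INR D * (K * INR D * INR N `^ (4 / 3 - 1 / 1200000)))).
  by apply: Rmult_le_compat_l; first by left; exact: Rinv_0_lt_compat.
have -> : / INR D * (K * INR D * INR N `^ (4 / 3 - 1 / 1200000)) = K * INR N `^ (4 / 3) * INR N `^ (- (1 / 1200000)).
  by rewrite /Rminus pw_add; field; lra.
have -> : K * L * (INR N `^ (4 / 3) * ln (INR N) `^ (- B)) = K * INR N `^ (4 / 3) * (L * ln (INR N) `^ (- B)) by ring.
apply: Rmult_le_compat_l; last exact: hL.
by apply: Rmult_le_pos; [lra | exact: pw_ge0].
Qed.

End PiatetskiShapiro.

Theorem theorem2 :
  forall gamma1 gamma2 gamma3 delta1 delta3 sigma : R,
    0 < gamma1 <= 1 -> 0 < gamma2 <= 1 -> 0 < gamma3 <= 1 ->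
    0 < delta1 < 1 -> 0 < delta3 < 1 ->
    (gamma1 + gamma2) / 2 + delta1 / 40 > 1 ->
    (gamma1 + gamma2) / 2 + delta3 / 3 > 1 ->
    73 * (1 - gamma1) + 86 * delta1 < 9 ->
    73 * (1 - gamma2) + 86 * delta1 < 9 ->
    1714 * (1 - gamma3) + 1725 * delta3 < 46 ->
    0 < sigma <= 1 / 6 ->
    forall B : R, 0 < B ->
    exists (K : R) (N0 : nat),
    forall N : nat, (N0 <= N)%nat ->
      let tau := Rpower (INR N) (1 - sigma) in
      Cmod
        (CRInt
           (fun alpha : R =>
              T1 gamma1 N alpha * T1 gamma2 N alpha * T3 gamma3 N alpha
                * e (- INR N * alpha))%C
           (1 / tau) (1 + 1 / tau)
         - CRInt
             (fun alpha : R =>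
                S1 N alpha * S1 N alpha * S3 N alpha * e (- INR N * alpha))%C
             (1 / tau) (1 + 1 / tau))%C
      <= K * (Rpower (INR N) (4 / 3) * Rpower (ln (INR N)) (- B)).
Proof.
intros g1 g2 g3 d1 d3 sigma h1 h2 h3 _ _ c1 c2 c3 c4 c5 _ B hB.
destruct (PiatetskiShapiro.integral_difference h1 h2 h3 c1 c2 c3 c4 c5 hB) as [K hK].
(* From N = 3 on the logarithm is positive, and a power of N absorbs its powers. *)
exists K, 3%nat.
intros N hN tau.
rewrite (Rplus_comm 1 (1 / tau)).
exact (hK N (1 / tau) hN).
Qed.
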